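(* Let $M$ be a smooth oriented manifold of dimension $n$ and let $\mathbf G=\mathrm{Diff}(M)$, regarded as a discrete group. Integration along the fibers $$\oint_{\Delta^\bullet}:\ \Omega_{\rm d}^\bullet(|\bar\triangle_{\mathbf G}M|)\to \bar C_{\rm d}^{\rm tot\,\bullet}(\mathbf G,\Omega^*(M)),\qquad \{\omega_p\}_{p\ge 0}\mapsto \Big\{\oint_{\Delta^p}\omega_p\Big\}_{p\ge 0},$$ is a chain map which induces an isomorphism $H_{\rm d}^\bullet(|\triangle_{\mathbf G}M|,\mathbb R)\cong H_{\rm d,\mathbf G}^\bullet(M,\mathbb R)$ from the cohomology of the differentiable simplicial de Rham complex to the cohomology of the differentiable Bott complex.
   Context: Simplicial manifold: $\bar\triangle_{\mathbf G}M[p]=\mathbf G^{p+1}\times M$, with faces $\bar\partial_i(\rho_0,\dots,\rho_p,x)=(\rho_0,\dots,\check\rho_i,\dots,\rho_p,x)$ (omit $\rho_i$) and degeneracies $\bar\sigma_i(\rho_0,\dots,\rho_p,x)=(\rho_0,\dots,\rho_i,\rho_i,\dots,\rho_p,x)$, $0\le i\le p$. Differentiable Bott complex: $\bar C^p(\mathbf G,\Omega^q(M))$ is the space of maps $\bar c:\mathbf G^{p+1}\to\Omega^q(M)$ with $\bar c(\rho_0\rho,\dots,\rho_p\rho)=\rho^*\bar c(\rho_0,\dots,\rho_p)$ for all $\rho,\rho_i\in\mathbf G$. The group coboundary is $\bar\delta\bar c(\rho_0,\dots,\rho_{p+1})=\sum_{i=0}^{p+1}(-1)^i\bar c(\rho_0,\dots,\check\rho_i,\dots,\rho_{p+1})$,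 and $d$ is the de Rham differential. The total differential is $\bar\delta+(-1)^pd$. A cochain is differentiable if in every local chart $U\subset M$ with coordinates $(x^1,\dots,x^n)$ it has the form $\sum_I f_I\big(x,j^k_x(\rho_0),\dots,j^k_x(\rho_p)\big)\,dx^I$, with $f_I$ smooth functions of $x\in U$ and of the $k$-jets at $x$ of $\rho_0,\dots,\rho_p$, for some $k\in\mathbb N$. Differentiable cochains form the subcomplex $\bar C_{\rm d}^{\rm tot\,\bullet}(\mathbf G,\Omega^*(M))$, whose cohomology is $H_{\rm d,\mathbf G}^\bullet(M,\mathbb R)$. Differentiable simplicial de Rham complex: let $\Delta^p=\{\mathbf t\in\mathbb R^{p+1}: t_i\ge0,\ \sum t_i=1\}$. $\Omega^\bullet(|\bar\triangle_{\mathbf G}M|)$ consists of sequences $\omega=\{\omega_p\}_{p\ge0}$, where $\omega_p$ is a form on $\Delta^p\times\bar\triangle_{\mathbf G}M[p]$ (extendable smoothly to the affine hyperplane $\{\sum t_i=1\}$ in the $\mathbf t$ variable), which are compatible, i.e. for every morphism $\mu\in\Delta(p,q)$ of the simplicial category, $(\mu_\bullet\times\mathrm{Id})^*\omega_q=(\mathrm{Id}\times\mu^\bullet)^*\omega_p$ on $\Delta^p\times\bar\triangle_{\mathbf G}M[q]$ (with $\mu_\bullet:\Delta^p\to\Delta^q$, $\mu^\bullet:\bar\triangle_{\mathbf G}M[q]\to\bar\triangle_{\mathbf G}M[p]$ the induced maps), and which are $\mathbf G$-invariant: $\omega(\rho_0\rho,\dots,\rho_p\rho)=\rho^*\omega(\rho_0,\dots,\rho_p)$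 for all $\rho,\rho_i\in\mathbf G$. The subcomplex $\Omega_{\rm d}^\bullet(|\bar\triangle_{\mathbf G}M|)$ consists of those whose components have, in local charts, the form $\sum f_{I,J}\big(\mathbf t;x,j^k_x(\rho_0),\dots,j^k_x(\rho_p)\big)\,dt^I\wedge dx^J$ with $f_{I,J}$ smooth in all variables. The differential is the exterior derivative, and the cohomology is denoted $H_{\rm d}^\bullet(|\triangle_{\mathbf G}M|,\mathbb R)$. $\oint_{\Delta^p}:\Omega^\bullet(\Delta^p\times\bar\triangle_{\mathbf G}M[p])\to\Omega^{\bullet-p}(\bar\triangle_{\mathbf G}M[p])$ is integration over the fiber $\Delta^p$, with the $dt$-factors written first and $\Delta^p$ oriented by $dt_1\wedge\dots\wedge dt_p$. *)

(* Defs.v *)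
From HB Require Import structures.
From mathcomp Require Import all_boot all_order all_algebra.
From mathcomp Require Import all_classical all_reals all_analysis.

Set Implicit Arguments.
Unset Strict Implicit.
Unset Printing Implicit Defensive.

Import Order.TTheory GRing.Theory Num.Theory.
Import numFieldNormedType.Exports.

Local Open Scope classical_set_scope.
Local Open Scope ring_scope.

Section Smooth.
Variable R : realType.

(* U is meant to be open and V finite-dimensional; then this is C^infinity
   on U: all iterated directional derivatives of f exist on U and are Frechet
   differentiable there.  The values of f outside U are irrelevant. *)
Definition smooth_on (V W : normedModType R) (U : set V) (f : V -> W) : Prop :=
  forall (vs : seq V) (x : V), U x ->
    differentiable (foldr (fun v g => 'D_v g) f vs) x.

(* The chain rule below is what makes Diff(M) closed under composition. *)
Lemma near_eq_differentiable (V W : normedModType R) (f g : V -> W) (x : V) :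
  {near x, f =1 g} -> differentiable f x -> differentiable g x.
Proof.
move=> fg /diff_locallyxP[cdf df].
have gdf : g \o shift x = cst (g x) + 'd f x +o_ 0 id.
  apply/eqaddoP => _/posnumP[e].
  have /eqaddoP/(_ _ [gt0 of e%:num]) := diff_locally
     ((diff_locallyxP _ _).2 (conj cdf df)).
  have : \forall h \near (0 : V), f (h + x) = g (h + x).
    by move: fg; rewrite (near_shift 0)/=; apply: filterS => h /=; rewrite subr0.
  apply: filter_app2; near=> h => /= fgh.
  by rewrite !fctE/= fgh (nbhs_singleton fg).
by apply/diff_locallyP; split; rewrite (diff_unique cdf gdf).
Unshelve. all: by end_near. Qed.

Section Ck.
Variable m : nat.
Implicit Types (U : set 'rV[R]_m).

Fixpoint Ck (W : normedModType R) k U (f : 'rV[R]_m -> W) : Prop :=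
  (forall x, U x -> differentiable f x) /\
  if k is k'.+1 then forall v, Ck k' U ('D_v f) else True.

Lemma CkW (W : normedModType R) k U f : @Ck W k.+1 U f -> Ck k U f.
Proof. by elim: k f => [|k IH] f [df Df]; split=> // v; apply: IH. Qed.

Lemma smooth_onP (W : normedModType R) U (f : 'rV[R]_m -> W) :
  smooth_on U f <-> forall k, Ck k U f.
Proof.
split=> [sf k|].
  elim: k f sf => [|k IH] f sf /=; split=> //; try exact: (sf [::]).
  by move=> v; apply: IH => vs x Ux; have := sf (rcons vs v) x Ux; rewrite foldr_rcons.
move=> kf vs; elim/last_ind: vs f kf => [|vs v IH] f kf x Ux /=.
  exact: (kf 0).1.
by rewrite foldr_rcons; apply: IH => // k; apply: (kf k.+1).2.
Qed.

Lemma eq_Ck (W : normedModType R) k U (f g : 'rV[R]_m -> W) :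
  open U -> (forall x, U x -> f x = g x) -> Ck k U f -> Ck k U g.
Proof.
move=> oU fg Cf.
have nfg (f1 g1 : 'rV[R]_m -> W) : (forall x, U x -> f1 x = g1 x) ->
    forall x, U x -> {near x, f1 =1 g1}.
  by move=> fg1 x Ux; apply: filterS fg1 _; exact: open_nbhs_nbhs.
elim: k f g fg Cf => [|k IH] f g fg [df Df] /=.
  by split=> // x Ux; apply: near_eq_differentiable (df x Ux); exact: nfg.
split=> [x Ux|v]; first by apply: near_eq_differentiable (df x Ux); exact: nfg.
by apply: IH (Df v) => x Ux; apply: near_eq_derive; exact: nfg.
Qed.

Lemma CkD k U (f g : 'rV[R]_m -> R) : open U ->
  Ck k U f -> Ck k U g -> Ck k U (f + g).
Proof.
move=> oU; elim: k f g => [|k IH] f g [df Df] [dg Dg] /=.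
  by split=> // x Ux; apply: differentiableD; [exact: df|exact: dg].
split=> [x Ux|v]; first by apply: differentiableD; [exact: df|exact: dg].
apply: (@eq_Ck _ _ _ ('D_v f + 'D_v g)) => // [x Ux|]; last exact: IH (Df v) (Dg v).
by rewrite deriveD//; apply: diff_derivable; [exact: df|exact: dg].
Qed.

Lemma CkM k U (f g : 'rV[R]_m -> R) : open U ->
  Ck k U f -> Ck k U g -> Ck k U (f * g).
Proof.
move=> oU; elim: k f g => [|k IH] f g Cf Cg.
  case: Cf Cg => [df _] [dg _]; split=> // x Ux.
  by apply: differentiableM; [exact: df|exact: dg].
have [[df Df] [dg Dg]] := (Cf, Cg).
split=> [x Ux|v]; first by apply: differentiableM; [exact: df|exact: dg].
apply: (@eq_Ck _ _ _ (f * 'D_v g + g * 'D_v f)) => // [x Ux|].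
  by rewrite deriveM//; apply: diff_derivable; [exact: df|exact: dg].
by apply: CkD => //; [exact: IH (CkW Cf) (Dg v)|exact: IH (CkW Cg) (Df v)].
Qed.

Lemma Ck_sum k U n (f : 'I_n -> 'rV[R]_m -> R) : open U ->
  (forall i, Ck k U (f i)) -> Ck k U (\sum_(i < n) f i).
Proof.
move=> oU Cf; apply: (@big_ind _ (Ck k U)) => [|f1 f2|i _].
- elim: k {Cf} => [|k IH]; split=> //; try by move=> x _; exact: differentiable_cst.
  by move=> v; apply: eq_Ck IH => // x _; rewrite derive_cst.
- exact: CkD.
- exact: Cf.
Qed.

Lemma Ck_coord k U n (f : 'rV[R]_m -> 'rV[R]_n) : open U ->
  Ck k U f <-> forall j, Ck k U (fun x => f x 0 j).
Proof.
have dcoord g (x : 'rV[R]_m) j : differentiable g x ->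
    differentiable (fun x => (g x : 'rV[R]_n) 0 j) x.
  move=> dg; exact: (@differentiable_comp _ _ _ _ g
    (fun N : 'rV[R]_n => N 0 j) x dg (differentiable_coord _ _ _)).
have coordd g (x : 'rV[R]_m) :
    (forall j, differentiable (fun x => (g x : 'rV[R]_n) 0 j) x) ->
    differentiable g x.
  move=> dg.
  have -> : g = \sum_(j < n) (fun x => g x 0 j *: delta_mx 0 j).
    by apply/funext => y; rewrite fct_sumE [LHS]row_sum_delta.
  by apply: differentiable_sum => j; apply: differentiableZl.
move=> oU; elim: k f => [|k IH] f /=.
  split=> [[df _] j|df]; first by split=> // x Ux; exact/dcoord/df.
  by split=> // x Ux; apply: coordd => j; have [+ _] := df j; apply.
split=> [[df Df] j|Cf].
  split=> [x Ux|v]; first exact/dcoord/df.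
  have /IH/(_ j) := Df v; apply: eq_Ck => // x Ux.
  by rewrite derive_mx ?mxE//; exact/diff_derivable/df.
have df x : U x -> differentiable f x.
  by move=> Ux; apply: coordd => j; have [+ _] := Cf j; apply.
split=> // v; apply/IH => j; have [_ /(_ v)] := Cf j; apply: eq_Ck => // x Ux.
by rewrite derive_mx ?mxE//; exact/diff_derivable/df.
Qed.

End Ck.

Lemma Ck_comp a b k (U : set 'rV[R]_a) (V : set 'rV[R]_b) f (g : 'rV[R]_b -> R) :
  open U -> open V -> (forall x, U x -> V (f x)) ->
  Ck k U f -> Ck k V g -> Ck k U (g \o f).
Proof.
move=> oU oV UV; elim: k g => [|k IH] g Cf Cg.
  case: Cf Cg => [df _] [dg _]; split=> // x Ux.
  by apply: differentiable_comp; [exact: df|exact/dg/UV].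
have [[df Df] [dg Dg]] := (Cf, Cg).
split=> [x Ux|v]; first by apply: differentiable_comp; [exact: df|exact/dg/UV].
apply: (@eq_Ck _ _ _ _
  (\sum_(i < b) ((fun x => 'D_v f x 0 i) * ('D_(delta_mx 0 i) g \o f)))) => //.
  move=> x Ux; have dgx := dg _ (UV x Ux); have dfx := df x Ux.
  rewrite [RHS]deriveE; last exact: differentiable_comp.
  rewrite diff_comp//=.
  rewrite [X in _ = 'd g _ X]row_sum_delta linear_sum/=.
  rewrite fct_sumE; apply: eq_bigr => i _.
  by rewrite [RHS]linearZ -(deriveE _ dgx) -(deriveE _ dfx).
apply: Ck_sum => // i; apply: CkM => //.
  by have /Ck_coord := Df v; apply.
by apply: IH; [exact: CkW Cf|exact: Dg].
Qed.

Lemma smooth_on_comp a b c (U : set 'rV[R]_a) (V : set 'rV[R]_b)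
    (f : 'rV[R]_a -> 'rV[R]_b) (g : 'rV[R]_b -> 'rV[R]_c) :
  open U -> open V -> (forall x, U x -> V (f x)) ->
  smooth_on U f -> smooth_on V g -> smooth_on U (g \o f).
Proof.
move=> oU oV UV /smooth_onP sf /smooth_onP sg; apply/smooth_onP => k.
apply/Ck_coord => // j.
apply: (@Ck_comp _ _ _ _ _ f (fun y => g y 0 j) oU oV UV) => //.
by have /(Ck_coord _ _ oV) := sg k; apply.
Qed.

End Smooth.

Section Manifolds.
Variable R : realType.

(* param is a total function of which only the restriction to coord @` dom
   matters: there it is the inverse of coord. *)
Record chart (X : Type) (n : nat) := Chart {
  dom : set X;
  coord : X -> 'rV[R]_n;
  param : 'rV[R]_n -> X }.

(* The map f read in the charts phi and psi. *)
Definition local_map (X Y : Type) n m (phi : chart X n) (psi : chart Y m)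
    (f : X -> Y) : 'rV[R]_n -> 'rV[R]_m :=
  coord psi \o f \o param phi.

Definition smooth_in_charts (X Y : Type) n m (phi : chart X n)
    (psi : chart Y m) (f : X -> Y) : Prop :=
  smooth_on (coord phi @` (dom phi `&` f @^-1` dom psi)) (local_map phi psi f).

Definition topological_chart (X : topologicalType) n (phi : chart X n) : Prop :=
  [/\ open (dom phi), open (coord phi @` dom phi),
      forall x, dom phi x -> param phi (coord phi x) = x,
      forall x, dom phi x -> {for x, continuous (coord phi)} &
      forall x, dom phi x -> {for coord phi x, continuous (param phi)}].

Record smoothManifold (n : nat) := SmoothManifold {
  points :> topologicalType;
  atlas : set (chart points n);
  manifold_hausdorff : hausdorff_space points;
  manifold_countable : @second_countable points;
  atlas_chart : forall phi, atlas phi -> topological_chart phi;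
  atlas_cover : forall x : points, exists2 phi, atlas phi & dom phi x;
  atlas_compatible : forall phi psi, atlas phi -> atlas psi ->
    smooth_in_charts phi psi idfun;
  atlas_maximal : forall phi, topological_chart phi ->
    (forall psi, atlas psi -> smooth_in_charts phi psi idfun /\
                              smooth_in_charts psi phi idfun) ->
    atlas phi }.

Record orientation n (M : smoothManifold n) := Orientation {
  oriented_atlas : set (chart M n);
  oriented_atlas_sub : oriented_atlas `<=` @atlas n M;
  oriented_atlas_cover : forall x : M,
    exists2 phi, oriented_atlas phi & dom phi x;
  oriented_atlas_pos : forall phi psi x,
    oriented_atlas phi -> oriented_atlas psi -> dom phi x -> dom psi x ->
    0 < \det ('J (local_map phi psi idfun) (coord phi x)) }.

Definition smooth_map n m (M : smoothManifold n) (N : smoothManifold m)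
    (f : M -> N) : Prop :=
  continuous f /\ forall phi psi, @atlas n M phi -> @atlas m N psi ->
    smooth_in_charts phi psi f.

Lemma open_coord_image (X : topologicalType) n (phi : chart X n) (A : set X) :
  topological_chart phi -> open A -> open (coord phi @` (dom phi `&` A)).
Proof.
move=> [od oi K cc cp] oA; rewrite openE => _ [x [dx Ax] <-].
have oD : open (dom phi `&` A) by exact: openI.
have n1 : nbhs (coord phi x) (coord phi @` dom phi).
  by apply: open_nbhs_nbhs; split=> //; exists x.
have n2 : nbhs (coord phi x) (param phi @^-1` (dom phi `&` A)).
  by apply: (cp x dx); rewrite K//; apply: open_nbhs_nbhs.
apply: (@filterS _ (nbhs (coord phi x)) _ _ _ _ (filterI n1 n2)).
by move=> _ [[y dy <-]]; rewrite /preimage/= K// => -[_ Ay]; exists y.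
Qed.

Lemma smooth_map_comp a b c (M : smoothManifold a) (N : smoothManifold b)
    (P : smoothManifold c) (f : M -> N) (g : N -> P) :
  smooth_map f -> smooth_map g -> smooth_map (g \o f).
Proof.
move=> [cf sf] [cg sg]; split=> [x|phi psi aphi apsi].
  by apply: continuous_comp; [exact: cf|exact: cg].
move=> vs _ [x [dx dgx] <-].
have [chi achi dfx] := atlas_cover (f x).
have [_ _ Kphi _ _] := atlas_chart aphi.
have [_ _ Kchi _ _] := atlas_chart achi.
have [ochi _ _ _ _] := atlas_chart achi.
have [opsi _ _ _ _] := atlas_chart apsi.
have ogpsi : open (g @^-1` dom psi) by apply: open_comp => // y _; exact: cg.
pose U := coord phi @` (dom phi `&` f @^-1` (dom chi `&` g @^-1` dom psi)).
pose V := coord chi @` (dom chi `&` g @^-1` dom psi).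
have oU : open U.
  apply: open_coord_image; first exact: atlas_chart.
  by apply: open_comp => [y _|]; [exact: cf|exact: openI].
have oV : open V by apply: open_coord_image => //; exact: atlas_chart.
have UV u : U u -> V (local_map phi chi f u).
  by move=> [y [dy [dfy dgy]] <-]; exists (f y); rewrite // /local_map/= Kphi.
have sU : smooth_on U (local_map phi chi f).
  move=> ws _ [y [dy [dfy _]] <-]; apply: (sf _ _ aphi achi).
  by exists y.
have := smooth_on_comp oU oV UV sU (sg _ _ achi apsi).
move=> /smooth_onP sgf.
suff /smooth_onP : forall k, Ck k U (local_map phi psi (g \o f)).
  by apply; exists x.
move=> k; apply: eq_Ck (sgf k) => // _ [y [dy [dfy _]] <-].
by rewrite /local_map/= Kphi// Kchi.
Qed.

Record diffeo n (M : smoothManifold n) := Diffeo {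
  diffeo_fun :> M -> M;
  diffeo_inv : M -> M;
  diffeo_funK : cancel diffeo_fun diffeo_inv;
  diffeo_invK : cancel diffeo_inv diffeo_fun;
  diffeo_smooth : smooth_map diffeo_fun;
  diffeo_inv_smooth : smooth_map diffeo_inv }.

(* The group law of Diff(M): (rho * sigma) x = rho (sigma x). *)
Definition diffeo_mul n (M : smoothManifold n) (rho sigma : diffeo M) :
    diffeo M :=
  Diffeo (can_comp (diffeo_funK rho) (diffeo_funK sigma))
         (can_comp (diffeo_invK sigma) (diffeo_invK rho))
         (smooth_map_comp (diffeo_smooth sigma) (diffeo_smooth rho))
         (smooth_map_comp (diffeo_inv_smooth rho) (diffeo_inv_smooth sigma)).

End Manifolds.

Section Forms.
Variable R : realType.

(* A differential form is given by its coefficients in the charts of an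
   atlas: w phi x [:: i1; ...; iq] is the value of w at x on the coordinate
   fields d_i1, ..., d_iq of phi.  Hence in the chart phi
     w = \sum_(i1 < ... < iq) w phi x [:: i1; ...; iq] dx^i1 /\ ... /\ dx^iq. *)
Definition coefs (X : Type) (n : nat) :=
  chart R X n -> X -> seq 'I_n -> R.

HB.instance Definition _ X n := GRing.Lmodule.copy (coefs X n)
  (chart R X n -> X -> seq 'I_n -> R^o).

(* The pull-back of multilinear forms by the linear map with matrix A, acting
   on row vectors; this is the convention of 'J. *)
Definition pull n m (A : 'M[R]_(n, m)) (w : seq 'I_m -> R) (s : seq 'I_n) : R :=
  \sum_(L : (size s).-tuple 'I_m)
    w L * \prod_(a < size s) A (tnth (in_tuple s) a) (tnth L a).

(* v = f^* w at the points of D. *)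
Definition is_pullback (X Y : Type) n m (A : set (chart R X n))
    (B : set (chart R Y m)) (D : set X) (f : X -> Y)
    (w : coefs Y m) (v : coefs X n) : Prop :=
  forall phi psi x, A phi -> B psi -> D x -> dom phi x -> dom psi (f x) ->
    v phi x = pull ('J (local_map phi psi f) (coord phi x)) (w psi (f x)).

Definition smooth_coefs (X : Type) n (A : set (chart R X n))
    (w : coefs X n) : Prop :=
  forall phi s, A phi ->
    smooth_on (coord phi @` dom phi) (fun u => w phi (param phi u) s).

(* The smooth q-forms.  By the first clause coefficients that have no meaning
   are 0, so that = is equality of forms; the third one is the change of
   charts. *)
Definition is_form (X : Type) n (A : set (chart R X n)) (q : nat)
    (w : coefs X n) : Prop :=
  [/\ forall phi x s, w phi x s <> 0 -> [/\ A phi, dom phi x & size s = q],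
      forall phi x s1 i j s2,
        w phi x (s1 ++ i :: j :: s2) = - w phi x (s1 ++ j :: i :: s2),
      is_pullback A A setT idfun w w &
      smooth_coefs A w].

(* (d w)(d_i0, ..., d_iq) is the alternating sum of the
   d_ia (w (d_i0, ..., omit d_ia, ..., d_iq)). *)
Definition extd (X : Type) n (A : set (chart R X n)) (w : coefs X n) :
    coefs X n := fun phi x s =>
  if `[< A phi /\ dom phi x >] then
    \sum_(a < size s) (-1) ^+ a *
      'D_(delta_mx 0 (tnth (in_tuple s) a))
        (fun u => w phi (param phi u) (take a s ++ drop a.+1 s)) (coord phi x)
  else 0.

End Forms.

Section Simplices.
Variable R : realType.

(* The affine hyperplane t_0 + ... + t_p = 1 of R^(p+1) is identified with R^p
   by the coordinates (t_1, ..., t_p); bary t i is t_i, for 0 <= i <= p. *)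
Definition bary p (t : 'rV[R]_p) (i : 'I_p.+1) : R :=
  if unlift ord0 i is Some j then t 0 j else 1 - \sum_j t 0 j.

Definition simplex p : set 'rV[R]_p := [set t | forall i, 0 <= bary t i].

(* The affine map sending the i-th vertex to the (mu i)-th vertex. *)
Definition simplex_map p q (mu : 'I_p.+1 -> 'I_q.+1) (t : 'rV[R]_p) :
    'rV[R]_q :=
  \row_j \sum_(i | mu i == lift ord0 j) bary t i.

(* The iterated integral of f over t_1, ..., t_p >= 0, t_1 + ... + t_p <= r. *)
Fixpoint simplex_integral p (r : R) : ('rV[R]_p -> R) -> R :=
  match p with
  | 0 => fun f => f 0
  | p'.+1 => fun f => \int[lebesgue_measure]_(u in `[0, r])
      simplex_integral (r - u)
        (fun t : 'rV[R]_p' => f (row_mx (u%:M : 'rV[R]_1) t))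
  end.

Section SimplexForms.
Variables (n : nat) (M : smoothManifold R n) (p : nat).

(* The chart id x phi of R^p x M, and the resulting atlas of R^p x M. *)
Definition prod_chart (phi : chart R M n) : chart R ('rV[R]_p * M) (p + n) :=
  Chart (setT `*` dom phi) (fun y => row_mx y.1 (coord phi y.2))
        (fun z => (lsubmx z, param phi (rsubmx z))).

Definition prod_atlas : set (chart R ('rV[R]_p * M) (p + n)) :=
  [set prod_chart phi | phi in @atlas R n M].

Definition on_simplex (w : coefs R ('rV[R]_p * M) (p + n)) :
    coefs R ('rV[R]_p * M) (p + n) :=
  fun phi y s => if `[< simplex y.1 >] then w phi y s else 0.

(* The q-forms on simplex p x M that extend smoothly to R^p x M. *)
Definition is_simplex_form (q : nat)
    (w : coefs R ('rV[R]_p * M) (p + n)) : Prop :=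
  exists2 w', is_form prod_atlas q w' & w = on_simplex w'.

(* At a boundary point of the simplex the derivatives of the coefficients are
   those of any smooth extension. *)
Definition simplex_extd (w : coefs R ('rV[R]_p * M) (p + n)) :
    coefs R ('rV[R]_p * M) (p + n) :=
  on_simplex (extd prod_atlas
    (xget 0 [set w' | smooth_coefs prod_atlas w' /\ on_simplex w' = w])).

(* Integration over the fiber: f dt_1 /\ ... /\ dt_p /\ dx^J is sent to
   (\int f dt_1 ... dt_p) dx^J, the forms of lower degree in t to 0. *)
Definition fiber_integral (w : coefs R ('rV[R]_p * M) (p + n)) :
    coefs R M n := fun phi x s =>
  simplex_integral 1 (fun t : 'rV[R]_p =>
    w (prod_chart phi) (t, x) (map (@lshift p n) (enum 'I_p) ++
                               map (@rshift p n) s)).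

End SimplexForms.
End Simplices.

Section Complexes.
Variable R : realType.

(* The degree m part is cochains m; ambient and differential are only relevant
   there. *)
Record complex := Complex {
  ambient : lmodType R;
  cochains : nat -> set ambient;
  differential : ambient -> ambient }.

Definition cocycles (C : complex) m : set (ambient C) :=
  [set z | cochains m z /\ differential z = 0].

Definition coboundaries (C : complex) m : set (ambient C) :=
  [set b | cochains m b /\
    if m is m'.+1 then exists2 a, cochains m' a & b = differential a
    else b = 0].

Definition cohomology_class (C : complex) m (z : ambient C) :
    set (ambient C) :=
  [set z' | coboundaries m (z' - z)].

(* H^m as the set of the cosets of the coboundaries in the cocycles. *)
Definition cohomology (C : complex) m : set (set (ambient C)) :=
  [set cohomology_class m z | z in cocycles m].

Definition chain_map (C D : complex) (f : ambient C -> ambient D) : Prop :=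
  [/\ forall m z, cochains m z -> cochains m (f z),
      forall m k z z', cochains m z -> cochains m z' ->
        f (k *: z + z') = k *: f z + f z' &
      forall m z, cochains m z -> f (differential z) = differential (f z)].

Definition cohomology_map (C D : complex) (f : ambient C -> ambient D) m
    (c : set (ambient C)) : set (ambient D) :=
  \bigcup_(z in c) cohomology_class m (f z).

End Complexes.

Arguments cohomology {R} C m _.

Section Family.
Variables (R : realType) (V : nat -> lmodType R).

Definition family := forall p, V p.

HB.instance Definition _ := gen_eqMixin family.
HB.instance Definition _ := gen_choiceMixin family.

Definition family_add (c c' : family) : family := fun p => c p + c' p.
Definition family_opp (c : family) : family := fun p => - c p.
Definition family_scale (k : R) (c : family) : family := fun p => k *: c p.

Let addA : associative family_add.
Proof. by move=> *; apply: functional_extensionality_dep => p; exact: addrA. Qed.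
Let addC : commutative family_add.
Proof. by move=> *; apply: functional_extensionality_dep => p; exact: addrC. Qed.
Let add0 : left_id (fun p => 0) family_add.
Proof. by move=> *; apply: functional_extensionality_dep => p; exact: add0r. Qed.
Let addN : left_inverse (fun p => 0) family_opp family_add.
Proof. by move=> *; apply: functional_extensionality_dep => p; exact: addNr. Qed.

HB.instance Definition _ :=
  GRing.isZmodule.Build family addA addC add0 addN.

Let scaleA k k' c :
  family_scale k (family_scale k' c) = family_scale (k * k') c.
Proof. by apply: functional_extensionality_dep => p; exact: scalerA. Qed.
Let scale1 : left_id 1 family_scale.
Proof. by move=> *; apply: functional_extensionality_dep => p; exact: scale1r. Qed.
Let scaleDr : right_distributive family_scale +%R.
Proof. by move=> *; apply: functional_extensionality_dep => p; exact: scalerDr. Qed.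
Let scaleDl c : {morph family_scale^~ c : k k' / k + k'}.
Proof. by move=> *; apply: functional_extensionality_dep => p; exact: scalerDl. Qed.

HB.instance Definition _ :=
  GRing.Zmodule_isLmodule.Build R family scaleA scale1 scaleDr scaleDl.

End Family.

Section Jets.
Variable R : realType.

Definition multi_index (n k : nat) :=
  {alpha : {ffun 'I_n -> 'I_k.+1} | (\sum_i alpha i <= k)%N}.

Definition partial n (W : normedModType R) k (alpha : multi_index n k)
    (F : 'rV[R]_n -> W) : 'rV[R]_n -> W :=
  foldr (fun i g => iter (val alpha i) (fun h => 'D_(delta_mx 0 i) h) g) F
    (enum 'I_n).

(* The partial derivatives of F at u of all orders <= k, including F u. *)
Definition jet n k (F : 'rV[R]_n -> 'rV[R]_n) (u : 'rV[R]_n) :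
    'rV[R]_(#|{: multi_index n k}| * n) :=
  mxvec (\matrix_(a < #|{: multi_index n k}|) partial (enum_val a) F u).

Variables (n : nat) (M : smoothManifold R n).

Definition jet_space k p : normedModType R :=
  ('rV[R]_n * 'M[R]_(p.+1, #|{: multi_index n k}| * n))%type.

(* Coordinates of (x, j^k_x rho_0, ..., j^k_x rho_p): x is read in the chart
   phi and rho_i x in the chart psi i. *)
Definition jets_at k p (phi : chart R M n) (psi : 'I_p.+1 -> chart R M n)
    (rho : 'I_p.+1 -> diffeo M) (x : M) : jet_space k p :=
  (coord phi x,
   \matrix_(i < p.+1) jet k (local_map phi (psi i) (rho i)) (coord phi x)).

(* The space of the tuples (x, j^k_x rho_0, ..., j^k_x rho_p) is covered by
   its chart domains, one for each psi; a function on it is smooth iff it is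
   so in each of these charts.  The tuples of jets of diffeomorphisms form an
   open subset of the coordinate space, contained in O. *)
Definition differentiable_cochain p
    (c : ('I_p.+1 -> diffeo M) -> coefs R M n) : Prop :=
  forall phi, @atlas R n M phi -> exists k, forall s (psi : 'I_p.+1 -> chart R M n),
    (forall i, @atlas R n M (psi i)) ->
    exists (O : set (jet_space k p)) (f : jet_space k p -> R),
      [/\ open O, smooth_on O f &
      forall (rho : 'I_p.+1 -> diffeo M) x, dom phi x -> (forall i, dom (psi i) (rho i x)) ->
        O (jets_at k phi psi rho x) /\
        c rho phi x s = f (jets_at k phi psi rho x)].

Definition differentiable_simplex_form p
    (w : ('I_p.+1 -> diffeo M) -> coefs R ('rV[R]_p * M) (p + n)) : Prop :=
  forall phi, @atlas R n M phi -> exists k, forall s (psi : 'I_p.+1 -> chart R M n),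
    (forall i, @atlas R n M (psi i)) ->
    exists (O : set (jet_space k p)) (f : 'rV[R]_p * jet_space k p -> R),
      [/\ open O, smooth_on (setT `*` O) f &
      forall (rho : 'I_p.+1 -> diffeo M) x, dom phi x -> (forall i, dom (psi i) (rho i x)) ->
        O (jets_at k phi psi rho x) /\
        forall t, simplex t ->
          w rho (prod_chart p phi) (t, x) s = f (t, jets_at k phi psi rho x)].

End Jets.

Section BottComplex.
Variables (R : realType) (n : nat) (M : smoothManifold R n).

Definition bott_cochain (p : nat) : lmodType R :=
  ('I_p.+1 -> diffeo M) -> coefs R M n.

(* Elements of total degree m: c p has values in the (m - p)-forms. *)
Definition is_bott_cochain m (c : family bott_cochain) : Prop :=
  forall p,
  [/\ forall rho, if (p <= m)%N then is_form (@atlas R n M) (m - p) (c p rho)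
                  else c p rho = 0,
      forall (sigma : diffeo M) rho,
        is_pullback (@atlas R n M) (@atlas R n M) setT sigma
          (c p rho) (c p (fun i => diffeo_mul (rho i) sigma)) &
      differentiable_cochain (c p)].

Definition group_coboundary (c : family bott_cochain) : family bott_cochain :=
  fun p => match p with
  | 0 => 0
  | q.+1 => fun rho => \sum_(i < q.+2) (-1) ^+ i *: c q (fun j => rho (lift i j))
  end.

Arguments group_coboundary : clear implicits.

Definition bott_differential (c : family bott_cochain) : family bott_cochain :=
  fun p rho => group_coboundary c p rho +
               (-1) ^+ p *: extd (@atlas R n M) (c p rho).

Definition bott_complex : complex R :=
  Complex (fun m => [set c | is_bott_cochain m c]) bott_differential.

Definition simplicial_form (p : nat) : lmodType R :=
  ('I_p.+1 -> diffeo M) -> coefs R ('rV[R]_p * M) (p + n).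

Definition is_simplicial_form m (w : family simplicial_form) : Prop :=
  [/\ forall p rho, is_simplex_form m (w p rho),
      forall p q (mu : 'I_p.+1 -> 'I_q.+1) rho,
        {homo mu : i j / (i <= j)%N} ->
        is_pullback (@prod_atlas R n M p) (@prod_atlas R n M q)
          (@simplex R p `*` setT) (fun y => (simplex_map mu y.1, y.2))
          (w q rho) (w p (rho \o mu)),
      forall p (sigma : diffeo M) rho,
        is_pullback (@prod_atlas R n M p) (@prod_atlas R n M p)
          (@simplex R p `*` setT) (fun y => (y.1, sigma y.2))
          (w p rho) (w p (fun i => diffeo_mul (rho i) sigma)) &
      forall p, differentiable_simplex_form (w p)].

Definition simplicial_deRham_complex : complex R :=
  Complex (fun m => [set w | is_simplicial_form m w])
    (fun (w : family simplicial_form) p rho => simplex_extd (w p rho)).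

Definition integration_along_fibers (w : ambient simplicial_deRham_complex) :
    ambient bott_complex :=
  fun p rho => fiber_integral (w p rho).

End BottComplex.

Arguments integration_along_fibers {R n} M w.

(* Main.v *)
(* Fix a chart of M and a point x, and regard a form on Delta^p x M as a
   function of t in R^p.  Contracting along the segments towards the vertex j
   gives an operator h_j with D h_j + h_j D = id - eps_j, where eps_j is the
   restriction to the vertex j.  For a word J = j_0 ... j_q in the vertices,
   the iterated contraction eps_(j_q) h_(j_(q-1)) ... h_(j_0) is the integral
   over the simplex J (radial integration, Fubini), and iterating the Cartan
   formula gives Stokes' formula.  Applied to a compatible family, naturality
   under the monotone maps of simplices shows that for weakly increasing J
   this integral is the value of the integrated cochain at rho_J; with J = 0
   1 ... p, Stokes' formula is the chain map property.

   Conversely, a Bott cochain c gives the simplicial form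
     E c = sum_q sum t_(i_0) dt_(i_1) ... dt_(i_q) c(r(i_0 ... i_q)),
   where the chain map r retracts all words onto the weakly increasing ones
   and is natural under monotone maps, so that E c is compatible with faces
   and degeneracies; E is a chain map.  The same expression with c replaced by
   the iterated contractions h_J z defines s z with d s z = z - E(integral of
   z) whenever dz = 0.  Hence if the integral of z is D b, then
   z = d (E b + s z), which is injectivity.

   For surjectivity, the integral of E c is the evaluation of c on a universal
   chain of words (an average over permutations), natural in the letters and
   compatible with boundaries; coning from the first letter, it is chain
   homotopic to the identity, so that for a cocycle c it differs from c by a
   coboundary.  All these operations are finite sums, integrals over segments
   and linear changes of jets, so they preserve differentiability.

   Smooth extensions of forms beyond the simplex do not matter, since the
   interior of the simplex is dense. *)

From HB Require Import structures.
From mathcomp Require Import all_boot all_order all_algebra.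
From mathcomp Require Import all_classical all_reals all_analysis.
From mathcomp Require Import measurable_realfun.
From mathcomp Require Import zify ring lra.
Require Import Defs.

Set Implicit Arguments.
Unset Strict Implicit.
Unset Printing Implicit Defensive.

Import Order.TTheory GRing.Theory Num.Theory.
Import numFieldNormedType.Exports.

Local Open Scope classical_set_scope.
Local Open Scope ring_scope.

(** * Words in the vertices of a simplex *)

(** Compatibility of a simplicial form is required along monotone maps only, so the integral of a
    form over a word can be recognized as a value of the integrated cochain for weakly increasing
    words alone. A homotopy on forms that is natural in the simplex, however, is a sum over all
    words: the pull-back of t_l along mu is the sum of the t_i with mu i = l, and the sum over all
    words is stable under this substitution. The retraction r reconciles the two. Summing over all
    words also replaces the factorials and signs of Whitney forms and copes with degenerate
    simplices, cochains being neither alternating nor normalized. The price is that the integral of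
    E c is a combination of values of c; its coefficients are never computed, only naturality and
    Stokes' formula are used. Letters are natural numbers, and vertices, tuples and maps are
    extended constantly beyond the last index, which keeps dependent types out of the inductions
    over words. A change of charts, a diffeomorphism and a simplicial map are treated together, as
    pull-backs by a block diagonal matrix. *)

Section AlternatingSums.
Variable R : comNzRingType.

(* [asum W s] is the sum of the (-1)^k W s_k (s with s_k omitted). *)
Fixpoint asum (X : Type) (W : X -> seq X -> R) (s : seq X) : R :=
  if s is a :: s' then W a s' - asum (fun b v => W b (a :: v)) s' else 0.

Definition wdg X (al : X -> R) (G : seq X -> R) : seq X -> R :=
  asum (fun a v => al a * G v).

Definition coface X (G : seq X -> R) : seq X -> R := asum (fun=> G).

Section Theory.
Variable X : Type.
Implicit Types (al be : X -> R) (G H : seq X -> R) (W : X -> seq X -> R).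
Implicit Types (s : seq X).

Lemma eq_asum W W' s :
  (forall a v, size s = (size v).+1 -> W a v = W' a v) -> asum W s = asum W' s.
Proof.
elim: s W W' => //= a s IH W W' WW'; rewrite WW'//; congr (_ - _).
by apply: IH => b v sv; apply: WW'; rewrite /= sv.
Qed.

Lemma asumD W W' s :
  asum (fun a v => W a v + W' a v) s = asum W s + asum W' s.
Proof.
elim: s W W' => [|a s IH] W W' /=; first by rewrite addr0.
by rewrite IH opprD addrACA.
Qed.

Lemma asumZ c W s : asum (fun a v => c * W a v) s = c * asum W s.
Proof.
elim: s W => [|a s IH] W /=; first by rewrite mulr0.
by rewrite IH mulrBr.
Qed.

Lemma asumN W s : asum (fun a v => - W a v) s = - asum W s.
Proof. by rewrite -mulN1r -asumZ; apply: eq_asum => a v _; rewrite mulN1r. Qed.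

Lemma asumB W W' s :
  asum (fun a v => W a v - W' a v) s = asum W s - asum W' s.
Proof. by rewrite asumD asumN. Qed.

Lemma asum0 s : asum (fun (_ : X) _ => 0) s = 0.
Proof.
rewrite -[RHS](mul0r (asum (fun (_ : X) _ => 0) s)) -asumZ.
by apply: eq_asum => a v _; rewrite mul0r.
Qed.

Lemma asum_sum I (r : seq I) (P : pred I) (W : I -> X -> seq X -> R) s :
  asum (fun a v => \sum_(i <- r | P i) W i a v) s =
  \sum_(i <- r | P i) asum (W i) s.
Proof.
elim: r => [|i r IH].
  by rewrite big_nil -[RHS](asum0 s); apply: eq_asum => a v _; rewrite big_nil.
rewrite big_cons; case: ifPn => Pi.
  by rewrite -IH -asumD; apply: eq_asum => a v _; rewrite big_cons Pi.
by rewrite -IH; apply: eq_asum => a v _; rewrite big_cons (negbTE Pi).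
Qed.

Lemma eq_wdg al be G H s :
  al =1 be -> (forall v, size s = (size v).+1 -> G v = H v) ->
  wdg al G s = wdg be H s.
Proof. by move=> ab GH; apply: eq_asum => a v sv; rewrite ab GH. Qed.

Lemma wdgZ al c G s : wdg al (fun v => c * G v) s = c * wdg al G s.
Proof. by rewrite -asumZ; apply: eq_asum => a v _; rewrite mulrCA. Qed.

Lemma wdgN al G s : wdg al (fun v => - G v) s = - wdg al G s.
Proof. by rewrite -asumN; apply: eq_asum => a v _; rewrite mulrN. Qed.

Lemma wdgD al G H s : wdg al (fun v => G v + H v) s = wdg al G s + wdg al H s.
Proof. by rewrite -asumD; apply: eq_asum => a v _; rewrite mulrDr. Qed.

Lemma wdgB al G H s : wdg al (fun v => G v - H v) s = wdg al G s - wdg al H s.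
Proof. by rewrite wdgD wdgN. Qed.

Lemma wdg_sum al I (r : seq I) (P : pred I) (G : I -> seq X -> R) s :
  wdg al (fun v => \sum_(i <- r | P i) G i v) s =
  \sum_(i <- r | P i) wdg al (G i) s.
Proof. by rewrite -asum_sum; apply: eq_asum => a v _; rewrite mulr_sumr. Qed.

Lemma wdg_suml I (r : seq I) (P : pred I) (al : I -> X -> R) G s :
  wdg (fun a => \sum_(i <- r | P i) al i a) G s =
  \sum_(i <- r | P i) wdg (al i) G s.
Proof. by rewrite -asum_sum; apply: eq_asum => a v _; rewrite mulr_suml. Qed.

Lemma wdg0l G s : wdg (fun=> 0) G s = 0.
Proof. by rewrite -[RHS](asum0 s); apply: eq_asum => a v _; rewrite mul0r. Qed.

(** Exchanging the order in which two letters are omitted moves one position past the other and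
    changes the sign: this is the anticommutation of one-forms behind [dfm_wdg]. *)
Lemma asum_anti (Z : X -> X -> seq X -> R) s :
  asum (fun a => asum (Z a)) s = - asum (fun b => asum (Z^~ b)) s.
Proof.
elim: s Z => [|c s IH] Z; first by rewrite oppr0.
have E Z1 : asum (fun a => asum (Z1 a)) (c :: s) = asum (Z1 c) s -
  asum (fun a v => Z1 a c v - asum (fun b u => Z1 a b (c :: u)) v) s by [].
by rewrite !E !asumB (IH (fun a b u => Z a b (c :: u))); ring.
Qed.

Lemma cofaceB G H s : coface (fun v => G v - H v) s = coface G s - coface H s.
Proof. exact: asumB. Qed.

Lemma coface_coface G s : coface (coface G) s = 0.
Proof.
elim: s G => // a s IH G.
have -> : coface (coface G) (a :: s) = coface G s -
  coface (fun v => G v - coface (fun u => G (a :: u)) v) s by [].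
by rewrite cofaceB IH subr0 subrr.
Qed.

End Theory.

Lemma asum_map (X Y : Type) (f : X -> Y) (W : Y -> seq Y -> R) s :
  asum W (map f s) = asum (fun a v => W (f a) (map f v)) s.
Proof. by elim: s W => //= a s IH W; rewrite IH. Qed.

Lemma coface_map (X Y : Type) (f : X -> Y) (G : seq Y -> R) s :
  coface G (map f s) = coface (fun v => G (map f v)) s.
Proof. exact: asum_map. Qed.

(** Faces of [s] are recorded as subsequences, so that they inherit its sortedness and its
    letters. *)
Lemma eq_coface (X : eqType) (G H : seq X -> R) s :
  (forall v, subseq v s -> size s = (size v).+1 -> G v = H v) ->
  coface G s = coface H s.
Proof.
rewrite /coface; elim: s G H => //= a s IH G H GH.
congr (_ - _); first by apply: GH => //; exact: subseq_cons.
by apply: IH => v sv ss; apply: GH; rewrite /= ?eqxx// ss.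
Qed.

(** The omitted letter and the rest are known to permute [s]: this lets [nt s] be computed from
    them. *)
Lemma eq_asum_perm (X : eqType) (W W' : X -> seq X -> R) s :
  (forall a v, perm_eq (a :: v) s -> W a v = W' a v) -> asum W s = asum W' s.
Proof.
elim: s W W' => //= a s IH W W' WW'; rewrite WW'//; congr (_ - _).
apply: IH => b v bv; apply: WW'.
by rewrite -[[:: b, a & v]]/([:: b] ++ [:: a] ++ v) perm_catCA/= perm_cons.
Qed.

(** The recursive [asum] suits inductions on words; this indexed form is the one found in [extd] and
    [group_coboundary]. *)
Lemma asumE (X : Type) (W : X -> seq X -> R) s :
  asum W s = \sum_(a < size s) (-1) ^+ a *
    W (tnth (in_tuple s) a) (take a s ++ drop a.+1 s).
Proof.
elim: s W => [|x s IH] W /=; first by rewrite big_ord0.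
rewrite big_ord_recl expr0 mul1r /= drop0 (tnth_nth x)/=; congr (_ + _).
rewrite IH -sumrN; apply: eq_bigr => a _.
by rewrite !(tnth_nth x)/= exprS mulN1r mulNr.
Qed.

Section Alternating.
Variable X : Type.

Definition alternating (G : seq X -> R) :=
  forall s1 i j s2, G (s1 ++ i :: j :: s2) = - G (s1 ++ j :: i :: s2).

Lemma alternating_cons G a : alternating G -> alternating (fun v => G (a :: v)).
Proof. by move=> aG s1 i j s2; apply: (aG (a :: s1)). Qed.

Lemma alternating_asum W : (forall a, alternating (W a)) -> alternating (asum W).
Proof.
move=> aW s1; elim: s1 W aW => [|a s1 IH] W aW i j s2 /=.
  have -> : asum (fun b v => W b (i :: j :: v)) s2 =
      - asum (fun b v => W b (j :: i :: v)) s2.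
    by rewrite -asumN; apply: eq_asum => b v _; exact: (aW b [::]).
  ring.
rewrite aW (IH (fun b v => W b (a :: v))); first by ring.
by move=> b; exact: alternating_cons.
Qed.

Lemma alternating_sum I (r : seq I) (G : I -> seq X -> R) :
  (forall i, alternating (G i)) -> alternating (fun s => \sum_(i <- r) G i s).
Proof. by move=> aG s1 i j s2; rewrite -sumrN; apply: eq_bigr => k _; exact: aG. Qed.

(** Moving the omitted letter back to its place costs exactly the sign of the omission, so each
    letter satisfying [chi] contributes G s once. With [isT] for [chi] the factor is the degree in
    the dt's, which Cartan's formula matches with the derivative of a power of 1 - u. *)
Lemma alternating_asum_cons (chi : pred X) G s : alternating G ->
  asum (fun a v => (chi a)%:R * G (a :: v)) s = (count chi s)%:R * G s.
Proof.
elim: s G => [|a s IH] G aG /=; first by rewrite mul0r.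
have -> : asum (fun b v => (chi b)%:R * G [:: b, a & v]) s =
    - asum (fun b v => (chi b)%:R * G [:: a, b & v]) s.
  by rewrite -asumN; apply: eq_asum => b v _; rewrite (aG [::]) mulrN.
rewrite opprK (IH (fun v => G (a :: v))); last exact: alternating_cons.
by rewrite natrD mulrDl.
Qed.

End Alternating.
End AlternatingSums.

(** * Chains of words and the retraction onto the weakly increasing ones *)

Section Chains.
Variable R : comNzRingType.

(* Formal linear combinations of words in the vertices of a simplex. *)
Definition chain := seq (R * seq nat).

Definition ev (L : chain) (psi : seq nat -> R) : R := \sum_(x <- L) x.1 * psi x.2.

Definition cone x (L : chain) : chain := [seq (y.1, x :: y.2) | y <- L].
Definition scale_chain c (L : chain) : chain := [seq (c * y.1, y.2) | y <- L].

(** [T] stands for a map of chains already constructed one degree lower; it is applied to the faces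
    of [w]. *)
Fixpoint boundary (T : seq nat -> chain) (w : seq nat) : chain :=
  if w is x :: w' then
    T w' ++ scale_chain (-1) (boundary (fun v => T (x :: v)) w') else [::].

Lemma ev_nil psi : ev [::] psi = 0.
Proof. exact: big_nil. Qed.

Lemma ev_cat L L' psi : ev (L ++ L') psi = ev L psi + ev L' psi.
Proof. by rewrite /ev big_cat. Qed.

Lemma ev_cone x L psi : ev (cone x L) psi = ev L (fun v => psi (x :: v)).
Proof. by rewrite /ev big_map. Qed.

Lemma ev_scale c L psi : ev (scale_chain c L) psi = c * ev L psi.
Proof. by rewrite /ev big_map mulr_sumr; apply: eq_bigr => y _; rewrite mulrA. Qed.

Lemma ev_boundary T w psi : ev (boundary T w) psi = coface (fun v => ev (T v) psi) w.
Proof.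
elim: w T => [|x w IH] T /=; first by rewrite ev_nil.
by rewrite ev_cat ev_scale IH mulN1r.
Qed.

Lemma eq_ev L (psi psi' : seq nat -> R) :
  (forall x, x \in [seq y.2 | y <- L] -> psi x = psi' x) -> ev L psi = ev L psi'.
Proof.
move=> e; rewrite /ev big_seq [RHS]big_seq; apply: eq_bigr => x xL.
by rewrite e// map_f.
Qed.

Lemma evB L psi psi' : ev L (fun w => psi w - psi' w) = ev L psi - ev L psi'.
Proof. by rewrite /ev -sumrB; apply: eq_bigr => x _; rewrite mulrBr. Qed.

Lemma evZ L c psi : ev L (fun w => c * psi w) = c * ev L psi.
Proof. by rewrite /ev mulr_sumr; apply: eq_bigr => x _; rewrite mulrCA. Qed.

Lemma ev_asum L X (W : seq nat -> X -> seq X -> R) s :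
  ev L (fun w => asum (W w) s) = asum (fun a v => ev L (fun w => W w a v)) s.
Proof. by rewrite /ev asum_sum; apply: eq_bigr => x _; rewrite asumZ. Qed.

Lemma boundary_words T w v : v \in [seq y.2 | y <- boundary T w] ->
  exists2 u, subseq u w /\ size w = (size u).+1 & v \in [seq y.2 | y <- T u].
Proof.
elim: w T => [|x w IH] T //=.
rewrite map_cat mem_cat => /orP[vT|].
  by exists w => //; split=> //; exact: subseq_cons.
rewrite -map_comp => /IH[u [uw su] vT].
by exists (x :: u) => //=; rewrite eqxx su.
Qed.

(* The retraction of all words onto the weakly increasing ones: r(w) is the
   cone, with apex the least letter of w, over r of the boundary of w. *)
Fixpoint sorting_rec k (w : seq nat) : chain :=
  if k is k'.+1 then
    cone (foldr minn (head 0%N w) w) (boundary (sorting_rec k') w)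
  else [:: (1, [::])].

(** The empty word acts as an augmentation: it is the boundary of every letter and is sent to
    itself, so that the cone formula also covers one-letter words. *)
Definition sorting w := sorting_rec (size w) w.

Lemma sorting0 psi : ev (sorting [::]) psi = psi [::].
Proof. by rewrite /ev big_seq1 mul1r. Qed.

Lemma sortingS x w psi :
  ev (sorting (x :: w)) psi =
  coface (fun v => ev (sorting v) (fun u => psi (foldr minn x (x :: w) :: u))) (x :: w).
Proof.
rewrite -[LHS]/(ev (cone (foldr minn x (x :: w))
  (boundary (sorting_rec (size w)) (x :: w))) psi) ev_cone ev_boundary.
by apply: eq_coface => v _ /= [->].
Qed.

Lemma sorting1 j psi : ev (sorting [:: j]) psi = psi [:: j].
Proof. by rewrite sortingS /coface/= sorting0 minnn subr0. Qed.

(** In dual form, the boundary of the cone over a chain L is L minus the cone over the boundary of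
    L. Here L is r of the boundary of [w]; by induction its boundary is r of a double boundary,
    hence 0. *)
Lemma ev_sorting_coface w psi :
  ev (sorting w) (coface psi) = coface (fun v => ev (sorting v) psi) w.
Proof.
elim: {w}(size w) {-2}w (erefl (size w)) psi => [|k IH] [|x w]//= sw psi.
  by rewrite sorting0.
rewrite sortingS; set m := foldr _ _ _.
rewrite (@eq_coface _ _ _ (fun v => ev (sorting v) psi -
   coface (fun u => ev (sorting u) (fun u' => psi (m :: u'))) v)); last first.
  move=> v _ /= [sv]; rewrite -IH -?sv; last by case: sw.
  by rewrite -evB.
by rewrite cofaceB coface_coface subr0.
Qed.

(** The apex is the only choice made in r, and a monotone map sends the least letter of a word to
    the least letter of its image. *)
Lemma sorting_map (f : nat -> nat) w psi :
  {homo f : i j / (i <= j)%N} ->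
  ev (sorting (map f w)) psi = ev (sorting w) (fun v => psi (map f v)).
Proof.
move=> hf; have fmin i j : f (minn i j) = minn (f i) (f j).
  case: (leqP i j) => [ij|/ltnW ji].
    by rewrite (minn_idPl (hf _ _ ij)).
  by rewrite (minn_idPr (hf _ _ ji)).
elim: {w}(size w) {-2}w (erefl (size w)) psi => [|k IH] [|x w]//= sw psi.
  by rewrite !sorting0.
rewrite !sortingS -map_cons.
have -> : foldr minn (f x) (map f (x :: w)) = f (foldr minn x (x :: w)).
  by elim: (x :: w) => //= y v ->; rewrite fmin.
rewrite coface_map; apply: eq_coface => v _ /= [sv].
by rewrite IH//; case: sw => <-.
Qed.

(** The apex is a lower bound of the letters of [w], so a weakly increasing word in these letters
    stays so with the apex in front. *)
Lemma sorting_words w v : v \in [seq y.2 | y <- sorting w] ->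
  [/\ size v = size w, sorted leq v & {subset v <= w}].
Proof.
rewrite /sorting.
have [k sw] : exists k, size w = k by exists (size w).
rewrite sw; elim: k w sw v => [|k IH] w sw v /=.
  by rewrite inE => /eqP ->; split.
set m := foldr _ _ _; rewrite -map_comp => /mapP[y yB ->] /=.
have /boundary_words[u [uw su] yu0] : y.2 \in [seq y.2 | y <- boundary (sorting_rec k) w].
  exact: map_f.
have su' : size u = k by rewrite su in sw; case: sw.
have [sy ysort yu] := IH u su' y.2 yu0.
have mw z : z \in w -> (m <= z)%N.
  rewrite /m; elim: (w) (head 0%N w) => //= a w' IHw h.
  rewrite inE => /orP[/eqP ->|/IHw zw]; first exact: geq_minl.
  by rewrite (leq_trans (geq_minr _ _)).
have mm : m \in w.
  move: sw; rewrite /m; case: (w) => //= a w' _.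
  elim: w' => /=[|b w' IHw]; first by rewrite minnn inE eqxx.
  rewrite minnCA /minn; case: ifP => _; first by rewrite !inE eqxx orbT.
  by move: IHw; rewrite !inE => /orP[->//|->]; rewrite !orbT.
split.
- by rewrite /= sy.
- rewrite /= path_min_sorted//; apply/allP => z /yu zu.
  by apply: mw; exact: mem_subseq zu.
- move=> z; rewrite inE => /orP[/eqP ->//|/yu zu]; exact: mem_subseq zu.
Qed.

End Chains.

(** * Integrals depending on a parameter *)

Lemma continuous_bigsum (R : realType) (T : topologicalType) I (r : seq I)
    (P : pred I) (f : I -> T -> R) :
  (forall i, continuous (f i)) ->
  continuous (fun x => \sum_(i <- r | P i) f i x).
Proof.
move=> cf; elim: r => [|i r IH].
  rewrite (_ : (fun _ => _) = cst 0); first exact: cst_continuous.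
  by apply/funext => x; rewrite big_nil.
rewrite (_ : (fun _ => _) = (fun x =>
    (if P i then f i x else 0) + \sum_(j <- r | P j) f j x)).
  move=> x; apply: continuousD; last exact: IH.
  by case: (P i); [exact: cf|exact: cst_continuous].
by apply/funext => x; rewrite big_cons; case: (P i); rewrite ?add0r.
Qed.

Lemma continuous_cmul (R : realType) (T : topologicalType) (c : R) (f : T -> R) :
  continuous f -> continuous (fun x => c * f x).
Proof.
move=> cf x; apply: (@continuousM R T (fun=> c) f x); last exact: cf.
exact: cst_continuous.
Qed.

Lemma continuous_add (R : realType) (T : topologicalType) (f g : T -> R) :
  continuous f -> continuous g -> continuous (fun x => f x + g x).
Proof. by move=> cf cg x; apply: (@continuousD _ _ _ f g); [exact: cf|exact: cg]. Qed.

Lemma continuous_mul (R : realType) (T : topologicalType) (f g : T -> R) x :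
  {for x, continuous f} -> {for x, continuous g} ->
  {for x, continuous (fun x => f x * g x)}.
Proof. exact: continuousM. Qed.

Section UnitIntegral.
Variable R : realType.
Local Notation mu := (@lebesgue_measure R).

Definition int01 (f : R -> R) : R := \int[mu]_(u in `[0, 1]) f u.

Lemma continuous_integrable (f : R -> R) (a b : R) :
  continuous f -> mu.-integrable `[a, b] (EFin \o f).
Proof.
move=> cf; apply: continuous_compact_integrable; first exact: segment_compact.
exact: continuous_subspaceT.
Qed.

Lemma eq_int01 (f g : R -> R) : (forall u, 0 <= u <= 1 -> f u = g u) ->
  int01 f = int01 g.
Proof. by move=> fg; apply: eq_Rintegral => u; rewrite inE/= in_itv/= => /fg. Qed.

Lemma int01D (f g : R -> R) : continuous f -> continuous g ->
  int01 (fun u => f u + g u) = int01 f + int01 g.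
Proof. by move=> cf cg; rewrite /int01 RintegralD//; exact: continuous_integrable. Qed.

Lemma int01B (f g : R -> R) : continuous f -> continuous g ->
  int01 (fun u => f u - g u) = int01 f - int01 g.
Proof. by move=> cf cg; rewrite /int01 RintegralB//; exact: continuous_integrable. Qed.

Lemma int01Z c (f : R -> R) : continuous f ->
  int01 (fun u => c * f u) = c * int01 f.
Proof. by move=> cf; rewrite /int01 RintegralZl//; exact: continuous_integrable. Qed.

Lemma int01_cst c : int01 (fun=> c) = c.
Proof.
rewrite /int01 Rintegral_cst//=.
by rewrite lebesgue_measure_itv/= lte_fin ltr01 -EFinB/= subr0 mulr1.
Qed.

Lemma int01_sum I (r : seq I) (P : pred I) (f : I -> R -> R) :
  (forall i, continuous (f i)) ->
  int01 (fun u => \sum_(i <- r | P i) f i u) = \sum_(i <- r | P i) int01 (f i).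
Proof.
move=> cf; elim: r => [|i r IH].
  by rewrite big_nil -[RHS](int01_cst 0); apply: eq_int01 => u _; rewrite big_nil.
rewrite big_cons -IH; case Pi : (P i); last first.
  by apply: eq_int01 => u _; rewrite big_cons Pi.
rewrite -int01D//; last exact: continuous_bigsum.
by apply: eq_int01 => u _; rewrite big_cons Pi.
Qed.

Lemma le_int01 (f g : R -> R) : continuous f -> continuous g ->
  (forall u, 0 <= u <= 1 -> f u <= g u) -> int01 f <= int01 g.
Proof.
by move=> cf cg fg; apply: le_Rintegral => //; exact: continuous_integrable.
Qed.

Lemma int01_norm (f : R -> R) M : continuous f ->
  (forall u, 0 <= u <= 1 -> `|f u| <= M) -> `|int01 f| <= M.
Proof.
move=> cf fM; rewrite ler_norml -{1}(int01_cst (- M)) -{2}(int01_cst M).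
by rewrite !le_int01 ?andbT//; try exact: cst_continuous;
  move=> u /fM; rewrite ler_norml => /andP[].
Qed.

Lemma int01_FTC (F f : R -> R) : (forall u : R, is_derive u (1 : R) F (f u)) ->
  continuous f -> int01 f = F 1 - F 0.
Proof.
move=> dF cf; have cF : continuous F.
  by move=> u; apply/differentiable_continuous/derivable1_diffP; have := dF u => -[].
rewrite /int01 /Rintegral (@continuous_FTC2 _ f F)//.
- exact: continuous_subspaceT.
- split=> [u _||]; first by have := dF u => -[].
  + by apply: cvg_at_right_filter; exact: cF.
  + by apply: cvg_at_left_filter; exact: cF.
- by move=> u _; rewrite derive1E; have := dF u => -[].
Qed.

(* The tube lemma. *)
Lemma near_int01 (Y : topologicalType) (y : Y) (P : R -> Y -> Prop) :
  (forall u : R, 0 <= u <= 1 -> \forall p \near (u, y), P p.1 p.2) ->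
  \forall y' \near y, forall u : R, 0 <= u <= 1 -> P u y'.
Proof.
move=> nP.
have /compact_near_coveringP : compact (`[0%R, 1%R]%classic : set R).
  exact: segment_compact.
move=> /(_ Y (nbhs y) (fun y' u => P u y') _) H.
have {}H : \near y, `[0%R, 1%R]%classic `<=` P ^~ y.
  by apply: H => u; rewrite /= in_itv/= => /nP.
by apply: filterS H => y' H u u01; apply: H; rewrite /= in_itv.
Qed.

Lemma continuous_int01 (Y : topologicalType) (phi : R -> Y -> R) (y : Y) :
  (\forall y' \near y, continuous (phi ^~ y')) ->
  (forall u : R, 0 <= u <= 1 -> {for (u, y), continuous (fun p => phi p.1 p.2)}) ->
  {for y, continuous (fun y => int01 (phi ^~ y))}.
Proof.
move=> cu cp; apply/cvgrPdist_le => e e0.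
have := @near_int01 Y y (fun u y' => `|phi u y - phi u y'| <= e) => H.
have {}H : \forall y' \near y, forall u : R, 0 <= u <= 1 -> `|phi u y - phi u y'| <= e.
  apply: H => u u01.
  have /cvgrPdist_le/(_ (e / 2)) := cp u u01; rewrite divr_gt0// => /(_ isT) c1.
  have c2 : \forall p \near (u, y), `|phi u y - phi p.1 y| <= e / 2.
    have : {for (u, y), continuous (fun p : R * Y => phi p.1 y)}.
      apply: (@continuous_comp _ _ _ fst (phi ^~ y)); first exact: cvg_fst.
      exact: (nbhs_singleton cu).
    by move=> /cvgrPdist_le/(_ (e / 2)); rewrite divr_gt0// => /(_ isT).
  apply: filterS2 c1 c2 => -[u' y'] /= c1 c2.
  rewrite -(subrKA (phi u y)) (le_trans (ler_normD _ _))// [leRHS]splitr lerD//.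
  by rewrite distrC.
have cu0 := nbhs_singleton cu.
apply: filterS2 H cu => y' H cu'.
rewrite -int01B//.
by apply: int01_norm => // u; apply: continuousB; [exact: cu0|exact: cu'].
Qed.

End UnitIntegral.

(** * Differentiation under the integral sign *)

Section DiffUnderIntegral.
Variable R : realType.

Definition lincomb m (c : 'I_m -> R) (v : 'rV[R]_m) : R := \sum_i v 0 i * c i.

Lemma lincomb_is_linear m (c : 'I_m -> R) : linear (lincomb c : 'rV[R]_m -> R^o).
Proof.
move=> k v w; rewrite /lincomb scaler_sumr -big_split/=; apply: eq_bigr => i _.
by rewrite !mxE mulrDl -mulrA.
Qed.

HB.instance Definition _ m (c : 'I_m -> R) :=
  GRing.isLinear.Build R 'rV[R]_m R^o *:%R (lincomb c) (lincomb_is_linear c).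

Lemma differentiable_bound (V W : normedModType R) (F : V -> W)
    (L : {linear V -> W}) (z : V) : continuous L ->
  (forall e, 0 < e -> \forall h \near (0 : V),
     `|F (h + z) - F z - L h| <= e * `|h|) ->
  differentiable F z /\ 'd F z = L :> (V -> W).
Proof.
move=> cL FL.
have oF : F \o shift z = cst (F z) + L +o_ 0 id.
  apply/eqaddoP => _/posnumP[e]; apply: filterS (FL e%:num _) => // h.
  by rewrite !fctE/= opprD addrA.
have dF := diff_unique cL oF.
by split=> //; apply/diff_locallyP; rewrite dF.
Qed.

Lemma le_coord_norm m (v : 'rV[R]_m) i : `|v 0 i| <= `|v|.
Proof.
by rewrite [leRHS]/Num.Def.normr/= mx_normrE (@le_bigmax _ _ _ _ (fun i => `|v i.1 i.2|) (0, i)).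
Qed.

Lemma lincomb_continuous m (c : 'I_m -> R) : continuous (lincomb c).
Proof.
apply: continuous_bigsum => i v; apply: continuousM; last exact: cst_continuous.
exact: coord_continuous.
Qed.

Lemma is_derive_line m (f : 'rV[R]_m -> R) z h (s : R) :
  differentiable f (z + s *: h) ->
  is_derive s 1 (fun s : R => f (z + s *: h)) ('D_h f (z + s *: h)).
Proof.
move=> /(diff_derivable (v := h)) df.
have E : (fun k : R => k^-1 *: (f (z + (k *: (1 : R) + s) *: h) - f (z + s *: h))) =
    (fun k : R => k^-1 *: (f (k *: h + (z + s *: h)) - f (z + s *: h))).
  by apply/funext => k; rewrite scalerDl [_%:A]mulr1 addrCA.
by apply: DeriveDef; rewrite /derivable /derive/= E.
Qed.

(* The differential quotient is estimated uniformly in u by the mean value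
   theorem, which is why the partial derivatives have to be continuous. *)
Lemma diff_int01 m (U : set 'rV[R]_m) (phi : R -> 'rV[R]_m -> R)
    (C : 'I_m -> R -> 'rV[R]_m -> R) (z : 'rV[R]_m) :
  open U -> U z ->
  (forall u z', U z' -> differentiable (phi u) z') ->
  (forall u z' v, U z' -> 'D_v (phi u) z' = lincomb (fun i => C i u z') v) ->
  (forall z', U z' -> continuous (phi ^~ z')) ->
  (forall i z', U z' -> continuous (C i ^~ z')) ->
  (forall i (u : R), {for (u, z), continuous (fun p => C i p.1 p.2)}) ->
  differentiable (fun z => int01 (phi ^~ z)) z /\
  forall v, 'D_v (fun z => int01 (phi ^~ z)) z =
    int01 (fun u => 'D_v (phi u) z).
Proof.
move=> oU Uz dphi Dphi cphi cCu cC; pose c i := int01 (C i ^~ z).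
pose F : 'rV[R]_m -> R^o := fun z => int01 (phi ^~ z).
have cD v : continuous (fun u => lincomb (fun i => C i u z) v).
  apply: continuous_bigsum => i u; apply: continuousM; first exact: cst_continuous.
  exact: cCu.
have intD v : int01 (fun u => lincomb (fun i => C i u z) v) = lincomb c v.
  rewrite /lincomb int01_sum; last first.
    by move=> i u; apply: continuousM; [exact: cst_continuous|exact: cCu].
  by apply: eq_bigr => i _; rewrite int01Z//; exact: cCu.
have nU : \forall z' \near z, U z' by exact: open_nbhs_nbhs.
have [DF dF] : differentiable F z /\ 'd F z = lincomb c :> ('rV[R]_m -> R^o).
  apply: differentiable_bound; first exact: lincomb_continuous.
  move=> _/posnumP[e].
  (* The increment is a sum of m terms, each bounded by [|h|] times this number; [m.+1] keeps the
     denominator nonzero when m = 0. *)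
  have e'0 : 0 < e%:num / m.+1%:R by rewrite divr_gt0.
  have Hi i : \forall z' \near z, forall u : R, 0 <= u <= 1 ->
      `|C i u z - C i u z'| <= e%:num / m.+1%:R.
    apply: (@near_int01 _ _ z (fun u z' => `|C i u z - C i u z'| <= e%:num / m.+1%:R)) => u u01.
    have /cvgrPdist_le/(_ ((e%:num / m.+1%:R) / 2)) := cC i u.
    rewrite divr_gt0// => /(_ isT) c1.
    have c2 : \forall p \near (u, z), `|C i u z - C i p.1 z| <= (e%:num / m.+1%:R) / 2.
      have : {for (u, z), continuous (fun p : R * 'rV[R]_m => C i p.1 z)}.
        by apply: (@continuous_comp _ _ _ fst (C i ^~ z)); [exact: cvg_fst|exact: cCu].
      by move=> /cvgrPdist_le/(_ ((e%:num / m.+1%:R) / 2)); rewrite divr_gt0// => /(_ isT).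
    apply: filterS2 c1 c2 => -[u' z'] /= c1 c2.
    rewrite -(subrKA (C i u z)) (le_trans (ler_normD _ _))// [leRHS]splitr lerD//.
    by rewrite distrC.
  have nH : \forall z' \near z, forall i (u : R), 0 <= u <= 1 ->
      `|C i u z - C i u z'| <= e%:num / m.+1%:R by exact: (@filter_forall _ _ _ _ (nbhs_filter z) Hi).
  have [d /= d0 dC] := (nbhs_ballP z _).1 (filterI nU nH).
  apply/nbhs_ballP; exists d => //= h; rewrite -ball_normE/= sub0r normrN => hd.
  have Bz (s : R) : 0 <= s <= 1 -> ball z d (z + s *: h).
    move=> /andP[s0 s1]; rewrite -ball_normE/= opprD addNKr normrN normrZ.
    by rewrite (le_lt_trans _ hd)// ger0_norm// ler_piMl.
  have Uzh : U (h + z) by have [] := dC _ (Bz 1 (introT andP (conj ler01 (lexx _)))); rewrite scale1r addrC.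
  rewrite -intD -int01B//; try exact: cphi.
  have cp : continuous (fun u => phi u (h + z) - phi u z).
    by move=> u; apply: continuousB; exact: cphi.
  rewrite -int01B//; apply: int01_norm.
    move=> u; apply: (@continuousB _ _ _ (fun u => phi u (h + z) - phi u z)); first exact: cp.
    exact: cD.
  move=> u u01.
  pose g (s : R) : R := phi u (z + s *: h).
  have dg (s : R) : s \in `[0, 1] -> is_derive s (1 : R) g ('D_h (phi u) (z + s *: h)).
    by rewrite in_itv/= => s01; apply/is_derive_line/dphi; apply: (dC _ (Bz s _)).1.
  have dg' (s : R) : s \in `]0, 1[ -> is_derive s (1 : R) g ('D_h (phi u) (z + s *: h)).
    by move=> s01; apply: dg; exact: subset_itv_oo_cc.
  have cg : {within `[0, 1], continuous g}.
    by apply: derivable_within_continuous => s /dg[].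
  have [s + E] := MVT_segment ler01 dg' cg.
  rewrite in_itv/= => s01.
  move: E; rewrite /g scale1r scale0r addr0 subr0 mulr1 => E.
  have [Us Cs] := dC _ (Bz s s01).
  rewrite [h + z]addrC E Dphi// /lincomb -sumrB.
  rewrite (le_trans (ler_norm_sum _ _ _))//.
  rewrite (@le_trans _ _ (\sum_(i < m) `|h| * (e%:num / m.+1%:R)))//.
    apply: ler_sum => i _; rewrite -mulrBr normrM ler_pM//; first exact: le_coord_norm.
    by rewrite distrC; exact: Cs.
  rewrite sumr_const card_ord -mulrnAr mulrC ler_wpM2r//.
  by rewrite -mulr_natr mulrAC ler_pdivrMr ?ltr0n// ler_wpM2l// ler_nat.
split=> // v; rewrite deriveE// dF -intD; apply: eq_int01 => u _.
by rewrite Dphi.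
Qed.

End DiffUnderIntegral.

(** * Smooth functions, alone and depending on a parameter *)

Section SmoothFunctions.
Variable R : realType.

Lemma continuous_rV (T : topologicalType) m (f : T -> 'rV[R]_m) (x : T) :
  (forall j, {for x, continuous (fun x => f x 0 j)}) -> {for x, continuous f}.
Proof.
move=> cf; apply/cvgrPdist_le => e e0.
have : \forall y \near x, forall j, `|f x 0 j - f y 0 j| <= e.
  apply: (@filter_forall _ _ _ _ (nbhs_filter x)) => j.
  by have /cvgrPdist_le/(_ e e0) := cf j.
apply: filterS => y fy.
rewrite /Num.Def.normr/= mx_normrE (bigmax_le _ (ltW e0))//= => -[i j] _ /=.
by rewrite !mxE ord1; exact: fy.
Qed.

Lemma continuous_fst_slice (T T' V : topologicalType) (f : T -> T' -> V) u y :
  {for (u, y), continuous (fun q : T * T' => f q.1 q.2)} ->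
  {for u, continuous (f ^~ y)}.
Proof.
move=> cf; apply: (@cvg_comp _ _ _ (fun u => (u, y)) (fun q => f q.1 q.2) _ _ _ _ cf).
exact: (@cvg_pair _ _ _ (nbhs u) (nbhs u) (nbhs y) _ _ _ id (cst y) cvg_id (cvg_cst _)).
Qed.

Section Domain.
Variables (m : nat) (U : set 'rV[R]_m).
Hypothesis oU : open U.
Implicit Types f g : 'rV[R]_m -> R.

Lemma eq_smooth_on f g : (forall x, U x -> f x = g x) -> smooth_on U f -> smooth_on U g.
Proof. by move=> fg /smooth_onP sf; apply/smooth_onP => k; apply: eq_Ck (sf k). Qed.

Lemma smooth_onD f g : smooth_on U f -> smooth_on U g ->
  smooth_on U (fun x => f x + g x).
Proof.
move=> /smooth_onP sf /smooth_onP sg; apply/smooth_onP => k.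
exact: (CkD oU (sf k) (sg k)).
Qed.

Lemma smooth_onM f g : smooth_on U f -> smooth_on U g ->
  smooth_on U (fun x => f x * g x).
Proof.
move=> /smooth_onP sf /smooth_onP sg; apply/smooth_onP => k.
exact: (CkM oU (sf k) (sg k)).
Qed.

Lemma smooth_on_cst (W : normedModType R) (c : W) :
  smooth_on U (fun _ : 'rV[R]_m => c).
Proof.
move=> vs x _; suff [d ->] : exists d : W, foldr (fun v (g : 'rV[R]_m -> W) => 'D_v g) (fun=> c) vs = cst d.
  exact: differentiable_cst.
elim: vs => [|v vs [d /= ->]]; first by exists c.
by exists 0; apply/funext => y; rewrite derive_cst.
Qed.

Lemma smooth_onZ c f : smooth_on U f -> smooth_on U (fun x => c * f x).
Proof. by move=> sf; apply: smooth_onM => //; exact: smooth_on_cst. Qed.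

Lemma smooth_onN f : smooth_on U f -> smooth_on U (fun x => - f x).
Proof.
by move=> sf; apply: eq_smooth_on (smooth_onZ (-1) sf) => x _; rewrite mulN1r.
Qed.

Lemma smooth_on_sum I (r : seq I) (P : pred I) (f : I -> 'rV[R]_m -> R) :
  (forall i, P i -> smooth_on U (f i)) ->
  smooth_on U (fun x => \sum_(i <- r | P i) f i x).
Proof.
move=> sf; elim: r => [|i r IH].
  by apply: eq_smooth_on (smooth_on_cst (0 : R)) => x _; rewrite big_nil.
case Pi : (P i); last by apply: eq_smooth_on IH => x _; rewrite big_cons Pi.
by apply: eq_smooth_on (smooth_onD (sf i Pi) IH) => x _; rewrite big_cons Pi.
Qed.

Lemma smooth_on_coord j : smooth_on U (fun x : 'rV[R]_m => x 0 j).
Proof.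
have D v (x : 'rV[R]_m) : 'D_v (fun x : 'rV[R]_m => x 0 j) x = v 0 j.
  have := congr1 (fun M : 'rV[R]_m => M 0 j) 
    (@derive_mx _ _ _ _ id x v (@derivable_id _ _ x v)).
  by rewrite derive_id mxE => <-.
move=> vs x Ux; elim/last_ind: vs => [|vs v _]; first exact: differentiable_coord.
rewrite foldr_rcons (_ : 'D_v _ = cst (v 0 j)); last by apply/funext => y; rewrite D.
exact: smooth_on_cst.
Qed.

Lemma smooth_on_rV n (f : 'rV[R]_m -> 'rV[R]_n) :
  (forall j, smooth_on U (fun x => f x 0 j)) -> smooth_on U f.
Proof.
move=> sf; apply/smooth_onP => k; apply/Ck_coord => // j.
by have /smooth_onP := sf j; apply.
Qed.

Lemma smooth_on_compR n (V : set 'rV[R]_n) (f : 'rV[R]_m -> 'rV[R]_n)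
    (g : 'rV[R]_n -> R) : open V -> (forall x, U x -> V (f x)) ->
  (forall j, smooth_on U (fun x => f x 0 j)) -> smooth_on V g ->
  smooth_on U (fun x => g (f x)).
Proof.
move=> oV UV /smooth_on_rV/smooth_onP sf /smooth_onP sg; apply/smooth_onP => k.
exact: (Ck_comp oU oV UV (sf k) (sg k)).
Qed.

Lemma smooth_on_derive (W : normedModType R) v (f : 'rV[R]_m -> W) :
  smooth_on U f -> smooth_on U ('D_v f).
Proof. by move=> sf vs x Ux; have := sf (rcons vs v) x Ux; rewrite foldr_rcons. Qed.

Lemma smooth_on_continuous f x : smooth_on U f -> U x -> {for x, continuous f}.
Proof. by move=> sf Ux; apply: differentiable_continuous; exact: (sf [::]). Qed.

Lemma derive_coords f (x v : 'rV[R]_m) : differentiable f x ->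
  'D_v f x = lincomb (fun i => 'D_(delta_mx 0 i) f x) v.
Proof.
move=> df; rewrite deriveE// [X in 'd f _ X]row_sum_delta linear_sum/=.
by apply: eq_bigr => i _; rewrite linearZ deriveE.
Qed.

End Domain.

Lemma smooth_on_sub (V W : normedModType R) (U U' : set V) (f : V -> W) :
  U `<=` U' -> smooth_on U' f -> smooth_on U f.
Proof. by move=> UU sf vs x /UU; exact: sf. Qed.

(** The two difference quotients are the same function, so their limits agree. *)
Lemma derive_affine (V V' W : normedModType R) (f : V' -> W) (A L : V -> V')
    (v x : V) : (forall (k : R) w z, A (k *: w + z) = k *: L w + A z) ->
  'D_v (f \o A) x = 'D_(L v) f (A x).
Proof.
move=> AL.
have E : (fun k : R => k^-1 *: (((f \o A) \o shift x) (k *: v) - (f \o A) x)) =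
    (fun k : R => k^-1 *: ((f \o shift (A x)) (k *: L v) - f (A x))).
  by apply/funext => k /=; rewrite AL.
by rewrite /derive E.
Qed.

(** Stated for normed modules in general: it is what carries smoothness between jet spaces and
    spaces of row vectors. *)
Lemma smooth_on_affine (V V' W : normedModType R) (f : V' -> W)
    (A L : V -> V') (U : set V') :
  (forall (k : R) w z, A (k *: w + z) = k *: L w + A z) ->
  (forall z, differentiable A z) ->
  smooth_on U f -> smooth_on (A @^-1` U) (f \o A).
Proof.
move=> AL dA sf vs x Ux.
suff -> : foldr (fun v (g : V -> W) => 'D_v g) (f \o A) vs =
    foldr (fun v (g : V' -> W) => 'D_v g) f (map L vs) \o A.
  exact: (differentiable_comp (dA x) (sf (map L vs) (A x) Ux)).
elim: vs => //= v vs ->; apply/funext => z; exact: derive_affine.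
Qed.

End SmoothFunctions.

Section ParametrizedFunctions.
Variables (R : realType) (p N : nat).
Implicit Types (O : set 'rV[R]_N) (g : 'rV[R]_N -> 'rV[R]_p -> R).

(** The simplex variable comes first, as in the coordinates of [prod_chart], so that this is the
    local expression of a coefficient in a product chart. *)
Definition uncur (W : Type) (g : 'rV[R]_N -> 'rV[R]_p -> W) (z : 'rV[R]_(p + N)) :=
  g (rsubmx z) (lsubmx z).

Definition cyl O : set 'rV[R]_(p + N) := [set z | O (rsubmx z)].

(* Functions of [t] depending smoothly on a parameter in [O]. *)
Definition psmooth O g : Prop := smooth_on (cyl O) (uncur g).

Lemma open_cyl O : open O -> open (cyl O).
Proof. by move=> oO; apply: open_comp => // z _; exact: continuous_rsubmx. Qed.

Section OpenDomain.
Variable O : set 'rV[R]_N.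
Hypothesis oO : open O.
Let oC := open_cyl oO.

Lemma eq_psmooth g h : (forall y t, O y -> g y t = h y t) ->
  psmooth O g -> psmooth O h.
Proof. by move=> gh; apply: eq_smooth_on => // z Oz; exact: gh. Qed.

Lemma psmoothD g h : psmooth O g -> psmooth O h ->
  psmooth O (fun y t => g y t + h y t).
Proof. by move=> sg sh; exact: (smooth_onD oC sg sh). Qed.

Lemma psmoothM g h : psmooth O g -> psmooth O h ->
  psmooth O (fun y t => g y t * h y t).
Proof. by move=> sg sh; exact: (smooth_onM oC sg sh). Qed.

Lemma psmooth_cst c : psmooth O (fun _ _ => c).
Proof. exact: (@smooth_on_cst R (p + N) (cyl O) R c). Qed.

Lemma psmoothZ c g : psmooth O g -> psmooth O (fun y t => c * g y t).
Proof. by move=> sg; exact: (smooth_onZ oC c sg). Qed.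

Lemma psmoothN g : psmooth O g -> psmooth O (fun y t => - g y t).
Proof. by move=> sg; exact: (smooth_onN oC sg). Qed.

Lemma psmooth_sum I (r : seq I) (P : pred I) (g : I -> _) :
  (forall i, P i -> psmooth O (g i)) ->
  psmooth O (fun y t => \sum_(i <- r | P i) g i y t).
Proof. by move=> sg; exact: (smooth_on_sum oC r sg). Qed.

Lemma psmooth_coord j : psmooth O (fun _ t => t 0 j).
Proof.
apply: (eq_smooth_on oC) (smooth_on_coord (lshift N j)) => // z _.
by rewrite /uncur mxE.
Qed.

Lemma psmooth_asum X (W : X -> seq X -> 'rV[R]_N -> 'rV[R]_p -> R) s :
  (forall a v, psmooth O (W a v)) ->
  psmooth O (fun y t => asum (fun a v => W a v y t) s).
Proof.
elim: s W => [|a s IH] W sW /=; first exact: psmooth_cst.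
by apply: psmoothD => //; apply: psmoothN; apply: (IH (fun b v => W b (a :: v))).
Qed.

Lemma psmooth_continuous g y : psmooth O g -> O y -> continuous (g y).
Proof.
move=> sg Oy t.
have -> : g y = uncur g \o (fun t => row_mx t y).
  by apply/funext => t'; rewrite /uncur/= row_mxKl row_mxKr.
apply: continuous_comp.
  apply: continuous_rV => j.
  have [k jk|k jk] := splitP j.
    rewrite (_ : (fun _ => _) = (fun t : 'rV[R]_p => t 0 k)); first exact: coord_continuous.
    by apply/funext => t'; rewrite (_ : j = lshift N k) ?row_mxEl//; exact: val_inj.
  rewrite (_ : (fun _ => _) = cst (y 0 k)); first exact: cst_continuous.
  by apply/funext => t'; rewrite (_ : j = rshift p k) ?row_mxEr//; exact: val_inj.
by apply: smooth_on_continuous sg _; rewrite /cyl/= row_mxKr.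
Qed.

Lemma psmooth_point g a : psmooth O g -> psmooth O (fun y _ => g y a).
Proof.
move=> sg; apply: (@eq_smooth_on _ _ _ oC (fun z => uncur g (row_mx a (rsubmx z)))).
  by move=> z _; rewrite /uncur row_mxKl row_mxKr.
apply: smooth_on_compR sg => //; first by move=> z; rewrite /cyl/= row_mxKr.
move=> j; have [k jk|k jk] := splitP j.
  apply: (eq_smooth_on oC) (smooth_on_cst (a 0 k)) => // z _.
  by rewrite (_ : j = lshift N k) ?row_mxEl//; exact: val_inj.
apply: (eq_smooth_on oC) (smooth_on_coord (rshift p k)) => // z _.
by rewrite (_ : j = rshift p k) ?row_mxEr ?mxE//; exact: val_inj.
Qed.

End OpenDomain.

Section RadialIntegral.
Variable e : 'rV[R]_p.

Definition seg (t : 'rV[R]_p) (u : R) := (1 - u) *: t + u *: e.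

(** The homothety that moves t along its segment towards [e] scales every dt by 1 - u; the power
    accounts for the k factors dt that remain after a contraction. *)
Definition cint k (g : 'rV[R]_p -> R) (t : 'rV[R]_p) : R :=
  int01 (fun u => (1 - u) ^+ k * g (seg t u)).

Lemma continuous_seg t : continuous (seg t).
Proof.
move=> u; apply: (@continuousD _ _ _ (fun u : R => (1 - u) *: t) (fun u => u *: e)).
  apply: (@continuousZ _ _ _ (fun u : R => 1 - u) (fun=> t)); last exact: cst_continuous.
  by apply: continuousB; [exact: cst_continuous|exact: cvg_id].
by apply: (@continuousZ _ _ _ (fun u : R => u) (fun=> e)); [exact: cvg_id|exact: cst_continuous].
Qed.

Lemma continuous_onem_exp k : continuous (fun u : R => (1 - u) ^+ k).
Proof.
move=> u; elim: k => [|k IH]; first exact: cst_continuous.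
rewrite (_ : (fun _ => _) = (fun u => (1 - u) * (1 - u) ^+ k)).
  apply: (@continuousM R R (fun u : R => 1 - u) (fun u : R => (1 - u) ^+ k) u) => //.
  by apply: continuousB; [exact: cst_continuous|exact: cvg_id].
by apply/funext => v; rewrite exprS.
Qed.

Lemma continuous_cint_arg (k : nat) (g : 'rV[R]_p -> R) t : continuous g ->
  continuous (fun u : R => (1 - u) ^+ k * g (seg t u)).
Proof.
move=> cg u; apply: (@continuousM R R (fun u : R => (1 - u) ^+ k) (fun u => g (seg t u)) u).
  exact: continuous_onem_exp.
by apply: (@continuous_comp _ _ _ (seg t)); [exact: continuous_seg|exact: cg].
Qed.

Variable O : set 'rV[R]_N.
Hypothesis oO : open O.
Let oC := open_cyl oO.

(** The homothety in the joint coordinates (t, y), and below it its linear part [La], which scales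
    the t-coordinates only. *)
Let ga (u : R) (z : 'rV[R]_(p + N)) : 'rV[R]_(p + N) :=
  row_mx (seg (lsubmx z) u) (rsubmx z).
Let La (u : R) (v : 'rV[R]_(p + N)) : 'rV[R]_(p + N) :=
  row_mx ((1 - u) *: lsubmx v) (rsubmx v).

Let gaL u (k : R) w z : ga u (k *: w + z) = k *: La u w + ga u z.
Proof.
rewrite /ga /La scale_row_mx add_row_mx; congr row_mx; last by rewrite linearP.
by rewrite /seg linearP/= scalerDr scalerA mulrC -scalerA addrA.
Qed.

Let continuous_ga u z : {for (u, z), continuous (fun q : R * 'rV[R]_(p + N) => ga q.1 q.2)}.
Proof.
apply: continuous_rV => j; have [k jk|k jk] := splitP j.
  rewrite (_ : (fun _ => _) = (fun q : R * 'rV[R]_(p + N) =>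
      (1 - q.1) * q.2 0 j + q.1 * e 0 k)); last first.
    apply/funext => q; rewrite (_ : j = lshift N k); last exact: val_inj.
    by rewrite /ga /seg row_mxEl !mxE.
  apply: continuousD; apply: continuousM.
  - by apply: continuousB; [exact: cst_continuous|exact: cvg_fst].
  - apply: (@continuous_comp _ _ _ snd (fun v : 'rV[R]_(p + N) => v 0 j)); first exact: cvg_snd.
    exact: coord_continuous.
  - exact: cvg_fst.
  - exact: cst_continuous.
rewrite (_ : (fun _ => _) = (fun q : R * 'rV[R]_(p + N) => q.2 0 j)); last first.
  apply/funext => q; rewrite (_ : j = rshift p k); last exact: val_inj.
  by rewrite /ga row_mxEr !mxE.
apply: (@continuous_comp _ _ _ snd (fun v : 'rV[R]_(p + N) => v 0 j)); first exact: cvg_snd.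
exact: coord_continuous.
Qed.

Let differentiable_ga u z : differentiable (ga u) z.
Proof.
suff : smooth_on setT (ga u) by move=> /(_ [::] z); apply.
apply: smooth_on_rV; first exact: openT.
have oT : open [set: 'rV[R]_(p + N)] by exact: openT.
move=> j; have [k jk|k jk] := splitP j.
  apply: (@eq_smooth_on _ _ _ oT (fun z => (1 - u) * z 0 j + u * e 0 k)).
    move=> x _; rewrite (_ : j = lshift N k); last exact: val_inj.
    by rewrite /ga /seg row_mxEl !mxE.
  apply: smooth_onD => //; last exact: smooth_on_cst.
  by apply: smooth_onZ => //; exact: smooth_on_coord.
apply: (@eq_smooth_on _ _ _ oT (fun z => z 0 j)); last exact: smooth_on_coord.
move=> x _; rewrite (_ : j = rshift p k); last exact: val_inj.
by rewrite /ga row_mxEr !mxE.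
Qed.

Let F k (f : 'rV[R]_(p + N) -> R) z := int01 (fun u => (1 - u) ^+ k * f (ga u z)).

Let cylga u z : cyl O z -> cyl O (ga u z).
Proof. by rewrite /cyl/= row_mxKr. Qed.

(** A derivative along t brings out a factor 1 - u and raises k by one, a derivative along y does
    not. The right-hand side consists again of integrals of the same kind, so the induction on the
    order of differentiability in [F_Ck] can proceed. *)
Let F_diff k (f : 'rV[R]_(p + N) -> R) z : smooth_on (cyl O) f -> cyl O z ->
  differentiable (F k f) z /\ forall v,
  'D_v (F k f) z = F k ('D_(row_mx 0 (rsubmx v)) f) z +
                   F k.+1 ('D_(row_mx (lsubmx v) 0) f) z.
Proof.
move=> sf Oz.
pose w (i : 'I_(p + N)) (u : R) := if fintype.split i is inl _ then 1 - u else 1.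
pose C i u z := (1 - u) ^+ k * (w i u * 'D_(delta_mx 0 i) f (ga u z)).
have cgu z' : continuous (ga ^~ z').
  by move=> u; apply: (@continuous_fst_slice _ _ _ ga); exact: continuous_ga.
have cDg (h : 'rV[R]_(p + N) -> R) u z' : smooth_on (cyl O) h -> cyl O z' ->
    {for (u, z'), continuous (fun q : R * 'rV[R]_(p + N) => h (ga q.1 q.2))}.
  move=> sh Oz'; apply: (@continuous_comp _ _ _ (fun q : R * 'rV[R]_(p + N) => ga q.1 q.2) h).
    exact: continuous_ga.
  exact: (smooth_on_continuous sh (cylga u Oz')).
have cDgu (h : 'rV[R]_(p + N) -> R) z' : smooth_on (cyl O) h -> cyl O z' -> continuous (fun u => h (ga u z')).
  move=> sh Oz' u; apply: (@continuous_comp _ _ _ (ga ^~ z') h); first exact: cgu.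
  exact: (smooth_on_continuous sh (cylga _ Oz')).
have cw i : continuous (w i).
  rewrite /w; case: (fintype.split i) => _ u; last exact: cst_continuous.
  by apply: continuousB; [exact: cst_continuous|exact: cvg_id].
have df (h : 'rV[R]_(p + N) -> R) u z' : smooth_on (cyl O) h -> cyl O z' -> differentiable h (ga u z').
  by move=> sh Oz'; exact: (sh [::] _ (cylga u Oz')).
have Dphi u z' v : cyl O z' ->
  'D_v (fun z => (1 - u) ^+ k * f (ga u z)) z' = (1 - u) ^+ k * 'D_(La u v) f (ga u z').
  move=> Oz'; rewrite -[fun z => _]/((1 - u) ^+ k *: (f \o ga u)).
  rewrite deriveZ; last first.
    by apply: diff_derivable; apply: differentiable_comp; [exact: differentiable_ga|exact: df].
  by rewrite (derive_affine f _ _ (@gaL u)).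
have sD v : smooth_on (cyl O) ('D_v f) by exact: smooth_on_derive.
have H1 u z' : cyl O z' -> differentiable (fun z => (1 - u) ^+ k * f (ga u z)) z'.
  move=> Oz'; apply: differentiableM => //.
  exact: (differentiable_comp (differentiable_ga u z') (df f u z' sf Oz')).
have H2 u z' v : cyl O z' ->
    'D_v (fun z => (1 - u) ^+ k * f (ga u z)) z' = lincomb (fun i => C i u z') v.
  move=> Oz'; rewrite Dphi// derive_coords; last exact: df.
  rewrite /lincomb mulr_sumr; apply: eq_bigr => i _.
  rewrite /C [RHS]mulrCA; congr (_ * _); rewrite [RHS]mulrA; congr (_ * _).
  rewrite /La /w; case: splitP => j ij.
    by rewrite (_ : i = lshift N j) ?row_mxEl ?mxE 1?mulrC//; exact: val_inj.
  by rewrite (_ : i = rshift p j) ?row_mxEr ?mxE ?mulr1//; exact: val_inj.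
have H3 z' : cyl O z' -> continuous (fun u : R => (1 - u) ^+ k * f (ga u z')).
  move=> Oz' u.
  apply: (@continuousM R R (fun u : R => (1 - u) ^+ k) (fun u => f (ga u z')) u).
    exact: continuous_onem_exp.
  exact: cDgu.
have H4 i z' : cyl O z' -> continuous (C i ^~ z').
  move=> Oz' u.
  apply: (@continuousM R R (fun u : R => (1 - u) ^+ k)
    (fun u => w i u * 'D_(delta_mx 0 i) f (ga u z')) u); first exact: continuous_onem_exp.
  apply: (@continuousM R R (w i) (fun u => 'D_(delta_mx 0 i) f (ga u z')) u); first exact: cw.
  exact: (cDgu _ _ (sD _) Oz').
have H5 i u : {for (u, z), continuous (fun q : R * 'rV[R]_(p + N) => C i q.1 q.2)}.
  apply: (@continuousM R _ (fun q : R * 'rV[R]_(p + N) => (1 - q.1) ^+ k)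
    (fun q => w i q.1 * 'D_(delta_mx 0 i) f (ga q.1 q.2)) (u, z)).
    apply: (@continuous_comp _ _ _ fst (fun u : R => (1 - u) ^+ k)); first exact: cvg_fst.
    exact: continuous_onem_exp.
  apply: (@continuousM R _ (fun q : R * 'rV[R]_(p + N) => w i q.1)
    (fun q => 'D_(delta_mx 0 i) f (ga q.1 q.2)) (u, z)).
    by apply: (@continuous_comp _ _ _ fst (w i)); [exact: cvg_fst|exact: cw].
  exact: (cDg _ _ _ (sD _) Oz).
have [dF DF] := diff_int01 oC Oz H1 H2 H3 H4 H5.
split=> // v; rewrite [LHS]DF /F -int01D.
- apply: eq_int01 => u _; rewrite Dphi// exprSr -mulrA -mulrDr; congr (_ * _).
  have -> : La u v = row_mx 0 (rsubmx v) + (1 - u) *: row_mx (lsubmx v) 0.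
    by rewrite /La scale_row_mx add_row_mx add0r scaler0 addr0.
  have dfz := df f u z sf Oz.
  by rewrite deriveE// linearD linearZ/= -!deriveE.
- by move=> u; apply: (@continuousM R R (fun u : R => (1 - u) ^+ k)
    (fun u => 'D_(row_mx 0 (rsubmx v)) f (ga u z)) u);
    [exact: continuous_onem_exp|exact: (cDgu _ _ (sD _) Oz)].
- by move=> u; apply: (@continuousM R R (fun u : R => (1 - u) ^+ k.+1)
    (fun u => 'D_(row_mx (lsubmx v) 0) f (ga u z)) u);
    [exact: continuous_onem_exp|exact: (cDgu _ _ (sD _) Oz)].
Qed.

Let F_Ck j k (f : 'rV[R]_(p + N) -> R) : smooth_on (cyl O) f -> Ck j (cyl O) (F k f).
Proof.
elim: j k f => [|j IH] k f sf; first by split=> // z Oz; exact: (F_diff k sf Oz).1.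
split=> [z Oz|v]; first exact: (F_diff k sf Oz).1.
apply: (@eq_Ck _ _ _ _ _ (F k ('D_(row_mx 0 (rsubmx v)) f) +
                          F k.+1 ('D_(row_mx (lsubmx v) 0) f))) => //.
  by move=> z Oz; rewrite (F_diff k sf Oz).2.
by apply: CkD => //; apply: IH; exact: smooth_on_derive.
Qed.

Let uncur_cint k (g : 'rV[R]_N -> 'rV[R]_p -> R) :
  uncur (fun y => cint k (g y)) = F k (uncur g).
Proof.
apply/funext => z; apply: eq_int01 => u _.
by rewrite /uncur row_mxKl row_mxKr.
Qed.

Lemma psmooth_cint k g : psmooth O g -> psmooth O (fun y => cint k (g y)).
Proof.
move=> sg; rewrite /psmooth uncur_cint; apply/smooth_onP => j; exact: F_Ck.
Qed.

Lemma derive_cint k g v z : psmooth O g -> cyl O z ->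
  'D_v (uncur (fun y => cint k (g y))) z =
  cint k (fun t => 'D_(row_mx 0 (rsubmx v)) (uncur g) (row_mx t (rsubmx z))) (lsubmx z) +
  cint k.+1 (fun t => 'D_(row_mx (lsubmx v) 0) (uncur g) (row_mx t (rsubmx z))) (lsubmx z).
Proof. by move=> sg Oz; rewrite uncur_cint (F_diff k sg Oz).2. Qed.

End RadialIntegral.
End ParametrizedFunctions.

(** * Contractions of forms towards the vertices *)

Section SimplexForms.
Variables (R : realType) (p n : nat).

(* A form on R^p x M, at a given point of M and in a given chart around it, as
   a function of the point of R^p: the indices below p stand for the dt's, the
   others for the dx's. *)
Definition pform := 'rV[R]_p -> seq 'I_(p + n) -> R.
Implicit Types (eta : pform) (s : seq 'I_(p + n)).

Definition isT (a : 'I_(p + n)) := (a < p)%N.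
Definition nt s := count isT s.

(* The vertices of the simplex; the words in the letters 0, ..., p are the
   simplices spanned by them. *)
Definition vtx (j : nat) : 'rV[R]_p := \row_(b < p) (minn j p == b.+1)%:R.

(* The contraction of a form along the segments towards the vertex j. *)
Definition hop j eta : pform := fun t s =>
  \sum_(b < p) (t - vtx j) 0 b *
    cint (vtx j) (nt s) (fun t => eta t (lshift n b :: s)) t.

(** Restriction to a point kills every term containing a dt, whence the factor; the result is
    regarded as a form on R^p x M that is constant in t. *)
Definition epsop j eta : pform := fun _ s => (nt s == 0)%:R * eta (vtx j) s.

Fixpoint Kop w eta : pform := if w is j :: w' then Kop w' (hop j eta) else eta.

(** The value 0 on the empty word is what Stokes' formula [epsw_dfm] requires for a one-letter word,
    whose only face is empty. *)
Fixpoint epsw w eta : pform :=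
  if w is j :: w' then
    if w' is [::] then epsop j eta else epsw w' (hop j eta)
  else fun _ _ => 0.

(* The components of dt_i. *)
Definition dbary (i : 'I_p.+1) (a : 'I_(p + n)) : R :=
  if fintype.split a is inl b then (i == lift ord0 b)%:R - (i == ord0)%:R else 0.

(* [Aop q psi] is the sum of the dt_i1 /\ ... /\ dt_iq /\ psi(i1, ..., iq) over
   all words, and [Bop q psi] that of the t_i0 dt_i1 /\ ... /\ dt_iq /\
   psi(i0, ..., iq). *)
Fixpoint Aop q (psi : seq nat -> pform) : pform := fun t s =>
  if q is q'.+1 then
    \sum_(i < p.+1) wdg (dbary i) (Aop q' (fun w => psi ((i : nat) :: w)) t) s
  else psi [::] t s.

Definition Bop q (psi : seq nat -> pform) : pform := fun t s =>
  \sum_(i < p.+1) bary t i * Aop q (fun w => psi ((i : nat) :: w)) t s.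

Lemma isT_lshift b : isT (lshift n b).
Proof. by rewrite /isT/= ltn_ord. Qed.

Lemma isT_rshift b : isT (rshift p b) = false.
Proof. by rewrite /isT/= ltnNge leq_addr. Qed.

Lemma nt_perm s s' : perm_eq s s' -> nt s = nt s'.
Proof. by move=> /permP; apply. Qed.

End SimplexForms.

Arguments dbary {R p n} i a.

(** * Smoothness and linearity of the contractions *)

Section FamiliesOfForms.
Variables (R : realType) (p n N : nat) (O : set 'rV[R]_N).
Hypothesis oO : open O.
Local Notation pform := (pform R p n).
Implicit Types (F G : 'rV[R]_N -> pform).

Definition fsmooth F := forall s, psmooth O (fun y t => F y t s).

Lemma fsmooth_cont F y s : fsmooth F -> O y -> continuous (fun t => F y t s).
Proof. by move=> sF Oy; exact: (psmooth_continuous (sF s) Oy). Qed.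

Lemma fsmoothB F G : fsmooth F -> fsmooth G ->
  fsmooth (fun y t s => F y t s - G y t s).
Proof. by move=> sF sG s; apply: psmoothD => //; apply: psmoothN. Qed.

Lemma psmooth_bary i : psmooth O (fun _ (t : 'rV[R]_p) => bary t i).
Proof.
rewrite /bary; case: (unliftP ord0 i) => [j|] _; first exact: psmooth_coord.
apply: psmoothD => //; first exact: psmooth_cst.
by apply: psmoothN => //; apply: psmooth_sum => // j _; exact: psmooth_coord.
Qed.

Lemma fsmooth_hop j F : fsmooth F -> fsmooth (fun y => hop j (F y)).
Proof.
move=> sF s; apply: psmooth_sum => // b _; apply: psmoothM => //.
  apply: (@eq_psmooth _ _ _ _ oO (fun _ t => t 0 b - (vtx R p j) 0 b)).
    by move=> y t _; rewrite !mxE.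
  by apply: psmoothD => //; [exact: psmooth_coord|exact: psmooth_cst].
exact: psmooth_cint (sF _).
Qed.

Lemma fsmooth_epsop j F : fsmooth F -> fsmooth (fun y => epsop j (F y)).
Proof. by move=> sF s; apply: psmoothZ => //; exact: (psmooth_point oO _ (sF s)). Qed.

Lemma fsmooth_Kop w F : fsmooth F -> fsmooth (fun y => Kop w (F y)).
Proof. by elim: w F => //= j w IH F sF; apply: (IH (fun y => hop j (F y))); exact: fsmooth_hop. Qed.

Lemma fsmooth_epsw w F : fsmooth F -> fsmooth (fun y => epsw w (F y)).
Proof.
elim: w F => [|j [|i w] IH] F sF; first by move=> s; exact: psmooth_cst.
  exact: fsmooth_epsop.
by apply: (IH (fun y => hop j (F y))); exact: fsmooth_hop.
Qed.

Lemma fsmooth_Aop q (psi : seq nat -> 'rV[R]_N -> pform) :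
  (forall w, fsmooth (psi w)) -> fsmooth (fun y => Aop q (fun w => psi w y)).
Proof.
elim: q psi => [|q IH] psi spsi s /=; first exact: spsi.
apply: psmooth_sum => // i _; rewrite /wdg.
apply: (@psmooth_asum _ _ _ _ oO _ (fun a v y t => dbary i a *
  Aop q (fun w => psi ((i : nat) :: w) y) t v)) => a v.
by apply: psmoothZ => //; apply: (IH (fun w => psi ((i : nat) :: w))).
Qed.

Lemma fsmooth_Bop q (psi : seq nat -> 'rV[R]_N -> pform) :
  (forall w, fsmooth (psi w)) -> fsmooth (fun y => Bop q (fun w => psi w y)).
Proof.
move=> spsi s; apply: psmooth_sum => // i _; apply: psmoothM => //.
  exact: psmooth_bary.
by apply: (@fsmooth_Aop _ (fun w => psi ((i : nat) :: w))).
Qed.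

Section ContractionsAreLinear.
Variables (F G : 'rV[R]_N -> pform) (y : 'rV[R]_N).
Hypotheses (sF : fsmooth F) (sG : fsmooth G) (Oy : O y).

Lemma cint0 e k (t : 'rV[R]_p) : cint e k (fun=> 0) t = 0.
Proof. by rewrite -[RHS](int01_cst 0); apply: eq_int01 => u _; rewrite mulr0. Qed.

Lemma eq_cint e k (g h : 'rV[R]_p -> R) (t : 'rV[R]_p) :
  (forall u, 0 <= u <= 1 -> g (seg e t u) = h (seg e t u)) ->
  cint e k g t = cint e k h t.
Proof. by move=> gh; apply: eq_int01 => u /gh ->. Qed.

Lemma cintB e k (g h : 'rV[R]_p -> R) (t : 'rV[R]_p) :
  continuous g -> continuous h ->
  cint e k (fun t => g t - h t) t = cint e k g t - cint e k h t.
Proof.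
move=> cg ch; rewrite /cint -int01B; try exact: continuous_cint_arg.
by apply: eq_int01 => u _; rewrite mulrBr.
Qed.

Lemma cintZ e k c (g : 'rV[R]_p -> R) (t : 'rV[R]_p) : continuous g ->
  cint e k (fun t => c * g t) t = c * cint e k g t.
Proof.
move=> cg; rewrite /cint -int01Z; last exact: continuous_cint_arg.
by apply: eq_int01 => u _; rewrite mulrCA.
Qed.

Lemma continuous_asum X (W : X -> seq X -> 'rV[R]_p -> R) s :
  (forall a v, continuous (W a v)) -> continuous (fun t => asum (fun a v => W a v t) s).
Proof.
elim: s W => [|a s IH] W cW /=; first exact: cst_continuous.
move=> t; apply: continuousB; first exact: cW.
exact: (IH (fun b v => W b (a :: v))).
Qed.

Lemma cint_asum e k X (W : X -> seq X -> 'rV[R]_p -> R) s t :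
  (forall a v, continuous (W a v)) ->
  cint e k (fun t => asum (fun a v => W a v t) s) t =
  asum (fun a v => cint e k (W a v) t) s.
Proof.
elim: s W => [|a s IH] W cW /=; first exact: cint0.
rewrite cintB//; first by rewrite (IH (fun b v => W b (a :: v))).
exact: (@continuous_asum _ (fun b v => W b (a :: v))).
Qed.

Lemma hop_sub j : hop j (fun t s => F y t s - G y t s) =
  fun t s => hop j (F y) t s - hop j (G y) t s.
Proof.
apply/funext => t; apply/funext => s; rewrite /hop -sumrB; apply: eq_bigr => b _.
by rewrite cintB ?mulrBr//; exact: fsmooth_cont.
Qed.

End ContractionsAreLinear.

Lemma hop0 j : hop j (fun _ _ => 0) = (fun _ _ => 0) :> pform.
Proof.
apply/funext => t; apply/funext => s; rewrite /hop big1// => b _.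
by rewrite cint0 mulr0.
Qed.

Lemma Kop0 w : Kop w (fun _ _ => 0) = (fun _ _ => 0) :> pform.
Proof. by elim: w => //= j w IH; rewrite hop0. Qed.

Lemma epsw0 w : epsw w (fun _ _ => 0) = (fun _ _ => 0) :> pform.
Proof.
elim: w => // j [|i w] IH; last by rewrite [LHS]/= hop0.
by apply/funext => t; apply/funext => s; rewrite /= /epsop mulr0.
Qed.

(** After restriction to a vertex no dt is left to contract. In the iterated Cartan formula this
    removes all restrictions but the last. *)
Lemma hop_epsop i j (eta : pform) : hop i (epsop j eta) = fun _ _ => 0.
Proof.
rewrite -[RHS](hop0 i); apply/funext => t; apply/funext => s.
apply: eq_bigr => b _; congr (_ * _); apply: eq_cint => u _.
by rewrite /epsop /nt/= isT_lshift mul0r.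
Qed.

Lemma Kop_sub w F G y : fsmooth F -> fsmooth G -> O y ->
  Kop w (fun t s => F y t s - G y t s) =
  fun t s => Kop w (F y) t s - Kop w (G y) t s.
Proof.
elim: w F G => //= j w IH F G sF sG Oy.
rewrite (hop_sub sF sG)// (IH (fun y => hop j (F y)) (fun y => hop j (G y)))//;
  exact: fsmooth_hop.
Qed.

Lemma epsw_sub w F G y : fsmooth F -> fsmooth G -> O y ->
  epsw w (fun t s => F y t s - G y t s) =
  fun t s => epsw w (F y) t s - epsw w (G y) t s.
Proof.
elim: w F G => [|j [|i w] IH] F G sF sG Oy.
- by apply/funext => t; apply/funext => s; rewrite /= subr0.
- by apply/funext => t; apply/funext => s; rewrite /= /epsop mulrBr.
- rewrite [LHS]/= (hop_sub sF sG)//.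
  by apply: (IH (fun y => hop j (F y)) (fun y => hop j (G y))) => //; exact: fsmooth_hop.
Qed.

Lemma alternating_hop j F y : fsmooth F -> O y ->
  (forall t, alternating (F y t)) -> forall t, alternating (hop j (F y) t).
Proof.
move=> sF Oy aF t; apply: alternating_sum => b s1 i k s2.
rewrite -mulrN; congr (_ * _).
have -> : nt (s1 ++ i :: k :: s2) = nt (s1 ++ k :: i :: s2).
  by apply: nt_perm; rewrite perm_cat2l -[[:: i, k & s2]]/([:: i] ++ [:: k] ++ s2) perm_catCA.
rewrite -[RHS]mulN1r -cintZ; last by exact: fsmooth_cont.
by apply: eq_cint => u _; rewrite mulN1r (aF _ (lshift n b :: s1)).
Qed.

Lemma alternating_epsop j (eta : pform) :
  (forall t, alternating (eta t)) -> forall t, alternating (epsop j eta t).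
Proof.
move=> aF t s1 i k s2; rewrite /epsop (aF _ s1) mulrN; congr (- ((_ == _)%:R * _)).
by apply: nt_perm; rewrite perm_cat2l -[[:: i, k & s2]]/([:: i] ++ [:: k] ++ s2) perm_catCA.
Qed.

Lemma alternating_Bop q (psi : seq nat -> pform) :
  (forall w t, alternating (psi w t)) -> forall t, alternating (Bop q psi t).
Proof.
have aA : forall q (psi : seq nat -> pform), (forall w t, alternating (psi w t)) ->
    forall t, alternating (Aop q psi t).
  elim=> [|q' IH] psi' apsi t /=; first exact: apsi.
  apply: alternating_sum => i; apply: alternating_asum => a s1 k l s2.
  by rewrite (IH (fun w => psi' ((i : nat) :: w)))// mulrN.
move=> apsi t; apply: alternating_sum => i s1 k l s2.
by rewrite (aA q (fun w => psi ((i : nat) :: w)))// mulrN.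
Qed.

End FamiliesOfForms.

(** * The exterior derivative in a chart and Cartan's formula *)

Section ExteriorDerivative.
Variables (R : realType) (p n : nat) (O : set 'rV[R]_n).
Hypothesis oO : open O.
Let oC := open_cyl (p := p) oO.
Local Notation pform := (pform R p n).
Local Notation isT := (@isT p n).
Local Notation nt := (@nt p n).
Local Notation vtx := (vtx R p).
Local Notation fsmooth := (@fsmooth R p n n O).
Implicit Types (F G : 'rV[R]_n -> pform) (g h : 'rV[R]_n -> 'rV[R]_p -> R).

Definition pd (a : 'I_(p + n)) g (y : 'rV[R]_n) (t : 'rV[R]_p) : R :=
  'D_(delta_mx 0 a) (uncur g) (row_mx t y).

(** The exterior derivative on R^p x M in joint coordinates, both in t and in x; [extd_prod]
    identifies it with [extd] in a product chart. *)
Definition dfm F (y : 'rV[R]_n) : pform := fun t s =>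
  asum (fun a v => pd a (fun y t => F y t v) y t) s.

Let cylP y (t : 'rV[R]_p) : O y -> cyl O (row_mx t y).
Proof. by rewrite /cyl/= row_mxKr. Qed.

Let psd g y t : psmooth O g -> O y -> differentiable (uncur g) (row_mx t y).
Proof. by move=> sg Oy; exact: (sg [::] _ (cylP t Oy)). Qed.

Lemma eq_pd a g h y t : (forall y t, O y -> g y t = h y t) -> O y ->
  pd a g y t = pd a h y t.
Proof.
move=> gh Oy; apply: near_eq_derive.
apply: (@filterS _ _ _ (cyl O)); first by move=> z Oz; exact: gh.
by apply: open_nbhs_nbhs; split=> //; exact: cylP.
Qed.

Lemma psmooth_pd a g : psmooth O g -> psmooth O (pd a g).
Proof.
move=> sg; apply: (eq_smooth_on oC _ (smooth_on_derive (delta_mx 0 a) sg)).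
by move=> z _; rewrite /uncur /pd hsubmxK.
Qed.

Lemma pdD a g h y t : psmooth O g -> psmooth O h -> O y ->
  pd a (fun y t => g y t + h y t) y t = pd a g y t + pd a h y t.
Proof.
move=> sg sh Oy; rewrite /pd -[uncur _]/(uncur g + uncur h) deriveD//;
  by apply: diff_derivable; exact: psd.
Qed.

Lemma pdB a g h y t : psmooth O g -> psmooth O h -> O y ->
  pd a (fun y t => g y t - h y t) y t = pd a g y t - pd a h y t.
Proof.
move=> sg sh Oy; rewrite /pd -[uncur _]/(uncur g - uncur h) deriveB//;
  by apply: diff_derivable; exact: psd.
Qed.

Lemma pd_cst a c y t : pd a (fun _ _ => c) y t = 0.
Proof. exact: derive_cst. Qed.

Lemma pdM a g h y t : psmooth O g -> psmooth O h -> O y ->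
  pd a (fun y t => g y t * h y t) y t = pd a g y t * h y t + g y t * pd a h y t.
Proof.
move=> sg sh Oy; rewrite /pd -[uncur (fun _ _ => _)]/(uncur g * uncur h).
rewrite deriveM; try by apply: diff_derivable; exact: psd.
by rewrite /uncur row_mxKl row_mxKr addrC mulrC.
Qed.

Lemma pdZ a c g y t : psmooth O g -> O y ->
  pd a (fun y t => c * g y t) y t = c * pd a g y t.
Proof. by move=> sg Oy; rewrite pdM// ?pd_cst ?mul0r ?add0r//; exact: psmooth_cst. Qed.

Lemma pd_sum a I (r : seq I) (g : I -> 'rV[R]_n -> 'rV[R]_p -> R) y t :
  (forall i, psmooth O (g i)) -> O y ->
  pd a (fun y t => \sum_(i <- r) g i y t) y t = \sum_(i <- r) pd a (g i) y t.
Proof.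
move=> sg Oy; elim: r => [|i r IH].
  rewrite big_nil -[RHS](pd_cst a 0 y t); apply: eq_pd => // y' t' _.
  by rewrite big_nil.
rewrite big_cons -IH -pdD//; last exact: psmooth_sum.
by apply: eq_pd => // y' t' _; rewrite big_cons.
Qed.

Lemma pd_asum a X (W : X -> seq X -> 'rV[R]_n -> 'rV[R]_p -> R) s y t :
  (forall b v, psmooth O (W b v)) -> O y ->
  pd a (fun y t => asum (fun b v => W b v y t) s) y t =
  asum (fun b v => pd a (W b v) y t) s.
Proof.
move=> sW Oy; elim: s W sW => [|b s IH] W sW /=; first exact: pd_cst.
rewrite pdB//; first by rewrite (IH (fun c v => W c (b :: v))).
exact: (psmooth_asum oO (W := fun c v => W c (b :: v))).
Qed.

Lemma derive_coord m (j : 'I_m) (x v : 'rV[R]_m) :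
  'D_v (fun x : 'rV[R]_m => x 0 j) x = v 0 j.
Proof.
have := congr1 (fun M : 'rV[R]_m => M 0 j)
  (@derive_mx _ _ _ _ id x v (@derivable_id _ _ x v)).
by rewrite derive_id mxE => <-.
Qed.

Lemma pd_coord a b y t : O y ->
  pd a (fun _ t => t 0 b) y t = (a == lshift n b)%:R.
Proof.
move=> Oy; rewrite /pd (_ : uncur _ = fun z : 'rV[R]_(p + n) => z 0 (lshift n b)).
  by rewrite derive_coord mxE eqxx eq_sym.
by apply/funext => z; rewrite /uncur mxE.
Qed.

Lemma pd_bary a i y t : O y -> pd a (fun _ t => bary t i) y t = dbary i a.
Proof.
move=> Oy; rewrite /dbary /bary.
have sc b : psmooth O (fun _ (t : 'rV[R]_p) => t 0 b) by exact: psmooth_coord.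
case: (unliftP ord0 i) => [j ->|->].
  rewrite pd_coord//; case: splitP => k ak.
    rewrite (_ : a = lshift n k); last exact: val_inj.
    rewrite (inj_eq (@lshift_inj _ _)) (inj_eq lift_inj).
    by rewrite [lift _ _ == _]eq_sym (negbTE (neq_lift _ _)) subr0 [k == j]eq_sym.
  rewrite (_ : a = rshift p k); last exact: val_inj.
  by rewrite eq_sym -[_ == _]/(_ == _) eq_lrshift.
have s1 : psmooth O (fun _ (t : 'rV[R]_p) => \sum_j t 0 j) by apply: psmooth_sum.
rewrite pdB// ?pd_cst ?sub0r; last exact: psmooth_cst.
rewrite pd_sum//; under eq_bigr do rewrite pd_coord//.
case: splitP => k ak.
  rewrite (_ : a = lshift n k); last exact: val_inj.
  rewrite (bigD1 k)//= eqxx big1 ?addr0 ?(negbTE (neq_lift _ _)) ?sub0r//.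
  by move=> j jk; rewrite (inj_eq (@lshift_inj _ _)) eq_sym (negbTE jk).
rewrite (_ : a = rshift p k); last exact: val_inj.
by rewrite big1 ?oppr0// => j _; rewrite eq_rlshift.
Qed.

Lemma pd_cint a e k g y t : psmooth O g -> O y ->
  pd a (fun y => cint e k (g y)) y t = cint e (k + isT a) (pd a g y) t.
Proof.
move=> sg Oy; have Oc := cylP t Oy.
rewrite /pd (@derive_cint _ _ _ _ _ oO _ _ _ _ sg Oc) ?row_mxKl ?row_mxKr.
have c0 k' : cint e k' (fun t => 'D_0 (uncur g) (row_mx t y)) t = 0.
  by rewrite -[RHS](cint0 e k' t); apply: eq_cint => u _; rewrite derive0.
rewrite /isT; case: (ltnP a p) => ap; rewrite ?addn1 ?addn0.
  have -> : rsubmx (delta_mx 0 a : 'rV[R]_(p + n)) = 0.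
    apply/rowP => j; rewrite !mxE eqxx/=; case: eqP => // ja.
    by move: ap; rewrite -ja/= ltnNge leq_addr.
  have -> : row_mx (lsubmx (delta_mx 0 a : 'rV[R]_(p + n))) 0 = delta_mx 0 a.
    rewrite -[RHS]hsubmxK; congr row_mx; apply/rowP => j; rewrite !mxE eqxx/=.
    by case: eqP => // ja; move: ap; rewrite -ja/= ltnNge leq_addr.
  by rewrite row_mx0 c0 add0r.
have -> : lsubmx (delta_mx 0 a : 'rV[R]_(p + n)) = 0.
  apply/rowP => j; rewrite !mxE eqxx/=; case: eqP => // ja.
  by move: ap; rewrite -ja/= leqNgt ltn_ord.
have -> : row_mx 0 (rsubmx (delta_mx 0 a : 'rV[R]_(p + n))) = delta_mx 0 a.
  rewrite -[RHS]hsubmxK; congr row_mx; apply/rowP => j; rewrite !mxE eqxx/=.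
  by case: eqP => // ja; move: ap; rewrite -ja/= leqNgt ltn_ord.
by rewrite row_mx0 c0 addr0.
Qed.

Lemma pd_point a b g y t : psmooth O g -> O y ->
  pd a (fun y _ => g y b) y t = (~~ isT a)%:R * pd a g y b.
Proof.
move=> sg Oy; rewrite /pd.
have -> : uncur (fun y (_ : 'rV[R]_p) => g y b) =
    uncur g \o (fun z : 'rV[R]_(p + n) => row_mx b (rsubmx z)).
  by apply/funext => z; rewrite /uncur/= row_mxKl row_mxKr.
rewrite (@derive_affine _ _ _ _ _ _ (fun v : 'rV[R]_(p + n) => row_mx 0 (rsubmx v))); last first.
  by move=> k w z; rewrite scale_row_mx add_row_mx scaler0 add0r linearP.
rewrite row_mxKr /isT; case: (ltnP a p) => ap; rewrite ?mul0r ?mul1r/=.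
  have -> : rsubmx (delta_mx 0 a : 'rV[R]_(p + n)) = 0.
    apply/rowP => j; rewrite !mxE eqxx/=; case: eqP => // ja.
    by move: ap; rewrite -ja/= ltnNge leq_addr.
  by rewrite row_mx0 derive0.
congr ('D_ _ _ _); rewrite -[RHS]hsubmxK; congr row_mx; apply/rowP => j; rewrite !mxE eqxx/=.
by case: eqP => // ja; move: ap; rewrite -ja/= leqNgt ltn_ord.
Qed.

Lemma eq_dfm F G y t s : (forall y t s, O y -> F y t s = G y t s) -> O y ->
  dfm F y t s = dfm G y t s.
Proof.
by move=> FG Oy; apply: eq_asum => a v _; apply: eq_pd => // y' t' Oy'; exact: FG.
Qed.

Lemma fsmooth_dfm F : fsmooth F -> fsmooth (dfm F).
Proof.
move=> sF s; apply: (@psmooth_asum _ _ _ _ oO _ (fun a v => pd a (fun y t => F y t v))).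
by move=> a v; exact: psmooth_pd.
Qed.

Lemma dfmZ c F y t s : fsmooth F -> O y ->
  dfm (fun y t s => c * F y t s) y t s = c * dfm F y t s.
Proof.
by move=> sF Oy; rewrite /dfm -asumZ; apply: eq_asum => a v _; rewrite pdZ.
Qed.

Lemma dfm_sum I (r : seq I) (F : I -> 'rV[R]_n -> pform) y t s :
  (forall i, fsmooth (F i)) -> O y ->
  dfm (fun y t s => \sum_(i <- r) F i y t s) y t s = \sum_(i <- r) dfm (F i) y t s.
Proof.
move=> sF Oy; rewrite /dfm -asum_sum; apply: eq_asum => a v _.
by rewrite pd_sum// => i; exact: sF.
Qed.

(** The one-form has constant coefficients, hence is closed; what remains is the sign of moving d
    past it. *)
Lemma dfm_wdg al F y t s : fsmooth F -> O y ->
  dfm (fun y t => wdg al (F y t)) y t s = - wdg al (dfm F y t) s.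
Proof.
move=> sF Oy; rewrite /dfm /wdg.
rewrite (@eq_asum _ _ _ (fun a v => asum (fun b u => al b * pd a (fun y t => F y t u) y t) v)).
  rewrite asum_anti; congr (- _); apply: eq_asum => b u _.
  by rewrite -asumZ.
move=> a v _; rewrite (pd_asum _ _ (W := fun b u y t => al b * F y t u))//.
  by apply: eq_asum => b u _; rewrite pdZ.
by move=> b u; exact: psmoothZ.
Qed.

Lemma alternating_dfm F y : fsmooth F -> O y ->
  (forall y t, O y -> alternating (F y t)) -> forall t, alternating (dfm F y t).
Proof.
move=> sF Oy aF t; apply: alternating_asum => a s1 i j s2.
rewrite (eq_pd _ (h := fun y t => -1 * F y t (s1 ++ j :: i :: s2)))//.
  by rewrite pdZ// mulN1r.
by move=> y' t' Oy'; rewrite aF// mulN1r.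
Qed.

Lemma dfm_epsop j F y t s : fsmooth F -> O y ->
  dfm (fun y => epsop j (F y)) y t s = epsop j (dfm F y) t s.
Proof.
move=> sF Oy; rewrite /dfm /epsop -asumZ; apply: eq_asum_perm => a v av.
have sv : psmooth O (fun y (_ : 'rV[R]_p) => F y (vtx j) v) by exact: (psmooth_point oO _ (sF v)).
rewrite [LHS](pdZ _ _ _ sv Oy) (pd_point _ _ _ (sF v) Oy) mulrA; congr (_ * _); rewrite -(nt_perm av) /nt/= -natrM mulnb; congr _%:R.
by case: (isT a) => /=; rewrite ?add1n ?add0n ?andbF ?andbT.
Qed.

(* Cartan's formula for the radial contraction, integrated along the segment
   from [t] to the vertex [j]. *)
Lemma dfm_hop j F y t s : fsmooth F -> (forall t, alternating (F y t)) -> O y ->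
  dfm (fun y => hop j (F y)) y t s =
  F y t s - epsop j (F y) t s - hop j (dfm F y) t s.
Proof.
move=> sF aF Oy; set e := vtx j.
have sm b : psmooth O (fun _ t => (t - e) 0 b).
  apply: (@eq_psmooth _ _ _ _ oO (fun _ t => t 0 b - e 0 b)).
    by move=> y' t' _; rewrite !mxE.
  by apply: psmoothD => //; [exact: psmooth_coord|exact: psmooth_cst].
have scint k w : psmooth O (fun y => cint e k (fun t => F y t w)).
  exact: psmooth_cint (sF w).
have cF w : continuous (fun t => F y t w) by exact: fsmooth_cont.
have cpd a w : continuous (pd a (fun y t => F y t w) y).
  by apply: (@psmooth_continuous _ _ _ O) => //; exact: psmooth_pd.
(* [I1] collects the derivatives of the factor t - e, [I3] those of the integrand. In
   [hop j (dfm F y)] the sum [I3] returns with the opposite sign, and [I2] holds the derivatives in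
   the contracted direction. *)
pose I1 := asum (fun a v => (isT a)%:R * cint e (nt s).-1 (fun t => F y t (a :: v)) t) s.
pose I2 := \sum_(b < p) (t - e) 0 b * cint e (nt s) (pd (lshift n b) (fun y t => F y t s) y) t.
pose I3 := \sum_(b < p) (t - e) 0 b * asum (fun a v =>
   cint e (nt s) (pd a (fun y t => F y t (lshift n b :: v)) y) t) s.
have E1 : dfm (fun y => hop j (F y)) y t s = I1 + I3.
  rewrite /I3 (eq_bigr (fun b => asum (fun a v => (t - e) 0 b *
   cint e (nt s) (pd a (fun y t => F y t (lshift n b :: v)) y) t) s)); last first.
    by move=> b _; rewrite asumZ.
  rewrite -asum_sum -asumD; apply: eq_asum_perm => a v av.
  rewrite (pd_sum _ _ (g := fun b y t => (t - e) 0 b * cint e (nt v) (fun t => F y t (lshift n b :: v)) t))//; last first.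
    by move=> b; exact: psmoothM.
  under eq_bigr => b _ do rewrite pdM//.
  rewrite big_split/=; congr (_ + _).
    have -> : \sum_(b < p) pd a (fun _ t => (t - e) 0 b) y t *
        cint e (nt v) (fun t => F y t (lshift n b :: v)) t =
      \sum_(b < p) (a == lshift n b)%:R * cint e (nt v) (fun t => F y t (lshift n b :: v)) t.
      apply: eq_bigr => b _; congr (_ * _).
      rewrite (eq_pd _ (h := fun _ t => t 0 b - e 0 b))//; last by move=> ? ? _; rewrite !mxE.
      by rewrite pdB ?pd_cst ?subr0 ?pd_coord//; [exact: psmooth_coord|exact: psmooth_cst].
    rewrite -(nt_perm av) /nt/=; case: (boolP (isT a)) => ap /=; last first.
      rewrite mul0r big1// => b _; case: eqP => [ab|]; last by rewrite mul0r.
      by rewrite ab isT_lshift in ap.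
    have [b ab] : exists b, a = lshift n b.
      by exists (Ordinal ap); exact: val_inj.
    rewrite (bigD1 b)//= ab eqxx !mul1r big1 ?addr0// => b' b'b.
    by rewrite (inj_eq (@lshift_inj _ _)) eq_sym (negbTE b'b) mul0r.
  apply: eq_bigr => b _; congr (_ * _).
  transitivity (cint e (nt v + isT a) (pd a (fun y t => F y t (lshift n b :: v)) y) t).
    exact: (pd_cint _ _ _ _ (sF _) Oy).
  by rewrite -(nt_perm av) /nt/= addnC.
have E2 : hop j (dfm F y) t s = I2 - I3.
  rewrite /I2 /I3 -sumrB; apply: eq_bigr => b _; rewrite -mulrBr; congr (_ * _).
  rewrite {1}/dfm/= cintB//; last first.
    apply: (@psmooth_continuous _ _ _ O (fun y t => asum (fun a v => pd a (fun y t => F y t (lshift n b :: v)) y t) s)) => //.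
    by apply: (@psmooth_asum _ _ _ _ oO _ (fun a v => pd a (fun y t => F y t (lshift n b :: v)))) => a v; exact: psmooth_pd.
  by rewrite cint_asum.
suff E3 : I1 + I2 = F y t s - epsop j (F y) t s.
  by rewrite E1 E2 -E3; ring.
have cg k : continuous (fun u : R => (1 - u) ^+ k * F y (seg e t u) s).
  exact: continuous_cint_arg (cF s).
have cgd k b : continuous (fun u : R =>
    (1 - u) ^+ k * pd (lshift n b) (fun y t => F y t s) y (seg e t u)).
  exact: continuous_cint_arg (cpd _ s).
have -> : I1 = int01 (fun u => (nt s)%:R * ((1 - u) ^+ (nt s).-1 * F y (seg e t u) s)).
  rewrite int01Z//.
  transitivity (cint e (nt s).-1 (fun t => (nt s)%:R * F y t s) t); last exact: cintZ.
  have cI a v : continuous (fun t => (isT a)%:R * F y t (a :: v)).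
    exact: continuous_cmul.
  transitivity (cint e (nt s).-1 (fun t => asum (fun a v => (isT a)%:R * F y t (a :: v)) s) t).
    by rewrite cint_asum//; apply: eq_asum => a v _; rewrite cintZ.
  by apply: eq_cint => u _; rewrite alternating_asum_cons.
have -> : I2 = int01 (fun u => (1 - u) ^+ nt s * \sum_(b < p) (t - e) 0 b *
    pd (lshift n b) (fun y t => F y t s) y (seg e t u)).
  rewrite /I2 (eq_bigr (fun b => int01 (fun u => (t - e) 0 b * ((1 - u) ^+ nt s *
    pd (lshift n b) (fun y t => F y t s) y (seg e t u))))); last first.
    by move=> b _; rewrite int01Z.
  rewrite -int01_sum; last first.
    by move=> b; exact: continuous_cmul.
  by apply: eq_int01 => u _; rewrite mulr_sumr; apply: eq_bigr => b _; rewrite mulrCA.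
(* A primitive of the integrand of [I1 + I2]: [I1] differentiates the power of 1 - u and [I2] the
   value along the segment. At u = 1 the power of 0 is 1 exactly when [nt s] is 0, which is the
   factor in [epsop]. *)
pose Phi (u : R) := - ((1 - u) ^+ nt s * F y (seg e t u) s).
have -> : F y t s - epsop j (F y) t s = Phi 1 - Phi 0.
  by rewrite /Phi opprK /seg subrr subr0 !scale0r !scale1r add0r addr0 expr1n
    mul1r expr0n [RHS]addrC.
have cA : continuous (fun u : R => (nt s)%:R * ((1 - u) ^+ (nt s).-1 * F y (seg e t u) s)).
  exact: continuous_cmul.
have cB : continuous (fun u : R => (1 - u) ^+ nt s * \sum_(b < p) (t - e) 0 b *
    pd (lshift n b) (fun y t => F y t s) y (seg e t u)).
  rewrite (_ : (fun u : R => _) = (fun u : R => \sum_(b < p) (t - e) 0 b *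
    ((1 - u) ^+ nt s * pd (lshift n b) (fun y t => F y t s) y (seg e t u)))).
    by apply: continuous_bigsum => b; exact: continuous_cmul.
  by apply/funext => u; rewrite mulr_sumr; apply: eq_bigr => b _; rewrite mulrCA.
rewrite -int01D//; apply: (@int01_FTC _ Phi); last first.
  exact: continuous_add.
move=> u; pose h := row_mx (e - t) (0 : 'rV[R]_n); pose z := row_mx t y.
have segE v : row_mx (seg e t v) y = z + v *: h.
  rewrite /z /h scale_row_mx scaler0 add_row_mx addr0 /seg; congr row_mx.
  by rewrite scalerBl scale1r scalerBr addrA addrAC.
have d1 : is_derive u (1 : R) (fun v : R => F y (seg e t v) s)
    ('D_h (uncur (fun y t => F y t s)) (z + u *: h)).
  rewrite (_ : (fun v : R => _) = (fun v : R => uncur (fun y t => F y t s) (z + v *: h))).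
    by apply: is_derive_line; rewrite -segE; exact: psd.
  by apply/funext => v; rewrite -segE /uncur row_mxKl row_mxKr.
have d2 : is_derive u (1 : R) (fun v : R => (1 - v) ^+ nt s)
   (- (nt s)%:R * (1 - u) ^+ (nt s).-1).
  have d0 : is_derive u (1 : R) (fun v : R => 1 - v) (-1).
    by rewrite -[- 1]add0r; apply: is_deriveB.
  have := is_deriveX (nt s) d0.
  rewrite (_ : (fun v : R => 1 - v) ^+ nt s = (fun v : R => (1 - v) ^+ nt s)).
    by move=> dX; apply: is_derive_eq; rewrite scalerN [_ *: 1]mulr1 mulNr.
  by apply/funext => v; rewrite exprfctE.
have dh : 'D_h (uncur (fun y t => F y t s)) (z + u *: h) =
    - \sum_(b < p) (t - e) 0 b * pd (lshift n b) (fun y t => F y t s) y (seg e t u).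
  rewrite -segE derive_coords; last exact: psd.
  rewrite /lincomb big_split_ord/= [X in _ + X]big1 ?addr0 -?sumrN.
    by apply: eq_bigr => b _; rewrite /h row_mxEl !mxE -mulNr opprB.
  by move=> b _; rewrite /h row_mxEr mxE mul0r.
apply: (is_derive_eq (is_deriveN (is_deriveM d2 d1))).
rewrite dh; set S := \sum_(b < p) _.
rewrite -[_ *: - S]/(_ * - S) -[_ *: (_ * _)]/(_ * (_ * _)).
by ring.
Qed.

End ExteriorDerivative.

(** * Sums over words, the homotopy formula and Stokes' formula *)

Section WordSums.
Variables (R : realType) (p n : nat).
Local Notation pform := (pform R p n).
Implicit Types (psi : seq nat -> pform) (eta : pform).

Definition cof psi : seq nat -> pform := fun w t s => coface (fun v => psi v t s) w.

Lemma eq_Aop q psi psi' t s :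
  (forall w s, size w = q -> psi w t s = psi' w t s) -> Aop q psi t s = Aop q psi' t s.
Proof.
elim: q psi psi' s => [|q IH] psi psi' s e /=; first exact: e.
apply: eq_bigr => i _; apply: eq_wdg => // v _.
by apply: IH => w u sw; apply: e; rewrite /= sw.
Qed.

Lemma eq_Bop q psi psi' t s :
  (forall w s, size w = q.+1 -> psi w t s = psi' w t s) -> Bop q psi t s = Bop q psi' t s.
Proof.
move=> e; apply: eq_bigr => i _; congr (_ * _); apply: eq_Aop => w u sw.
by apply: e; rewrite /= sw.
Qed.

Lemma AopB q psi psi' t s :
  Aop q (fun w t s => psi w t s - psi' w t s) t s = Aop q psi t s - Aop q psi' t s.
Proof.
elim: q psi psi' s => [|q IH] psi psi' s //=; rewrite -sumrB; apply: eq_bigr => i _.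
by rewrite -wdgB; exact: eq_wdg.
Qed.

Lemma AopZ q c psi t s :
  Aop q (fun w t s => c * psi w t s) t s = c * Aop q psi t s.
Proof.
elim: q psi s => [|q IH] psi s //=; rewrite mulr_sumr; apply: eq_bigr => i _.
by rewrite -wdgZ; exact: eq_wdg.
Qed.

Lemma Aop0 q t s : Aop q (fun=> (fun _ _ => 0) : pform) t s = 0.
Proof.
rewrite -[RHS](mul0r (Aop q (fun=> (fun _ _ => 0) : pform) t s)) -AopZ.
by apply: eq_Aop => w u _; rewrite mul0r.
Qed.

Lemma BopB q psi psi' t s :
  Bop q (fun w t s => psi w t s - psi' w t s) t s = Bop q psi t s - Bop q psi' t s.
Proof.
rewrite /Bop -sumrB; apply: eq_bigr => i _; rewrite -mulrBr.
by rewrite -(AopB q (fun w => psi ((i : nat) :: w)) (fun w => psi' ((i : nat) :: w))).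
Qed.

Lemma BopZ q c psi t s :
  Bop q (fun w t s => c * psi w t s) t s = c * Bop q psi t s.
Proof.
rewrite /Bop mulr_sumr; apply: eq_bigr => i _.
by rewrite (AopZ q c (fun w => psi ((i : nat) :: w))) mulrCA.
Qed.

Lemma Bop0 q t s : Bop q (fun=> (fun _ _ => 0) : pform) t s = 0.
Proof.
rewrite -[RHS](mul0r (Bop q (fun=> (fun _ _ => 0) : pform) t s)) -BopZ.
by apply: eq_Bop => w u _; rewrite mul0r.
Qed.

Lemma sum_bary (t : 'rV[R]_p) : \sum_(i < p.+1) bary t i = 1.
Proof.
rewrite big_ord_recl [X in _ + X](eq_bigr (fun j => t 0 j)); last first.
  by move=> j _; rewrite /bary; case: unliftP => [k /lift_inj ->|/eqP]; rewrite // eq_sym (negbTE (neq_lift _ _)).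
by rewrite /bary unlift_none subrK.
Qed.

Lemma sum_dbary (a : 'I_(p + n)) : \sum_(i < p.+1) dbary i a = 0 :> R.
Proof.
have E (c : 'I_p.+1) : \sum_(i < p.+1) (i == c)%:R = 1 :> R.
  by rewrite (bigD1 c)//= eqxx big1 ?addr0// => i /negbTE ->.
rewrite /dbary; case: (fintype.split a) => b; last by rewrite big1.
by rewrite sumrB !E subrr.
Qed.

(** Omitting the first letter leaves the sum of all dt_i as a factor, which is 0; the other faces
    vanish by induction. *)
Lemma Aop_cof q psi t s : Aop q (cof psi) t s = 0.
Proof.
elim: q psi s => [|q IH] psi s //=.
rewrite (eq_bigr (fun i : 'I_p.+1 => wdg (dbary i) (Aop q psi t) s)); last first.
  move=> i _; apply: eq_wdg => // v _.
  rewrite (AopB q psi (cof (fun w => psi ((i : nat) :: w)))).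
  by rewrite IH subr0.
rewrite -wdg_suml -[RHS](wdg0l (Aop q psi t) s).
by apply: eq_wdg => // a; rewrite sum_dbary.
Qed.

(** The factor left by omitting the first letter is now the sum of the t_i, which is 1; the other
    faces vanish by [Aop_cof]. Thus coboundaries of coefficients correspond to the differentiation
    of the leading t_(i_0). *)
Lemma Bop_cof q psi t s : Bop q (cof psi) t s = Aop q psi t s.
Proof.
rewrite /Bop (eq_bigr (fun i : 'I_p.+1 => bary t i * Aop q psi t s)); last first.
  move=> i _; congr (_ * _).
  by rewrite (AopB q psi (cof (fun w => psi ((i : nat) :: w)))) Aop_cof subr0.
by rewrite -mulr_suml sum_bary mul1r.
Qed.

Lemma Kop_deg w eta d : (forall t s, size s != d -> eta t s = 0) ->
  forall t s, (size s + size w)%N != d -> Kop w eta t s = 0.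
Proof.
elim: w eta d => [|j w IH] eta d eta0 t s /=; first by rewrite addn0; exact: eta0.
(* A contraction lowers the degree by one. In degree 0 it vanishes altogether, and the value of [d']
   is chosen only to satisfy the condition on sizes. *)
rewrite addnS => sd; pose d' := if d is d'.+1 then d' else (size s + size w).+1.
apply: (IH _ d'); last by rewrite /d'; move: sd; case: (d) => //= _; rewrite neq_ltn ltnSn.
move=> t' s' sd'; rewrite /hop big1// => b _.
rewrite (@eq_cint _ _ _ _ _ (fun=> 0)) ?cint0 ?mulr0// => u _.
by apply: eta0; move: sd'; rewrite /d'; case: (d).
Qed.

Section Locality.
Variable D : set 'rV[R]_p.
Hypothesis D_seg : forall t j u, D t -> 0 <= u <= 1 -> D (seg (vtx R p j) t u).
Variables eta eta' : pform.
Hypothesis ee : forall t s, D t -> eta t s = eta' t s.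

(** [D] is star-shaped about every vertex, so contracting at a point of [D] only looks at the form
    on [D]. It is applied to the simplex, where alone a simplicial form is given. *)
Lemma eq_Kop w t s : D t -> Kop w eta t s = Kop w eta' t s.
Proof.
elim: w eta eta' ee t s => [|j w IH] e e' ee' t s Dt /=; first exact: ee'.
apply: IH => // t' s' Dt'; apply: eq_bigr => b _; congr (_ * _).
by apply: eq_cint => u u01; apply: ee'; exact: D_seg.
Qed.

Lemma D_vtx t j : D t -> D (vtx R p j).
Proof.
move=> /(@D_seg t j 1); rewrite lexx ler01 /seg subrr scale0r scale1r add0r; exact.
Qed.

End Locality.

Lemma epsw_const w eta t t' s : epsw w eta t s = epsw w eta t' s.
Proof. by elim: w eta => [|j [|i w] IH] eta //; exact: IH. Qed.

Lemma epsw_nt w eta t s : nt s != 0 -> epsw w eta t s = 0.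
Proof.
move=> s0; elim: w eta => [|j [|i w] IH] eta //; last exact: IH.
by rewrite /= /epsop (negbTE s0) mul0r.
Qed.

End WordSums.

Section HomotopyFormula.
Variables (R : realType) (p n : nat) (O : set 'rV[R]_n).
Hypothesis oO : open O.
Local Notation pform := (pform R p n).
Local Notation fsmooth := (@fsmooth R p n n O).
Implicit Types (F G : 'rV[R]_n -> pform) (psi : seq nat -> 'rV[R]_n -> pform).

Let falt F := forall y t, O y -> alternating (F y t).

Lemma dfm_Aop q psi y t s : (forall w, fsmooth (psi w)) -> O y ->
  dfm (fun y => Aop q (fun w => psi w y)) y t s =
  (-1) ^+ q * Aop q (fun w => dfm (psi w) y) t s.
Proof.
elim: q psi y t s => [|q IH] psi y t s spsi Oy /=; first by rewrite expr0 mul1r.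
have sA (i : 'I_p.+1) : fsmooth (fun y => Aop q (fun w => psi ((i : nat) :: w) y)).
  by apply: (@fsmooth_Aop _ _ _ _ _ oO _ (fun w => psi ((i : nat) :: w))).
rewrite (dfm_sum oO _ (F := fun i : 'I_p.+1 => fun y t => wdg (dbary i)
   (Aop q (fun w => psi ((i : nat) :: w) y) t)))//; last first.
  move=> i v; apply: (@psmooth_asum _ _ _ _ oO _ (fun a u y t => dbary i a *
    Aop q (fun w => psi ((i : nat) :: w) y) t u)) => a u.
  by apply: psmoothZ => //; exact: sA.
rewrite mulr_sumr; apply: eq_bigr => i _; rewrite (dfm_wdg oO)// exprS mulN1r mulNr.
congr (- _); rewrite -wdgZ; apply: eq_wdg => // v _.
by rewrite (IH (fun w => psi ((i : nat) :: w))).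
Qed.

(** Differentiating t_(i_0) completes the q factors dt to the q + 1 factors of [Aop]; d reaches the
    coefficients past q one-forms, which gives the sign. *)
Lemma dfm_Bop q psi y t s : (forall w, fsmooth (psi w)) -> O y ->
  dfm (fun y => Bop q (fun w => psi w y)) y t s =
  Aop q.+1 (fun w => psi w y) t s + (-1) ^+ q * Bop q (fun w => dfm (psi w) y) t s.
Proof.
move=> spsi Oy.
have sA (i : 'I_p.+1) : fsmooth (fun y => Aop q (fun w => psi ((i : nat) :: w) y)).
  by apply: (@fsmooth_Aop _ _ _ _ _ oO _ (fun w => psi ((i : nat) :: w))).
have sb i := @psmooth_bary _ p _ _ oO i.
rewrite /Bop (dfm_sum oO _ (F := fun i : 'I_p.+1 => fun y t s => bary t i *
   Aop q (fun w => psi ((i : nat) :: w) y) t s))//; last first.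
  by move=> i v; apply: psmoothM => //; exact: sA.
rewrite /= mulr_sumr -big_split/=; apply: eq_bigr => i _.
rewrite /dfm (@eq_asum _ _ _ (fun a v => dbary i a * Aop q (fun w => psi ((i : nat) :: w) y) t v +
  bary t i * pd a (fun y t => Aop q (fun w => psi ((i : nat) :: w) y) t v) y t)); last first.
  by move=> a v _; rewrite (pdM (O := O))//; [rewrite (pd_bary (O := O))|exact: sA].
rewrite asumD asumZ; congr (_ + _).
rewrite -[asum _ s]/(dfm (fun y => Aop q (fun w => psi ((i : nat) :: w) y)) y t s).
by rewrite (@dfm_Aop q (fun w => psi ((i : nat) :: w)))// mulrCA.
Qed.

(** Cartan's formula iterated over the letters: by [hop_epsop] a restriction to a vertex survives
    only if it comes last, and then it is [epsw]. *)
Lemma dfm_Kop w F y t s : fsmooth F -> falt F -> O y ->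
  dfm (fun y => Kop w (F y)) y t s =
  (-1) ^+ size w * Kop w (dfm F y) t s -
  (-1) ^+ size w * coface (fun v => Kop v (F y) t s) w - epsw w (F y) t s.
Proof.
elim: w F y t s => [|j w IH] F y t s sF aF Oy.
  by rewrite /coface/= expr0 !mul1r !subr0.
have sh := fsmooth_hop oO j sF.
have ah : falt (fun y => hop j (F y)) by move=> y' t' Oy'; apply: alternating_hop => // ?; exact: aF.
have sd := fsmooth_dfm oO sF.
have se := fsmooth_epsop oO j sF.
have e1 : dfm (fun y => hop j (F y)) y = fun t s =>
    (F y t s - epsop j (F y) t s) - hop j (dfm F y) t s.
  by apply/funext => t'; apply/funext => s'; apply: (dfm_hop oO) => // t0; exact: aF.
rewrite [dfm _]/= (IH (fun y => hop j (F y)))// e1.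
rewrite (Kop_sub oO w (F := fun y t s => F y t s - epsop j (F y) t s)
  (G := fun y => hop j (dfm F y)))//; last 2 first.
- exact: fsmoothB.
- exact: fsmooth_hop.
rewrite (Kop_sub oO w (F := F) (G := fun y => epsop j (F y)))//.
rewrite [size _]/= exprS mulN1r [Kop (j :: w) _]/=.
have -> : coface (fun v => Kop v (F y) t s) (j :: w) = Kop w (F y) t s -
  coface (fun v => Kop v (hop j (F y)) t s) w by [].
case: w {IH} => [|i w].
  by rewrite /= expr0 !mulN1r !mul1r /coface/= ?subr0 ?mulr0; ring.
have -> : epsw [:: j, i & w] (F y) = epsw (i :: w) (hop j (F y)) by [].
have -> : Kop (i :: w) (epsop j (F y)) = fun _ _ => 0 by rewrite /= hop_epsop Kop0.
by ring.
Qed.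

(* Stokes' formula, [epsw w] being the integral over the simplex w. *)
Lemma epsw_dfm w F y t s : fsmooth F -> falt F -> O y ->
  epsw w (dfm F y) t s = coface (fun v => epsw v (F y) t s) w -
    (-1) ^+ size w * dfm (fun y => epsw w (F y)) y t s.
Proof.
elim: w F y t s => [|j w IH] F y t s sF aF Oy.
  rewrite /= expr0 mul1r /dfm (@eq_asum _ _ _ (fun _ _ => 0)) ?asum0 ?subr0//.
  by move=> a v _; rewrite pd_cst.
have sh := fsmooth_hop oO j sF.
have ah : falt (fun y => hop j (F y)) by move=> y' t' Oy'; apply: alternating_hop => // ?; exact: aF.
have sd := fsmooth_dfm oO sF.
have se := fsmooth_epsop oO j sF.
case: w IH => [|i w] IH.
  by rewrite /= (dfm_epsop oO)// /coface/= subr0 expr1 mulN1r opprK add0r.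
have e1 : hop j (dfm F y) = fun t s =>
    (F y t s - epsop j (F y) t s) - dfm (fun y => hop j (F y)) y t s.
  apply/funext => t'; apply/funext => s'; rewrite (dfm_hop oO)//; last by move=> t0; exact: aF.
  by ring.
rewrite -[LHS]/(epsw (i :: w) (hop j (dfm F y)) t s) e1.
rewrite (@epsw_sub _ _ _ _ _ oO (i :: w) (fun y t s => F y t s - epsop j (F y) t s)
  (fun y => dfm (fun y => hop j (F y)) y) y)//; last 2 first.
- exact: fsmoothB.
- exact: fsmooth_dfm.
rewrite (@epsw_sub _ _ _ _ _ oO (i :: w) F (fun y => epsop j (F y)) y)//.
rewrite (IH (fun y => hop j (F y)))//.
have -> : coface (fun v => epsw v (F y) t s) (j :: i :: w) =
  epsw (i :: w) (F y) t s - coface (fun v => epsw (j :: v) (F y) t s) (i :: w) by [].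
have -> : dfm (fun y => epsw (j :: i :: w) (F y)) = dfm (fun y => epsw (i :: w) (hop j (F y))) by [].
(* [epsw (j :: v)] is [epsw v] after [hop j], except for empty [v], where it is [epsop j]. The
   exception occurs as a face of a two-letter word only. *)
have -> : coface (fun v => epsw (j :: v) (F y) t s) (i :: w) =
    epsw (i :: w) (epsop j (F y)) t s + coface (fun v => epsw v (hop j (F y)) t s) (i :: w).
  case: w {IH} => [|k w].
    by rewrite /coface/= !subr0 addr0 /epsop mulrA -natrM mulnb andbb.
  rewrite -[epsw [:: i, k & w] (epsop j (F y))]/(epsw (k :: w) (hop i (epsop j (F y)))).
  rewrite hop_epsop epsw0 add0r.
  by apply: eq_coface => -[|v1 v] _ // [].
rewrite [size (j :: _)]/= [(-1) ^+ (size (i :: w)).+1]exprS; ring.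
Qed.

(* The chain homotopy between the identity and the composite of the
   integration over simplices with the extension by [Bop]. *)
Definition sop m (eta : pform) : pform := fun t s =>
  \sum_(q < m.+1) (-1) ^+ q *
    Bop q (fun w t s => ev (sorting R w) (fun v => Kop v eta t s)) t s.

Lemma fsmooth_ev (L : chain R) (psi : seq nat -> 'rV[R]_n -> pform) :
  (forall v, fsmooth (psi v)) ->
  fsmooth (fun y t s => ev L (fun v => psi v y t s)).
Proof.
move=> spsi s; apply: psmooth_sum => // x _.
by apply: psmoothZ => //; exact: spsi.
Qed.

Lemma dfm_ev (L : chain R) (psi : seq nat -> 'rV[R]_n -> pform) y t s :
  (forall v, fsmooth (psi v)) -> O y ->
  dfm (fun y t s => ev L (fun v => psi v y t s)) y t s =
  ev L (fun v => dfm (psi v) y t s).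
Proof.
move=> spsi Oy; rewrite /ev (dfm_sum oO _ (F := fun x y t s => x.1 * psi x.2 y t s))//.
  by apply: eq_bigr => x _; rewrite (dfmZ (O := O)).
by move=> x v; apply: psmoothZ => //; exact: spsi.
Qed.

(** The [Aop] terms coming from [dfm_Bop] and from [dfm_Kop] telescope. The first is F, as r fixes
    the empty word and no contraction is made; the last vanishes because m + 1 contractions exceed
    the degree of F. *)
Lemma dfm_sop m F y t s : fsmooth F -> falt F -> O y ->
  (forall t s, size s != m -> F y t s = 0) ->
  dfm (fun y => sop m (F y)) y t s = F y t s -
   \sum_(q < m.+1) Bop q (fun w t s => ev (sorting R w) (fun v => epsw v (F y) t s)) t s -
   \sum_(q < m.+1) (-1) ^+ q *
     Bop q (fun w t s => ev (sorting R w) (fun v => Kop v (dfm F y) t s)) t s.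
Proof.
move=> sF aF Oy F0.
have sK v : fsmooth (fun y => Kop v (F y)) by exact: fsmooth_Kop.
pose psi w y t s := ev (sorting R w) (fun v => Kop v (F y) t s).
have spsi w : fsmooth (psi w) by exact: (@fsmooth_ev _ (fun v y => Kop v (F y))).
have sB q : fsmooth (fun y => Bop q (fun w => psi w y)) by exact: fsmooth_Bop.
rewrite /sop (dfm_sum oO _ (F := fun (q : 'I_m.+1) y t s =>
  (-1) ^+ q * Bop q (fun w => psi w y) t s))//; last first.
  by move=> q v; apply: psmoothZ => //; exact: sB.
pose EE q := Bop q (fun w t s => ev (sorting R w) (fun v => epsw v (F y) t s)) t s.
pose KK q := Bop q (fun w t s => ev (sorting R w) (fun v => Kop v (dfm F y) t s)) t s.
pose AA q := Aop q (fun w => psi w y) t s.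
rewrite (eq_bigr (fun q : 'I_m.+1 => (-1) ^+ q * AA q.+1 + (-1) ^+ q * AA q - EE q - (-1) ^+ q * KK q)).
  rewrite !sumrB; congr (_ - _ - _).
  have A0 : AA 0%N = F y t s by rewrite /AA /= /psi sorting0.
  have Am : AA m.+1 = 0.
    rewrite /AA -[RHS](Aop0 (R := R) (n := n) m.+1 t s); apply: eq_Aop => w u sw.
    rewrite /psi /ev big1_seq// => x /andP[_ xr].
    have [sx _ _] := sorting_words (map_f snd xr).
    by rewrite (Kop_deg F0) ?mulr0// sx sw; lia.
  have tele k : \sum_(q < k) ((-1) ^+ q * AA q.+1 + (-1) ^+ q * AA q) =
      F y t s - (-1) ^+ k * AA k.
    elim: k => [|k IH]; first by rewrite big_ord0 expr0 mul1r A0 subrr.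
    by rewrite big_ord_recr/= IH exprS; ring.
  by rewrite tele Am mulr0 subr0.
move=> q _; rewrite (dfmZ (O := O))// dfm_Bop// -/(AA q.+1).
(* The coface in [dfm_Kop] passes through r, which is a chain map, and [Bop_cof] then turns it into
   [AA q]. *)
have e1 : Bop q (fun w => dfm (psi w) y) t s =
    (-1) ^+ q * AA q - EE q - (-1) ^+ q * KK q.
  rewrite /AA -Bop_cof /KK /EE -!BopZ -!BopB; apply: eq_Bop => w u sw.
  rewrite /psi (@dfm_ev _ (fun v y => Kop v (F y)))//.
  rewrite /cof -/(coface _ _) -ev_sorting_coface -!evZ -!evB.
  apply: eq_ev => x xr; have [sx _ _] := sorting_words xr.
  by rewrite dfm_Kop// sx sw exprS; ring.
by rewrite e1 mulrDr mulrA -expr2 sqrr_sign mul1r !addrA.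
Qed.

End HomotopyFormula.

(** * Naturality *)

Section PullBacks.
Variable R : realType.

Lemma pull_nil n m (A : 'M[R]_(n, m)) w : pull A w [::] = w [::].
Proof.
rewrite /pull (big_pred1 [tuple]) ?big_ord0 ?mulr1//.
by move=> L; apply/esym/eqP; exact: tuple0.
Qed.

Lemma pull_cons n m (A : 'M[R]_(n, m)) w x s :
  pull A w (x :: s) = \sum_j A x j * pull A (fun v => w (j :: v)) s.
Proof.
under eq_bigr do rewrite /pull mulr_sumr.
rewrite pair_big /= /pull.
rewrite (reindex (fun jL : 'I_m * (size s).-tuple 'I_m => [tuple of jL.1 :: jL.2]))/=; last first.
  exists (fun L : (size s).+1.-tuple 'I_m => (thead L, [tuple of behead L])).
    by move=> [j L] _ /=; rewrite theadE; congr pair; apply: val_inj.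
  by move=> L _ /=; rewrite -tuple_eta.
apply: eq_bigr => -[j L] _ /=; rewrite big_ord_recl mulrCA; congr (_ * (_ * _)).
apply: eq_bigr => a _; rewrite (tnth_nth x) (tnth_nth j)/=.
by rewrite [in RHS](tnth_nth x) [in RHS](tnth_nth j).
Qed.

Lemma eq_pull n m (A : 'M[R]_(n, m)) w w' s :
  (forall v, size v = size s -> w v = w' v) -> pull A w s = pull A w' s.
Proof.
move=> e; apply: eq_bigr => L _; congr (_ * _); apply: e.
by rewrite size_tuple.
Qed.

Lemma pullD n m (A : 'M[R]_(n, m)) w w' s :
  pull A (fun v => w v + w' v) s = pull A w s + pull A w' s.
Proof. by rewrite /pull -big_split/=; apply: eq_bigr => L _; rewrite mulrDl. Qed.

Lemma pullZ n m (A : 'M[R]_(n, m)) c w s :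
  pull A (fun v => c * w v) s = c * pull A w s.
Proof. by rewrite /pull mulr_sumr; apply: eq_bigr => L _; rewrite mulrA. Qed.

Lemma pullB n m (A : 'M[R]_(n, m)) w w' s :
  pull A (fun v => w v - w' v) s = pull A w s - pull A w' s.
Proof. by rewrite /pull -sumrB; apply: eq_bigr => L _; rewrite mulrBl. Qed.

Lemma pull_sum n m (A : 'M[R]_(n, m)) I (r : seq I) (P : pred I) w s :
  pull A (fun v => \sum_(i <- r | P i) w i v) s = \sum_(i <- r | P i) pull A (w i) s.
Proof. by rewrite /pull exchange_big/=; apply: eq_bigr => L _; rewrite mulr_suml. Qed.

Lemma pull_ev n m (A : 'M[R]_(n, m)) (L : chain R) w s :
  pull A (fun v => ev L (fun u => w u v)) s = ev L (fun u => pull A (w u) s).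
Proof. by rewrite /ev pull_sum; apply: eq_bigr => x _; rewrite pullZ. Qed.

Lemma pull_int01 n m (A : 'M[R]_(n, m)) (w : R -> seq 'I_m -> R) s :
  (forall v, continuous (w ^~ v)) ->
  int01 (fun u => pull A (w u) s) = pull A (fun v => int01 (w ^~ v)) s.
Proof.
move=> cw; rewrite int01_sum; last first.
  move=> L; rewrite (_ : (fun u => _) = (fun u => (\prod_(a < size s)
     A (tnth (in_tuple s) a) (tnth L a)) * w u L)); first exact: continuous_cmul.
  by apply/funext => u; rewrite mulrC.
apply: eq_bigr => L _; rewrite mulrC -int01Z//.
by apply: eq_int01 => u _; rewrite mulrC.
Qed.

Lemma pull_wdg n m (A : 'M[R]_(n, m)) (al : 'I_m -> R) w s :
  pull A (wdg al w) s = wdg (fun a => \sum_j A a j * al j) (pull A w) s.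
Proof.
elim: s w => [|x s IH] w; first by rewrite pull_nil.
have -> : wdg (fun a => \sum_j A a j * al j) (pull A w) (x :: s) =
    (\sum_j A x j * al j) * pull A w s -
    wdg (fun a => \sum_j A a j * al j) (fun v => pull A w (x :: v)) s by [].
rewrite pull_cons.
under eq_bigr => j _.
  rewrite (@eq_pull _ _ _ _ (fun v => al j * w v - wdg al (fun u => w (j :: u)) v)) //.
  rewrite pullB pullZ IH mulrBr mulrA; over.
rewrite sumrB -mulr_suml; congr (_ - _).
rewrite [RHS](@eq_wdg _ _ _ (fun a => \sum_j A a j * al j) _
  (fun v => \sum_j A x j * pull A (fun u => w (j :: u)) v))//; last first.
  by move=> v _; rewrite pull_cons.
by rewrite wdg_sum; apply: eq_bigr => j _; rewrite wdgZ.
Qed.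

Lemma pull1 n (w : seq 'I_n -> R) s : pull 1%:M w s = w s.
Proof.
elim: s w => [|x s IH] w; first exact: pull_nil.
rewrite pull_cons (bigD1 x)//= mxE eqxx mul1r IH big1 ?addr0// => j jx.
by rewrite mxE eq_sym (negbTE jx) mul0r.
Qed.

(* A form on M, pulled back to R^p x M. *)
Fixpoint liftx p n (g : seq 'I_n -> R) (s : seq 'I_(p + n)) : R :=
  if s is a :: s' then
    if fintype.split a is inr j then liftx (fun v => g (j :: v)) s' else 0
  else g [::].

Lemma liftx_rshift p n (g : seq 'I_n -> R) s : liftx g (map (@rshift p n) s) = g s.
Proof.
elim: s g => //= a s IH g; rewrite -[fintype.split _]/(fintype.split (unsplit (inr a))).
by rewrite unsplitK IH.
Qed.

Lemma liftx_nt p n (g : seq 'I_n -> R) (s : seq 'I_(p + n)) : nt s != 0 -> liftx g s = 0.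
Proof.
elim: s g => //= a s IH g; case: splitP => // j aj.
by rewrite /nt/= /isT aj ltnNge leq_addr/= add0n; exact: IH.
Qed.

Lemma nt0P p n (s : seq 'I_(p + n)) : nt s = 0%N -> exists v, s = map (@rshift p n) v.
Proof.
elim: s => [|a s IH]; first by exists [::].
rewrite /nt/= => /eqP; rewrite addn_eq0 => /andP[a0 /eqP/IH[v ->]].
move: a0; rewrite /isT; case: (splitP a) => // j aj _.
by exists (j :: v) => /=; congr cons; exact: val_inj.
Qed.

Lemma liftxE p n (h : seq 'I_(p + n) -> R) s :
  (nt s != 0 -> h s = 0) -> h s = liftx (fun v => h (map (@rshift p n) v)) s.
Proof.
case: (eqVneq (nt s) 0%N) => [/nt0P[v ->] _|s0 ->//]; first by rewrite liftx_rshift.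
by rewrite liftx_nt.
Qed.

Lemma liftxZ p n c (g : seq 'I_n -> R) (s : seq 'I_(p + n)) :
  liftx (fun v => c * g v) s = c * liftx g s.
Proof.
elim: s g => //= a s IH g; case: (fintype.split a) => j; first by rewrite mulr0.
exact: (IH (fun v => g (j :: v))).
Qed.

Lemma liftx_sum p n I (r : seq I) (P : pred I) (g : I -> seq 'I_n -> R) (s : seq 'I_(p + n)) :
  liftx (fun v => \sum_(i <- r | P i) g i v) s = \sum_(i <- r | P i) liftx (g i) s.
Proof.
elim: s g => //= a s IH g; case: (fintype.split a) => j; first by rewrite big1.
exact: (IH (fun i v => g i (j :: v))).
Qed.

Lemma liftx_ev p n (L : chain R) (g : seq nat -> seq 'I_n -> R) (s : seq 'I_(p + n)) :
  liftx (fun v => ev L (fun w => g w v)) s = ev L (fun w => liftx (g w) s).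
Proof. by rewrite /ev liftx_sum; apply: eq_bigr => x _; rewrite liftxZ. Qed.

Lemma eq_liftx p n (g h : seq 'I_n -> R) (s : seq 'I_(p + n)) :
  (forall v, g v = h v) -> liftx g s = liftx h s.
Proof.
elim: s g h => //= a s IH g h gh; case: (fintype.split a) => // j.
by apply: IH => v.
Qed.

Lemma alternating_liftx p n (g : seq 'I_n -> R) :
  alternating g -> alternating (@liftx p n g).
Proof.
move=> ag s1; elim: s1 g ag => [|a s1 IH] g ag i j s2 /=.
  case: (fintype.split i) (fintype.split j) => [x|x] [y|y]; rewrite ?oppr0//.
  rewrite -mulN1r -liftxZ; apply: eq_liftx => v.
  by rewrite mulN1r; exact: (ag [::]).
case: (fintype.split a) => x; rewrite ?oppr0//.
by apply: IH; exact: alternating_cons.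
Qed.

End PullBacks.

Section Naturality.
Variables (R : realType) (p q n m : nat).
Variables (B : 'M[R]_(p, q)) (b : 'rV[R]_q) (C : 'M[R]_(n, m)).
Local Notation A := (block_mx B 0 0 C).
Local Notation f t := (t *m B + b).

(** A block diagonal matrix sends dt's to dt's and dx's to dx's, so only words with as many dt's as
    [s] contribute. *)
Lemma pull_nt (g : nat -> R) (w : seq 'I_(q + m) -> R) (s : seq 'I_(p + n)) :
  pull A (fun v => g (nt v) * w v) s = g (nt s) * pull A w s.
Proof.
elim: s g w => [|x s IH] g w; first by rewrite !pull_nil.
rewrite !pull_cons mulr_sumr; apply: eq_bigr => j _.
rewrite (@eq_pull _ _ _ _ _ (fun v => g (isT j + nt v)%N * w (j :: v)))//.
rewrite (IH (fun k => g (isT j + k)%N)) mulrCA.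
have [->|A0] := eqVneq (A x j) 0; first by rewrite !mul0r !mulr0.
suff -> : isT j = isT x by [].
move: A0; rewrite /isT; case: (splitP x) => x' xx; case: (splitP j) => j' jj.
- by [].
- have -> : x = lshift n x' by exact: val_inj.
  have -> : j = rshift q j' by exact: val_inj.
  by rewrite block_mxEur mxE eqxx.
- have -> : x = rshift p x' by exact: val_inj.
  have -> : j = lshift m j' by exact: val_inj.
  by rewrite block_mxEdl mxE eqxx.
- by [].
Qed.

Lemma pull_liftx (g : seq 'I_m -> R) (s : seq 'I_(p + n)) :
  pull A (liftx g) s = liftx (pull C g) s.
Proof.
elim: s g => [|x s IH] g; first by rewrite pull_nil /= pull_nil.
rewrite pull_cons big_split_ord/= [X in X + _]big1 ?add0r; last first.
  move=> j _; rewrite -[fintype.split _]/(fintype.split (unsplit (inl j))) unsplitK.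
  rewrite (@eq_pull _ _ _ _ _ (fun v => 0 * liftx g v)); last by move=> *; rewrite mul0r.
  by rewrite pullZ mul0r mulr0.
case: (splitP x) => k xk.
  rewrite big1// => j _; rewrite (_ : x = lshift n k) ?block_mxEur ?mxE ?mul0r//.
  exact: val_inj.
rewrite (@eq_liftx _ _ _ _ (fun v => \sum_j C k j * pull C (fun u => g (j :: u)) v)); last first.
  by move=> v; rewrite pull_cons.
rewrite liftx_sum; apply: eq_bigr => j _; rewrite (_ : x = rshift p k); last exact: val_inj.
rewrite block_mxEdr liftxZ -IH; congr (_ * _); apply: eq_pull => v _.
by rewrite -[fintype.split _]/(fintype.split (unsplit (inr j))) unsplitK.
Qed.

Variables (mu : nat -> nat) (D : set 'rV[R]_p).
Hypothesis mu_vtx : forall j, f (vtx R p j) = vtx R q (mu j).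
Hypothesis D_seg : forall t j u, D t -> 0 <= u <= 1 -> D (seg (vtx R p j) t u).

(** Pull-back along an affine map of the simplex variables times a map of M with Jacobian [C] at the
    point considered. Changes of charts, invariance under Diff(M) and simplicial compatibility are
    all of this form. *)
Definition related (eta : pform R p n) (zeta : pform R q m) :=
  forall t s, D t -> eta t s = pull A (zeta (f t)) s.

Lemma seg_affine j t u : f (seg (vtx R p j) t u) = seg (vtx R q (mu j)) (f t) u.
Proof.
by rewrite /seg -mu_vtx mulmxDl -!scalemxAl !scalerDr addrACA -scalerDl subrK scale1r.
Qed.

Definition pcont r k (eta : pform R r k) := forall s, continuous (eta ^~ s).

Lemma pcont_hop r k j (eta : pform R r k) : pcont eta -> pcont (hop j eta).
Proof.
move=> ce s.
suff cc c : continuous (fun t : 'rV[R]_r => (t - vtx R r j) 0 c *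
    cint (vtx R r j) (nt s) (fun t => eta t (lshift k c :: s)) t).
  exact: continuous_bigsum.
move=> t; apply: (@continuous_mul R _ (fun t : 'rV[R]_r => (t - vtx R r j) 0 c)
  (cint (vtx R r j) (nt s) (fun t => eta t (lshift k c :: s))) t).
  rewrite (_ : (fun _ => _) = (fun t : 'rV[R]_r => t 0 c - vtx R r j 0 c)).
    by apply: continuousB; [exact: coord_continuous|exact: cst_continuous].
  by apply/funext => t'; rewrite !mxE.
apply: (@continuous_int01 R _ (fun u t => (1 - u) ^+ nt s * eta (seg (vtx R r j) t u) (lshift k c :: s))).
  by near=> t'; exact: (@continuous_cint_arg _ _ _ _ (fun t => eta t (lshift k c :: s))).
move=> u _.
apply: (@continuous_mul R _ (fun z : R * 'rV[R]_r => (1 - z.1) ^+ nt s)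
  (fun z => eta (seg (vtx R r j) z.2 z.1) (lshift k c :: s)) (u, t)).
  apply: (@continuous_comp _ _ _ fst (fun u : R => (1 - u) ^+ nt s)); first exact: cvg_fst.
  exact: continuous_onem_exp.
apply: (@continuous_comp _ _ _ (fun z : R * 'rV[R]_r => seg (vtx R r j) z.2 z.1)
   (fun t => eta t (lshift k c :: s))); last exact: ce.
apply: continuous_rV => d.
rewrite (_ : (fun _ => _) = (fun z : R * 'rV[R]_r => (1 - z.1) * z.2 0 d + z.1 * vtx R r j 0 d)).
  apply: (@continuousD _ _ _ (fun z : R * 'rV[R]_r => (1 - z.1) * z.2 0 d) (fun z => z.1 * vtx R r j 0 d));
    apply: continuous_mul.
  - by apply: continuousB; [exact: cst_continuous|exact: cvg_fst].
  - apply: (@continuous_comp _ _ _ snd (fun v : 'rV[R]_r => v 0 d)); first exact: cvg_snd.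
    exact: coord_continuous.
  - exact: cvg_fst.
  - exact: cst_continuous.
by apply/funext => z; rewrite !mxE.
Unshelve. all: by end_near. Qed.

(** An affine map carries the segment from t to a vertex onto the segment between the images
    ([seg_affine]) and the vector t - vtx j onto the corresponding vector, so contraction commutes
    with the pull-back. *)
Lemma related_hop j eta zeta : pcont zeta -> related eta zeta ->
  related (hop j eta) (hop (mu j) zeta).
Proof.
move=> cz ez t s Dt.
pose e := vtx R p j; pose e' := vtx R q (mu j).
pose w c u v := (1 - u) ^+ nt s * zeta (seg e' (f t) u) (lshift m c :: v).
have cw c v : continuous (fun u => w c u v).
  exact: (@continuous_cint_arg _ _ _ _ (fun t => zeta t (lshift m c :: v))).
have E1 a : cint e (nt s) (fun t => eta t (lshift n a :: s)) t =
    \sum_(c < q) B a c * int01 (fun u => pull A (w c u) s).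
  transitivity (int01 (fun u => \sum_(c < q) B a c * pull A (w c u) s)).
    apply: eq_int01 => u u01; rewrite ez; last exact: D_seg.
    rewrite pull_cons big_split_ord/= [X in _ * (_ + X)]big1 ?addr0; last first.
      by move=> c _; rewrite block_mxEur mxE mul0r.
    rewrite mulr_sumr; apply: eq_bigr => c _; rewrite block_mxEul mulrCA; congr (_ * _).
    by rewrite -pullZ seg_affine.
  have cp c : continuous (fun u => pull A (w c u) s).
    apply: continuous_bigsum => L.
    rewrite (_ : (fun u => _) = (fun u => (\prod_(a < size s)
       A (tnth (in_tuple s) a) (tnth L a)) * w c u L)); first exact: continuous_cmul.
    by apply/funext => u; rewrite mulrC.
  rewrite int01_sum; last by move=> c; exact: continuous_cmul.
  by apply: eq_bigr => c _; rewrite int01Z.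
rewrite /hop (eq_bigr (fun a => \sum_(c < q) (t - e) 0 a * B a c * int01 (fun u => pull A (w c u) s))); last first.
  by move=> a _; rewrite E1 mulr_sumr; apply: eq_bigr => c _; rewrite mulrA.
rewrite exchange_big/=.
rewrite (@eq_pull _ _ _ _ _ (fun v => \sum_(c < q) (f t - e') 0 c * (fun v =>
  cint e' (nt v) (fun t => zeta t (lshift m c :: v)) (f t)) v))//.
rewrite pull_sum; apply: eq_bigr => c _; rewrite -mulr_suml pullZ; congr (_ * _).
  rewrite /e' -mu_vtx opprD addrACA subrr addr0 -mulmxBl mxE.
  by apply: eq_bigr => a _.
rewrite pull_int01//.
(* The exponent varies with the index that is summed over. Splitting by its value k, [pull_nt] shows
   that only k = [nt s] contributes. *)
have -> : pull A (fun v => cint e' (nt v) (fun t => zeta t (lshift m c :: v)) (f t)) s =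
  pull A (fun v => cint e' (nt s) (fun t => zeta t (lshift m c :: v)) (f t)) s.
  have -> : pull A (fun v => cint e' (nt v) (fun t => zeta t (lshift m c :: v)) (f t)) s =
    pull A (fun v => \sum_(k < (size s).+1) (nt v == k)%:R *
      cint e' k (fun t => zeta t (lshift m c :: v)) (f t)) s.
    apply: eq_pull => v sv; have nv : (nt v < (size s).+1)%N by rewrite ltnS -sv count_size.
    rewrite (bigD1 (Ordinal nv))//= eqxx mul1r big1 ?addr0// => k kv.
    by case: eqP => // e0; [move: kv; rewrite -val_eqE/= e0 eqxx|rewrite mul0r].
  rewrite pull_sum (eq_bigr (fun k : 'I_(size s).+1 => (nt s == k)%:R *
    pull A (fun v => cint e' k (fun t => zeta t (lshift m c :: v)) (f t)) s)); last first.
    by move=> k _; rewrite (pull_nt (fun x => (x == k)%:R)).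
  have ns : (nt s < (size s).+1)%N by rewrite ltnS count_size.
  rewrite (bigD1 (Ordinal ns))//= eqxx mul1r big1 ?addr0// => k ks.
  by case: eqP => // e0; [move: ks; rewrite -val_eqE/= e0 eqxx|rewrite mul0r].
by [].
Qed.

Lemma D_vtx' t j : D t -> D (vtx R p j).
Proof. exact: (@D_vtx R p D D_seg). Qed.

Lemma related_epsop j eta zeta : related eta zeta ->
  related (epsop j eta) (epsop (mu j) zeta).
Proof.
move=> ez t s Dt; rewrite /epsop ez; last exact: D_vtx' Dt.
by rewrite (pull_nt (fun k => (k == 0)%:R)) mu_vtx.
Qed.

Lemma related_Kop w eta zeta : pcont zeta -> related eta zeta ->
  related (Kop w eta) (Kop (map mu w) zeta).
Proof.
elim: w eta zeta => //= j w IH eta zeta cz ez.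
by apply: IH; [exact: pcont_hop|exact: related_hop].
Qed.

Lemma related_epsw w eta zeta : pcont zeta -> related eta zeta ->
  related (epsw w eta) (epsw (map mu w) zeta).
Proof.
elim: w eta zeta => [|j [|i w] IH] eta zeta cz ez.
- by move=> t s Dt; rewrite (@eq_pull _ _ _ _ _ (fun v => 0 * 0)) ?pullZ ?mul0r// => v _; rewrite mul0r.
- exact: related_epsop.
- by apply: (IH (hop j eta) (hop (mu j) zeta)); [exact: pcont_hop|exact: related_hop].
Qed.

Hypothesis mu_le : forall i, (i <= p -> mu i <= q)%N.
Hypothesis mu_bary : forall t (l : 'I_q.+1),
  bary (f t) l = \sum_(i < p.+1 | mu i == l) bary t i.
Hypothesis mu_dbary : forall a (l : 'I_q.+1),
  \sum_j A a j * dbary l j = \sum_(i < p.+1 | mu i == l) dbary i a.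

Let muo (i : 'I_p.+1) : 'I_q.+1 := inord (mu i).

Let muoE (i : 'I_p.+1) : (muo i : nat) = mu i.
Proof. by rewrite inordK// ltnS mu_le// -ltnS. Qed.

(** The pull-back of dt_l is the sum of the dt_i with mu i = l. Substituting this letter by letter
    turns the sum over all words of the target into the sum over all words of the source, grouped by
    their images. *)
Lemma related_Aop k (psi : seq nat -> pform R p n) (psi' : seq nat -> pform R q m) t :
  (forall w s, psi w t s = pull A (psi' (map mu w) (f t)) s) ->
  forall s, Aop k psi t s = pull A (Aop k psi' (f t)) s.
Proof.
elim: k psi psi' => [|k IH] psi psi' pp s /=; first exact: pp.
rewrite pull_sum (partition_big muo xpredT)//=; apply: eq_bigr => l _.
rewrite pull_wdg.
transitivity (wdg (fun a => \sum_(i < p.+1 | mu i == l) dbary i a)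
  (pull A (Aop k (fun w => psi' ((l : nat) :: w)) (f t))) s); last first.
  by apply: eq_wdg => // a; rewrite mu_dbary.
rewrite wdg_suml; apply: eq_big => i; first by rewrite -val_eqE/= muoE.
move=> /eqP il; apply: eq_wdg => // v _; apply: IH => w s'.
by rewrite pp/= -muoE il.
Qed.

Lemma related_Bop k (psi : seq nat -> pform R p n) (psi' : seq nat -> pform R q m) t :
  (forall w s, psi w t s = pull A (psi' (map mu w) (f t)) s) ->
  forall s, Bop k psi t s = pull A (Bop k psi' (f t)) s.
Proof.
move=> pp s; rewrite /Bop pull_sum (partition_big muo xpredT)//=; apply: eq_bigr => l _.
rewrite pullZ mu_bary mulr_suml; apply: eq_big => i; first by rewrite -val_eqE/= muoE.
move=> /eqP il; congr (_ * _); apply: related_Aop => w s'.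
by rewrite pp/= -muoE il.
Qed.

End Naturality.

(** * Integration over the simplex *)

Section Fubini.
Variable R : realType.
Local Notation mu := (@lebesgue_measure R).
Local Notation RR := (measurableTypeR R * measurableTypeR R)%type.

Lemma rat_itv_around (x e : R) : 0 < e -> exists a b : rat,
  [/\ ratr a < x, x < ratr b & forall z, ratr a < z < ratr b -> ball x e z].
Proof.
move=> e0.
have [a] : exists a : rat, ratr a \in `]x - e, x[ by apply: rat_in_itvoo; rewrite ltrBlDr ltrDl.
rewrite in_itv/= => /andP[a1 a2].
have [b] : exists b : rat, ratr b \in `]x, x + e[ by apply: rat_in_itvoo; rewrite ltrDl.
rewrite in_itv/= => /andP[b1 b2].
exists a, b; split=> // z /andP[az zb]; rewrite -ball_normE/= ltr_norml.
by apply/andP; split; lra.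
Qed.

(** An open set of the plane is the union of the countably many rational rectangles contained in it,
    and these generate the product sigma-algebra. *)
Lemma open_measurable_prod (U : set (R * R)) : open U -> measurable (U : set RR).
Proof.
move=> oU.
pose rect (q : rat * rat * (rat * rat)) : set RR :=
  `]ratr q.1.1, ratr q.1.2[%classic `*` `]ratr q.2.1, ratr q.2.2[%classic.
pose F k : set RR := if unpickle k is Some q then
  (if `[< rect q `<=` U >] then rect q else set0) else set0.
have -> : (U : set RR) = \bigcup_k F k.
  apply/seteqP; split=> [[x y] Uxy|z [k _]]; last first.
    by rewrite /F; case: unpickle => // q; case: asboolP => // qU; exact: qU.
  have [/= [V W] /= [Vx Wy] VWU] : nbhs (x, y) U by exact: open_nbhs_nbhs.
  have [e /= e0 eV] := (nbhs_ballP _ _).1 Vx.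
  have [d /= d0 dW] := (nbhs_ballP _ _).1 Wy.
  have [a [b [ax xb ab]]] := rat_itv_around x e0.
  have [a' [b' [ay yb ab']]] := rat_itv_around y d0.
  exists (pickle (a, b, (a', b'))); first exact: I.
  rewrite /F pickleK.
  rewrite asboolT; first by split; rewrite /= in_itv/=; apply/andP.
  move=> [x' y'] [] /=; rewrite !in_itv/= => xx yy; apply: VWU.
  by split; [apply: eV; exact: ab|apply: dW; exact: ab'].
apply: bigcupT_measurable => k; rewrite /F; case: unpickle => // q.
by case: asboolP => // _; apply: measurableX; exact: measurable_itv.
Qed.

Lemma continuous_measurable_prod (f : R * R -> R) : continuous f ->
  measurable_fun setT (f : RR -> R).
Proof.
move=> /continuousP cf; apply: (measurability _ (RGenOpens.measurableE R)).
move=> _ [_ [a [b ->] <-]]; rewrite setTI; apply: open_measurable_prod.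
exact/cf/interval_open.
Qed.

(** The condition on [a] and [b] says that both iterated integrals run over the same region. G
    extended by 0 outside it is integrable, being bounded on the rectangle [0, r] x [0, c] that
    contains the region. *)
Lemma Rintegral_swap (G : R -> R -> R) (r c : R) (a b : R -> R) :
  continuous (fun z : R * R => G z.1 z.2) -> continuous a ->
  (forall x y : R, (0 <= x <= r) && (0 <= y <= a x) = (0 <= y <= c) && (0 <= x <= b y)) ->
  \int[mu]_(x in `[0, r]) \int[mu]_(y in `[0, a x]) G x y =
  \int[mu]_(y in `[0, c]) \int[mu]_(x in `[0, b y]) G x y.
Proof.
move=> cG ca ab.
pose A : set RR := [set z | (0 <= z.1 <= r) && (0 <= z.2 <= a z.1)].
pose g (z : RR) : R := G z.1 z.2.
pose h := (EFin \o g) \_ A.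
have mG : measurable_fun setT g by exact: continuous_measurable_prod.
have mA : measurable A.
  have -> : A = (fst @^-1` `[0, r]%classic) `&` (snd @^-1` `[0, +oo[%classic) `&`
      ((fun z : RR => a z.1 - z.2) @^-1` `[0, +oo[%classic).
    apply/seteqP; split=> -[x y] /=; rewrite /A/= !in_itv/= !andbT subr_ge0.
      by move=> /and3P[x0 y0 ya]; rewrite x0 y0.
    by move=> [[-> ->] ->].
  have m (f : R * R -> R) (I : interval R) : continuous f ->
      measurable ((f : RR -> R) @^-1` [set` I]).
    by move=> cf; rewrite -[X in measurable X]setTI; apply: (continuous_measurable_prod cf) => //; exact: measurable_itv.
  apply: measurableI; first apply: measurableI; apply: m.
  - by move=> z; exact: cvg_fst.
  - by move=> z; exact: cvg_snd.
  - move=> z; apply: (@continuousB _ _ _ (fun z : R * R => a z.1) snd); last exact: cvg_snd.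
    by apply: (@continuous_comp _ _ _ fst a); [exact: cvg_fst|exact: ca].
have [M GM] : exists M, forall x y, 0 <= x <= r -> 0 <= y <= c -> `|G x y| <= M.
  case: (leP 0 r) => r0; last by exists 0 => x y /andP[x0 xr]; move: (le_trans x0 xr); rewrite leNgt r0.
  case: (leP 0 c) => c0; last by exists 0 => x y _ /andP[y0 yc]; move: (le_trans y0 yc); rewrite leNgt c0.
  have K : compact (`[0, r]%classic `*` `[0, c]%classic : set (R * R)).
    by apply: compact_setX; exact: segment_compact.
  have [||z _ zM] := @compact_EVT_max (R * R)%type R (fun z => `|G z.1 z.2|) _ _ K.
  - by exists (0, 0); split; rewrite /= in_itv/= lexx.
  - apply: continuous_subspaceT => z.
    by apply: (@continuous_comp _ _ _ (fun z : R * R => G z.1 z.2)); [exact: cG|exact: norm_continuous].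
  exists `|G z.1 z.2| => x y x0 y0; apply: (zM (x, y)); rewrite inE; split; by rewrite /= in_itv.
have bound x y : (x, y) \in A -> `|G x y| <= M.
  rewrite inE /A/= => xy; move: (xy); rewrite ab => /andP[y0 _].
  by case/andP: xy => x0 _; exact: GM.
have ih : (mu \x mu)%E.-integrable setT h.
  suff ig : (mu \x mu)%E.-integrable A (EFin \o g) by have := (integrable_mkcond (EFin \o g) mA).1 ig.
  apply: (@measurable_bounded_integrable _ RR R (mu \x mu)%E g A mA).
  - have mQ : measurable (`[0, r]%classic `*` `[0, c]%classic : set RR).
      by apply: measurableX; exact: measurable_itv.
    apply: (@le_lt_trans _ _ ((mu \x mu)%E (`[0, r]%classic `*` `[0, c]%classic : set RR))).
      apply: le_measure; rewrite ?inE// => -[x y] xy; split; rewrite /= in_itv/=.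
        by case/andP: xy.
      by move: xy; rewrite /A/= ab => /andP[].
    rewrite product_measure1E//; try exact: measurable_itv.
    by rewrite /= !lebesgue_measure_itv/=; case: ifP => _; case: ifP => _;
      rewrite ?mul0e ?mule0 ?ltry// -?EFinB -?EFinM ltry.
  - exact: measurable_funTS.
  - exists M; split; first exact: num_real.
    by move=> k Mk [x y] xyA; apply: le_trans (ltW Mk); apply: bound; exact/mem_set.
have slice1 x : continuous (G x).
  move=> y; apply: (@cvg_comp _ _ _ (fun y => (x, y)) (fun z => G z.1 z.2) _ _ _ _ (cG (x, y))).
  exact: (@cvg_pair _ _ _ (nbhs y) (nbhs x) (nbhs y) _ _ _ (cst x) id (cvg_cst _) cvg_id).
have slice2 y : continuous (G ^~ y) by move=> x; apply: (@continuous_fst_slice _ _ _ G); exact: cG.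
have := Fubini ih.
have -> : (\int[mu]_x \int[mu]_y h (x, y) =
    \int[mu]_(x in `[0%R, r]) (\int[mu]_(y in `[0, a x]) G x y)%:E)%E.
  rewrite [RHS]integral_mkcond; apply: eq_integral => x _; rewrite patchE.
  case: ifPn => xr.
    rewrite /Rintegral fineK; last first.
      by apply: integrable_fin_num => //; exact: continuous_integrable.
    rewrite [RHS]integral_mkcond; apply: eq_integral => y _.
    rewrite /h !patchE/=; congr (if _ then _ else _).
    by apply/idP/idP; rewrite !inE /A/= in_itv/=; move: xr; rewrite inE/= in_itv/= => ->.
  rewrite -[RHS](integral0 mu setT); apply: eq_integral => y _.
  rewrite /h patchE ifF//; apply/negbTE; move: xr; apply: contra.
  by rewrite !inE /A/= in_itv/= => /andP[].
have -> : (\int[mu]_y \int[mu]_x h (x, y) =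
    \int[mu]_(y in `[0%R, c]) (\int[mu]_(x in `[0, b y]) G x y)%:E)%E.
  rewrite [RHS]integral_mkcond; apply: eq_integral => y _; rewrite patchE.
  case: ifPn => yc.
    rewrite /Rintegral fineK; last first.
      by apply: integrable_fin_num => //; exact: continuous_integrable.
    rewrite [RHS]integral_mkcond; apply: eq_integral => x _.
    rewrite /h !patchE/=; congr (if _ then _ else _).
    by apply/idP/idP; rewrite !inE /A/= in_itv/= ab; move: yc; rewrite inE/= in_itv/= => ->.
  rewrite -[RHS](integral0 mu setT); apply: eq_integral => x _.
  rewrite /h patchE ifF//; apply/negbTE; move: yc; apply: contra.
  by rewrite !inE /A/= ab in_itv/= => /andP[].
by move=> E; rewrite /Rintegral/= E.
Qed.

End Fubini.

(** * Iterated integrals over the simplex *)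

Section SimplexIntegrals.
Variable R : realType.
Local Notation mu := (@lebesgue_measure R).
Implicit Types (f : R -> R) (r u v : R).

Lemma continuous_pair (X Y Z : topologicalType) (f : X -> Y) (g : X -> Z) :
  continuous f -> continuous g -> continuous (fun x => (f x, g x)).
Proof. by move=> cf cg x; apply: cvg_pair; [exact: cf|exact: cg]. Qed.

Lemma continuous_after (X Y Z : topologicalType) (f : X -> Y) (g : Y -> Z) :
  continuous g -> continuous f -> continuous (fun x => g (f x)).
Proof. by move=> cg cf x; apply: continuous_comp; [exact: cf|exact: cg]. Qed.

Lemma continuous_sub (X : topologicalType) (f g : X -> R) :
  continuous f -> continuous g -> continuous (fun x => f x - g x).
Proof. by move=> cf cg x; apply: continuousB; [exact: cf|exact: cg]. Qed.

Lemma continuous_cons p (X : topologicalType) (a : X -> R) (t : X -> 'rV[R]_p) :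
  continuous a -> continuous t ->
  continuous (fun x => row_mx ((a x)%:M : 'rV[R]_1) (t x)).
Proof.
move=> ca ct x; apply: continuous_rV => j; have [k jk|k jk] := splitP j.
  rewrite (_ : (fun _ => _) = a); first exact: ca.
  apply/funext => y; rewrite (_ : j = lshift p k); last exact: val_inj.
  by rewrite row_mxEl mxE (ord1 k) eqxx mulr1n.
rewrite (_ : (fun _ => _) = (fun y => t y 0 k)).
  by apply: (@continuous_comp _ _ _ t (fun v : 'rV[R]_p => v 0 k)); [exact: ct|exact: coord_continuous].
apply/funext => y; rewrite (_ : j = rshift 1 k); last exact: val_inj.
by rewrite row_mxEr.
Qed.

Lemma row_cons0 p (u : R) (t : 'rV[R]_p) :
  (row_mx (u%:M : 'rV[R]_1) t : 'rV[R]_p.+1) 0 ord0 = u.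
Proof.
transitivity ((u%:M : 'rV[R]_1) 0 0); last by rewrite mxE eqxx mulr1n.
by rewrite -[RHS](row_mxEl _ t); congr (fun_of_matrix _ 0 _); exact: val_inj.
Qed.

Lemma row_consS p (u : R) (t : 'rV[R]_p) j :
  (row_mx (u%:M : 'rV[R]_1) t : 'rV[R]_p.+1) 0 (lift ord0 j) = t 0 j.
Proof.
rewrite -[RHS](row_mxEr (u%:M : 'rV[R]_1) t).
by congr (fun_of_matrix _ 0 _); exact: val_inj.
Qed.

(** The positive part. The integral over [0, r] is 0 for negative r, so with [pos r] it has one
    formula for all r, visibly continuous in r. *)
Let pos r := (r + `|r|) / 2.

Let pos_ge r : 0 <= r -> pos r = r.
Proof. by move=> r0; rewrite /pos ger0_norm//; lra. Qed.

Let pos_le r : r <= 0 -> pos r = 0.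
Proof. by move=> r0; rewrite /pos ler0_norm//; lra. Qed.

Let continuous_pos (X : topologicalType) (f : X -> R) :
  continuous f -> continuous (fun x => pos (f x)).
Proof.
move=> cf x; apply: (@continuous_mul R X (fun x => f x + `|f x|) (fun=> 2^-1) x); last exact: cst_continuous.
by apply: continuous_add => //; apply: (continuous_after _ cf); exact: norm_continuous.
Qed.

Lemma Rintegral_scale f r : continuous f -> 0 <= r ->
  \int[mu]_(x in `[0, r]) f x = r * int01 (fun u => f (r * u)).
Proof.
move=> cf; rewrite le_eqVlt => /predU1P[<-|r0].
  by rewrite set_itv1 Rintegral_set1 mul0r.
have cr : continuous (fun u => f (r * u)).
  by apply: continuous_after => //; apply: continuous_cmul => u; exact: cvg_id.
have D : derive1 ( *%R r : R -> R) = cst r.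
  apply/funext => z; rewrite derive1E.
  by rewrite (_ : *%R r = r \*: id) ?deriveZ// derive_id /GRing.scale/= mulr1.
have dr (z : R) : derivable ( *%R r : R -> R) z 1.
  by rewrite (_ : *%R r = r \*: id)//; apply: derivableZ.
have cmr : continuous ( *%R r : R -> R).
  by apply: continuous_cmul => u; exact: cvg_id.
rewrite /int01 -RintegralZl//; last exact: continuous_integrable.
rewrite /Rintegral; congr fine.
have := @integration_by_substitution_increasing R ( *%R r) f 0 1.
rewrite mulr0 mulr1 => ->//.
- by apply: eq_integral => x _; rewrite D/= mulrC.
- by move=> x y _ _; rewrite ltr_pM2l.
- by rewrite D => ? _; exact: cst_continuous.
- by rewrite D; exact: is_cvg_cst.
- by rewrite D; exact: is_cvg_cst.
- split=> [z _||]; first exact: dr.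
    exact/cvg_at_right_filter/cmr.
  exact/cvg_at_left_filter/cmr.
- exact: continuous_subspaceT.
Qed.

Let Rintegral_pos f r : continuous f ->
  \int[mu]_(x in `[0, r]) f x = pos r * int01 (fun u => f (pos r * u)).
Proof.
move=> cf; case: (leP 0 r) => r0; first by rewrite Rintegral_scale ?pos_ge.
by rewrite set_itv_ge -?leNgt ?bnd_simp// Rintegral_set0 pos_le ?mul0r// ltW.
Qed.

Lemma int01_onem f : continuous f -> int01 (fun u => f (1 - u)) = int01 f.
Proof.
move=> cf; rewrite [RHS]/int01 Rintegration_by_substitution_onem ?lexx ?ler01//.
  by rewrite (_ : unstable.onem 1 = 0)// /unstable.onem subrr.
exact: continuous_subspaceT.
Qed.

Lemma Rintegral_reflect f r : continuous f ->
  \int[mu]_(x in `[0, r]) f (r - x) = \int[mu]_(x in `[0, r]) f x.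
Proof.
move=> cf; case: (leP 0 r) => r0; last by rewrite set_itv_ge -?leNgt ?bnd_simp// !Rintegral_set0.
have cs (g : R -> R) : continuous g -> continuous (fun u => g (r * u)).
  by move=> cg; apply: continuous_after => //; apply: continuous_cmul => u; exact: cvg_id.
have cb : continuous (fun x : R => f (r - x)).
  apply: continuous_after => //; apply: continuous_sub; first exact: cst_continuous.
  by move=> u; exact: cvg_id.
rewrite !Rintegral_scale//; congr (_ * _).
rewrite -[RHS](int01_onem (f := fun u => f (r * u))); last exact: cs.
by apply: eq_int01 => u _; rewrite mulrBr mulr1.
Qed.

Lemma Rintegral_triangle (G : R -> R -> R) r :
  continuous (fun z : R * R => G z.1 z.2) ->
  \int[mu]_(x in `[0, r]) \int[mu]_(y in `[0, r - x]) G x y =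
  \int[mu]_(y in `[0, r]) \int[mu]_(x in `[0, r - y]) G x y.
Proof.
move=> cG; apply: Rintegral_swap => //.
  by apply: continuous_sub; [exact: cst_continuous|move=> u; exact: cvg_id].
by move=> x y; apply/idP/idP => /andP[/andP[x0 xr] /andP[y0 yr]];
  apply/andP; split; apply/andP; split; lra.
Qed.

(** The induction is on p with the parameter space [Y] generalized: the outer variable of
    integration becomes a further parameter. *)
Lemma continuous_simplex_integral p (Y : topologicalType) (rho : Y -> R)
    (h : Y -> 'rV[R]_p -> R) :
  continuous rho -> continuous (fun z : Y * 'rV[R]_p => h z.1 z.2) ->
  continuous (fun y => simplex_integral (rho y) (h y)).
Proof.
elim: p Y rho h => [|p IH] Y rho h crho ch y.
  exact: (@continuous_fst_slice _ _ _ h y 0 (ch (y, 0))).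
pose G (q : R * Y) := simplex_integral (rho q.2 - q.1)
  (fun t : 'rV[R]_p => h q.2 (row_mx (q.1%:M : 'rV[R]_1) t)).
have cG : continuous G.
  apply: IH.
    apply: continuous_sub; last by move=> q; exact: cvg_fst.
    by apply: continuous_after => // q; exact: cvg_snd.
  apply: (@continuous_after _ _ _ (fun z : (R * Y) * 'rV[R]_p =>
    (z.1.2, row_mx (z.1.1%:M : 'rV[R]_1) z.2)) (fun z => h z.1 z.2)) => //.
  apply: continuous_pair.
    by apply: (@continuous_after _ _ _ fst snd) => q; [exact: cvg_snd|exact: cvg_fst].
  apply: continuous_cons; last by move=> q; exact: cvg_snd.
  by apply: (@continuous_after _ _ _ fst fst) => q; exact: cvg_fst.
have cGy y' : continuous (fun u => G (u, y')).
  apply: continuous_after => //; apply: continuous_pair; last exact: cst_continuous.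
  by move=> u; exact: cvg_id.
have -> : (fun y => simplex_integral (rho y) (h y)) =
    (fun y => pos (rho y) * int01 (fun u => G (pos (rho y) * u, y))).
  by apply/funext => y'; exact: (Rintegral_pos _ (cGy y')).
apply: (@continuous_mul R Y (fun y => pos (rho y)) (fun y => int01 (fun u => G (pos (rho y) * u, y))) y).
  exact: continuous_pos.
apply: (@continuous_int01 R _ (fun u y => G (pos (rho y) * u, y))).
  near=> y'; apply: (@continuous_after _ _ _ (fun u => pos (rho y') * u) (fun u => G (u, y'))) => //.
  by apply: continuous_cmul => u; exact: cvg_id.
move=> u _; move: (u, y) => {u y}.
apply: continuous_after => //; apply: continuous_pair; last by move=> q; exact: cvg_snd.
move=> q; apply: (@continuous_mul R _ (fun q : R * Y => pos (rho q.2)) fst q); last exact: cvg_fst.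
by apply: (@continuous_after _ _ _ snd (fun y => pos (rho y))) => [|q']; [exact: continuous_pos|exact: cvg_snd].
Unshelve. all: by end_near. Qed.

Lemma eq_simplex_integral p r (g h : 'rV[R]_p -> R) : 0 <= r ->
  (forall t : 'rV[R]_p, (forall j, 0 <= t 0 j) -> \sum_j t 0 j <= r -> g t = h t) ->
  simplex_integral r g = simplex_integral r h.
Proof.
elim: p r g h => [|p IH] r g h r0 gh.
  by apply: gh => [[]//|]; rewrite big_ord0.
apply: eq_Rintegral => u; rewrite inE/= in_itv/= => /andP[u0 ur].
apply: IH => [|t t0 tr]; first by rewrite subr_ge0.
apply: gh => [j|].
  by case: (unliftP ord0 j) => [k|] ->; rewrite ?row_consS ?row_cons0.
rewrite big_ord_recl row_cons0 addrC -lerBrDr.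
by under eq_bigr do rewrite row_consS.
Qed.

Let continuous_slices p (g : 'rV[R]_p.+1 -> R) r : continuous g ->
  continuous (fun u => simplex_integral (r - u)
    (fun t : 'rV[R]_p => g (row_mx (u%:M : 'rV[R]_1) t))).
Proof.
move=> cg; apply: (@continuous_simplex_integral p R (fun u : R => r - u)
   (fun (u : R) (t : 'rV[R]_p) => g (row_mx (u%:M : 'rV[R]_1) t))).
  by apply: continuous_sub; [exact: cst_continuous|move=> u; exact: cvg_id].
apply: continuous_after => //; apply: continuous_cons => z; [exact: cvg_fst|exact: cvg_snd].
Qed.

Lemma simplex_integral_linear p r k (g h : 'rV[R]_p -> R) : continuous g -> continuous h ->
  simplex_integral r (fun t => k * g t + h t) =
  k * simplex_integral r g + simplex_integral r h.
Proof.
elim: p r g h => [//|p IH] r g h cg ch.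
rewrite -[RHS]/(k * (\int[mu]_(u in `[0, r]) simplex_integral (r - u)
        (fun t : 'rV[R]_p => g (row_mx (u%:M : 'rV[R]_1) t))) +
  \int[mu]_(u in `[0, r]) simplex_integral (r - u)
        (fun t : 'rV[R]_p => h (row_mx (u%:M : 'rV[R]_1) t))).
have cs (f : 'rV[R]_p.+1 -> R) (u : R) : continuous f ->
    continuous (fun t : 'rV[R]_p => f (row_mx (u%:M : 'rV[R]_1) t)).
  move=> cf; apply: continuous_after => //; apply: continuous_cons; first exact: cst_continuous.
  by move=> t; exact: cvg_id.
rewrite -RintegralZl//; last by apply: continuous_integrable; exact: continuous_slices.
rewrite -RintegralD//; last by apply: continuous_integrable; exact: continuous_slices.
  by apply: eq_Rintegral => u _; apply: (IH _ (fun t => g _) (fun t => h _)); exact: cs.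
by apply: continuous_integrable; apply: continuous_cmul; exact: continuous_slices.
Qed.

Lemma simplex_integral0 p r : simplex_integral r (fun _ : 'rV[R]_p => 0) = 0 :> R.
Proof.
have c0 : continuous (fun _ : 'rV[R]_p => 0 : R) by exact: cst_continuous.
transitivity (simplex_integral r (fun _ : 'rV[R]_p => -1 * 0 + 0 : R)).
  by rewrite mulr0 addr0.
by rewrite (@simplex_integral_linear p r (-1) (fun=> 0) (fun=> 0) c0 c0) mulN1r addNr.
Qed.

Lemma simplex_integral_scale p r (g : 'rV[R]_p -> R) : continuous g -> 0 <= r ->
  simplex_integral r g = r ^+ p * simplex_integral 1 (fun t => g (r *: t)).
Proof.
elim: p r g => [|p IH] r g cg r0; first by rewrite expr0 mul1r/= scaler0.
have cs (u : R) : continuous (fun t : 'rV[R]_p => g (row_mx (u%:M : 'rV[R]_1) t)).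
  apply: continuous_after => //; apply: continuous_cons; first exact: cst_continuous.
  by move=> t; exact: cvg_id.
have cr m : continuous (fun t : 'rV[R]_m => r *: t).
  by move=> t; apply: (@continuousZ _ _ _ (fun=> r) id); [exact: cst_continuous|exact: cvg_id].
pose S u := simplex_integral 1 (fun t : 'rV[R]_p => g (row_mx ((r * u)%:M : 'rV[R]_1) ((r * (1 - u)) *: t))).
rewrite [LHS](Rintegral_scale (continuous_slices (r := r) cg) r0).
rewrite exprS -mulrA; congr (_ * _).
rewrite -[in RHS]/(int01 (fun u => simplex_integral (1 - u)
  (fun t : 'rV[R]_p => g (r *: row_mx (u%:M : 'rV[R]_1) t)))).
rewrite -int01Z; last first.
  by apply: (@continuous_slices p (fun t => g (r *: t)) 1); apply: (continuous_after cg); exact: cr.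
apply: eq_int01 => u /andP[u0 u1].
have u1' : 0 <= 1 - u by rewrite subr_ge0.
have E2 : continuous (fun t : 'rV[R]_p => g (r *: row_mx (u%:M : 'rV[R]_1) t)).
  have cgr : continuous (fun s : 'rV[R]_p.+1 => g (r *: s)).
    by apply: (continuous_after cg); exact: cr.
  apply: (continuous_after cgr); apply: continuous_cons; first exact: cst_continuous.
  by move=> t; exact: cvg_id.
transitivity (r ^+ p * ((1 - u) ^+ p * simplex_integral 1
   (fun t : 'rV[R]_p => g (r *: row_mx (u%:M : 'rV[R]_1) ((1 - u) *: t))))); last first.
  by congr (_ * _); exact/esym/(IH (1 - u) _ E2 u1').
rewrite mulrA -exprMn (_ : r - r * u = r * (1 - u)); last by rewrite mulrBr mulr1.
rewrite (IH (r * (1 - u)) _ (cs (r * u)) (mulr_ge0 r0 u1')).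
congr (_ * _); congr simplex_integral; apply/funext => t; congr g; apply/rowP => j.
rewrite [RHS]mxE; case: (unliftP ord0 j) => [k|] ->; rewrite ?row_consS ?row_cons0//.
by rewrite !mxE mulrA.
Qed.

Lemma simplex_integral_int01 p r (G : R -> 'rV[R]_p -> R) :
  continuous (fun z : R * 'rV[R]_p => G z.1 z.2) -> 0 <= r ->
  int01 (fun u => simplex_integral r (G u)) =
  simplex_integral r (fun t => int01 (G ^~ t)).
Proof.
elim: p r G => [//|p IH] r G cG r0.
rewrite /int01 /= (@Rintegral_swap R (fun u v => simplex_integral (r - v)
   (fun t => G u (row_mx (v%:M : 'rV[R]_1) t))) 1 r (fun=> r) (fun=> 1)).
- apply: eq_Rintegral => v; rewrite inE/= in_itv/= => /andP[v0 vr].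
  apply: (IH _ (fun u t => G u (row_mx (v%:M : 'rV[R]_1) t))); last by rewrite subr_ge0.
  apply: (@continuous_after _ _ _ (fun z : R * 'rV[R]_p => (z.1, row_mx (v%:M : 'rV[R]_1) z.2))
    (fun z => G z.1 z.2)) => //.
  apply: continuous_pair => [z|]; first exact: cvg_fst.
  by apply: continuous_cons; [exact: cst_continuous|move=> z; exact: cvg_snd].
- apply: (@continuous_simplex_integral p (R * R)%type (fun z => r - z.2)
    (fun z t => G z.1 (row_mx (z.2%:M : 'rV[R]_1) t))).
    by apply: continuous_sub; [exact: cst_continuous|move=> z; exact: cvg_snd].
  apply: (@continuous_after _ _ _ (fun z : (R * R) * 'rV[R]_p => (z.1.1, row_mx (z.1.2%:M : 'rV[R]_1) z.2))
    (fun z => G z.1 z.2)) => //.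
  apply: continuous_pair.
    by apply: (@continuous_after _ _ _ fst fst) => z; exact: cvg_fst.
  apply: continuous_cons; last by move=> z; exact: cvg_snd.
  by apply: (@continuous_after _ _ _ fst snd) => z; [exact: cvg_snd|exact: cvg_fst].
- exact: cst_continuous.
- by move=> x y; rewrite andbC.
Qed.

(* The simplex is sliced by the hyperplanes on which the sum of the
   coordinates is constant. *)
Lemma simplex_integral_slices p r (g : 'rV[R]_p.+1 -> R) : continuous g ->
  simplex_integral r g = \int[mu]_(l in `[0, r]) simplex_integral l
    (fun t : 'rV[R]_p => g (row_mx ((l - \sum_j t 0 j)%:M : 'rV[R]_1) t)).
Proof.
elim: p r g => [|p IH] r g cg.
  by apply: eq_Rintegral => u _ /=; rewrite big_ord0 subr0.
(* For a fixed second coordinate v, the number k is the sum of all the others: [H v k] integrates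
   over the slice where both are given. *)
pose H v k := simplex_integral k (fun t : 'rV[R]_p =>
  g (row_mx ((k - \sum_j t 0 j)%:M : 'rV[R]_1) (row_mx (v%:M : 'rV[R]_1) t))).
pose G u v := simplex_integral (r - u - v) (fun t : 'rV[R]_p =>
  g (row_mx (u%:M : 'rV[R]_1) (row_mx (v%:M : 'rV[R]_1) t))).
have cH : continuous (fun z : R * R => H z.1 z.2).
  apply: (@continuous_simplex_integral p (R * R)%type snd (fun z t =>
    g (row_mx ((z.2 - \sum_j t 0 j)%:M : 'rV[R]_1) (row_mx (z.1%:M : 'rV[R]_1) t)))).
    by move=> z; exact: cvg_snd.
  have c12 : continuous (fun z : (R * R) * 'rV[R]_p => z.1.2).
    by apply: (@continuous_after _ _ _ fst snd) => z; [exact: cvg_snd|exact: cvg_fst].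
  apply: continuous_after => //; apply: continuous_cons.
    apply: continuous_sub => //; apply: continuous_bigsum => j.
    by apply: (@continuous_after _ _ _ snd (fun t : 'rV[R]_p => t 0 j)) => z; [exact: coord_continuous|exact: cvg_snd].
  apply: continuous_cons; last by move=> z; exact: cvg_snd.
  by apply: (@continuous_after _ _ _ fst fst) => z; exact: cvg_fst.
have cG : continuous (fun z : R * R => G z.1 z.2).
  apply: (@continuous_simplex_integral p (R * R)%type (fun z => r - z.1 - z.2) (fun z t =>
    g (row_mx (z.1%:M : 'rV[R]_1) (row_mx (z.2%:M : 'rV[R]_1) t)))).
    apply: continuous_sub; last by move=> z; exact: cvg_snd.
    by apply: continuous_sub; [exact: cst_continuous|move=> z; exact: cvg_fst].
  apply: continuous_after => //; apply: continuous_cons.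
    by apply: (@continuous_after _ _ _ fst fst) => z; exact: cvg_fst.
  apply: continuous_cons; last by move=> z; exact: cvg_snd.
  by apply: (@continuous_after _ _ _ fst snd) => z; [exact: cvg_snd|exact: cvg_fst].
(* The substitution l = v + k on a triangle is composed of exchanges of the order of integration and
   reflections x |-> a - x. *)
transitivity (\int[mu]_(v in `[0, r]) \int[mu]_(k in `[0, r - v]) H v k); last first.
  have sw (f : R -> R -> R) : continuous (fun z : R * R => f z.1 z.2) -> forall u, continuous (f u).
    move=> cf u; apply: (@continuous_after _ _ _ (fun v => (u, v)) (fun z => f z.1 z.2)) => //.
    by apply: continuous_pair => [|v]; [exact: cst_continuous|exact: cvg_id].
  transitivity (\int[mu]_(l in `[0, r]) \int[mu]_(v in `[0, l]) H v (l - v)); last first.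
    apply: eq_Rintegral => l _; apply: eq_Rintegral => v _; congr simplex_integral.
    apply/funext => t; congr g.
    have -> : \sum_j (row_mx (v%:M : 'rV[R]_1) t : 'rV[R]_p.+1) 0 j = v + \sum_j t 0 j.
      rewrite big_ord_recl row_cons0; congr (_ + _).
      by apply: eq_bigr => j _; rewrite row_consS.
    by rewrite opprD addrA.
  have cc (f : R * R -> R) : continuous f -> continuous (fun z : R * R => H (f z) z.2).
    move=> cf; apply: (@continuous_after _ _ _ (fun z => (f z, z.2)) (fun z => H z.1 z.2)) => //.
    by apply: continuous_pair => // z; exact: cvg_snd.
  have c1 : continuous (fst : R * R -> R) by move=> z; exact: cvg_fst.
  have c2 : continuous (snd : R * R -> R) by move=> z; exact: cvg_snd.
  transitivity (\int[mu]_(k in `[0, r]) \int[mu]_(v in `[0, r - k]) H v k).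
    by rewrite (@Rintegral_triangle (fun v k => H v k)).
  transitivity (\int[mu]_(k in `[0, r]) \int[mu]_(v in `[0, r - k]) H (r - k - v) k).
    apply: eq_Rintegral => k _; rewrite [RHS](@Rintegral_reflect (fun v => H v k) (r - k))//.
    by apply: (sw (fun k v => H v k)); apply: (@continuous_after _ _ _ (fun z : R * R => (z.2, z.1)) (fun z => H z.1 z.2)) => //; exact: continuous_pair.
  transitivity (\int[mu]_(l in `[0, r]) \int[mu]_(k in `[0, r - l]) H (r - l - k) k).
    rewrite [RHS](@Rintegral_triangle (fun l k => H (r - l - k) k)); last first.
      by apply: cc; apply: continuous_sub => //; apply: continuous_sub => //; exact: cst_continuous.
    by apply: eq_Rintegral => k _; apply: eq_Rintegral => l _; rewrite addrAC.
  transitivity (\int[mu]_(l in `[0, r]) \int[mu]_(k in `[0, l]) H (l - k) k).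
    transitivity (\int[mu]_(l in `[0, r]) (fun l => \int[mu]_(k in `[0, l]) H (l - k) k) (r - l)); first by [].
    rewrite (@Rintegral_reflect (fun l => \int[mu]_(k in `[0, l]) H (l - k) k) r)//.
    pose F l := simplex_integral l (fun t : 'rV[R]_1 => H (l - t 0 0) (t 0 0)).
    have -> : (fun l => \int[mu]_(k in `[0, l]) H (l - k) k) = F.
      apply/funext => l; apply: eq_Rintegral => k _ /=.
      by rewrite (row_cons0 k).
    apply: (@continuous_simplex_integral 1 R id (fun l t => H (l - t 0 0) (t 0 0))).
      by move=> l; exact: cvg_id.
    have ct : continuous (fun z : R * 'rV[R]_1 => z.2 0 0).
      by apply: (@continuous_after _ _ _ snd (fun t : 'rV[R]_1 => t 0 0)) => z; [exact: coord_continuous|exact: cvg_snd].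
    apply: (@continuous_after _ _ _ (fun z : R * 'rV[R]_1 => (z.1 - z.2 0 0, z.2 0 0)) (fun z => H z.1 z.2)) => //.
    by apply: continuous_pair => //; apply: continuous_sub => // z; exact: cvg_fst.
  apply: eq_Rintegral => l _.
  rewrite -(@Rintegral_reflect (fun k => H (l - k) k)).
    by apply: eq_Rintegral => v _; congr H; lra.
  apply: (sw (fun l k => H (l - k) k)).
  by apply: cc; exact: continuous_sub.
transitivity (\int[mu]_(v in `[0, r]) \int[mu]_(u in `[0, r - v]) G u v).
  exact: Rintegral_triangle.
apply: eq_Rintegral => v _.
have := IH (r - v) (fun s => g (row_mx ((s 0 0)%:M : 'rV[R]_1)
  (row_mx (v%:M : 'rV[R]_1) (rsubmx (s : 'rV[R]_(1 + p)))))).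
have E (u : R) (t : 'rV[R]_p) : (row_mx (u%:M : 'rV[R]_1) t) 0 0 = u.
  exact: row_cons0.
set h := (X in simplex_integral _ X) => IHv.
transitivity (simplex_integral (r - v) h).
  apply: eq_Rintegral => u _; rewrite /G addrAC; congr simplex_integral.
  by apply/funext => t; rewrite /h E row_mxKr.
rewrite IHv.
  apply: eq_Rintegral => k _; congr simplex_integral.
  by apply/funext => t; rewrite /h E row_mxKr.
apply: continuous_after => //; apply: continuous_cons => [s|]; first exact: coord_continuous.
apply: continuous_cons; first exact: cst_continuous.
move=> s; apply: continuous_rV => j.
rewrite (_ : (fun _ => _) = (fun s : 'rV[R]_p.+1 => s 0 (lift ord0 j))).
  exact: coord_continuous.
by apply/funext => s'; rewrite mxE; congr (s' _ _); exact: val_inj.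
Qed.

(** The slice at height l = 1 - u is the face opposite to the origin scaled by l, whose measure
    carries l ^ p. Integrating over the slices is thus integrating radially from that face to the
    origin with weight (1 - u) ^ p. *)
Lemma simplex_integral_radial p (g : 'rV[R]_p.+1 -> R) : continuous g ->
  simplex_integral 1 g = simplex_integral 1
    (fun t : 'rV[R]_p => cint 0 p g (row_mx ((1 - \sum_j t 0 j)%:M : 'rV[R]_1) t)).
Proof.
move=> cg; pose A (t : 'rV[R]_p) : 'rV[R]_p.+1 := row_mx ((1 - \sum_j t 0 j)%:M : 'rV[R]_1) t.
have csum (l : R) : continuous (fun t : 'rV[R]_p => l - \sum_j t 0 j).
  apply: continuous_sub; first exact: cst_continuous.
  by apply: continuous_bigsum => j; exact: coord_continuous.
have cA : continuous A.
  by apply: continuous_cons => [|t]; [exact: csum|exact: cvg_id].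
pose S l := l ^+ p * simplex_integral 1 (fun t => g (l *: A t)).
have cS : continuous S.
  rewrite /S => l; apply: (@continuous_mul R R (fun l => l ^+ p) (fun l => simplex_integral 1 (fun t => g (l *: A t))) l).
    move: l; elim: p {g cg A csum cA S} => [|p IHp] l; first exact: cst_continuous.
    rewrite (_ : (fun _ => _) = (fun l : R => l * l ^+ p)).
      by apply: (@continuous_mul _ _ id (fun l => l ^+ p) l); [exact: cvg_id|exact: IHp].
    by apply/funext => l'; rewrite exprS.
  apply: (@continuous_simplex_integral p R (fun=> 1) (fun l t => g (l *: A t))); first exact: cst_continuous.
  apply: continuous_after => // z; apply: (@continuousZ _ _ _ (fun z : R * 'rV[R]_p => z.1) (fun z => A z.2)).
    exact: cvg_fst.
  by apply: (@continuous_after _ _ _ snd A) => [|z']; [exact: cA|exact: cvg_snd].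
transitivity (int01 S).
  rewrite simplex_integral_slices//; apply: eq_int01 => l /andP[l0 _].
  rewrite simplex_integral_scale//.
    congr (_ * _); congr simplex_integral; apply/funext => t; congr g.
    apply/rowP => j; rewrite [RHS]mxE /A.
    case: (unliftP ord0 j) => [k|] ->; rewrite ?row_consS ?row_cons0 ?mxE//.
    by rewrite mulrBr mulr1 mulr_sumr; congr (_ - _); apply: eq_bigr => k _; rewrite mxE.
  by apply: continuous_after => //; apply: continuous_cons => [|t]; [exact: csum|exact: cvg_id].
rewrite -int01_onem// /cint -simplex_integral_int01 ?ler01//; last first.
  move=> z; apply: (@continuous_mul _ _ (fun z : R * 'rV[R]_p => (1 - z.1) ^+ p) (fun z => g (seg 0 (A z.2) z.1))).
    apply: (@continuous_after _ _ _ fst (fun u : R => (1 - u) ^+ p)) => [|z']; [exact: continuous_onem_exp|exact: cvg_fst].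
  apply: (@continuous_after _ _ _ (fun z => seg 0 (A z.2) z.1) g) => //.
  rewrite (_ : (fun _ => _) = (fun z : R * 'rV[R]_p => (1 - z.1) *: A z.2)); last first.
    by apply/funext => z'; rewrite /seg scaler0 addr0.
  move=> z'; apply: (@continuousZ _ _ _ (fun z : R * 'rV[R]_p => 1 - z.1) (fun z => A z.2)).
    by apply: continuous_sub => [|z'']; [exact: cst_continuous|exact: cvg_fst].
  by apply: (@continuous_after _ _ _ snd A) => [|z'']; [exact: cA|exact: cvg_snd].
apply: eq_int01 => u /andP[u0 u1]; rewrite /S.
have cgA : continuous (fun t => g ((1 - u) *: A t)).
  apply: continuous_after => // t; apply: (@continuousZ _ _ _ (fun=> 1 - u) A); [exact: cst_continuous|exact: cA].
have := @simplex_integral_linear p 1 ((1 - u) ^+ p) (fun t => g ((1 - u) *: A t)) (fun=> 0) cgA (@cst_continuous _ _ 0).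
rewrite simplex_integral0 addr0 => <-; congr simplex_integral; apply/funext => t.
by rewrite addr0 /seg scaler0 addr0.
Qed.

End SimplexIntegrals.

(** * Affine maps of simplices, and the fiber integral as an iterated contraction *)

Section FiberIntegrals.
Variable R : realType.

Lemma continuous_mulc (T : topologicalType) (f : T -> R) c :
  continuous f -> continuous (fun x => f x * c).
Proof. by move=> cf x; apply: (@continuous_mul R T f (fun=> c)); [exact: cf|exact: cst_continuous]. Qed.

Lemma bary0 p (t : 'rV[R]_p) : bary t ord0 = 1 - \sum_j t 0 j.
Proof. by rewrite /bary unlift_none. Qed.

Lemma baryS p (t : 'rV[R]_p) j : bary t (lift ord0 j) = t 0 j.
Proof. by rewrite /bary liftK. Qed.

Lemma continuous_bary p i : continuous (fun t : 'rV[R]_p => bary t i).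
Proof.
have [k ->|->] := unliftP ord0 i => t.
  by rewrite (_ : (fun _ => _) = (fun t : 'rV[R]_p => t 0 k)); [exact: coord_continuous|apply/funext => ?; rewrite baryS].
rewrite (_ : (fun _ => _) = (fun t : 'rV[R]_p => 1 - \sum_j t 0 j)); last first.
  by apply/funext => ?; rewrite bary0.
move: t; apply: continuous_sub; first exact: cst_continuous.
by apply: continuous_bigsum => k; exact: coord_continuous.
Qed.

Lemma vtx_minn p j : vtx R p (minn j p) = vtx R p j.
Proof. by apply/rowP => b; rewrite !mxE -minnA minnn. Qed.

Lemma bary_vtx p j (i : 'I_p.+1) : bary (vtx R p j) i = (minn j p == i)%:R.
Proof.
have [k ->|->] := unliftP ord0 i; first by rewrite baryS mxE.
rewrite bary0; under eq_bigr do rewrite mxE.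
have [[k Ek]|Ek] : {k : 'I_p | minn j p = k.+1} + {minn j p = 0%N}.
  case E: (minn j p) => [|k]; [by right|left].
  have kp : (k < p)%N by rewrite -E geq_minr.
  by exists (Ordinal kp).
rewrite Ek (bigD1 k)//= eqxx big1 ?addr0 ?subrr// => b bk.
  by rewrite eqSS; case: eqP => // kb; case/eqP: bk; exact: val_inj.
by rewrite Ek big1 ?subr0.
Qed.

Lemma bary_seg p (e t : 'rV[R]_p) u i :
  bary (seg e t u) i = (1 - u) * bary t i + u * bary e i.
Proof.
have [k ->|->] := unliftP ord0 i; first by rewrite !baryS !mxE.
rewrite !bary0; under eq_bigr do rewrite !mxE.
by rewrite big_split/= -!mulr_sumr; ring.
Qed.

Lemma simplex_seg p (t : 'rV[R]_p) j u : simplex t -> 0 <= u <= 1 ->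
  simplex (seg (vtx R p j) t u).
Proof.
move=> st /andP[u0 u1] i; rewrite bary_seg bary_vtx.
by rewrite addr_ge0// mulr_ge0// subr_ge0.
Qed.

Lemma simplexP p (t : 'rV[R]_p) :
  simplex t <-> (forall j, 0 <= t 0 j) /\ \sum_j t 0 j <= 1.
Proof.
split=> [st|[t0 t1] i].
  by split=> [j|]; [have := st (lift ord0 j); rewrite baryS|have := st ord0; rewrite bary0 subr_ge0].
by have [k ->|->] := unliftP ord0 i; rewrite ?baryS// bary0 subr_ge0.
Qed.

Section AffineMaps.
Variables (p q : nat) (mu : nat -> nat).

(* [t |-> t *m affB + affb] is the affine map sending the vertex i to the
   vertex mu i. *)
Definition affB : 'M[R]_(p, q) := \matrix_(i, j) (vtx R q (mu i.+1) 0 j - vtx R q (mu 0%N) 0 j).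
Definition affb : 'rV[R]_q := vtx R q (mu 0%N).

Lemma affE (t : 'rV[R]_p) j :
  (t *m affB + affb) 0 j = \sum_(i < p.+1) bary t i * vtx R q (mu i) 0 j.
Proof.
rewrite big_ord_recl bary0 mxE [X in X + _]mxE.
rewrite (eq_bigr (fun i => t 0 i * vtx R q (mu i.+1) 0 j - t 0 i * vtx R q (mu 0%N) 0 j)); last first.
  by move=> i _; rewrite [affB _ _]mxE mulrBr.
have -> : \sum_(i < p) bary t (lift ord0 i) * vtx R q (mu (lift ord0 i)) 0 j =
    \sum_(i < p) t 0 i * vtx R q (mu i.+1) 0 j.
  by apply: eq_bigr => i _; rewrite baryS lift0.
rewrite sumrB -mulr_suml.
by rewrite /affb; ring.
Qed.

Lemma bary_aff (t : 'rV[R]_p) l :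
  bary (t *m affB + affb) l = \sum_(i < p.+1) bary t i * bary (vtx R q (mu i)) l.
Proof.
have [k ->|->] := unliftP ord0 l.
  by rewrite baryS affE; apply: eq_bigr => i _; rewrite baryS.
rewrite bary0 (eq_bigr _ (fun j _ => affE t j)) exchange_big/= -{1}(sum_bary t) -sumrB.
by apply: eq_bigr => i _; rewrite -mulr_sumr bary0 mulrBr mulr1.
Qed.

(** Only the barycentric coordinate of index [minn j p] is nonzero at the vertex j; so [mu] has to
    be constant beyond p as far as vertices are concerned. *)
Lemma aff_vtx j : (forall j, vtx R q (mu (minn j p)) = vtx R q (mu j)) ->
  vtx R p j *m affB + affb = vtx R q (mu j).
Proof.
move=> mup; apply/rowP => b; rewrite affE -mup.
have jp : (minn j p < p.+1)%N by rewrite ltnS geq_minr.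
rewrite (bigD1 (Ordinal jp))//= bary_vtx eqxx mul1r big1 ?addr0// => i ij.
rewrite bary_vtx; case: eqP => [ji|_]; last by rewrite mul0r.
by case/eqP: ij; exact: val_inj.
Qed.

Hypothesis mu_le : forall i, (i <= p -> mu i <= q)%N.

Lemma aff_bary (t : 'rV[R]_p) (l : 'I_q.+1) :
  bary (t *m affB + affb) l = \sum_(i < p.+1 | mu i == l) bary t i.
Proof.
rewrite bary_aff [RHS]big_mkcond; apply: eq_bigr => i _.
have /minn_idPl E : (mu i <= q)%N by rewrite mu_le// -ltnS.
by rewrite bary_vtx E; case: eqP => _; rewrite ?mulr1 ?mulr0.
Qed.

(** This is [aff_bary] differentiated in t; the dx's contribute nothing to either side. *)
Lemma aff_dbary n m (C : 'M[R]_(n, m)) a (l : 'I_q.+1) :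
  \sum_j block_mx affB 0 0 C a j * dbary l j = \sum_(i < p.+1 | mu i == l) dbary i a.
Proof.
have B0 (j : 'I_m) : dbary l (rshift q j) = 0 :> R.
  by rewrite /dbary -[fintype.split _]/(fintype.split (unsplit (inr j))) unsplitK.
have B1 (j : 'I_q) : dbary l (lshift m j) = (l == lift ord0 j)%:R - (l == ord0)%:R :> R.
  by rewrite /dbary -[fintype.split _]/(fintype.split (unsplit (inl j))) unsplitK.
rewrite big_split_ord/= [X in _ + X]big1 ?addr0 => [|j _]; last by rewrite B0 mulr0.
have [b ab|b ab] := splitP a; last first.
  have -> : a = rshift p b by exact: val_inj.
  rewrite !big1// => j _; last by rewrite block_mxEdl mxE mul0r.
  by rewrite /dbary -[fintype.split _]/(fintype.split (unsplit (inr b))) unsplitK.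
have -> : a = lshift n b by exact: val_inj.
have D (i : 'I_p.+1) : dbary i (lshift n b) = (i == lift ord0 b)%:R - (i == ord0)%:R :> R.
  by rewrite /dbary -[fintype.split _]/(fintype.split (unsplit (inl b))) unsplitK.
under eq_bigr do rewrite block_mxEul B1.
under [in RHS]eq_bigr do rewrite D.
have S (c : 'I_p.+1) : \sum_(i < p.+1 | mu i == l) (i == c)%:R = if mu c == l then 1 else 0 :> R.
  rewrite big_mkcond (bigD1 c)//= eqxx big1 ?addr0// => i /negbTE ->.
  by case: ifP.
rewrite sumrB !S lift0 -[mu (@ord0 p)]/(mu 0%N).
have E i : (i <= p)%N -> bary (vtx R q (mu i)) l = (if mu i == l then 1 else 0).
  by move=> /mu_le/minn_idPl e; rewrite bary_vtx e; case: eqP.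
rewrite -!E//.
have [k ->|->] := unliftP ord0 l.
  rewrite !baryS (eq_bigr (fun j => affB b j * (k == j)%:R)); last first.
    by move=> j _; rewrite (inj_eq lift_inj) [lift ord0 k == ord0]eq_sym (negbTE (neq_lift _ _)) subr0.
  rewrite (bigD1 k)//= eqxx mulr1 mxE big1 ?addr0// => j jk.
  by rewrite eq_sym (negbTE jk) mulr0.
rewrite !bary0 opprB addrC addrA subrK.
rewrite (eq_bigr (fun j => vtx R q (mu 0%N) 0 j - vtx R q (mu b.+1) 0 j)); last first.
  by move=> j _; rewrite mxE (negbTE (neq_lift _ _)) eqxx sub0r mulrN1 opprB.
by rewrite sumrB.
Qed.

Lemma aff_simplex (t : 'rV[R]_p) : simplex t -> simplex (t *m affB + affb).
Proof. by move=> st l; rewrite aff_bary sumr_ge0. Qed.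

End AffineMaps.

Lemma alternating_pull n m (A : 'M[R]_(n, m)) w : alternating w -> alternating (pull A w).
Proof.
move=> aw s1; elim: s1 w aw => [|x s1 IH] w aw i j s2 /=.
  rewrite !pull_cons.
  under eq_bigr do rewrite pull_cons mulr_sumr.
  under [in RHS]eq_bigr do rewrite pull_cons mulr_sumr.
  rewrite exchange_big/= -sumrN; apply: eq_bigr => a _; rewrite -sumrN; apply: eq_bigr => b _.
  rewrite mulrCA -[X in _ = X]mulrN; congr (_ * _); rewrite -mulrN; congr (_ * _); rewrite -mulN1r -pullZ.
  by apply: eq_pull => v _; rewrite mulN1r (aw [::]).
rewrite !pull_cons -sumrN; apply: eq_bigr => a _; rewrite -mulrN; congr (_ * _).
by apply: IH; exact: alternating_cons.
Qed.

Lemma alternating_repeat (X : eqType) (w : seq X -> R) x l :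
  alternating w -> x \in l -> w (x :: l) = 0.
Proof.
elim: l w => // y l IH w aw; rewrite inE => /orP[/eqP <-|xl].
  by apply/eqP; have /eqP := aw [::] x x l; rewrite /= -addr_eq0 -mulr2n mulrn_eq0.
by rewrite (aw [::])/= (IH (fun v => w (y :: v))) ?oppr0//; exact: alternating_cons.
Qed.

Lemma pull_block_rshift p q n (B : 'M[R]_(p, q)) (C : 'M[R]_n) (w : seq 'I_(q + n) -> R) s :
  pull (block_mx B 0 0 C) w (map (@rshift p n) s) =
  pull C (fun v => w (map (@rshift q n) v)) s.
Proof.
elim: s w => [|x s IH] w; first by rewrite !pull_nil.
rewrite /= !pull_cons big_split_ord/= [X in X + _]big1 ?add0r; last first.
  by move=> j _; rewrite block_mxEdl mxE mul0r.
by apply: eq_bigr => j _; rewrite block_mxEdr IH.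
Qed.

Lemma pull_rshift p q n (B : 'M[R]_(p, q)) (w : seq 'I_(q + n) -> R) s :
  pull (block_mx B 0 0 1%:M) w (map (@rshift p n) s) = w (map (@rshift q n) s).
Proof. by rewrite pull_block_rshift pull1. Qed.

Section FaceOppositeTheOrigin.
Variables (p n : nat).
Local Notation B := (affB p p.+1 succn).
Local Notation A := (block_mx B 0 0 (1%:M : 'M[R]_n)).
Local Notation face t := (t *m B + affb p.+1 succn).

Let BE (i : 'I_p) (j : 'I_p.+1) : B i j = (j == lift ord0 i)%:R - (j == ord0)%:R.
Proof.
rewrite !mxE (minn_idPl _) ?ltnS// (minn_idPl _)// !eqSS.
by congr (_%:R - _%:R); rewrite -val_eqE/= eq_sym.
Qed.

Lemma faceE (t : 'rV[R]_p) : face t = row_mx ((1 - \sum_j t 0 j)%:M : 'rV[R]_1) t :> 'rV[R]_p.+1.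
Proof.
apply/rowP => j; rewrite affE (eq_bigr (fun i : 'I_p.+1 => bary t i * (i == j)%:R)); last first.
  by move=> i _; rewrite mxE (minn_idPl _)// eqSS.
rewrite (bigD1 j)//= eqxx mulr1 big1 ?addr0; last by move=> i /negbTE ->; rewrite mulr0.
by have [k ->|->] := unliftP ord0 j; rewrite ?row_consS ?row_cons0 ?baryS ?bary0.
Qed.

Let pull_face (G : seq 'I_(p.+1 + n) -> R) (es : seq 'I_p) s :
  (forall v, lshift n ord0 \in v -> G v = 0) ->
  pull A G (map (lshift n) es ++ map (@rshift p n) s) =
  G (map (fun i => lshift n (lift ord0 i)) es ++ map (@rshift p.+1 n) s).
Proof.
elim: es G => [|e es IH] G G0; first exact: pull_rshift.
rewrite /= pull_cons (bigD1 (lshift n (lift ord0 e)))//=.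
rewrite block_mxEul BE eqxx [_ == ord0]eq_sym (negbTE (neq_lift _ _)) subr0 mul1r.
rewrite IH; last by move=> v v0; apply: G0; rewrite inE v0 orbT.
rewrite big1 ?addr0// => j; have [k jk|k jk] := splitP j => je.
  have Ej : j = lshift n k by exact: val_inj.
  rewrite Ej block_mxEul BE; have [k0|k0] := eqVneq k ord0.
    rewrite (@eq_pull _ _ _ _ _ (fun v => 0 * 0)) ?pullZ ?mul0r ?mulr0// => v _.
    by rewrite G0 ?mul0r// k0 inE eqxx.
  suff -> : (k == lift ord0 e) = false by rewrite subrr mul0r.
  by apply/negbTE; apply: contra je => /eqP ke; rewrite Ej ke.
by rewrite (_ : j = rshift p.+1 k) ?block_mxEur ?mxE ?mul0r//; exact: val_inj.
Qed.

(** The vectors e_(i+1) - e_0 are tangent to the face and already occur in [l], so by alternation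
    the contractions of a top form by the various basis vectors agree on the face ([P]). Their
    coefficients, the coordinates of a point of the face, add up to 1. *)
Let pull_top (w : seq 'I_(p.+1 + n) -> R) (t : 'rV[R]_p) s : alternating w ->
  \sum_(b < p.+1) face t 0 b *
    pull A (fun v => w (lshift n b :: v)) (map (lshift n) (enum 'I_p) ++ map (@rshift p n) s) =
  w (map (lshift n) (enum 'I_p.+1) ++ map (@rshift p.+1 n) s).
Proof.
move=> aw; set l := _ ++ _.
have P (i : 'I_p) : pull A (fun v => w (lshift n (lift ord0 i) :: v)) l =
    pull A (fun v => w (lshift n ord0 :: v)) l.
  have : pull A w (lshift n i :: l) = 0.
    apply: alternating_repeat; first exact: alternating_pull.
    by rewrite mem_cat map_f ?mem_enum.
  rewrite pull_cons big_split_ord/= [X in _ + X]big1 ?addr0; last first.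
    by move=> j _; rewrite block_mxEur mxE mul0r.
  have B0 : B i ord0 = -1 by rewrite BE (negbTE (neq_lift _ _)) eqxx sub0r.
  have B1 : B i (lift ord0 i) = 1 by rewrite BE eqxx eq_sym (negbTE (neq_lift _ _)) subr0.
  rewrite big_ord_recl (bigD1 i)//= !block_mxEul B0 B1 big1 ?addr0.
    by rewrite mulN1r mul1r => /eqP; rewrite addrC subr_eq0 => /eqP.
  move=> k ki; rewrite block_mxEul BE [_ == ord0]eq_sym (negbTE (neq_lift _ _)).
  by rewrite (inj_eq lift_inj) (negbTE ki) subrr mul0r.
rewrite faceE big_ord_recl row_cons0.
rewrite [X in _ + X](eq_bigr (fun i : 'I_p => t 0 i * pull A (fun v => w (lshift n ord0 :: v)) l)); last first.
  by move=> i _; rewrite row_consS P.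
rewrite -mulr_suml -mulrDl subrK mul1r /l pull_face.
  by rewrite enum_ordSl/= -map_comp.
by move=> v v0; exact: alternating_repeat.
Qed.

(** On the face opposite to the vertex 0, contraction towards that vertex is radial integration of
    the top coefficient: the point of the face supplies the coefficients in [pull_top], the p
    remaining dt's the exponent. *)
Lemma hop_face (eta : pform R p.+1 n) t s : pcont eta -> (forall t, alternating (eta t)) ->
  pull A (hop 0 eta (face t)) (map (lshift n) (enum 'I_p) ++ map (@rshift p n) s) =
  cint 0 p (fun t => eta t (map (lshift n) (enum 'I_p.+1) ++ map (@rshift p.+1 n) s)) (face t).
Proof.
move=> ce ae; set l := _ ++ _.
have v0 : vtx R p.+1 0 = 0 by apply/rowP => b; rewrite !mxE min0n.
have ntl : nt l = p.
  have c1 : count (@isT p n) (map (lshift n) (enum 'I_p)) = p.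
    rewrite count_map (eq_count (a2 := predT)); last by move=> b; rewrite /= isT_lshift.
    by rewrite count_predT; exact: size_enum_ord.
  have c2 : count (@isT p n) (map (@rshift p n) s) = 0%N.
    rewrite count_map (eq_count (a2 := pred0)) ?count_pred0// => b.
    by rewrite /= isT_rshift.
  by rewrite /nt /l count_cat c1 c2 addn0.
rewrite (@eq_pull _ _ _ _ _ (fun v => \sum_(b < p.+1) face t 0 b *
  \sum_(k < (size l).+1) (nt v == k)%:R * cint 0 k (fun t => eta t (lshift n b :: v)) (face t))); last first.
  move=> v sv; rewrite /hop v0; apply: eq_bigr => b _; rewrite subr0; congr (_ * _).
  have nv : (nt v < (size l).+1)%N by rewrite ltnS -sv count_size.
  rewrite (bigD1 (Ordinal nv))//= eqxx mul1r big1 ?addr0// => k kv.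
  by case: eqP => // e0; [move: kv; rewrite -val_eqE/= e0 eqxx|rewrite mul0r].
rewrite pull_sum.
have cc b v : continuous (fun u : R => (1 - u) ^+ p * eta (seg 0 (face t) u) (lshift n b :: v)).
  exact: (@continuous_cint_arg _ _ _ _ (fun t => eta t (lshift n b :: v))).
transitivity (\sum_(b < p.+1) face t 0 b *
  pull A (fun v => cint 0 p (fun t => eta t (lshift n b :: v)) (face t)) l).
  apply: eq_bigr => b _; rewrite pullZ pull_sum; congr (_ * _).
  rewrite (eq_bigr (fun k : 'I_(size l).+1 => (nt l == k)%:R *
     pull A (fun v => cint 0 k (fun t => eta t (lshift n b :: v)) (face t)) l)); last first.
    by move=> k _; rewrite (pull_nt B 1%:M (fun x => (x == k)%:R)).
  have ns : (nt l < (size l).+1)%N by rewrite ltnS count_size.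
  rewrite (bigD1 (Ordinal ns))//= eqxx mul1r big1 ?addr0 ?ntl// => k ks.
  by case: eqP => // e0; [case/eqP: ks; apply: val_inj; rewrite /= -e0 ?ntl|rewrite mul0r].
under eq_bigr => b _ do rewrite /cint -(pull_int01 A l (cc b)).
have cpull b : continuous (fun u : R => pull A (fun v => (1 - u) ^+ p * eta (seg 0 (face t) u) (lshift n b :: v)) l).
  apply: continuous_bigsum => L.
  rewrite (_ : (fun u : R => _) = (fun u : R => (\prod_(a < size l)
     A (tnth (in_tuple l) a) (tnth L a)) * ((1 - u) ^+ p * eta (seg 0 (face t) u) (lshift n b :: L)))).
    by apply: continuous_cmul; exact: (cc b L).
  by apply/funext => u; rewrite mulrC.
rewrite (eq_bigr (fun b => int01 (fun u => face t 0 b * pull A (fun v => (1 - u) ^+ p *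
  eta (seg 0 (face t) u) (lshift n b :: v)) l))); last by move=> b _; rewrite int01Z.
rewrite -int01_sum; last by move=> b; apply: continuous_cmul; exact: cpull.
apply: eq_int01 => u _; rewrite -(@pull_top (eta (seg 0 (face t) u)) t s)// mulr_sumr.
by apply: eq_bigr => b _; rewrite pullZ mulrCA.
Qed.

End FaceOppositeTheOrigin.

Lemma alternating_hop_pcont p n j (eta : pform R p n) : pcont eta ->
  (forall t, alternating (eta t)) -> forall t, alternating (hop j eta t).
Proof.
move=> ce ae t; apply: alternating_sum => b s1 i k s2.
rewrite -mulrN; congr (_ * _).
have -> : nt (s1 ++ i :: k :: s2) = nt (s1 ++ k :: i :: s2).
  by apply: nt_perm; rewrite perm_cat2l -[i :: k :: s2]/([:: i] ++ [:: k] ++ s2) perm_catCA.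
rewrite -mulN1r -cintZ//; apply: eq_cint => u _.
by rewrite mulN1r (ae _ (lshift n b :: s1)).
Qed.

(** Induction on p: radial integration replaces the top coefficient of [eta] by that of [hop 0 eta]
    on the opposite face. This face is a p-simplex with vertices 1, ..., p + 1, and naturality under
    [succn] identifies the contractions that remain. *)
Lemma fiber_epsw p n (eta : pform R p n) s : pcont eta -> (forall t, alternating (eta t)) ->
  simplex_integral 1 (fun t => eta t (map (lshift n) (enum 'I_p) ++ map (@rshift p n) s)) =
  epsw (iota 0 p.+1) eta 0 (map (@rshift p n) s).
Proof.
elim: p eta s => [|p IH] eta s ce ae.
  have -> : enum 'I_0 = [::] by apply: size0nil; rewrite size_enum_ord.
  rewrite /= /epsop (_ : nt _ = 0%N) ?eqxx ?mul1r.
    by congr (eta _ _); apply/rowP => -[].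
  by rewrite /nt count_map (eq_count (a2 := pred0)) ?count_pred0// => b; rewrite /= isT_rshift.
rewrite simplex_integral_radial; last exact: ce.
pose zeta := hop 0 eta.
(* The restriction of [zeta] to the face opposite to the vertex 0, parametrized by the p-simplex
   through i |-> i + 1. *)
pose eta' : pform R p n := fun t s => pull (block_mx (affB p p.+1 succn) 0 0 1%:M)
  (zeta (t *m affB p p.+1 succn + affb p.+1 succn)) s.
have cz : pcont zeta by exact: pcont_hop.
have az t : alternating (zeta t) by exact: alternating_hop_pcont.
have cf : continuous (fun t : 'rV[R]_p => t *m affB p p.+1 succn + affb p.+1 succn).
  move=> t; apply: continuous_rV => j.
  rewrite (_ : (fun _ => _) = (fun t : 'rV[R]_p => \sum_(i < p.+1) bary t i * vtx R p.+1 i.+1 0 j)).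
    move: t; apply: continuous_bigsum => i; apply: continuous_mulc.
    exact: continuous_bary.
  by apply/funext => t'; rewrite affE.
have ce' : pcont eta'.
  move=> v; apply: continuous_bigsum => L; apply: continuous_mulc.
  exact: (continuous_after (cz L) cf).
have ae' t : alternating (eta' t) by exact: alternating_pull.
transitivity (epsw (iota 0 p.+1) eta' 0 (map (@rshift p n) s)).
  rewrite -IH//; congr simplex_integral; apply/funext => t.
  by rewrite -faceE -hop_face.
rewrite (@related_epsw _ _ _ _ _ (affB p p.+1 succn) (affb p.+1 succn) 1%:M succn setT _ _ _ eta' zeta)//.
  rewrite pull_rshift (epsw_const _ _ _ 0).
  by rewrite -[iota 0 p.+2]/(0%N :: iota 1 p.+1) (iotaDl 1 0 p.+1).
by move=> j; apply: aff_vtx => i; rewrite -[in RHS]vtx_minn minnSS.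
Qed.

End FiberIntegrals.

(** * Forms on the product of R^p and M *)

Section Jacobians.
Variable R : realType.

Lemma smooth_on_sub2 m (U V : set 'rV[R]_m) (f g : 'rV[R]_m -> R) : open V ->
  U `<=` V -> (forall x, V x -> g x = f x) -> smooth_on V f -> smooth_on U g.
Proof.
move=> oV UV gf sf; apply: (smooth_on_sub UV); apply: (eq_smooth_on oV) sf.
by move=> x Vx; rewrite gf.
Qed.

Lemma differentiable_rV (V : normedModType R) m (f : V -> 'rV[R]_m) x :
  (forall j, differentiable (fun x => f x 0 j) x) -> differentiable f x.
Proof.
move=> df; have -> : f = \sum_(j < m) (fun x => f x 0 j *: delta_mx 0 j).
  by apply/funext => y; rewrite fct_sumE [LHS]row_sum_delta.
by apply: differentiable_sum => j; apply: differentiableZl.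
Qed.

Lemma derive_0 (V W : normedModType R) (f : V -> W) x : 'D_0 f x = 0.
Proof.
rewrite /derive (_ : (fun _ => _) = cst 0) ?lim_cst//.
by apply/funext => h; rewrite /= scaler0 add0r subrr scaler0.
Qed.

Lemma jacobianE a b (f : 'rV[R]_a -> 'rV[R]_b) x i j : differentiable f x ->
  'J f x i j = 'D_(delta_mx 0 i) (fun y => f y 0 j) x.
Proof.
move=> df; have := deriveEjacobian (delta_mx 0 i) df.
rewrite derive_mx; last exact: diff_derivable.
by move=> /(congr1 (fun A : 'rV[R]_b => A 0 j)); rewrite mxE -rowE mxE.
Qed.

Lemma lsubmx_delta a b (i : 'I_a) : lsubmx (delta_mx 0 (lshift b i) : 'rV[R]_(a + b)) = delta_mx 0 i.
Proof. by apply/rowP => k; rewrite !mxE eq_lshift. Qed.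

Lemma lsubmx_delta0 a b (i : 'I_b) : lsubmx (delta_mx 0 (rshift a i) : 'rV[R]_(a + b)) = 0.
Proof. by apply/rowP => k; rewrite !mxE eq_lrshift andbF. Qed.

Lemma rsubmx_delta a b (i : 'I_b) : rsubmx (delta_mx 0 (rshift a i) : 'rV[R]_(a + b)) = delta_mx 0 i.
Proof. by apply/rowP => k; rewrite !mxE eq_rshift. Qed.

Lemma rsubmx_delta0 a b (i : 'I_a) : rsubmx (delta_mx 0 (lshift b i) : 'rV[R]_(a + b)) = 0.
Proof. by apply/rowP => k; rewrite !mxE eq_rlshift andbF. Qed.

Lemma jacobian_prod p q n m (B : 'M[R]_(p, q)) b (g : 'rV[R]_n -> 'rV[R]_m) z :
  differentiable g (rsubmx z) ->
  'J (fun z : 'rV[R]_(p + n) => row_mx (lsubmx z *m B + b) (g (rsubmx z))) z =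
  block_mx B 0 0 ('J g (rsubmx z)).
Proof.
move=> dg; set A := (X in 'J X z).
have oT : open [set: 'rV[R]_(p + n)] by exact: openT.
have Al j : (fun z => A z 0 (lshift m j)) = (fun z => (lsubmx z *m B + b) 0 j).
  by apply/funext => z'; rewrite /A row_mxEl.
have Ar j : (fun z => A z 0 (rshift q j)) = (fun y => g y 0 j) \o rsubmx.
  by apply/funext => z'; rewrite /A row_mxEr.
have dr : differentiable (rsubmx : 'rV[R]_(p + n) -> 'rV[R]_n) z.
  apply: differentiable_rV => j; rewrite (_ : (fun _ => _) = (fun z : 'rV[R]_(p + n) => z 0 (rshift p j))).
    exact: differentiable_coord.
  by apply/funext => z'; rewrite mxE.
have dA : differentiable A z.
  apply: differentiable_rV => j; have [k jk|k jk] := splitP j.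
    rewrite (_ : j = lshift m k) ?Al; last exact: val_inj.
    have : smooth_on setT (fun z : 'rV[R]_(p + n) => \sum_k' z 0 (lshift n k') * B k' k + b 0 k).
      apply: (smooth_onD oT); last exact: smooth_on_cst.
      apply: (smooth_on_sum oT) => k' _; apply: (smooth_onM oT); [exact: smooth_on_coord|exact: smooth_on_cst].
    move=> /(_ [::] z I) /=; congr (differentiable _ z); apply/funext => z'.
    by rewrite !mxE; congr (_ + _); apply: eq_bigr => k' _; rewrite mxE.
  rewrite (_ : j = rshift q k) ?Ar; last exact: val_inj.
  apply: differentiable_comp => //.
  exact: (@differentiable_comp _ _ _ _ g (fun N : 'rV[R]_m => N 0 k) _ dg (differentiable_coord _ _ _)).
apply/matrixP => i j; rewrite jacobianE//; have [k jk|k jk] := splitP j.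
  rewrite (_ : j = lshift m k) ?Al; last exact: val_inj.
  have -> v : 'D_v (fun z : 'rV[R]_(p + n) => (lsubmx z *m B + b) 0 k) z = (lsubmx v *m B) 0 k.
    rewrite (@derive_affine R _ R R id (fun z : 'rV[R]_(p + n) => (lsubmx z *m B + b) 0 k)
       (fun v => (lsubmx v *m B) 0 k)) ?derive_id// => c w y.
    by rewrite linearP/= mulmxDl -scalemxAl -addrA !mxE.
  have [l il|l il] := splitP i.
    rewrite (_ : i = lshift n l) ?lsubmx_delta -?rowE ?block_mxEul ?mxE//; exact: val_inj.
  by rewrite (_ : i = rshift p l) ?lsubmx_delta0 ?mul0mx ?block_mxEdl ?mxE//; exact: val_inj.
rewrite (_ : j = rshift q k) ?Ar; last exact: val_inj.
have -> v : 'D_v ((fun y => g y 0 k) \o rsubmx) z = 'D_(rsubmx v) (fun y => g y 0 k) (rsubmx z).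
  by apply: derive_affine => c w y; rewrite linearP.
have [l il|l il] := splitP i.
  by rewrite (_ : i = lshift n l) ?rsubmx_delta0 ?derive_0 ?block_mxEur ?mxE//; exact: val_inj.
rewrite (_ : i = rshift p l) ?rsubmx_delta ?block_mxEdr ?jacobianE//; exact: val_inj.
Qed.

End Jacobians.

Section ProductsWithRp.
Variables (R : realType) (n : nat) (M : smoothManifold R n).
Local Notation atlas := (@atlas R n M).
Implicit Types (phi psi : chart R M n) (x : M).

Definition chart_range phi : set 'rV[R]_n := coord phi @` dom phi.

Lemma open_range phi : atlas phi -> open (chart_range phi).
Proof. by move=> /atlas_chart[]. Qed.

Lemma range_coord phi x : dom phi x -> chart_range phi (coord phi x).
Proof. by move=> dx; exists x. Qed.

Lemma paramK phi x : atlas phi -> dom phi x -> param phi (coord phi x) = x.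
Proof. by move=> /atlas_chart[_ _ K _ _]; exact: K. Qed.

Lemma dom_param phi y : atlas phi -> chart_range phi y -> dom phi (param phi y).
Proof. by move=> ap [x dx <-]; rewrite paramK. Qed.

Lemma coordK phi y : atlas phi -> chart_range phi y -> coord phi (param phi y) = y.
Proof. by move=> ap [x dx <-]; rewrite paramK. Qed.

Lemma differentiable_local_map phi psi (f : M -> M) x :
  smooth_in_charts phi psi f -> dom phi x -> dom psi (f x) ->
  differentiable (local_map phi psi f) (coord phi x).
Proof. by move=> sf dx dfx; apply: (sf [::]); exists x. Qed.

Lemma jacobian_same phi x : atlas phi -> dom phi x ->
  'J (local_map phi phi idfun) (coord phi x) = 1%:M.
Proof.
move=> ap dx; apply/matrixP => i j; rewrite jacobianE; last first.
  by apply: differentiable_local_map => //; exact: atlas_compatible.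
rewrite (@near_eq_derive _ _ _ _ (fun y : 'rV[R]_n => y 0 j)).
  by rewrite derive_coord !mxE eq_sym.
apply: (@filterS _ (nbhs (coord phi x)) _ (chart_range phi)).
  by move=> y ry; rewrite /local_map/= coordK.
by apply: open_nbhs_nbhs; split; [exact: open_range|exact: range_coord].
Qed.

(** The factor of a product chart is unique, so forms can be defined by cases on it, as in
    [mkprod]. *)
Lemma prod_chart_inj p phi psi : prod_chart p phi = prod_chart p psi -> phi = psi.
Proof.
case: phi => d c u; case: psi => d' c' u'; rewrite /prod_chart /= => -[Ed Ec Eu].
congr Chart.
- apply/funext => x; have := congr1 (fun D : set ('rV[R]_p * M) => D (0, x)) Ed.
  by rewrite /setX/= => E; apply/propext; move: E; rewrite !propeqE/=; split=> dx; have [E1 E2] := E; [apply: (E1 _).2|apply: (E2 _).2].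
- apply/funext => x; have := congr1 (fun f => rsubmx (f ((0 : 'rV[R]_p), x))) Ec.
  by rewrite !row_mxKr.
- apply/funext => y; have := congr1 (fun f => (f (row_mx (0 : 'rV[R]_p) y)).2) Eu.
  by rewrite !row_mxKr.
Qed.

Section Pullbacks.
Variables (p q : nat) (B : 'M[R]_(p, q)) (b : 'rV[R]_q) (f : M -> M).
Hypothesis sf : forall phi psi, atlas phi -> atlas psi -> smooth_in_charts phi psi f.

(** The Jacobian of a product map is block diagonal, so the pull-back condition becomes [related]
    for each pair of charts of M. *)
Lemma pullback_prodP (D : set 'rV[R]_p) h
    (w : coefs R ('rV[R]_p * M) (p + n)) (w' : coefs R ('rV[R]_q * M) (q + n)) :
  (forall y, h y = (y.1 *m B + b, f y.2)) ->
  is_pullback (@prod_atlas R n M p) (@prod_atlas R n M q) (D `*` setT) h w' w <->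
  forall phi psi x, atlas phi -> atlas psi -> dom phi x -> dom psi (f x) ->
    related B b ('J (local_map phi psi f) (coord phi x)) D
      (fun t => w (prod_chart p phi) (t, x)) (fun t => w' (prod_chart q psi) (t, f x)).
Proof.
move=> hE; have J phi psi t x : atlas phi -> atlas psi -> dom phi x -> dom psi (f x) ->
    'J (local_map (prod_chart p phi) (prod_chart q psi) h) (coord (prod_chart p phi) (t, x)) =
    block_mx B 0 0 ('J (local_map phi psi f) (coord phi x)).
  move=> ap aq dx dfx; rewrite /= (_ : local_map _ _ h = (fun z : 'rV[R]_(p + n) =>
    row_mx (lsubmx z *m B + b) (local_map phi psi f (rsubmx z)))); last first.
    by apply/funext => z; rewrite /local_map/= hE.
  rewrite jacobian_prod row_mxKr//.
  by apply: differentiable_local_map => //; exact: sf.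
split=> [P phi psi x ap aq dx dfx t s Dt|P _ _ [t x] [phi ap <-] [psi aq <-] [Dt _] [_ dx]].
  rewrite -(J _ _ t)// -[t *m B + b]/((t, x).1 *m B + b, f (t, x).2).1 -[f x]/((t, x).1 *m B + b, f (t, x).2).2.
  rewrite -surjective_pairing -hE (P (prod_chart p phi) (prod_chart q psi) (t, x))//; first by exists phi.
  - by exists psi.
  - by rewrite hE.
rewrite hE => -[_ dfx]; apply/funext => s; rewrite J//.
exact: (P phi psi x ap aq dx dfx t s Dt).
Qed.

End Pullbacks.

Section Forms.
Variable p : nat.
Local Notation pform := (pform R p n).
Local Notation pcoefs := (coefs R ('rV[R]_p * M) (p + n)).

Definition formF (w : pcoefs) phi : 'rV[R]_n -> pform :=
  fun y t s => w (prod_chart p phi) (t, param phi y) s.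

Lemma fsmooth_formF w phi : smooth_coefs (@prod_atlas R n M p) w -> atlas phi ->
  fsmooth (chart_range phi) (formF w phi).
Proof.
move=> sw ap s; apply: (smooth_on_sub _ (sw (prod_chart p phi) s _)); last by exists phi.
move=> z [x dx xz]; exists (lsubmx z, x) => //=.
by rewrite xz hsubmxK.
Qed.

Lemma extd_prod w phi x t s : atlas phi -> dom phi x ->
  extd (@prod_atlas R n M p) w (prod_chart p phi) (t, x) s =
  dfm (formF w phi) (coord phi x) t s.
Proof.
move=> ap dx; rewrite /extd asboolT; last by split=> //; exists phi.
by rewrite /dfm asumE.
Qed.

Definition formM (c : coefs R M n) phi : 'rV[R]_n -> seq 'I_n -> R :=
  fun y s => c phi (param phi y) s.

Lemma extdE c phi x s : atlas phi -> dom phi x ->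
  extd atlas c phi x s =
  asum (fun a v => 'D_(delta_mx 0 a) (fun y => formM c phi y v) (coord phi x)) s.
Proof. by move=> ap dx; rewrite /extd asboolT ?asumE. Qed.

Lemma dfm_liftx (G : 'rV[R]_n -> seq 'I_n -> R) y (t : 'rV[R]_p) s :
  dfm (fun y (_ : 'rV[R]_p) s => liftx (G y) s) y t s =
  liftx (asum (fun a v => 'D_(delta_mx 0 a) (fun y => G y v) y)) s.
Proof.
have pdE a (g : 'rV[R]_n -> R) : pd a (fun y (_ : 'rV[R]_p) => g y) y t =
    'D_(rsubmx (delta_mx 0 a : 'rV[R]_(p + n))) g y.
  rewrite /pd -[in RHS](row_mxKr t y); apply: (@derive_affine R _ _ _ g (rsubmx : 'rV[R]_(p + n) -> 'rV[R]_n) rsubmx).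
  by move=> c w z; rewrite linearP.
case: (eqVneq (nt s) 0%N) => [/nt0P[v ->]|s0].
  rewrite liftx_rshift /dfm asum_map; apply: eq_asum => a u _.
  rewrite (pdE _ (fun y => liftx (G y) (map (@rshift p n) u))) rsubmx_delta.
  by congr ('D_ _ _ _); apply/funext => y'; rewrite liftx_rshift.
rewrite liftx_nt// -[RHS](@asum0 R _ s); apply: eq_asum_perm => a v av.
rewrite (pdE _ (fun y => liftx (G y) v)).
have [b ab|b ab] := splitP a.
  by rewrite (_ : a = lshift n b) ?rsubmx_delta0 ?derive_0//; exact: val_inj.
rewrite (_ : (fun y => _) = cst 0) ?derive_cst//; apply/funext => y'.
rewrite liftx_nt//; move: s0; rewrite -(nt_perm av) /nt/=.
by rewrite (_ : a = rshift p b) ?isT_rshift//; exact: val_inj.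
Qed.

(* The interior of the simplex is dense. *)
Lemma pd_simplex (O : set 'rV[R]_n) a g h y (t : 'rV[R]_p) : open O ->
  psmooth O g -> psmooth O h ->
  (forall y t, O y -> simplex t -> g y t = h y t) -> O y -> simplex t ->
  pd a g y t = pd a h y t.
Proof.
move=> oO sg sh gh Oy st.
pose d y t := g y t - h y t.
have sd : psmooth O d by apply: psmoothD => //; exact: psmoothN.
suff : pd a d y t = 0.
  by rewrite /d (pdB (O := O))// => /eqP; rewrite subr_eq0 => /eqP.
have inner t' : (forall i, 0 < bary t' i) -> pd a d y t' = 0.
  move=> t'0; rewrite /pd (@near_eq_derive _ _ _ _ (cst 0)) ?derive_cst//.
  have n1 : \forall z \near (row_mx t' y : 'rV[R]_(p + n)), O (rsubmx z).
    apply: (@open_nbhs_nbhs _ _ (cyl O)); split; first exact: open_cyl.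
    by rewrite /cyl/= row_mxKr.
  have n2 : \forall z \near (row_mx t' y : 'rV[R]_(p + n)), forall i, 0 < bary (lsubmx z) i.
    apply: (@filter_forall _ _ _ _ (nbhs_filter (row_mx t' y : 'rV[R]_(p + n)))) => i.
    have cb : continuous (fun z : 'rV[R]_(p + n) => bary (lsubmx z) i).
      apply: (@continuous_after _ _ _ (lsubmx : 'rV[R]_(p + n) -> 'rV[R]_p) (fun t => bary t i)).
        exact: continuous_bary.
      by move=> z; exact: continuous_lsubmx.
    apply: (cb (row_mx t' y) [set u | 0 < u]).
    rewrite row_mxKl; apply: open_nbhs_nbhs; split; first exact: open_gt.
    exact: t'0.
  apply: filterS (filterI n1 n2) => z [Oz z0].
  by rewrite /uncur /d gh ?subrr// => i; exact: ltW.
(* The barycentre: the segment from t to it enters the interior at once, and the derivative,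
   continuous along the segment and zero in the interior, is zero at t. *)
pose c : 'rV[R]_p := \row_(j < p) (p.+1)%:R^-1.
have p0 : (p.+1)%:R != 0 :> R by rewrite pnatr_eq0.
have bc i : bary c i = (p.+1)%:R^-1.
  have [k ->|->] := unliftP ord0 i; first by rewrite baryS mxE.
  rewrite bary0; under eq_bigr do rewrite mxE.
  rewrite sumr_const card_ord -mulr_natr.
  by move: p0; rewrite -natr1 => p0; field.
have cphi : continuous (fun u : R => pd a d y (seg c t u)).
  apply: (continuous_after _ (@continuous_seg R p c t)).
  exact: (psmooth_continuous (psmooth_pd oO a sd)).
have h1 : pd a d y (seg c t u) @[u --> (0 : R)^'+] --> pd a d y (seg c t 0).
  by apply: cvg_at_right_filter; exact: cphi.
have h2 : pd a d y (seg c t u) @[u --> (0 : R)^'+] --> (0 : R).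
  apply: cvg_near_cst; near=> u; apply: inner => i; rewrite bary_seg bc.
  have u0 : 0 < u by near: u; exact: nbhs_right_gt.
  have u1 : u <= 1 by near: u; apply: nbhs_right_le.
  by rewrite ltr_wpDl ?mulr_gt0 ?invr_gt0 ?ltr0n// mulr_ge0// subr_ge0.
have : pd a d y (seg c t 0) = 0.
  by rewrite -(cvg_lim (@Rhausdorff R) h1) (cvg_lim (@Rhausdorff R) h2).
by rewrite /seg subr0 scale1r scale0r addr0.
Unshelve. all: by end_near. Qed.

Lemma eq_dfm_simplex (O : set 'rV[R]_n) (F G : 'rV[R]_n -> pform) y t s : open O ->
  fsmooth O F -> fsmooth O G ->
  (forall y t s, O y -> simplex t -> F y t s = G y t s) -> O y -> simplex t ->
  dfm F y t s = dfm G y t s.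
Proof.
move=> oO sF sG FG Oy st; apply: eq_asum => a v _.
by apply: (pd_simplex (O := O)) => // y' t' Oy' st'; exact: FG.
Qed.

(** [simplex_extd] differentiates an extension chosen by [xget]; any two smooth extensions have the
    same partial derivatives on the simplex, boundary included. *)
Lemma simplex_extdE (w : pcoefs) : smooth_coefs (@prod_atlas R n M p) w ->
  simplex_extd (on_simplex w) = on_simplex (extd (@prod_atlas R n M p) w).
Proof.
move=> sw; rewrite /simplex_extd; set P := [set _ | _].
have [sw' Ew] : P (xget 0 P) by apply: (@xgetPex _ 0 P); exists w.
move: (xget 0 P) sw' Ew => w' sw' Ew.
apply/funext => Phi; apply/funext => -[t x]; apply/funext => s; rewrite /on_simplex/=.
case: asboolP => // st.
have [[[phi ap <-] [_ dx]]|nP] := pselect (@prod_atlas R n M p Phi /\ dom Phi (t, x)).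
  rewrite !extd_prod//; apply: (@eq_dfm_simplex (chart_range phi)) => //.
  - exact: open_range.
  - exact: fsmooth_formF.
  - exact: fsmooth_formF.
  - move=> y t' s' Oy st'.
    have := congr1 (fun w : pcoefs => w (prod_chart p phi) (t', param phi y) s') Ew.
    by rewrite /on_simplex/= asboolT.
  - exact: range_coord.
by rewrite /extd asboolF.
Qed.

(** Outside the product atlas the coefficients are 0, as the first clause of [is_form] demands. *)
Definition mkprod (Th : chart R M n -> M -> pform) : pcoefs := fun Phi y s =>
  if pselect (exists phi, [/\ atlas phi, Phi = prod_chart p phi & dom phi y.2]) is left H
  then Th (projT1 (cid H)) y.2 y.1 s else 0.

Lemma mkprodE Th phi t x s : atlas phi -> dom phi x ->
  mkprod Th (prod_chart p phi) (t, x) s = Th phi x t s.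
Proof.
move=> ap dx; rewrite /mkprod; case: pselect => [H|[]]; last by exists phi.
by case: (cid H) => psi /= P; case: P => _ /prod_chart_inj -> _.
Qed.

Lemma mkprod_neq0 Th Phi y s : mkprod Th Phi y s <> 0 ->
  exists phi, [/\ atlas phi, Phi = prod_chart p phi & dom phi y.2].
Proof. by rewrite /mkprod; case: pselect. Qed.

Lemma is_form_mkprod q Th :
  (forall phi x t, atlas phi -> dom phi x -> alternating (Th phi x t)) ->
  (forall phi x t s, atlas phi -> dom phi x -> size s != q -> Th phi x t s = 0) ->
  (forall phi psi x, atlas phi -> atlas psi -> dom phi x -> dom psi x ->
    related 1%:M 0 ('J (local_map phi psi idfun) (coord phi x)) setT (Th phi x) (Th psi x)) ->
  (forall phi, atlas phi -> fsmooth (chart_range phi) (fun y => Th phi (param phi y))) ->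
  is_form (@prod_atlas R n M p) q (mkprod Th).
Proof.
move=> Ta Td Tr Ts; split.
- move=> Phi [t x] s; case: (pselect (exists phi, [/\ atlas phi, Phi = prod_chart p phi & dom phi x])).
    move=> [phi [ap -> dx]]; rewrite mkprodE// => T0.
    split=> //; first by exists phi.
    by apply/eqP; apply: contra_notT T0; exact: Td.
  by move=> nP /mkprod_neq0.
- move=> Phi [t x] s1 i j s2; case: (pselect (exists phi, [/\ atlas phi, Phi = prod_chart p phi & dom phi x])).
    by move=> [phi [ap -> dx]]; rewrite !mkprodE//; exact: Ta.
  by move=> nP; rewrite /mkprod; case: pselect => // _; rewrite oppr0.
- have -> : [set: 'rV[R]_p * M] = setT `*` setT by apply/seteqP; split.
  apply/(@pullback_prodP p p 1%:M 0 idfun); first exact: atlas_compatible.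
    by move=> [t x]; rewrite /= mulmx1 addr0.
  move=> phi psi x ap aq dx dx' t s _ /=; rewrite mkprodE//.
  rewrite (Tr phi psi x ap aq dx dx' t s I); apply: eq_pull => v _.
  by rewrite mkprodE.
- move=> _ s [phi ap <-]; have := Ts phi ap s; apply: smooth_on_sub2.
  + exact: open_cyl (open_range ap).
  + by move=> _ [[t x] [_ dx] <-]; rewrite /cyl/= row_mxKr; exact: range_coord.
  + by move=> z /= Oz; rewrite mkprodE//; exact: dom_param.
Qed.

End Forms.
End ProductsWithRp.

(** * Smoothness in the jets *)

Section LinearMaps.
Variable R : realType.

Lemma continuous_mx (T : topologicalType) a b (f : T -> 'M[R]_(a, b)) :
  (forall i j, continuous (fun x => f x i j)) -> continuous f.
Proof.
move=> cf x; apply/cvgrPdist_le => e e0.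
have : \forall y \near x, forall i, forall j, `|f x i j - f y i j| <= e.
  apply: (@filter_forall _ _ _ _ (nbhs_filter x)) => i.
  apply: (@filter_forall _ _ _ _ (nbhs_filter x)) => j.
  by have /cvgrPdist_le/(_ e e0) := cf i j x.
apply: filterS => y fy.
rewrite /Num.Def.normr/= mx_normrE (bigmax_le _ (ltW e0))//= => -[i j] _ /=.
by rewrite !mxE; exact: fy.
Qed.

Lemma linear_fun_differentiable (V W : normedModType R) (f : V -> W) z :
  linear f -> continuous f -> differentiable f z.
Proof.
move=> lf cf; pose F : {linear V -> W} := HB.pack_for {linear V -> W} f
  (GRing.isLinear.Build R V W *:%R f lf).
exact: (@linear_differentiable R V W F z cf).
Qed.

Lemma smooth_on_linear (V V' W : normedModType R) (f : V' -> W) (A : V -> V') (U : set V') :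
  linear A -> continuous A -> smooth_on U f -> smooth_on (A @^-1` U) (f \o A).
Proof.
move=> lA cA; apply: smooth_on_affine => [c w z|z]; first exact: lA.
exact: linear_fun_differentiable.
Qed.

End LinearMaps.

Section Differentiability.
Variables (R : realType) (n : nat) (M : smoothManifold R n).
Local Notation atlas := (@atlas R n M).
Local Notation K k := #|{: multi_index n k}|.
Local Notation jdim k p := (n + p.+1 * (K k * n))%N.

(** A point of a jet space is a row vector and a matrix, while smooth functions are handled on row
    vectors; this linear bijection and its inverse [flatten_jets] exchange the two. *)
Definition unflatten k p (v : 'rV[R]_(jdim k p)) : jet_space R n k p :=
  (lsubmx v, vec_mx (rsubmx v)).

Definition flatten_jets k p (j : jet_space R n k p) : 'rV[R]_(jdim k p) :=
  row_mx j.1 (mxvec j.2).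

Definition jetv k p phi psi (rho : 'I_p.+1 -> diffeo M) x : 'rV[R]_(jdim k p) :=
  flatten_jets (jets_at k phi psi rho x).

Lemma flatten_jetsK k p : cancel (@flatten_jets k p) (@unflatten k p).
Proof. by move=> [x A]; rewrite /unflatten row_mxKl row_mxKr mxvecK. Qed.

Lemma unflatten_linear k p : linear (@unflatten k p).
Proof. by move=> c u v; rewrite /unflatten !linearP. Qed.

Lemma flatten_jets_linear k p : linear (@flatten_jets k p).
Proof. by move=> c u v; rewrite /flatten_jets scale_row_mx add_row_mx; congr row_mx; exact: linearP. Qed.

Lemma continuous_unflatten k p : continuous (@unflatten k p).
Proof.
apply: continuous_pair; first by move=> z; exact: continuous_lsubmx.
apply: continuous_mx => i j.
rewrite (_ : (fun _ => _) = (fun v : 'rV[R]_(jdim k p) => v 0 (rshift n (mxvec_index i j)))).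
  exact: coord_continuous.
by apply/funext => v; rewrite !mxE.
Qed.

Lemma continuous_flatten_jets k p : continuous (@flatten_jets k p).
Proof.
apply: continuous_mx => i j; rewrite (ord1 i); have [a ja|a ja] := splitP j.
  rewrite (_ : (fun _ => _) = (fun u : jet_space R n k p => u.1 0 a)).
    by apply: (@continuous_after _ _ _ fst (fun v : 'rV[R]_n => v 0 a)) => u; [exact: coord_continuous|exact: cvg_fst].
  apply/funext => u; rewrite (_ : j = lshift _ a) ?row_mxEl//; exact: val_inj.
case/mxvec_indexP: a ja => b c ja.
rewrite (_ : (fun _ => _) = (fun u : jet_space R n k p => u.2 b c)).
  by apply: (@continuous_after _ _ _ snd (fun v : 'M[R]_(p.+1, K k * n) => v b c)) => u; [exact: coord_continuous|exact: cvg_snd].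
apply/funext => u; rewrite (_ : j = rshift n (mxvec_index b c)) ?row_mxEr ?mxvecE//; exact: val_inj.
Qed.

(* [a rho x t] is a smooth function of [t], [x] and the jets of [rho] at [x],
   for [t] in the simplex. *)
Definition jet_smooth r k p phi (a : ('I_p.+1 -> diffeo M) -> M -> 'rV[R]_r -> R) :=
  forall psi : 'I_p.+1 -> chart R M n, (forall i, atlas (psi i)) ->
  exists (O : set 'rV[R]_(jdim k p)) (g : 'rV[R]_(jdim k p) -> 'rV[R]_r -> R),
    [/\ open O, psmooth O g &
    forall (rho : 'I_p.+1 -> diffeo M) x, dom phi x -> (forall i, dom (psi i) (rho i x)) ->
      O (jetv k phi psi rho x) /\
      forall t, simplex t -> a rho x t = g (jetv k phi psi rho x) t].

Lemma psmooth_lift r N (O : set 'rV[R]_N) (f : 'rV[R]_N -> R) : open O ->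
  smooth_on O f -> psmooth O (fun y (_ : 'rV[R]_r) => f y).
Proof.
move=> oO sf; apply: (@smooth_on_compR R _ (@cyl R r N O) (open_cyl oO) _ O (fun z : 'rV[R]_(r + N) => rsubmx z) f oO _ _ sf) => // j.
apply: (eq_smooth_on (open_cyl oO)) (smooth_on_coord (rshift r j)) => z _.
by rewrite mxE.
Qed.

Lemma psmooth_at r N (O : set 'rV[R]_N) (g : 'rV[R]_N -> 'rV[R]_r -> R) a : open O ->
  psmooth O g -> smooth_on O (fun y => g y a).
Proof.
move=> oO sg; apply: (@eq_smooth_on _ _ _ oO (fun y => uncur g (row_mx a y))).
  by move=> y _; rewrite /uncur row_mxKl row_mxKr.
apply: (smooth_on_compR oO (open_cyl oO) _ _ sg).
  by move=> y Oy; rewrite /cyl/= row_mxKr.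
move=> j; have [k jk|k jk] := splitP j.
  rewrite (_ : (fun _ => _) = (fun=> a 0 k)); first exact: smooth_on_cst.
  by apply/funext => y; rewrite (_ : j = lshift N k) ?row_mxEl//; exact: val_inj.
rewrite (_ : (fun _ => _) = (fun y : 'rV[R]_N => y 0 k)); first exact: smooth_on_coord.
by apply/funext => y; rewrite (_ : j = rshift r k) ?row_mxEr//; exact: val_inj.
Qed.

Lemma simplex_rV0 (t : 'rV[R]_0) : simplex t.
Proof. by move=> i; rewrite (ord1 i) bary0 big_ord0 subr0. Qed.

(** Cochains are the case r = 0: the space R^0 is a point and coincides with its simplex. *)
Lemma differentiable_cochainP p (c : ('I_p.+1 -> diffeo M) -> coefs R M n) :
  differentiable_cochain c <-> forall phi, atlas phi -> exists k, forall s,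
    @jet_smooth 0 k p phi (fun rho x _ => c rho phi x s).
Proof.
split=> dc phi ap; have [k ck] := dc phi ap; exists k => s psi aq.
  have [ O [f [oO sf cf]]] := ck s psi aq.
  have oO' : open (@unflatten k p @^-1` O).
    by apply: open_comp => // z _; exact: continuous_unflatten.
  exists (@unflatten k p @^-1` O), (fun y _ => f (unflatten y)); split=> //.
    apply: psmooth_lift => //.
    by apply: (@smooth_on_linear R _ _ R f (@unflatten k p)) => //; [exact: unflatten_linear|exact: continuous_unflatten].
  move=> rho x dx dr; rewrite /jetv /preimage/= flatten_jetsK.
  by have [Oj cj] := cf rho x dx dr; split.
have [ O [g [oO sg cg]]] := ck s psi aq.
exists (@flatten_jets k p @^-1` O), (fun j => g (flatten_jets j) 0); split.
- by apply: open_comp => // z _; exact: continuous_flatten_jets.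
- apply: (@smooth_on_linear R _ _ R (fun y => g y 0) (@flatten_jets k p)).
  + exact: flatten_jets_linear.
  + exact: continuous_flatten_jets.
  + exact: psmooth_at.
- move=> rho x dx dr; have [Oj cj] := cg rho x dx dr; split=> //.
  by rewrite (cj 0)//; exact: simplex_rV0.
Qed.

Lemma differentiable_simplex_formP p
    (w : ('I_p.+1 -> diffeo M) -> coefs R ('rV[R]_p * M) (p + n)) :
  differentiable_simplex_form w <-> forall phi, atlas phi -> exists k, forall s,
    @jet_smooth p k p phi (fun rho x t => w rho (prod_chart p phi) (t, x) s).
Proof.
split=> dw phi ap; have [k wk] := dw phi ap; exists k => s psi aq.
  have [ O [f [oO sf wf]]] := wk s psi aq.
  have oO' : open (@unflatten k p @^-1` O).
    by apply: open_comp => // z _; exact: continuous_unflatten.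
  exists (@unflatten k p @^-1` O), (fun y t => f (t, unflatten y)); split=> //.
    have := @smooth_on_linear R _ _ R f (fun z : 'rV[R]_(p + jdim k p) =>
      (lsubmx z, unflatten (rsubmx z))) _ _ _ sf.
    move=> H; apply: (smooth_on_sub _ (H _ _)).
    - by move=> z Oz; split.
    - by move=> c u v; rewrite !linearP/= unflatten_linear.
    - apply: continuous_pair; first by move=> z; exact: continuous_lsubmx.
      apply: (continuous_after (@continuous_unflatten k p)).
      by move=> z; exact: continuous_rsubmx.
  move=> rho x dx dr; rewrite /jetv /preimage/= flatten_jetsK.
  by have [Oj cj] := wf rho x dx dr; split.
have [ O [g [oO sg wg]]] := wk s psi aq.
exists (@flatten_jets k p @^-1` O), (fun z => g (flatten_jets z.2) z.1); split.
- by apply: open_comp => // z _; exact: continuous_flatten_jets.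
- pose A (z : 'rV[R]_p * jet_space R n k p) := row_mx z.1 (flatten_jets z.2).
  have -> : (fun z : 'rV[R]_p * jet_space R n k p => g (flatten_jets z.2) z.1) = uncur g \o A.
    by apply/funext => z; rewrite /uncur/= row_mxKl row_mxKr.
  have H := @smooth_on_linear R _ _ R (uncur g) A _ _ _ sg.
  apply: (smooth_on_sub _ (H _ _)).
  + by move=> z [_ Oz]; rewrite /preimage/= /cyl/= row_mxKr.
  + by move=> c u v; rewrite /A flatten_jets_linear/= -add_row_mx -scale_row_mx.
  + apply: continuous_mx => i j; rewrite (ord1 i); have [a ja|a ja] := splitP j.
      rewrite (_ : (fun _ => _) = (fun u : 'rV[R]_p * jet_space R n k p => u.1 0 a)).
        by apply: (@continuous_after _ _ _ fst (fun v : 'rV[R]_p => v 0 a)) => u; [exact: coord_continuous|exact: cvg_fst].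
      by apply/funext => u; rewrite (_ : j = lshift _ a) ?row_mxEl//; exact: val_inj.
    rewrite (_ : (fun _ => _) = (fun u : 'rV[R]_p * jet_space R n k p => (flatten_jets u.2) 0 a)).
      apply: (@continuous_after _ _ _ snd (fun v => flatten_jets v 0 a)) => u; last exact: cvg_snd.
      by apply: (@continuous_comp _ _ _ (@flatten_jets k p) (fun v : 'rV[R]_(jdim k p) => v 0 a)); [exact: continuous_flatten_jets|exact: coord_continuous].
    by apply/funext => u; rewrite (_ : j = rshift p a) ?row_mxEr//; exact: val_inj.
- move=> rho x dx dr; have [Oj cj] := wg rho x dx dr; split=> //.
Qed.

(** The k-jets of a subtuple are found among the coordinates of the k'-jets of the tuple, at places
    independent of charts, diffeomorphisms and point. This serves both to pass to subtuples and to
    bring several jet orders to a common one. *)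
Lemma jetv_select k k' p q (iota : 'I_q.+1 -> 'I_p.+1) : (k <= k')%N ->
  exists sigma : 'I_(jdim k q) -> 'I_(jdim k' p), forall phi psi (rho : 'I_p.+1 -> diffeo M) x,
    jetv k phi (psi \o iota) (rho \o iota) x =
    \row_j jetv k' phi psi rho x 0 (sigma j).
Proof.
move=> kk'.
have E k0 p0 phi psi (rho : 'I_p0.+1 -> diffeo M) x i (a : 'I_(K k0)) c :
    jetv k0 phi psi rho x 0 (rshift n (mxvec_index i (mxvec_index a c))) =
    partial (enum_val a) (local_map phi (psi i) (rho i)) (coord phi x) 0 c.
  by rewrite row_mxEr mxvecE mxE mxvecE mxE.
suff /choice[sigma sigmaP] : forall j : 'I_(jdim k q), exists j' : 'I_(jdim k' p),
    forall phi psi (rho : 'I_p.+1 -> diffeo M) x,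
    jetv k phi (psi \o iota) (rho \o iota) x 0 j = jetv k' phi psi rho x 0 j'.
  by exists sigma => phi psi rho x; apply/rowP => j; rewrite mxE.
move=> j; have [a ja|a ja] := splitP j.
  exists (lshift _ a) => phi psi rho x; rewrite (_ : j = lshift _ a) ?row_mxEl//.
  exact: val_inj.
case/mxvec_indexP: a ja => i b; case/mxvec_indexP: b => a c ja.
have lt (l : 'I_n) : (val (enum_val a) l < k'.+1)%N.
  by rewrite (leq_trans (ltn_ord _)).
have le : (\sum_l ([ffun l => Ordinal (lt l)] : {ffun 'I_n -> 'I_k'.+1}) l <= k')%N.
  apply: leq_trans kk'; apply: leq_trans (valP (enum_val a)).
  by apply: leq_sum => l _; rewrite ffunE.
pose a' : multi_index n k' := exist (fun al : {ffun 'I_n -> 'I_k'.+1} => (\sum_i al i <= k')%N) _ le.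
exists (rshift n (mxvec_index (iota i) (mxvec_index (enum_rank a') c))) => phi psi rho x.
rewrite (_ : j = rshift n (mxvec_index i (mxvec_index a c))) ?E; last exact: val_inj.
rewrite enum_rankK; congr (fun_of_matrix (_ _) 0 c); rewrite /partial /=.
by elim: (enum 'I_n) => //= l r ->; rewrite ffunE.
Qed.

Lemma jet_smooth_select r k k' p q phi (iota : 'I_q.+1 -> 'I_p.+1) a : (k <= k')%N ->
  @jet_smooth r k q phi a -> @jet_smooth r k' p phi (fun rho => a (rho \o iota)).
Proof.
move=> kk' sa psi aq; have [sigma sigmaP] := jetv_select iota kk'.
have [ O [g [oO sg ag]]] := sa (psi \o iota) (fun i => aq (iota i)).
pose T (v : 'rV[R]_(jdim k' p)) : 'rV[R]_(jdim k q) := \row_j v 0 (sigma j).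
have cT : continuous T.
  apply: continuous_mx => i j; rewrite (_ : (fun _ => _) = (fun v : 'rV[R]_(jdim k' p) => v 0 (sigma j))).
    exact: coord_continuous.
  by apply/funext => v; rewrite mxE.
have oO' : open (T @^-1` O) by apply: open_comp => // z _; exact: cT.
exists (T @^-1` O), (fun y => g (T y)); split=> //.
  rewrite /psmooth; pose A (z : 'rV[R]_(r + jdim k' p)) := row_mx (lsubmx z) (T (rsubmx z)).
  apply: (eq_smooth_on (open_cyl oO') (f := fun z => uncur g (A z))).
    by move=> z _; rewrite /uncur /A row_mxKl row_mxKr.
  apply: (smooth_on_compR (open_cyl oO') (open_cyl oO) _ _ sg).
    by move=> z; rewrite /cyl/= /A row_mxKr.
  move=> j; have [b jb|b jb] := splitP j.
    apply: (eq_smooth_on (open_cyl oO')) (smooth_on_coord (lshift _ b)) => z _.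
    by rewrite (_ : j = lshift _ b) ?row_mxEl ?mxE//; exact: val_inj.
  apply: (eq_smooth_on (open_cyl oO')) (smooth_on_coord (rshift r (sigma b))) => z _.
  by rewrite (_ : j = rshift _ b) ?row_mxEr ?mxE//; exact: val_inj.
move=> rho x dx dr; have [Oj aj] := ag (rho \o iota) x dx (fun i => dr (iota i)).
by rewrite /preimage/= /T -sigmaP; split.
Qed.

Section Closure.
Variables (r k p : nat) (phi : chart R M n).
Local Notation smooth := (@jet_smooth r k p phi).
Implicit Types a : ('I_p.+1 -> diffeo M) -> M -> 'rV[R]_r -> R.

Lemma eq_jet_smooth a a' :
  (forall rho x t, dom phi x -> simplex t -> a rho x t = a' rho x t) -> smooth a -> smooth a'.
Proof.
move=> aa' sa psi aq; have [ O [g [oO sg ag]]] := sa psi aq.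
exists O, g; split=> // rho x dx dr; have [Oj aj] := ag rho x dx dr.
by split=> // t st; rewrite -aa'// aj.
Qed.

Lemma jet_smoothD a a' : smooth a -> smooth a' -> smooth (fun rho x t => a rho x t + a' rho x t).
Proof.
move=> sa sa' psi aq.
have [ O [g [oO sg ag]]] := sa psi aq; have [ O' [g' [oO' sg' ag']]] := sa' psi aq.
exists (O `&` O'), (fun y t => g y t + g' y t); split; first exact: openI.
  apply: psmoothD; first exact: openI.
    by apply: smooth_on_sub sg => z [].
  by apply: smooth_on_sub sg' => z [].
move=> rho x dx dr; have [Oj aj] := ag rho x dx dr; have [Oj' aj'] := ag' rho x dx dr.
by split=> // t st; rewrite aj// aj'.
Qed.

Lemma jet_smoothM (h : 'rV[R]_r -> R) a :
  (forall N (O : set 'rV[R]_N), open O -> psmooth O (fun=> h)) ->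
  smooth a -> smooth (fun rho x t => h t * a rho x t).
Proof.
move=> sh sa psi aq; have [ O [g [oO sg ag]]] := sa psi aq.
exists O, (fun y t => h t * g y t); split=> //; first by apply: psmoothM => //; exact: sh.
move=> rho x dx dr; have [Oj aj] := ag rho x dx dr.
by split=> // t st; rewrite aj.
Qed.

Lemma jet_smoothZ c a : smooth a -> smooth (fun rho x t => c * a rho x t).
Proof. by apply: (@jet_smoothM (fun=> c)) => N O oO; exact: psmooth_cst. Qed.

Lemma jet_smooth0 : smooth (fun _ _ _ => 0).
Proof.
move=> psi aq; exists setT, (fun _ _ => 0); split=> //; first exact: openT.
by apply: psmooth_cst; exact: openT.
Qed.

Lemma jet_smooth_sum I (l : seq I) (b : I -> ('I_p.+1 -> diffeo M) -> M -> 'rV[R]_r -> R) :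
  (forall i, smooth (b i)) -> smooth (fun rho x t => \sum_(i <- l) b i rho x t).
Proof.
move=> sa; elim: l => [|i l IH].
  by apply: eq_jet_smooth jet_smooth0 => rho x t _ _; rewrite big_nil.
by apply: eq_jet_smooth (jet_smoothD (sa i) IH) => rho x t _ _; rewrite big_cons.
Qed.

Lemma jet_smooth_asum X (W : X -> seq X -> _) s : (forall b v, smooth (W b v)) ->
  smooth (fun rho x t => asum (fun b v => W b v rho x t) s).
Proof.
elim: s W => [|b s IH] W sW; first exact: jet_smooth0.
apply: (@eq_jet_smooth (fun rho x t => W b s rho x t +
   -1 * asum (fun c v => W c (b :: v) rho x t) s)).
  by move=> rho x t _ _; rewrite mulN1r.
by apply: jet_smoothD => //; apply: jet_smoothZ; apply: (IH (fun c v => W c (b :: v))).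
Qed.

Lemma jet_smooth_ev (L : chain R) (b : seq nat -> ('I_p.+1 -> diffeo M) -> M -> 'rV[R]_r -> R) :
  (forall w, smooth (b w)) -> smooth (fun rho x t => ev L (fun w => b w rho x t)).
Proof. by move=> sa; apply: jet_smooth_sum => -[c w]; exact: jet_smoothZ. Qed.

(** The representing function is known for t in the simplex only, and the simplex contains the
    segments to its vertices. *)
Lemma jet_smooth_cint j m a : smooth a -> smooth (fun rho x => cint (vtx R r j) m (a rho x)).
Proof.
move=> sa psi aq; have [ O [g [oO sg ag]]] := sa psi aq.
exists O, (fun y => cint (vtx R r j) m (g y)); split=> //; first exact: psmooth_cint.
move=> rho x dx dr; have [Oj aj] := ag rho x dx dr.
by split=> // t st; apply: eq_cint => u u01; rewrite aj//; exact: simplex_seg.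
Qed.

End Closure.

Lemma simplex_vtx p j : simplex (vtx R p j).
Proof. by move=> i; rewrite bary_vtx. Qed.

Lemma jet_smooth_vtx r r' k p phi j a : @jet_smooth r k p phi a ->
  @jet_smooth r' k p phi (fun rho x _ => a rho x (vtx R r j)).
Proof.
move=> sa psi aq; have [ O [g [oO sg ag]]] := sa psi aq.
exists O, (fun y _ => g y (vtx R r j)); split=> //.
  by apply: psmooth_lift => //; exact: psmooth_at.
move=> rho x dx dr; have [Oj aj] := ag rho x dx dr.
by split=> // t _; rewrite aj//; exact: simplex_vtx.
Qed.

Section FormsSmoothInJets.
Variables (r k p : nat) (phi : chart R M n).
Local Notation smooth := (@jet_smooth r k p phi).
Implicit Types Th : ('I_p.+1 -> diffeo M) -> M -> pform R r n.
Local Notation fsmooth Th := (forall s, smooth (fun rho x t => Th rho x t s)).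

Lemma jet_smooth_hop j Th : fsmooth Th -> fsmooth (fun rho x => hop j (Th rho x)).
Proof.
move=> sT s; apply: jet_smooth_sum => b.
apply: (@jet_smoothM _ _ _ _ (fun t => (t - vtx R r j) 0 b)) => [N O oO|].
  apply: (@eq_psmooth _ _ _ _ oO (fun _ t => t 0 b - (vtx R r j) 0 b)).
    by move=> y t _; rewrite !mxE.
  by apply: psmoothD => //; [exact: psmooth_coord|exact: psmooth_cst].
exact: (@jet_smooth_cint _ _ _ _ _ _ (fun rho x t => Th rho x t (lshift n b :: s))).
Qed.

Lemma jet_smooth_epsop j Th : fsmooth Th -> fsmooth (fun rho x => epsop j (Th rho x)).
Proof.
move=> sT s; apply: jet_smoothZ.
exact: (@jet_smooth_vtx r r _ _ _ j (fun rho x t => Th rho x t s)).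
Qed.

Lemma jet_smooth_Kop w Th : fsmooth Th -> fsmooth (fun rho x => Kop w (Th rho x)).
Proof.
elim: w Th => //= j w IH Th sT.
by apply: (IH (fun rho x => hop j (Th rho x))); exact: jet_smooth_hop.
Qed.

Lemma jet_smooth_epsw w Th : fsmooth Th -> fsmooth (fun rho x => epsw w (Th rho x)).
Proof.
elim: w Th => [|j [|i w] IH] Th sT; first by move=> s; exact: jet_smooth0.
  exact: jet_smooth_epsop.
by apply: (IH (fun rho x => hop j (Th rho x))); exact: jet_smooth_hop.
Qed.

Lemma jet_smooth_Aop q (psi : seq nat -> ('I_p.+1 -> diffeo M) -> M -> pform R r n) : (forall w, fsmooth (psi w)) ->
  fsmooth (fun rho x => Aop q (fun w => psi w rho x)).
Proof.
elim: q psi => [|q IH] psi spsi s /=; first exact: spsi.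
apply: jet_smooth_sum => i.
apply: (@jet_smooth_asum _ _ _ _ _ (fun a v rho x t => dbary i a *
  Aop q (fun w => psi ((i : nat) :: w) rho x) t v)) => a v.
by apply: jet_smoothZ; apply: (IH (fun w => psi ((i : nat) :: w))).
Qed.

Lemma jet_smooth_Bop q (psi : seq nat -> ('I_p.+1 -> diffeo M) -> M -> pform R r n) : (forall w, fsmooth (psi w)) ->
  fsmooth (fun rho x => Bop q (fun w => psi w rho x)).
Proof.
move=> spsi s; apply: jet_smooth_sum => i.
apply: (@jet_smoothM _ _ _ _ (fun t => bary t i)) => [N O oO|]; first exact: psmooth_bary.
exact: (@jet_smooth_Aop q (fun w => psi ((i : nat) :: w))).
Qed.

Lemma jet_smooth_liftx (A : ('I_p.+1 -> diffeo M) -> M -> seq 'I_n -> R) :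
  (forall s, @jet_smooth 0 k p phi (fun rho x _ => A rho x s)) ->
  fsmooth (fun rho x (_ : 'rV[R]_r) => @liftx R r n (A rho x)).
Proof.
move=> sA s; case: (eqVneq (nt s) 0%N) => [/nt0P[v sv]|s0].
  apply: eq_jet_smooth (@jet_smooth_vtx 0 r _ _ _ 0 (fun rho x _ => A rho x v) (sA v)).
  by move=> rho x t _ _; rewrite sv liftx_rshift.
apply: eq_jet_smooth (@jet_smooth0 _ _ _ _) => rho x t _ _.
by rewrite liftx_nt.
Qed.

End FormsSmoothInJets.
End Differentiability.

(** * Averages of words over the symmetric group *)

Section Words.
Variable R : realType.

Lemma eq_Aop_letters p n q (psi psi' : seq nat -> pform R p n) t s :
  (forall w s, size w = q -> all (fun i => (i <= p)%N) w -> psi w t s = psi' w t s) ->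
  Aop q psi t s = Aop q psi' t s.
Proof.
elim: q psi psi' s => [|q IH] psi psi' s e /=; first exact: e.
apply: eq_bigr => i _; apply: eq_wdg => // v _.
by apply: IH => w u sw aw; apply: e; rewrite /= ?sw// aw -ltnS ltn_ord.
Qed.

Lemma eq_Bop_letters p n q (psi psi' : seq nat -> pform R p n) t s :
  (forall w s, size w = q.+1 -> all (fun i => (i <= p)%N) w -> psi w t s = psi' w t s) ->
  Bop q psi t s = Bop q psi' t s.
Proof.
move=> e; apply: eq_bigr => i _; congr (_ * _); apply: eq_Aop_letters => w u sw aw.
by apply: e; rewrite /= ?sw// aw -ltnS ltn_ord.
Qed.

(** The word as a map on vertices, constant beyond its last letter in accordance with [vtx]. *)
Definition wmap (J : seq nat) (j : nat) : nat := nth 0%N J (minn j (size J).-1).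

Lemma wmap_iota J : map (wmap J) (iota 0 (size J)) = J.
Proof.
apply: (@eq_from_nth _ 0%N); first by rewrite size_map size_iota.
move=> i; rewrite size_map size_iota => iJ.
rewrite (nth_map 0%N) ?size_iota// nth_iota// /wmap add0n (minn_idPl _)//.
by case: (size J) iJ.
Qed.

Lemma wmap_homo J : sorted leq J -> {homo wmap J : i j / (i <= j)%N}.
Proof.
case: J => [|a J] sJ i j ij; first by rewrite /wmap !nth_nil.
apply: (sorted_leq_nth leq_trans leqnn 0%N sJ); rewrite ?inE /= ?ltnS ?geq_minr//.
by rewrite leq_min geq_minr andbT (leq_trans (geq_minl _ _)).
Qed.

Lemma wmap_le J q : all (fun i => (i <= q)%N) J -> forall i, (wmap J i <= q)%N.
Proof.
case: J => [|a J] aJ i; first by rewrite /wmap nth_nil.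
by apply: (allP aJ); rewrite mem_nth//= ltnS geq_minr.
Qed.

Lemma wmap_vtx J q j : vtx R q (wmap J (minn j (size J).-1)) = vtx R q (wmap J j).
Proof. by rewrite /wmap -minnA minnn. Qed.

Section Averages.
Variable p : nat.
Implicit Types G : seq nat -> R.

(** M is replaced by a point (n = 0): how values of G enter the integral of [Bop] does not depend on
    M, so scalar coefficients determine it. *)
Definition scalar_psi G (w : seq nat) : pform R p 0 :=
  fun _ s => (s == [::])%:R * ev (sorting R w) G.

(* The integral over the simplex of the form [Bop p] built on the function G
   of the sorted words. *)
Definition Lam G : R := simplex_integral 1 (fun t =>
  Bop p (scalar_psi G) t (map (@lshift p 0) (enum 'I_p))).

Lemma fsmooth_scalar_Bop q G : fsmooth setT (fun _ : 'rV[R]_0 => Bop q (scalar_psi G)).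
Proof.
apply: (@fsmooth_Bop R p 0 0 setT openT q (fun w _ => scalar_psi G w)) => w s.
exact: (@psmooth_cst _ _ _ _ ((s == [::])%:R * ev (sorting R w) G)).
Qed.

Lemma pcont_scalar_Bop q G : pcont (Bop q (scalar_psi G)).
Proof.
by move=> s; have := fsmooth_cont (y := 0) (s := s) (@fsmooth_scalar_Bop q G) I.
Qed.

Lemma alternating_scalar_Bop q G t : alternating (Bop q (scalar_psi G) t).
Proof.
apply: alternating_Bop => w t' s1 i j s2.
by rewrite /scalar_psi; case: s1 => [|a s1]; rewrite !mul0r oppr0.
Qed.

Lemma LamE G : Lam G = epsw (iota 0 p.+1) (Bop p (scalar_psi G)) 0 [::].
Proof.
have := @fiber_epsw R p 0 (Bop p (scalar_psi G)) [::] (@pcont_scalar_Bop p G) (@alternating_scalar_Bop p G).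
by rewrite cats0.
Qed.

Lemma eq_Lam G G' : (forall w, size w = p.+1 -> all (fun i => (i <= p)%N) w -> G w = G' w) ->
  Lam G = Lam G'.
Proof.
move=> GG; congr simplex_integral; apply/funext => t; apply: eq_Bop_letters => w s sw aw.
congr (_ * _); apply: eq_ev => v /sorting_words[sv _ vw]; apply: GG; rewrite ?sv//.
by apply/allP => i /vw; exact: (allP aw).
Qed.

Lemma Lam_linear k G G' : Lam (fun w => k * G w + G' w) = k * Lam G + Lam G'.
Proof.
pose l := map (@lshift p 0) (enum 'I_p).
rewrite /Lam -(@simplex_integral_linear R p 1 k (fun t => Bop p (scalar_psi G) t l)
  (fun t => Bop p (scalar_psi G') t l)); try exact: pcont_scalar_Bop.
congr simplex_integral; apply/funext => t.
have := BopB p (scalar_psi G') (fun w t s => - k * scalar_psi G w t s) t l.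
rewrite BopZ mulNr opprK addrC => <-.
by apply: eq_Bop => w s _; rewrite /scalar_psi /ev !mulr_sumr -sumrB;
  apply: eq_bigr => x _; ring.
Qed.

Lemma Lam_sum (r : seq (seq nat)) (c : seq nat -> R) (G : seq nat -> seq nat -> R) :
  Lam (fun v => \sum_(w <- r) c w * G w v) = \sum_(w <- r) c w * Lam (G w).
Proof.
elim: r => [|w r IH].
  transitivity (Lam (fun=> -1 * 0 + 0)).
    by apply: eq_Lam => v _ _; rewrite big_nil mulr0 addr0.
  by rewrite big_nil (Lam_linear (-1) (fun=> 0) (fun=> 0)) mulN1r addNr.
rewrite big_cons -IH -Lam_linear; apply: eq_Lam => v _ _.
by rewrite big_cons.
Qed.

Definition vertex_words : seq (seq nat) :=
  [seq map val (tval x) | x : p.+1.-tuple 'I_p.+1].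

Lemma vertex_words_uniq : uniq vertex_words.
Proof.
rewrite map_inj_uniq ?enum_uniq// => x y /(inj_map val_inj) xy.
exact: val_inj.
Qed.

Lemma mem_vertex_words w : size w = p.+1 -> all (fun i => (i <= p)%N) w -> w \in vertex_words.
Proof.
move=> sw aw; apply/mapP.
have sx : size (map (@inord p) w) == p.+1 by rewrite size_map sw.
exists (Tuple sx); rewrite ?mem_enum//= -map_comp -[LHS]map_id.
by apply/eq_in_map => i /(allP aw) ip /=; rewrite inordK.
Qed.

Definition average : chain R := [seq (Lam (fun v => (v == w)%:R), w) | w <- vertex_words].

Lemma ev_average G : ev average G = Lam G.
Proof.
rewrite /ev big_map; under eq_bigr do rewrite mulrC.
rewrite -Lam_sum; apply: eq_Lam => v sv av.
rewrite (bigD1_seq v) ?vertex_words_uniq ?mem_vertex_words//= eqxx mulr1.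
by rewrite big1 ?addr0// => w wv; rewrite eq_sym (negbTE wv) mulr0.
Qed.

Lemma average_size w : w \in [seq y.2 | y <- average] -> size w = p.+1.
Proof.
rewrite -map_comp => /mapP[v /mapP[x _ ->] ->] /=.
by rewrite size_map size_tuple.
Qed.

End Averages.

Lemma Lam0 G : Lam 0 G = G [:: 0%N].
Proof.
rewrite /Lam /=; have -> : enum 'I_0 = [::] by apply: size0nil; rewrite size_enum_ord.
rewrite /Bop big_ord1 /= bary0 big_ord0 subr0 mul1r /scalar_psi eqxx mul1r.
exact: sorting1.
Qed.

Lemma pull_scalar p q (A : 'M[R]_(p + 0, q + 0)) g s :
  pull A (fun v => (v == [::])%:R * g) s = (s == [::])%:R * g.
Proof.
case: s => [|i s]; first by rewrite pull_nil.
rewrite (@eq_pull _ _ _ _ _ (fun v => 0 * g)) ?pullZ ?mul0r// => v.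
by case: v => //= j v _; rewrite mul0r.
Qed.

(** The word J is the image of 0 1 ... p under the monotone map [wmap J], along which the form built
    on G pulls back to the form built on G composed with that map. *)
Lemma epsw_scalar_Bop p q J G : size J = p.+1 -> sorted leq J -> all (fun i => (i <= q)%N) J ->
  epsw J (Bop p (@scalar_psi q G)) 0 [::] = Lam p (fun v => G (map (nth 0%N J) v)).
Proof.
move=> sJ oJ aJ.
have -> : Lam p (fun v => G (map (nth 0%N J) v)) = Lam p (fun v => G (map (wmap J) v)).
  apply: eq_Lam => w sw aw; congr G; apply/eq_in_map => i iw.
  by rewrite /wmap sJ/= (minn_idPl _)// (allP aw).
rewrite LamE (@related_epsw R p q 0 0 (affB R p q (wmap J)) (affb R q (wmap J)) 1%:M
  (wmap J) setT _ _ (iota 0 p.+1) _ (Bop p (@scalar_psi q G)))//.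
- by rewrite pull_nil -sJ wmap_iota; exact: epsw_const.
- by move=> j; apply: aff_vtx => i; rewrite -{1}[p]/p.+1.-1 -sJ wmap_vtx.
- exact: pcont_scalar_Bop.
- move=> t s _; apply: (related_Bop (mu := wmap J)).
  + by move=> i _; exact: wmap_le.
  + by move=> t' l; apply: aff_bary => i _; exact: wmap_le.
  + by move=> a l; apply: aff_dbary => i _; exact: wmap_le.
  + move=> w v; rewrite /scalar_psi pull_scalar; congr (_ * _).
    by rewrite -sorting_map//; exact: wmap_homo.
Qed.

(** Stokes' formula for the form [Bop p] on the (p+1)-simplex: its derivative is [Bop p.+1] of the
    coface of G, and its integrals over the faces are values of [Lam p]. *)
Lemma Lam_coface p G :
  Lam p.+1 (coface G) =
  coface (fun J => Lam p (fun v => G (map (nth 0%N J) v))) (iota 0 p.+2).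
Proof.
pose F (_ : 'rV[R]_0) := Bop p (@scalar_psi p.+1 G).
have sF : fsmooth setT F by exact: fsmooth_scalar_Bop.
have E t s : Bop p.+1 (@scalar_psi p.+1 (coface G)) t s = dfm F 0 t s.
  rewrite (@dfm_Bop R p.+1 0 setT openT p (fun w _ => scalar_psi G w) 0 t s)//; last first.
    by move=> w u; exact: (@psmooth_cst _ _ _ _ ((u == [::])%:R * ev (sorting R w) G)).
  rewrite (@eq_Bop _ _ _ p _ (fun=> (fun _ _ => 0)))//; last first.
    move=> w u _; rewrite -[RHS](@asum0 R _ u); apply: eq_asum => a v _; exact: pd_cst.
  rewrite Bop0 mulr0 addr0 -Bop_cof; apply: eq_Bop => w u _.
  by rewrite /cof /scalar_psi /coface asumZ -/(coface _ _) -ev_sorting_coface.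
rewrite LamE (_ : Bop p.+1 (@scalar_psi p.+1 (coface G)) = dfm F 0); last first.
  by apply/funext => t; apply/funext => s; exact: E.
rewrite (epsw_dfm openT)//; last by move=> y t _; exact: alternating_scalar_Bop.
(* The index is empty, so this derivative is an empty sum: there is no contribution along the point
   M. *)
rewrite [dfm _ _ _ _]/(0 : R) mulr0 subr0; apply: eq_coface => J Jp [sJ].
apply: epsw_scalar_Bop; first by rewrite -sJ size_iota.
  exact: (subseq_sorted leq_trans Jp (iota_sorted _ _)).
by apply/allP => i /(mem_subseq Jp); rewrite mem_iota add0n.
Qed.

Definition averages (w : seq nat) : chain R :=
  [seq (x.1, map (nth 0%N w) x.2) | x <- average (size w).-1].

Lemma ev_averages w psi :
  ev (averages w) psi = Lam (size w).-1 (fun v => psi (map (nth 0%N w) v)).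
Proof. by rewrite -ev_average /ev big_map. Qed.

Lemma averages_map f w psi : w != [::] ->
  ev (averages (map f w)) psi = ev (averages w) (fun v => psi (map f v)).
Proof.
case: w => // a w _; rewrite !ev_averages size_map; apply: eq_Lam => v _ av.
rewrite -map_comp; congr psi; apply/eq_in_map => i /(allP av) iv /=.
by rewrite -map_cons (nth_map 0%N)// ltnS.
Qed.

(** One-letter words are excluded because their face is the empty word, on which [averages] is
    governed by the truncated [(size w).-1]. *)
Lemma averages_coface w psi : (1 < size w)%N ->
  ev (averages w) (coface psi) = coface (fun v => ev (averages v) psi) w.
Proof.
move=> sw; have [p Ep] : exists p, size w = p.+2 by case: (size w) sw => [|[|p]]//; exists p.
rewrite ev_averages Ep /=.
have -> : (fun v => coface psi (map (nth 0%N w) v)) = coface (fun v => psi (map (nth 0%N w) v)).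
  by apply/funext => v; rewrite coface_map.
rewrite Lam_coface -[in RHS](mkseq_nth 0%N w) Ep coface_map.
apply: eq_coface => J _; rewrite size_iota => -[sJ].
rewrite averages_map; last by case: (J) sJ.
by rewrite ev_averages -sJ.
Qed.

(* What is left of [averages - id] after subtracting the homotopy of the
   boundary is a cycle, hence the boundary of the cone over it from the first
   letter. *)
Fixpoint average_htpy k (w : seq nat) : chain R :=
  if k is k'.+1 then
    cone (head 0%N w) (averages w ++ scale_chain (-1) ((1, w) :: boundary (average_htpy k') w))
  else [::].

Lemma ev_average_htpy k w psi :
  ev (average_htpy k.+1 w) psi =
  ev (averages w) (fun v => psi (head 0%N w :: v)) - psi (head 0%N w :: w) -
  coface (fun v => ev (average_htpy k v) (fun u => psi (head 0%N w :: u))) w.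
Proof.
rewrite [average_htpy _ _]/(cone _ _) ev_cone ev_cat ev_scale.
rewrite -[(1, w) :: _]/([:: (1, w)] ++ _) ev_cat ev_boundary {2}/ev big_seq1 mul1r.
by rewrite mulN1r opprD addrA.
Qed.

(** In dual form, the boundary of H is A - id - H of the boundary, for A the averages. In degree 0
    both A and id fix a letter; in higher degree the cone formula leaves the boundary of A - id - H
    of the boundary, which is 0 by induction. *)
Lemma average_htpyP k w psi : size w = k.+1 ->
  ev (average_htpy k w) (coface psi) =
  ev (averages w) psi - psi w - coface (fun v => ev (average_htpy k.-1 v) psi) w.
Proof.
elim: k w psi => [|k IH] w psi sw.
  rewrite /= ev_nil; case: w sw => [|a []]// _.
  rewrite ev_averages/= Lam0/= subrr sub0r (_ : coface _ _ = 0) ?oppr0//.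
  by rewrite /coface/= ev_nil subrr.
rewrite ev_average_htpy -[k.+1.-1]/(k); set h := head _ _.
have CE v : coface psi (h :: v) = psi v - coface (fun u => psi (h :: u)) v by [].
rewrite (_ : (fun v => coface psi (h :: v)) = (fun v => psi v - coface (fun u => psi (h :: u)) v))//.
rewrite CE evB averages_coface ?sw//.
have -> : coface (fun v => ev (average_htpy k v) (fun u => psi u - coface (fun u => psi (h :: u)) u)) w =
    coface (fun v => ev (average_htpy k v) psi - (ev (averages v) (fun u => psi (h :: u)) -
      psi (h :: v) - coface (fun u => ev (average_htpy k.-1 u) (fun u => psi (h :: u))) v)) w.
  apply: eq_coface => v _; rewrite sw => -[sv]; rewrite -IH//.
  exact: evB.
by rewrite !cofaceB coface_coface; ring.
Qed.

Lemma average_htpy_map k f w psi : size w = k.+1 ->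
  ev (average_htpy k (map f w)) psi = ev (average_htpy k w) (fun v => psi (map f v)).
Proof.
elim: k w psi => [|k IH] w psi sw; first by rewrite /= !ev_nil.
have w0 : w != [::] by case: (w) sw.
rewrite !ev_average_htpy averages_map// coface_map.
have -> : head 0%N (map f w) = f (head 0%N w) by case: (w) w0.
congr (_ - _); apply: eq_coface => v _; rewrite sw => -[sv].
by rewrite IH.
Qed.

Lemma average_htpy_size k w v : size w = k.+1 ->
  v \in [seq y.2 | y <- average_htpy k w] -> size v = k.+2.
Proof.
elim: k w v => [//|k IH] w v sw.
rewrite [average_htpy _ _]/(cone _ _) /cone -map_comp => /mapP[x].
rewrite mem_cat => /orP[|] xL -> /=; congr S.
  move: xL => /mapP[y ya ->] /=; rewrite size_map.
  by rewrite (average_size (map_f snd ya)) sw.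
move: xL => /mapP[y]; rewrite inE => /orP[/eqP -> -> //|yb ->] /=.
have /boundary_words[u [_ su] yu] := map_f snd yb.
by apply: IH yu; move: su; rewrite sw => -[].
Qed.

End Words.

(** * Bott cochains evaluated on words *)

Section BottWords.
Variables (R : realType) (n : nat) (M : smoothManifold R n).
Local Notation family := (family (bott_cochain M)).
Implicit Types (c : family) (g : nat -> diffeo M) (v w : seq nat).

(** The value 0 on the empty word agrees with [group_coboundary] being 0 in degree 0, so that
    [coface_word_value] holds for all words. *)
Definition word_value c g v : coefs R M n :=
  if v is [::] then 0 else c (size v).-1 (fun i => g (nth 0%N v i)).

(** A tuple indexed by all letters, constant beyond p as [vtx] is. *)
Definition ext_tuple p (rho : 'I_p.+1 -> diffeo M) (j : nat) := rho (inord (minn j p)).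

Lemma word_valueE c g v q : size v = q.+1 ->
  word_value c g v = c q (fun i : 'I_q.+1 => g (nth 0%N v i)).
Proof. by move=> sv; case: v sv => // a v [<-]. Qed.

Lemma word_value_iota c p (rho : 'I_p.+1 -> diffeo M) :
  word_value c (ext_tuple rho) (iota 0 p.+1) = c p rho.
Proof.
rewrite (@word_valueE _ _ _ p) ?size_iota//; congr (c p); apply/funext => i.
rewrite /ext_tuple nth_iota// add0n (minn_idPl _) ?inord_val//.
by rewrite -ltnS.
Qed.

Lemma word_value_map c g (f : nat -> nat) v :
  word_value c g (map f v) = word_value c (g \o f) v.
Proof.
case: v => // a v; rewrite (@word_valueE _ _ _ (size v)) ?(@word_valueE _ _ (a :: v) (size v)) ?size_map//=.
by congr (c _); apply/funext => i; rewrite -map_cons (nth_map 0%N).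
Qed.

Lemma ext_tuple_comp p q (mu : 'I_p.+1 -> 'I_q.+1) (rho : 'I_q.+1 -> diffeo M) :
  ext_tuple (rho \o mu) = ext_tuple rho \o (fun j => mu (inord (minn j p)) : nat).
Proof.
apply/funext => j; have mq i : minn (mu i) q = mu i by apply/minn_idPl; rewrite -ltnS ltn_ord.
by rewrite /ext_tuple/= mq inord_val.
Qed.

Lemma coefs_sumE X m (I : Type) (r : seq I) (c : I -> coefs R X m) phi x s :
  (\sum_(i <- r) c i) phi x s = \sum_(i <- r) c i phi x s.
Proof. by elim: r => [|i r IH]; rewrite ?big_nil// !big_cons -IH. Qed.

Lemma coface_word_value c g w phi x s :
  coface (fun v => word_value c g v phi x s) w =
  word_value (group_coboundary c) g w phi x s.
Proof.
case: w => [|a [|b w]] //; first by rewrite /coface/= subrr.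
rewrite [RHS](f_equal (fun f : coefs R M n => f phi x s) (@word_valueE _ _ [:: a, b & w] (size w).+1 erefl)).
rewrite /coface asumE [RHS]coefs_sumE; apply: eq_bigr => i _.
set l := [:: a, b & w].
have sl : size (take i l ++ drop i.+1 l) = (size w).+1.
  have := ltn_ord i; rewrite size_cat size_drop size_take => /= il.
  by rewrite il; lia.
rewrite (@word_valueE _ _ _ (size w))//; congr (_ * _).
congr (c _ _ phi x s); apply/funext => j; congr g.
have il := ltn_ord i.
rewrite nth_cat size_take -/l (_ : (i < size l)%N)// /= /bump.
case: ltnP => ji; first by rewrite nth_take// leqNgt ji.
by rewrite nth_drop; congr nth; lia.
Qed.

End BottWords.

(** * Integration along the fibers as a cochain map *)

Section SimplicialForms.
Variables (R : realType) (n : nat) (M : smoothManifold R n).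
Local Notation atlas := (@atlas R n M).
Local Notation sfamily := (family (simplicial_form M)).
Local Notation J phi psi f x := ('J (local_map phi psi f) (coord phi x)).
Implicit Types (phi psi : chart R M n) (x : M).

Lemma alternating_epsw p w (eta : pform R p n) : pcont eta ->
  (forall t, alternating (eta t)) -> forall t, alternating (epsw w eta t).
Proof.
elim: w eta => [|j [|i w] IH] eta ce ae t.
- by move=> s1 i j s2; rewrite /= oppr0.
- exact: alternating_epsop.
- by apply: (IH (hop j eta)); [exact: pcont_hop|exact: alternating_hop_pcont].
Qed.

(* Constant beyond p, like [vtx]. *)
Definition ext_vertices p q (mu : 'I_p.+1 -> 'I_q.+1) (j : nat) : nat := mu (inord (minn j p)).

Lemma ext_verticesE p q (mu : 'I_p.+1 -> 'I_q.+1) (i : 'I_p.+1) : ext_vertices mu i = mu i.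
Proof.
have le : (i <= p)%N by rewrite -ltnS ltn_ord.
by rewrite /ext_vertices (minn_idPl le) inord_val.
Qed.

Lemma ext_vertices_le p q (mu : 'I_p.+1 -> 'I_q.+1) i : (ext_vertices mu i <= q)%N.
Proof. by rewrite -ltnS /ext_vertices ltn_ord. Qed.

Lemma ext_vertices_homo p q (mu : 'I_p.+1 -> 'I_q.+1) : {homo mu : i j / (i <= j)%N} ->
  {homo ext_vertices mu : i j / (i <= j)%N}.
Proof.
move=> hmu i j ij; apply: hmu; rewrite !inordK ?ltnS ?geq_minr//.
by rewrite leq_min geq_minr andbT (leq_trans (geq_minl _ _)).
Qed.

Lemma ext_vertices_vtx p q (mu : 'I_p.+1 -> 'I_q.+1) j :
  vtx R q (ext_vertices mu (minn j p)) = vtx R q (ext_vertices mu j).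
Proof. by rewrite /ext_vertices -minnA minnn. Qed.

Lemma simplex_mapE p q (mu : 'I_p.+1 -> 'I_q.+1) (t : 'rV[R]_p) :
  simplex_map mu t = t *m affB R p q (ext_vertices mu) + affb R q (ext_vertices mu).
Proof.
apply/rowP => j; rewrite affE mxE big_mkcond; apply: eq_bigr => i _.
have le : (mu i <= q)%N by rewrite -ltnS ltn_ord.
rewrite ext_verticesE mxE (minn_idPl le) -val_eqE/=.
by case: eqP => _; rewrite ?mulr1 ?mulr0.
Qed.

Section Criterion.
Variable (Th : forall p, ('I_p.+1 -> diffeo M) -> chart R M n -> M -> pform R p n) (q : nat).
Hypothesis Th_alternating : forall p (rho : 'I_p.+1 -> diffeo M) phi x t,
  atlas phi -> dom phi x -> alternating (Th rho phi x t).
Hypothesis Th_degree : forall p (rho : 'I_p.+1 -> diffeo M) phi x t s,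
  atlas phi -> dom phi x -> size s != q -> Th rho phi x t s = 0.
Hypothesis Th_charts : forall p (rho : 'I_p.+1 -> diffeo M) phi psi x,
  atlas phi -> atlas psi -> dom phi x -> dom psi x ->
  related 1%:M 0 (J phi psi idfun x) setT (Th rho phi x) (Th rho psi x).
Hypothesis Th_smooth : forall p (rho : 'I_p.+1 -> diffeo M) phi, atlas phi ->
  fsmooth (chart_range phi) (fun y => Th rho phi (param phi y)).
Hypothesis Th_simplicial : forall p p' (mu : 'I_p.+1 -> 'I_p'.+1) (rho : 'I_p'.+1 -> diffeo M) phi psi x,
  {homo mu : i j / (i <= j)%N} -> atlas phi -> atlas psi -> dom phi x -> dom psi x ->
  related (affB R p p' (ext_vertices mu)) (affb R p' (ext_vertices mu)) (J phi psi idfun x)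
    (@simplex R p) (Th (rho \o mu) phi x) (Th rho psi x).
Hypothesis Th_invariant : forall p (sigma : diffeo M) (rho : 'I_p.+1 -> diffeo M) phi psi x,
  atlas phi -> atlas psi -> dom phi x -> dom psi (sigma x) ->
  related 1%:M 0 (J phi psi sigma x) (@simplex R p)
    (Th (fun i => diffeo_mul (rho i) sigma) phi x) (Th rho psi (sigma x)).
Hypothesis Th_jets : forall p phi, atlas phi -> exists k, forall s,
  @jet_smooth R n M p k p phi (fun rho x t => Th rho phi x t s).

(** The form E c, the primitive of a cocycle and linear combinations all arise in this way from
    chartwise data over the simplex, so the conditions on simplicial forms are checked in one place,
    [is_simplicial_of]. *)
Definition simplicial_of : sfamily := fun p rho => on_simplex (mkprod (Th rho)).

Lemma mkprod_form p (rho : 'I_p.+1 -> diffeo M) : is_form (@prod_atlas R n M p) q (mkprod (Th rho)).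
Proof.
apply: is_form_mkprod.
- by move=> phi x t; exact: Th_alternating.
- by move=> phi x t s; exact: Th_degree.
- by move=> phi psi x; exact: Th_charts.
- by move=> phi; exact: Th_smooth.
Qed.

Lemma is_simplicial_of : is_simplicial_form q simplicial_of.
Proof.
split.
- by move=> p rho; exists (mkprod (Th rho)) => //; exact: mkprod_form.
- move=> p p' mu rho hmu.
  apply/(@pullback_prodP R n M p p' (affB R p p' (ext_vertices mu)) (affb R p' (ext_vertices mu)) idfun).
  + exact: atlas_compatible.
  + by move=> y; rewrite simplex_mapE.
  + move=> phi psi x ap aq dx dx' t s st; rewrite /simplicial_of /on_simplex/= asboolT// mkprodE//.
    rewrite (Th_simplicial rho hmu ap aq dx dx' s st); apply: eq_pull => v _.
    rewrite asboolT ?mkprodE//; apply: aff_simplex => // i _; exact: ext_vertices_le.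
- move=> p sigma rho.
  apply/(@pullback_prodP R n M p p 1%:M 0 sigma).
  + by move=> phi psi ap aq; have [_] := diffeo_smooth sigma; apply.
  + by move=> y; rewrite mulmx1 addr0.
  + move=> phi psi x ap aq dx dx' t s st; rewrite /simplicial_of /on_simplex/= asboolT// mkprodE//.
    rewrite (Th_invariant rho ap aq dx dx' s st); apply: eq_pull => v _.
    by rewrite asboolT ?mkprodE// mulmx1 addr0.
- move=> p; apply/differentiable_simplex_formP => phi ap.
  have [k sk] := Th_jets p ap; exists k => s; apply: eq_jet_smooth (sk s) => rho x t dx st.
  by rewrite /simplicial_of /on_simplex/= asboolT// mkprodE.
Qed.

End Criterion.

Section Coefficients.
Variables (m : nat) (z : sfamily).
Hypothesis zform : is_simplicial_form m z.

(** The extension is chosen for each [rho] on its own: compatibility and invariance of [zeta]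
    therefore hold over the simplex, whereas a change of charts is respected on all of R^p. *)
Definition extension p (rho : 'I_p.+1 -> diffeo M) : coefs R ('rV[R]_p * M) (p + n) :=
  xget 0 [set w | is_form (@prod_atlas R n M p) m w /\ z rho = on_simplex w].

Lemma extensionP p (rho : 'I_p.+1 -> diffeo M) :
  is_form (@prod_atlas R n M p) m (extension rho) /\ z rho = on_simplex (extension rho).
Proof.
rewrite /extension; apply: (@xgetPex _ 0 [set w | is_form (@prod_atlas R n M p) m w /\ z rho = on_simplex w]).
by have [zs _ _ _] := zform; have [w fw Ew] := zs p rho; exists w.
Qed.

Definition zeta p (rho : 'I_p.+1 -> diffeo M) phi x : pform R p n :=
  fun t s => extension rho (prod_chart p phi) (t, x) s.

Lemma zetaE p (rho : 'I_p.+1 -> diffeo M) phi x t s : simplex t ->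
  z rho (prod_chart p phi) (t, x) s = zeta rho phi x t s.
Proof. by move=> st; rewrite (extensionP rho).2 /on_simplex/= asboolT. Qed.

Lemma z_neq0 p (rho : 'I_p.+1 -> diffeo M) Phi y s : z rho Phi y s <> 0 ->
  [/\ simplex y.1, exists2 phi, atlas phi & Phi = prod_chart p phi, dom Phi y & size s = m].
Proof.
have [[w0 _ _ _] ->] := extensionP rho; rewrite /on_simplex; case: asboolP => // st /w0[[phi ap <-] dx ss].
by split=> //; exists phi.
Qed.

Lemma z_off_chart p (rho : 'I_p.+1 -> diffeo M) phi x t s : ~ (atlas phi /\ dom phi x) ->
  z rho (prod_chart p phi) (t, x) s = 0.
Proof.
move=> nP; apply: contrapT => /z_neq0[_ [psi aq E] [_ dx] _].
by apply: nP; rewrite (prod_chart_inj E); split=> //; rewrite -(prod_chart_inj E).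
Qed.

Lemma zeta_degree p (rho : 'I_p.+1 -> diffeo M) phi x t s : size s != m -> zeta rho phi x t s = 0.
Proof.
have [[w0 _ _ _] _] := extensionP rho; move=> sm; apply: contrapT => /w0[_ _ ss].
by rewrite ss eqxx in sm.
Qed.

Lemma zeta_alternating p (rho : 'I_p.+1 -> diffeo M) phi x t : alternating (zeta rho phi x t).
Proof. by have [[_ wa _ _] _] := extensionP rho => s1 i j s2; exact: wa. Qed.

Lemma zeta_smooth p (rho : 'I_p.+1 -> diffeo M) phi : atlas phi ->
  fsmooth (chart_range phi) (fun y => zeta rho phi (param phi y)).
Proof. by move=> ap; have [[_ _ _ ws] _] := extensionP rho; exact: fsmooth_formF. Qed.

Lemma zeta_pcont p (rho : 'I_p.+1 -> diffeo M) phi x : atlas phi -> dom phi x ->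
  pcont (zeta rho phi x).
Proof.
move=> ap dx s; have := fsmooth_cont (s := s) (zeta_smooth rho ap) (range_coord dx).
by rewrite paramK.
Qed.

Lemma zeta_charts p (rho : 'I_p.+1 -> diffeo M) phi psi x :
  atlas phi -> atlas psi -> dom phi x -> dom psi x ->
  related 1%:M 0 (J phi psi idfun x) setT (zeta rho phi x) (zeta rho psi x).
Proof.
move=> ap aq dx dx'; have [[_ _ wp _] _] := extensionP rho.
have E : [set: 'rV[R]_p * M] = setT `*` setT by apply/seteqP; split.
rewrite E in wp.
have h1 (y : 'rV[R]_p * M) : idfun y = (y.1 *m 1%:M + 0, idfun y.2).
  by case: y => t y; rewrite /= mulmx1 addr0.
exact: ((@pullback_prodP R n M p p 1%:M 0 idfun (@atlas_compatible R n M) setT idfun _ _ h1).1 wp phi psi x ap aq dx dx').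
Qed.

Lemma zeta_simplicial p p' (mu : 'I_p.+1 -> 'I_p'.+1) (rho : 'I_p'.+1 -> diffeo M) phi psi x :
  {homo mu : i j / (i <= j)%N} -> atlas phi -> atlas psi -> dom phi x -> dom psi x ->
  related (affB R p p' (ext_vertices mu)) (affb R p' (ext_vertices mu)) (J phi psi idfun x)
    (@simplex R p) (zeta (rho \o mu) phi x) (zeta rho psi x).
Proof.
move=> hmu ap aq dx dx' t s st; have [_ zp _ _] := zform.
have h1 (y : 'rV[R]_p * M) : (simplex_map mu y.1, y.2) = (y.1 *m affB R p p' (ext_vertices mu) + affb R p' (ext_vertices mu), idfun y.2).
  by rewrite simplex_mapE.
rewrite -zetaE//.
rewrite ((@pullback_prodP R n M _ _ _ _ idfun (@atlas_compatible R n M) _ _ _ _ h1).1 (zp p p' mu rho hmu) phi psi x ap aq dx dx' t s st).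
apply: eq_pull => v _; apply: zetaE; apply: aff_simplex => // i _; exact: ext_vertices_le.
Qed.

Lemma zeta_invariant p (sigma : diffeo M) (rho : 'I_p.+1 -> diffeo M) phi psi x :
  atlas phi -> atlas psi -> dom phi x -> dom psi (sigma x) ->
  related 1%:M 0 (J phi psi sigma x) (@simplex R p)
    (zeta (fun i => diffeo_mul (rho i) sigma) phi x) (zeta rho psi (sigma x)).
Proof.
move=> ap aq dx dx' t s st; have [_ _ zs _] := zform.
have h1 (y : 'rV[R]_p * M) : (y.1, sigma y.2) = (y.1 *m 1%:M + 0, sigma y.2).
  by rewrite mulmx1 addr0.
have ss phi' psi' : atlas phi' -> atlas psi' -> smooth_in_charts phi' psi' sigma.
  by move=> ap' aq'; have [_] := diffeo_smooth sigma; apply.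
rewrite -zetaE//.
rewrite ((@pullback_prodP R n M _ _ _ _ sigma ss _ _ _ _ h1).1 (zs p sigma rho) phi psi x ap aq dx dx' t s st).
by apply: eq_pull => v _; apply: zetaE; rewrite mulmx1 addr0.
Qed.

Lemma zeta_jets p phi : atlas phi -> exists k, forall s,
  @jet_smooth R n M p k p phi (fun rho x t => zeta rho phi x t s).
Proof.
move=> ap; have [_ _ _ zd] := zform.
have [k zk] := (differentiable_simplex_formP (@z p)).1 (zd p) phi ap.
by exists k => s; apply: eq_jet_smooth (zk s) => rho x t _ st; rewrite zetaE.
Qed.

Lemma zeta_extd p (rho : 'I_p.+1 -> diffeo M) phi x t s : atlas phi -> dom phi x -> simplex t ->
  simplex_extd (z rho) (prod_chart p phi) (t, x) s =
  dfm (fun y => zeta rho phi (param phi y)) (coord phi x) t s.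
Proof.
move=> ap dx st; have [[_ _ _ ws] ->] := extensionP rho.
by rewrite simplex_extdE// /on_simplex/= asboolT// extd_prod.
Qed.

Lemma extd_off_chart p (rho : 'I_p.+1 -> diffeo M) phi x t s : ~ (atlas phi /\ dom phi x) ->
  simplex_extd (z rho) (prod_chart p phi) (t, x) s = 0.
Proof.
move=> nP; have [[_ _ _ ws] ->] := extensionP rho.
rewrite simplex_extdE// /on_simplex/=; case: asboolP => // _.
rewrite /extd asboolF// => -[[psi aq E] [_ dx]].
by apply: nP; rewrite -(prod_chart_inj E); split=> //; rewrite (prod_chart_inj E).
Qed.

Local Notation fz := (integration_along_fibers M z).

Lemma integrationE p (rho : 'I_p.+1 -> diffeo M) phi x s : atlas phi -> dom phi x ->
  fz p rho phi x s = epsw (iota 0 p.+1) (zeta rho phi x) 0 (map (@rshift p n) s).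
Proof.
move=> ap dx; rewrite -fiber_epsw; [|exact: zeta_pcont|exact: zeta_alternating].
apply: eq_simplex_integral => // t t0 t1; apply: zetaE.
exact/simplexP.
Qed.

Lemma integration_neq0 p (rho : 'I_p.+1 -> diffeo M) phi x s : fz p rho phi x s <> 0 ->
  [/\ atlas phi, dom phi x & (p + size s)%N = m].
Proof.
move=> f0; have [ad|nad] := pselect (atlas phi /\ dom phi x); last first.
  case: f0; rewrite -[RHS](simplex_integral0 p 1); congr simplex_integral.
  by apply/funext => t; rewrite z_off_chart.
split; [exact: ad.1|exact: ad.2|apply: contrapT => sm; apply: f0].
rewrite -[RHS](simplex_integral0 p 1); congr simplex_integral.
apply/funext => t; apply: contrapT => /z_neq0[_ _ _ E].
by apply: sm; rewrite -E size_cat !size_map -enumT size_enum_ord.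
Qed.

Lemma epsw_related (D : set 'rV[R]_0) p (C : 'M[R]_n) D' (eta eta' : pform R p n) s :
  (forall t j u, D' t -> 0 <= u <= 1 -> D' (seg (vtx R p j) t u)) -> D' (vtx R p 0) ->
  pcont eta' -> related 1%:M 0 C D' eta eta' ->
  epsw (iota 0 p.+1) eta 0 (map (@rshift p n) s) =
  pull C (fun v => epsw (iota 0 p.+1) eta' 0 (map (@rshift p n) v)) s.
Proof.
move=> sD D0 ce ee; rewrite (epsw_const _ _ 0 (vtx R p 0)).
rewrite (@related_epsw R p p n n 1%:M 0 C id D' _ sD (iota 0 p.+1) eta eta' ce ee)//; last first.
  by move=> j; rewrite mulmx1 addr0.
rewrite pull_block_rshift map_id; apply: eq_pull => v _; exact: epsw_const.
Qed.

Lemma integration_cochain : is_bott_cochain m fz.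
Proof.
move=> p; split.
- move=> rho; case: leqP => pm; last first.
    apply/funext => phi; apply/funext => x; apply/funext => s; apply: contrapT.
    by move=> /integration_neq0[_ _]; move: pm => /[swap] <-; rewrite ltnNge leq_addr.
  split.
  + by move=> phi x s /integration_neq0[ap dx <-]; split=> //; lia.
  + move=> phi x s1 i j s2; have [[ap dx]|nad] := pselect (atlas phi /\ dom phi x).
      rewrite !integrationE// !map_cat !map_cons.
      exact: (@alternating_epsw p (iota 0 p.+1) (zeta rho phi x) (@zeta_pcont p rho phi x ap dx)
        (@zeta_alternating p rho phi x) 0 (map (@rshift p n) s1) (rshift p i) (rshift p j)
        (map (@rshift p n) s2)).
    have f0 s : fz p rho phi x s = 0 by apply: contrapT => /integration_neq0[? ? _]; apply: nad.
    by rewrite !f0 oppr0.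
  + move=> phi psi x ap aq _ dx dx'; apply/funext => s; rewrite integrationE//.
    rewrite (@epsw_related setT p (J phi psi idfun x) setT _ (zeta rho psi x))//.
    * by apply: eq_pull => v _; rewrite integrationE.
    * exact: zeta_pcont.
    * exact: zeta_charts.
  + move=> phi s ap; apply: (eq_smooth_on (open_range ap)
      (f := fun y => epsw (iota 0 p.+1) (zeta rho phi (param phi y)) 0 (map (@rshift p n) s))).
      by move=> y Oy; rewrite integrationE//; exact: dom_param.
    apply: (psmooth_at (g := fun y t => epsw (iota 0 p.+1) (zeta rho phi (param phi y)) t (map (@rshift p n) s)));
      first exact: open_range.
    have oU := open_range ap.
    by apply: (fsmooth_epsw oU (iota 0 p.+1) (zeta_smooth rho ap)).
- move=> sigma rho phi psi x ap aq _ dx dx'; apply/funext => s; rewrite integrationE//.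
  rewrite (@epsw_related setT p (J phi psi sigma x) (@simplex R p) _ (zeta rho psi (sigma x)))//.
  + by apply: eq_pull => v _; rewrite integrationE.
  + by move=> t j u; exact: simplex_seg.
  + exact: simplex_vtx.
  + exact: zeta_pcont.
  + exact: zeta_invariant.
- apply/differentiable_cochainP => phi ap; have [k zk] := zeta_jets p ap; exists k => s.
  have sk := @jet_smooth_epsw R n M p k p phi (iota 0 p.+1) (fun rho x => zeta rho phi x) zk (map (@rshift p n) s).
  apply: eq_jet_smooth (@jet_smooth_vtx R n M p 0 k p phi 0 _ sk) => rho x t dx _.
  by rewrite integrationE//; exact: epsw_const.
Qed.

(** A weakly increasing word is the image of 0 1 ... q under a monotone map [mu], and compatibility
    of z along [mu] identifies its integral over the word with the fiber integral for [rho \o mu].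
    Monotonicity of [mu] is where the order of the letters enters. *)
Lemma epsw_sorted p (rho : 'I_p.+1 -> diffeo M) phi x w t s : atlas phi -> dom phi x ->
  w != [::] -> sorted leq w -> all (fun i => (i <= p)%N) w ->
  epsw w (zeta rho phi x) t s = liftx (word_value fz (ext_tuple rho) w phi x) s.
Proof.
move=> ap dx w0 ow aw; have [q sw] : exists q, size w = q.+1.
  by case: (w) w0 => // a l _; exists (size l).
rewrite liftxE; last exact: epsw_nt.
apply: eq_liftx => v; rewrite (@word_valueE _ _ _ _ _ _ q)//.
pose mu (i : 'I_q.+1) : 'I_p.+1 := inord (nth 0%N w i).
have muE i : (i <= q)%N -> nth 0%N w i = mu (inord i).
  move=> iq; have e : (inord i : 'I_q.+1) = i :> nat by rewrite inordK.
  rewrite /mu e inordK// ltnS.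
  by apply: (allP aw); rewrite mem_nth// sw ltnS.
have evE i : ext_vertices mu i = wmap w i.
  by rewrite /ext_vertices /wmap sw -muE// geq_minr.
have hmu : {homo mu : i j / (i <= j)%N}.
  move=> i j ij; have := wmap_homo ow ij; rewrite -!evE !ext_verticesE.
  by [].
have -> : (fun i : 'I_q.+1 => ext_tuple rho (nth 0%N w i)) = rho \o mu.
  apply/funext => i; have iq : (i <= q)%N by rewrite -ltnS.
  rewrite /ext_tuple/= muE// inord_val (minn_idPl _) ?inord_val//.
  by rewrite -ltnS.
rewrite integrationE// (epsw_const _ _ 0 (vtx R q 0)).
rewrite (related_epsw (mu := ext_vertices mu) _ _ (iota 0 q.+1) (@zeta_pcont p rho phi x ap dx)
  (@zeta_simplicial q p mu rho phi phi x hmu ap ap dx dx))//.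
- rewrite jacobian_same// pull_rshift.
  have -> : map (ext_vertices mu) (iota 0 q.+1) = w.
    by rewrite (eq_map evE) -sw wmap_iota.
  exact: epsw_const.
- by move=> j; apply: aff_vtx => i; exact: ext_vertices_vtx.
- by move=> t' j u; exact: simplex_seg.
- exact: simplex_vtx.
Qed.

(** Stokes' formula for the word 0 1 ... p. The faces are increasing words and give the group
    coboundary by [epsw_sorted]; minus the sign (-1)^(p+1) is the sign (-1)^p of d in the total
    differential. *)
Lemma integration_differential :
  integration_along_fibers M (@differential R (simplicial_deRham_complex M) z) =
  bott_differential fz.
Proof.
apply: functional_extensionality_dep => p; apply/funext => rho; apply/funext => phi.
apply/funext => x; apply/funext => s.
have -> : bott_differential fz rho phi x s = group_coboundary fz rho phi x s +
    (-1) ^+ p * extd atlas (fz p rho) phi x s by [].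
have [[ap dx]|nad] := pselect (atlas phi /\ dom phi x); last first.
  have f0 q (rho' : 'I_q.+1 -> diffeo M) s' : fz q rho' phi x s' = 0.
    by apply: contrapT => /integration_neq0[? ? _]; apply: nad.
  rewrite /extd asboolF// mulr0 addr0.
  have -> : group_coboundary fz rho phi x s = 0.
    case: p rho => [|p] rho //=; rewrite coefs_sumE big1// => i _.
    by rewrite -[LHS]/((-1) ^+ i * fz p (fun j => rho (lift i j)) phi x s) f0 mulr0.
  rewrite -[RHS](simplex_integral0 p 1); congr simplex_integral.
  by apply/funext => t; exact: extd_off_chart.
have oU := open_range ap; have Uy := range_coord dx.
pose F y := zeta rho phi (param phi y).
have sF : fsmooth (chart_range phi) F by exact: zeta_smooth.
have aF y t : chart_range phi y -> alternating (F y t) by move=> _; exact: zeta_alternating.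
have Fx : F (coord phi x) = zeta rho phi x by rewrite /F paramK.
transitivity (simplex_integral 1 (fun t : 'rV[R]_p => dfm F (coord phi x) t
    (map (@lshift p n) (enum 'I_p) ++ map (@rshift p n) s))).
  apply: eq_simplex_integral => // t t0 t1; apply: zeta_extd => //; exact/simplexP.
rewrite fiber_epsw; last first.
- by move=> t; apply: (alternating_dfm (O := chart_range phi)) => // t'; exact: aF.
- by move=> v; have := fsmooth_cont (s := v) (fsmooth_dfm oU sF) Uy.
rewrite (epsw_dfm oU)// size_iota exprS mulN1r mulNr opprK; congr (_ + _ * _).
  rewrite -[in RHS](word_value_iota (group_coboundary fz) rho) -coface_word_value.
  apply: eq_coface => v vp; rewrite size_iota => -[sv]; rewrite Fx.
  case: p rho F sF aF Fx v vp sv => [|p] rho F sF aF Fx v vp sv.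
    by case: v sv {vp}.
  rewrite epsw_sorted ?liftx_rshift//.
  - by case: (v) sv.
  - exact: (subseq_sorted leq_trans vp (iota_sorted _ _)).
  - by apply/allP => i /(mem_subseq vp); rewrite mem_iota.
rewrite (eq_dfm oU (G := fun y _ s => liftx (formM (fz p rho) phi y) s))//.
  by rewrite dfm_liftx liftx_rshift extdE.
move=> y t v Oy; rewrite epsw_sorted ?word_value_iota//.
- exact: dom_param.
- exact: iota_sorted.
- by apply/allP => i; rewrite mem_iota.
Qed.

End Coefficients.
End SimplicialForms.

(** * Simplicial forms built from Bott cochains *)

Section FormsOfWords.
Variables (R : realType) (n : nat).

Lemma affB_id p : affB R p p id = 1%:M.
Proof.
apply/matrixP => i j; rewrite !mxE min0n subr0 (minn_idPl (ltn_ord i)) eqSS.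
by [].
Qed.

Lemma affb_id p : affb R p id = 0.
Proof. by apply/rowP => j; rewrite !mxE min0n. Qed.

Lemma Aop_degree p k q d (psi : seq nat -> pform R p k) t s :
  (forall w s, size w = q -> (size s + q)%N != d -> psi w t s = 0) ->
  size s != d -> Aop q psi t s = 0.
Proof.
elim: q psi d s => [|q IH] psi d s psi0 sd /=; first by apply: psi0; rewrite ?addn0.
rewrite big1// => i _; rewrite -[RHS](@asum0 R _ s); apply: eq_asum => a v sv.
rewrite (_ : Aop _ _ _ _ = 0) ?mulr0//; case: d psi0 sd => [|d] psi0 sd.
  rewrite -[RHS](Aop0 (R := R) (n := k) q t v); apply: eq_Aop => w u sw.
  by apply: psi0; rewrite /= ?sw// addnS.
apply: (IH _ d); last by move: sd; rewrite sv eqSS.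
by move=> w u sw ud; apply: psi0; rewrite /= ?sw// addnS eqSS.
Qed.

Lemma Bop_degree p k q d (psi : seq nat -> pform R p k) t s :
  (forall w s, size w = q.+1 -> (size s + q)%N != d -> psi w t s = 0) ->
  size s != d -> Bop q psi t s = 0.
Proof.
move=> psi0 sd; rewrite /Bop big1// => i _; rewrite (@Aop_degree p k q d) ?mulr0// => w u sw ud.
by apply: psi0; rewrite //= sw.
Qed.

Lemma liftxB p (g h : seq 'I_n -> R) (s : seq 'I_(p + n)) :
  liftx (fun v => g v - h v) s = liftx g s - liftx h s.
Proof.
elim: s g h => //= a s IH g h; case: (fintype.split a) => j; first by rewrite subrr.
exact: (IH (fun v => g (j :: v)) (fun v => h (j :: v))).
Qed.

Lemma liftx0 p (s : seq 'I_(p + n)) : liftx (fun _ : seq 'I_n => 0) s = 0 :> R.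
Proof. by elim: s => //= a s IH; case: (fintype.split a). Qed.

Lemma liftx_asum p X (W : X -> seq X -> seq 'I_n -> R) l (s : seq 'I_(p + n)) :
  liftx (fun u => asum (fun a v => W a v u) l) s = asum (fun a v => liftx (W a v) s) l.
Proof.
elim: l W => [|a l IH] W /=; first exact: liftx0.
by rewrite liftxB (IH (fun b v => W b (a :: v))).
Qed.

Lemma alternating_ev X (L : chain R) (G : seq nat -> seq X -> R) :
  (forall w, alternating (G w)) -> alternating (fun s => ev L (fun w => G w s)).
Proof.
move=> aG s1 i j s2; rewrite /ev -sumrN; apply: eq_bigr => x _.
by rewrite aG mulrN.
Qed.

Definition word_psi p (W : seq nat -> seq 'I_n -> R) (w : seq nat) : pform R p n :=
  fun _ s => ev (sorting R w) (fun v => liftx (W v) s).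

(** [W v] will be a form of degree m + 1 - [size v], so that terms with more than m factors dt would
    be 0. *)
Definition Eop p m (W : seq nat -> seq 'I_n -> R) : pform R p n := fun t s =>
  \sum_(q < m.+1) Bop q (word_psi W) t s.

Lemma alternating_Eop p m W : (forall v, alternating (W v)) ->
  forall t, alternating (@Eop p m W t).
Proof.
move=> aW t; apply: alternating_sum => q; apply: alternating_Bop => w t'.
by apply: alternating_ev => v; exact: alternating_liftx.
Qed.

Lemma Eop_degree p m W : (forall v s, (size s + size v)%N != m.+1 -> W v s = 0) ->
  forall t s, size s != m -> @Eop p m W t s = 0.
Proof.
move=> W0 t s sm; rewrite /Eop big1// => q _; apply: (@Bop_degree p n q m) => // w u sw um.
rewrite /word_psi -[RHS](ev_nil (fun=> 0)) ev_nil /ev big1_seq// => x /andP[_ xr].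
have [sx _ _] := sorting_words (map_f snd xr).
have [u0|u0] := eqVneq (nt u) 0%N; last by rewrite liftx_nt ?mulr0.
have [v uv] := nt0P u0; rewrite uv liftx_rshift W0 ?mulr0//.
by rewrite sx sw addnS eqSS -(size_map (@rshift p n)) -uv.
Qed.

Lemma related_Eop p p' m (C : 'M[R]_n) (mu : nat -> nat) (D : set 'rV[R]_p) W W' :
  {homo mu : i j / (i <= j)%N} -> (forall i, (i <= p -> mu i <= p')%N) ->
  (forall v s, W v s = pull C (W' (map mu v)) s) ->
  related (affB R p p' mu) (affb R p' mu) C D (Eop m W) (Eop m W').
Proof.
move=> hmu lmu WW t s _; rewrite /Eop pull_sum; apply: eq_bigr => q _.
apply: (related_Bop (mu := mu)) => //.
- by move=> t' l; exact: aff_bary.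
- by move=> a l; exact: aff_dbary.
move=> w u; rewrite /word_psi pull_ev sorting_map//.
by apply: eq_ev => v _; rewrite pull_liftx; apply: eq_liftx => u'; rewrite WW.
Qed.

Lemma fsmooth_liftx p (O : set 'rV[R]_n) (G : 'rV[R]_n -> seq 'I_n -> R) : open O ->
  (forall v, smooth_on O (fun y => G y v)) ->
  fsmooth O (fun y (_ : 'rV[R]_p) => @liftx R p n (G y)).
Proof.
move=> oO sG s; have [s0|s0] := eqVneq (nt s) 0%N.
  have [v ->] := nt0P s0.
  apply: (eq_psmooth oO (g := fun y _ => G y v)); first by move=> y t _; rewrite liftx_rshift.
  exact: psmooth_lift.
apply: (eq_psmooth oO (g := fun _ _ => 0)); last exact: psmooth_cst.
by move=> y t _; rewrite liftx_nt.
Qed.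

Section FamilyOfWordFunctions.
Variables (p m : nat) (O : set 'rV[R]_n) (G : 'rV[R]_n -> seq nat -> seq 'I_n -> R).
Hypothesis oO : open O.
Hypothesis sG : forall v u, smooth_on O (fun y => G y v u).

Lemma fsmooth_word_psi w : fsmooth O (fun y => @word_psi p (G y) w).
Proof.
apply: (@fsmooth_ev R p n O oO _ (fun v y _ => liftx (G y v))) => v.
exact: fsmooth_liftx.
Qed.

Lemma fsmooth_Eop : fsmooth O (fun y => @Eop p m (G y)).
Proof.
move=> s; apply: psmooth_sum => // q _.
by apply: (@fsmooth_Bop _ _ _ _ _ oO q (fun w y => word_psi (G y) w)) => w; exact: fsmooth_word_psi.
Qed.

(** Differentiating t_(i_0) gives an [Aop], which [Bop_cof] rewrites as [Bop q.+1] of the coface: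
    this is the share of the group coboundary. The derivatives of the coefficients are the share of
    d on M. *)
Lemma dfm_Eop y t s : O y ->
  dfm (fun y => @Eop p m (G y)) y t s = \sum_(q < m.+1)
    (Bop q.+1 (word_psi (fun v u => coface (fun v => G y v u) v)) t s + (-1) ^+ q *
     Bop q (word_psi (fun v => asum (fun a u => 'D_(delta_mx 0 a) (fun y => G y v u) y))) t s).
Proof.
move=> Oy; rewrite (dfm_sum oO _ (F := fun (q : 'I_m.+1) y => Bop q (word_psi (G y))))//; last first.
  move=> q; apply: (@fsmooth_Bop _ _ _ _ _ oO q (fun w y => word_psi (G y) w)) => w.
  exact: fsmooth_word_psi.
apply: eq_bigr => q _.
rewrite (dfm_Bop oO q (psi := fun w y => word_psi (G y) w))//; last first.
  by move=> w; exact: fsmooth_word_psi.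
congr (_ + _ * _).
  rewrite -Bop_cof; apply: eq_Bop => w u _; rewrite /cof /word_psi -ev_sorting_coface.
  by apply: eq_ev => v _; exact/esym/(liftx_asum (fun _ v u => G y v u)).
apply: eq_Bop => w u _; rewrite /word_psi (@dfm_ev _ _ _ _ oO _ (fun v y _ => liftx (G y v)))//.
  by apply: eq_ev => v _; exact: (dfm_liftx (fun y => G y v)).
by move=> v; exact: fsmooth_liftx.
Qed.

End FamilyOfWordFunctions.

Lemma wdg_cat (X : eqType) (al : X -> R) (G : seq X -> R) l r : {in r, forall a, al a = 0} ->
  wdg al G (l ++ r) = wdg al (fun v => G (v ++ r)) l.
Proof.
have E a l' H : wdg al H (a :: l') = al a * H l' - wdg al (fun v => H (a :: v)) l' by [].
move=> al0; elim: l G => [|a l IH] G /=.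
  elim: r al0 G => // a r IH al0 G; rewrite E al0 ?mem_head// mul0r sub0r.
  by rewrite IH ?oppr0// => b br; apply: al0; rewrite inE br orbT.
by rewrite !E IH.
Qed.

(* Only the coefficient of dt_i1 /\ ... /\ dt_iq matters. *)
Lemma Bop_slice p q (G : seq nat -> seq 'I_n -> R) (t : 'rV[R]_p) es s :
  Bop q (fun w _ u => liftx (G w) u) t (map (lshift n) es ++ map (@rshift p n) s) =
  Bop q (fun w (_ : 'rV[R]_p) u => (u == [::])%:R * G w s) t (map (@lshift p 0) es).
Proof.
have dE k (i : 'I_p.+1) e : dbary i (lshift k e) = (i == lift ord0 e)%:R - (i == ord0)%:R :> R.
  by rewrite /dbary -[fintype.split _]/(fintype.split (unsplit (inl e))) unsplitK.
have A k H l : Aop k (fun w _ u => liftx (H w) u) t (map (lshift n) l ++ map (@rshift p n) s) =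
    Aop k (fun w (_ : 'rV[R]_p) u => (u == [::])%:R * H w s) t (map (@lshift p 0) l).
  elim: k H l => [|k IH] H l /=.
    case: l => [|e l]; first by rewrite mul1r liftx_rshift.
    by rewrite mul0r liftx_nt// /nt/= isT_lshift.
  apply: eq_bigr => i _; rewrite wdg_cat; last first.
    move=> a /mapP[b _ ->].
    by rewrite /dbary -[fintype.split _]/(fintype.split (unsplit (inr b))) unsplitK.
  rewrite /wdg !asum_map; apply: eq_asum => e v _; rewrite !dE; congr (_ * _).
  exact: (IH (fun w => H ((i : nat) :: w))).
by apply: eq_bigr => i _; congr (_ * _); exact: (A q (fun w => G ((i : nat) :: w)) es).
Qed.

(** In top degree in t only the term with exactly p factors dt survives, and its scalar part is what
    [Lam] integrates. For p > m this term is missing from [Eop], but then the values of W vanish by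
    degree. *)
Lemma fiber_Eop p m (W : seq nat -> seq 'I_n -> R) s :
  (forall v s, (size s + size v)%N != m.+1 -> W v s = 0) ->
  simplex_integral 1 (fun t : 'rV[R]_p =>
    Eop m W t (map (lshift n) (enum 'I_p) ++ map (@rshift p n) s)) =
  ev (averages R (iota 0 p.+1)) (fun v => W v s).
Proof.
move=> W0; rewrite ev_averages size_iota /=.
transitivity (Lam p (fun v => W v s)); last first.
  apply: eq_Lam => v _ av; congr (W _ s); rewrite -[LHS]map_id; apply/eq_in_map => i /(allP av) ip.
  by rewrite -[0%N :: _]/(iota 0 p.+1) nth_iota.
congr simplex_integral; apply/funext => t; set l := map (@lshift p 0) _.
have sl : size l = p by rewrite size_map; exact: size_enum_ord.
transitivity (\sum_(q < m.+1) Bop q (scalar_psi (fun v => W v s)) t l).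
  apply: eq_bigr => q _.
  rewrite -(@Bop_slice p q (fun w u => ev (sorting R w) (fun v => W v u)) t (enum 'I_p) s).
  by apply: eq_Bop => w u _; exact/esym/(liftx_ev (sorting R w) W).
have S0 q : q != p -> Bop q (scalar_psi (fun v => W v s)) t l = 0.
  move=> qp; apply: (@Bop_degree p 0 q q); last by rewrite sl eq_sym.
  move=> w u _; rewrite -[X in _ != X]add0n eqn_add2r => u0.
  by rewrite /scalar_psi; case: (u) u0 => // a u' _; rewrite mul0r.
case: (ltnP p m.+1) => pm.
  rewrite (bigD1 (Ordinal pm))//= big1 ?addr0// => q qp; apply: S0.
  by apply: contra qp => /eqP qp; apply/eqP/val_inj.
rewrite big1 => [|q _]; last by apply: S0; rewrite ltn_eqF// (leq_trans (ltn_ord q)).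
rewrite -[LHS](Bop0 (R := R) (n := 0) p t l); apply: eq_Bop => w u sw.
rewrite /scalar_psi /ev big1_seq ?mulr0// => x /andP[_ xr].
have [sx _ _] := sorting_words (map_f snd xr).
by rewrite W0 ?mulr0// sx sw; lia.
Qed.

End FormsOfWords.

Section Supports.
Variables (R : realType) (n : nat) (M : smoothManifold R n).
Local Notation sfamily := (family (simplicial_form M)).

(** Coefficients without meaning are 0, so two such families are equal as soon as they agree in
    product charts over the simplex ([eq_supported]). *)
Definition supported (A : sfamily) := forall p (rho : 'I_p.+1 -> diffeo M) Phi y s,
  A p rho Phi y s <> 0 -> simplex y.1 /\
    exists phi, [/\ @atlas R n M phi, Phi = prod_chart p phi & dom phi y.2].

Lemma eq_supported (A B : sfamily) : supported A -> supported B ->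
  (forall p (rho : 'I_p.+1 -> diffeo M) phi x t s, @atlas R n M phi -> dom phi x -> simplex t ->
    A p rho (prod_chart p phi) (t, x) s = B p rho (prod_chart p phi) (t, x) s) -> A = B.
Proof.
move=> sA sB AB; apply: functional_extensionality_dep => p; apply/funext => rho.
apply/funext => Phi; apply/funext => -[t x]; apply/funext => s.
have [[st [phi [ap -> dx]]]|nP] := pselect (simplex t /\
  exists phi, [/\ @atlas R n M phi, Phi = prod_chart p phi & dom phi x]); first exact: AB.
have -> : A p rho Phi (t, x) s = 0 by apply: contrapT => /sA.
by apply/esym; apply: contrapT => /sB.
Qed.

Lemma supported_simplicial_of Th : supported (@simplicial_of R n M Th).
Proof.
move=> p rho Phi y s; rewrite /simplicial_of /on_simplex; case: asboolP => // st.
by move=> /mkprod_neq0.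
Qed.

Lemma supported_form m z : is_simplicial_form m z -> supported z.
Proof.
move=> zf p rho Phi y s /(z_neq0 zf)[st [phi ap ->] [_ dx] _]; split=> //.
by exists phi.
Qed.

Lemma supported_extd m z : is_simplicial_form m z ->
  supported (fun p rho => simplex_extd (z p rho)).
Proof.
move=> zf p rho Phi [t x] s; have [[_ _ _ ws] E] := extensionP zf rho.
rewrite [X in X -> _]/= (_ : z p rho = on_simplex (extension m z rho))// simplex_extdE//.
rewrite /on_simplex; case: asboolP => // st; rewrite /extd; case: asboolP => // -[[phi ap <-] [_ dx]] _.
by split=> //; exists phi.
Qed.

End Supports.

(** * The chain map E and the homotopy on Bott cochains *)

Section BottCochains.
Variables (R : realType) (n : nat) (M : smoothManifold R n).
Local Notation atlas := (@atlas R n M).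
Local Notation J phi psi f x := ('J (local_map phi psi f) (coord phi x)).
Variables (m : nat) (c : family (bott_cochain M)).
Hypothesis cc : is_bott_cochain m c.
Implicit Types (phi psi : chart R M n) (x : M) (g : nat -> diffeo M) (v w : seq nat).

Lemma pull0 k l (A : 'M[R]_(k, l)) s : pull A (fun=> 0) s = 0.
Proof. by rewrite -[RHS](mul0r (pull A (fun=> 0) s)) -pullZ; apply: eq_pull => v _; rewrite mul0r. Qed.

Lemma c_above p (rho : 'I_p.+1 -> diffeo M) : (m < p)%N -> c rho = 0.
Proof. by move=> mp; have [/(_ rho) + _ _] := cc p; rewrite leqNgt mp. Qed.

Lemma c_form p (rho : 'I_p.+1 -> diffeo M) : (p <= m)%N -> is_form atlas (m - p) (c rho).
Proof. by move=> pm; have [/(_ rho) + _ _] := cc p; rewrite pm. Qed.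

Lemma word_value_neq0 g v phi x s : word_value c g v phi x s <> 0 ->
  [/\ atlas phi, dom phi x & (size s + size v)%N = m.+1].
Proof.
case: v => [|a v] //=; case: (leqP (size v) m) => vm; last by rewrite c_above.
have [w0 _ _ _] := c_form (fun i : 'I_(size v).+1 => g (nth 0%N (a :: v) i)) vm.
by move=> /w0[ap dx ->]; split=> //; lia.
Qed.

Lemma word_value_degree g v phi x s : (size s + size v)%N != m.+1 ->
  word_value c g v phi x s = 0.
Proof. by move=> sv; apply: contrapT => /word_value_neq0[_ _ E]; rewrite E eqxx in sv. Qed.

Lemma word_value_alternating g v phi x : alternating (word_value c g v phi x).
Proof.
case: v => [|a v] s1 i j s2; first by rewrite oppr0.
rewrite /word_value; case: (leqP (size v) m) => vm; last by rewrite c_above//= oppr0.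
by have [_ wa _ _] := c_form (fun i : 'I_(size v).+1 => g (nth 0%N (a :: v) i)) vm; exact: wa.
Qed.

Lemma word_value_charts g v phi psi x s : atlas phi -> atlas psi -> dom phi x -> dom psi x ->
  word_value c g v phi x s = pull (J phi psi idfun x) (word_value c g v psi x) s.
Proof.
move=> ap aq dx dx'; case: v => [|a v]; first by rewrite pull0.
rewrite /word_value; case: (leqP (size v) m) => vm; last by rewrite c_above// pull0.
have [_ _ wp _] := c_form (fun i : 'I_(size v).+1 => g (nth 0%N (a :: v) i)) vm.
by rewrite (wp phi psi x).
Qed.

Lemma word_value_smooth g v phi s : atlas phi ->
  smooth_on (chart_range phi) (fun y => word_value c g v phi (param phi y) s).
Proof.
move=> ap; case: v => [|a v]; first exact: smooth_on_cst.
rewrite /word_value; case: (leqP (size v) m) => vm; last by rewrite c_above//; exact: smooth_on_cst.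
have [_ _ _ ws] := c_form (fun i : 'I_(size v).+1 => g (nth 0%N (a :: v) i)) vm.
exact: ws.
Qed.

Lemma word_value_invariant (sigma : diffeo M) g v phi psi x s :
  atlas phi -> atlas psi -> dom phi x -> dom psi (sigma x) ->
  word_value c (fun j => diffeo_mul (g j) sigma) v phi x s =
  pull (J phi psi sigma x) (word_value c g v psi (sigma x)) s.
Proof.
move=> ap aq dx dx'; case: v => [|a v]; first by rewrite pull0.
have [_ ci _] := cc (size v).
by have := ci sigma (fun i : 'I_(size v).+1 => g (nth 0%N (a :: v) i)) phi psi x ap aq I dx dx' => /(congr1 (fun f => f s)).
Qed.

(** One order k serves all words: the cochain vanishes above degree m, so finitely many jet orders
    have to be bounded. *)
Lemma word_value_jets p phi : atlas phi -> exists k, forall v s,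
  @jet_smooth R n M 0 k p phi (fun rho x _ => word_value c (ext_tuple rho) v phi x s).
Proof.
move=> ap.
have [k ck] : exists k, forall q, (q < m.+1)%N -> forall s,
    @jet_smooth R n M 0 k q phi (fun rho x _ => c rho phi x s).
  elim: m.+1 => [|N [k IH]]; first by exists 0%N.
  have [_ _ cd] := cc N; have [k' ck'] := (differentiable_cochainP (@c N)).1 cd phi ap.
  exists (maxn k k') => q; rewrite ltnS leq_eqVlt => /orP[/eqP -> s|qN s].
    exact: (@jet_smooth_select R n M 0 k' (maxn k k') N N phi id _ (leq_maxr _ _) (ck' s)).
  exact: (@jet_smooth_select R n M 0 k (maxn k k') q q phi id _ (leq_maxl _ _) (IH q qN s)).
exists k => -[|a v] s; first exact: jet_smooth0.
rewrite /word_value; case: (leqP (size v) m) => vm; last first.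
  by apply: eq_jet_smooth (@jet_smooth0 _ _ _ _ _ _ _) => rho x t _ _; rewrite c_above.
have H := @jet_smooth_select R n M 0 k k p (size v) phi
  (fun i => inord (minn (nth 0%N (a :: v) i) p)) (fun rho x (_ : 'rV[R]_0) => c rho phi x s)
  (leqnn _) (ck _ vm s).
exact: eq_jet_smooth H.
Qed.

(** The form E c'. Degree and family are arguments because E is applied to the differential of [c]
    and to the integral of a form as well. *)
Definition word_form m' (c' : family (bott_cochain M)) : family (simplicial_form M) :=
  simplicial_of (fun p rho phi x => @Eop R n p m' (fun v => word_value c' (ext_tuple rho) v phi x)).

Lemma word_formE m' c' p (rho : 'I_p.+1 -> diffeo M) phi x t s : atlas phi -> dom phi x ->
  simplex t -> word_form m' c' rho (prod_chart p phi) (t, x) s =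
  Eop m' (fun v => word_value c' (ext_tuple rho) v phi x) t s.
Proof. by move=> ap dx st; rewrite /word_form /simplicial_of /on_simplex/= asboolT// mkprodE. Qed.

Lemma word_form_simplicial : is_simplicial_form m (word_form m c).
Proof.
apply: is_simplicial_of.
- by move=> p rho phi x t _ _; apply: alternating_Eop => v; exact: word_value_alternating.
- move=> p rho phi x t s _ _; apply: Eop_degree => v u; exact: word_value_degree.
- move=> p rho phi psi x ap aq dx dx'; rewrite -(affB_id R p) -(affb_id R p).
  by apply: related_Eop => // v s; rewrite map_id; exact: word_value_charts.
- move=> p rho phi ap.
  apply: (@fsmooth_Eop R n p m _ (fun y v => word_value c (ext_tuple rho) v phi (param phi y))
    (open_range ap)) => v u.
  exact: word_value_smooth.
- move=> p p' mu rho phi psi x hmu ap aq dx dx'; apply: related_Eop.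
  + exact: ext_vertices_homo.
  + by move=> i _; exact: ext_vertices_le.
  + by move=> v s; rewrite ext_tuple_comp -word_value_map; exact: word_value_charts.
- move=> p sigma rho phi psi x ap aq dx dx'; rewrite -(affB_id R p) -(affb_id R p).
  apply: related_Eop => // v s; rewrite map_id.
  exact: (word_value_invariant (ext_tuple rho) v s ap aq dx dx').
- move=> p phi ap; have [k ck] := word_value_jets p ap; exists k => s.
  apply: jet_smooth_sum => q.
  apply: (@jet_smooth_Bop R n M p k p phi q (fun w rho x => word_psi (fun v => word_value c (ext_tuple rho) v phi x) w)) => w u.
  apply: (@jet_smooth_ev R n M p k p phi (sorting R w) (fun v rho x (_ : 'rV[R]_p) =>
     @liftx R p n (word_value c (ext_tuple rho) v phi x) u)) => v.
  exact: (@jet_smooth_liftx R n M p k p phi (fun rho x => word_value c (ext_tuple rho) v phi x) (ck v)).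
Qed.

Lemma liftx_lin p k (g h : seq 'I_n -> R) (s : seq 'I_(p + n)) :
  liftx (fun u => g u + k * h u) s = liftx g s + k * liftx h s.
Proof.
rewrite -[k * _]opprK -mulNr -liftxZ -liftxB; apply: eq_liftx => v.
by rewrite mulNr opprK.
Qed.

Lemma Bop_lin p q k (psi psi' : seq nat -> pform R p n) t s :
  Bop q (fun w t s => psi w t s + k * psi' w t s) t s = Bop q psi t s + k * Bop q psi' t s.
Proof.
rewrite -[k * _]opprK -mulNr -BopZ -BopB; apply: eq_Bop => w u _.
by rewrite mulNr opprK.
Qed.

(** By [dfm_Eop] the two sides contain the same coface and derivative terms, up to a shift of q by
    one in the former; the terms at the two ends of the ranges of q vanish. *)
Lemma word_form_differential :
  (fun p rho => simplex_extd (word_form m c rho)) = word_form m.+1 (bott_differential c)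
  :> family (simplicial_form M).
Proof.
apply: eq_supported.
- exact: (supported_extd word_form_simplicial).
- exact: supported_simplicial_of.
move=> p rho phi x t s ap dx st.
have cf := word_form_simplicial; rewrite word_formE//.
have oU := open_range ap; have Uy := range_coord dx.
pose g := ext_tuple rho.
pose G y v := word_value c g v phi (param phi y).
have sG v u : smooth_on (chart_range phi) (fun y => G y v u) by exact: word_value_smooth.
have Gx v u : G (coord phi x) v u = word_value c g v phi x u by rewrite /G paramK.
transitivity (dfm (fun y => @Eop R n p m (G y)) (coord phi x) t s).
  have [[_ _ _ ws] _] := extensionP cf rho.
  rewrite (zeta_extd cf)//.
  apply: (@eq_dfm_simplex R n p (chart_range phi) (fun y => zeta m (word_form m c) rho phi (param phi y))
    (fun y => @Eop R n p m (G y)) (coord phi x) t s oU) => //.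
  - exact: zeta_smooth.
  - exact: fsmooth_Eop.
  - by move=> y t' u Oy st'; rewrite -(zetaE cf)// word_formE//; exact: dom_param.
rewrite (@dfm_Eop R n p m (chart_range phi) G oU sG)// big_split/=.
pose Wd v := asum (fun a u => 'D_(delta_mx 0 a) (fun y => G y v u) (coord phi x)).
pose Wc v u := coface (fun v => word_value c g v phi x u) v.
have E q : Bop q (word_psi (fun v => word_value (bott_differential c) g v phi x)) t s =
    Bop q (word_psi Wc) t s + (-1) ^+ q * Bop q (word_psi Wd) t s.
  rewrite -Bop_lin; apply: eq_Bop => w u sw; rewrite /word_psi.
  rewrite /ev mulr_sumr -big_split/= big_seq [RHS]big_seq; apply: eq_bigr => y yr.
  have [sy _ _] := sorting_words (map_f snd yr).
  rewrite mulrCA -mulrDr -liftx_lin; congr (_ * _); apply: eq_liftx => z.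
  rewrite /Wc coface_word_value (word_valueE (group_coboundary c) g (etrans sy sw)).
  rewrite (word_valueE (bott_differential c) g (etrans sy sw)).
  have -> (rho' : 'I_q.+1 -> diffeo M) : bott_differential c rho' phi x z =
     group_coboundary c rho' phi x z + (-1) ^+ q * extd atlas (c rho') phi x z by [].
  congr (_ + _ * _); rewrite extdE//; apply: eq_asum => a z' _.
  congr ('D_ _ _ _); apply/funext => y'.
  by rewrite /G /formM (word_valueE c g (etrans sy sw)).
rewrite /Eop (eq_bigr _ (fun (q : 'I_m.+2) _ => E q)) big_split/=; congr (_ + _).
  (* The coface terms start at q = 1 on the left; on the right the one at q = 0 vanishes, a letter
     having only an empty face. *)
  rewrite [RHS]big_ord_recl [X in _ = X + _](_ : _ = 0) ?add0r.
    apply: eq_bigr => q _; apply: eq_Bop => w u _; apply: eq_ev => v _; apply: eq_liftx => z.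
    by congr (coface _ v); apply/funext => v'; rewrite Gx.
  rewrite -[RHS](Bop0 (R := R) (n := n) 0 t s); apply: eq_Bop => w u sw.
  rewrite /word_psi /ev big1_seq// => y /andP[_ yr].
  have [sy _ _] := sorting_words (map_f snd yr); rewrite sw in sy.
  case: (y.2) sy => [|a [|]]// _; rewrite -[X in _ * X](_ : 0 = _) ?mulr0//.
  by rewrite -[LHS](@liftx0 R n p u); apply: eq_liftx => z; rewrite /Wc /coface/= subrr.
(* The derivative terms stop at q = m on the left; on the right the one at q = m + 1 vanishes, c
   being 0 above degree m. *)
rewrite [RHS]big_ord_recr/= [X in _ = _ + X](_ : _ = 0) ?addr0//.
rewrite (_ : Bop _ _ _ _ = 0) ?mulr0// -[RHS](Bop0 (R := R) (n := n) m.+1 t s).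
apply: eq_Bop => w u sw; rewrite /word_psi /ev big1_seq// => y /andP[_ yr].
have [sy _ _] := sorting_words (map_f snd yr); rewrite sw in sy.
rewrite -[X in _ * X](_ : 0 = _) ?mulr0// -[LHS](@liftx0 R n p u); apply: eq_liftx => z.
rewrite -[LHS](@asum0 R _ z); apply: eq_asum => a z' _.
rewrite (_ : (fun y => _) = cst 0) ?derive_cst//; apply/funext => y'.
by apply: word_value_degree; rewrite sy; lia.
Qed.

Lemma integration_word_form p (rho : 'I_p.+1 -> diffeo M) phi x s :
  integration_along_fibers M (word_form m c) p rho phi x s =
  ev (averages R (iota 0 p.+1)) (fun v => word_value c (ext_tuple rho) v phi x s).
Proof.
have [[ap dx]|nad] := pselect (atlas phi /\ dom phi x).
  rewrite -(@fiber_Eop R n p m (fun v => word_value c (ext_tuple rho) v phi x) s); last by move=> v u; exact: word_value_degree.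
  apply: eq_simplex_integral => // t t0 t1; apply: word_formE => //.
  exact/simplexP.
have w0 v : word_value c (ext_tuple rho) v phi x s = 0.
  by apply: contrapT => /word_value_neq0[? ? _]; apply: nad.
transitivity (0 : R); last by rewrite /ev big1// => y _; rewrite w0 mulr0.
by apply: contrapT => /(integration_neq0 word_form_simplicial)[? ? _]; apply: nad.
Qed.

(** [average_htpy] makes words one letter longer, so c is used in simplicial degree p + 1 and the
    total degree drops by one. *)
Definition htpy_cochain : family (bott_cochain M) := fun p rho phi x s =>
  ev (average_htpy R p (iota 0 p.+1)) (fun v => word_value c (ext_tuple rho) v phi x s).

Lemma htpy_cochain_neq0 p (rho : 'I_p.+1 -> diffeo M) phi x s :
  htpy_cochain rho phi x s <> 0 -> [/\ atlas phi, dom phi x & (size s + p).+1 = m].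
Proof.
move=> h0; apply: contrapT => nP; apply: h0.
rewrite /htpy_cochain /ev big1_seq// => y /andP[_ yr].
have sy := average_htpy_size (size_iota 0 p.+1) (map_f snd yr).
rewrite (_ : word_value _ _ _ _ _ _ = 0) ?mulr0//.
apply: contrapT => /word_value_neq0[ap dx E]; apply: nP; split=> //.
by move: E; rewrite sy; lia.
Qed.

Lemma htpy_cochain_cochain m' : m = m'.+1 -> is_bott_cochain m' htpy_cochain.
Proof.
move=> mm' p; split.
- move=> rho; case: leqP => pm; last first.
    apply/funext => phi; apply/funext => x; apply/funext => s; apply: contrapT.
    by move=> /htpy_cochain_neq0[_ _]; lia.
  split.
  + by move=> phi x s /htpy_cochain_neq0[ap dx E]; split=> //; lia.
  + move=> phi x; exact: (@alternating_ev R 'I_n (average_htpy R p (iota 0 p.+1))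
      (fun v => word_value c (ext_tuple rho) v phi x) (fun v => @word_value_alternating _ v phi x)).
  + move=> phi psi x ap aq _ dx dx'; apply/funext => s.
    rewrite (pull_ev _ _ (fun v => word_value c (ext_tuple rho) v psi x)).
    by apply: eq_ev => v _; exact: word_value_charts.
  + move=> phi s ap; apply: smooth_on_sum; first exact: open_range.
    by move=> y _; apply: smooth_onZ; [exact: open_range|exact: word_value_smooth].
- move=> sigma rho phi psi x ap aq _ dx dx'; apply/funext => s.
  rewrite (pull_ev _ _ (fun v => word_value c (ext_tuple rho) v psi (sigma x))).
  by apply: eq_ev => v _; exact: (word_value_invariant (ext_tuple rho) v s ap aq dx dx').
- apply/differentiable_cochainP => phi ap; have [k ck] := word_value_jets p ap; exists k => s.
  by apply: jet_smooth_ev => v; exact: ck.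
Qed.

(** This is [average_htpyP] evaluated on c. Closedness of c replaces its group coboundary in degree
    p + 1 by (-1)^p times its exterior derivative, which accounts for the second part of the total
    differential. *)
Lemma htpy_cochain_differential : bott_differential c = 0 ->
  bott_differential htpy_cochain = integration_along_fibers M (word_form m c) - c.
Proof.
move=> dc; apply: functional_extensionality_dep => p; apply/funext => rho.
apply/funext => phi; apply/funext => x; apply/funext => s.
have -> : bott_differential htpy_cochain rho phi x s = group_coboundary htpy_cochain rho phi x s +
    (-1) ^+ p * extd atlas (htpy_cochain rho) phi x s by [].
have -> : (integration_along_fibers M (word_form m c) - c) p rho phi x s =
    integration_along_fibers M (word_form m c) p rho phi x s - c rho phi x s by [].
pose W v := word_value c (ext_tuple rho) v phi x s.
have Wi : c rho phi x s = W (iota 0 p.+1) by rewrite /W word_value_iota.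
rewrite Wi integration_word_form.
have -> : group_coboundary htpy_cochain rho phi x s =
    coface (fun v => ev (average_htpy R p.-1 v) W) (iota 0 p.+1).
  rewrite -[in LHS](word_value_iota (group_coboundary htpy_cochain) rho) -coface_word_value.
  apply: eq_coface => v _; rewrite size_iota => -[pv]; subst p.
  case: v rho @W Wi => [|a v] rho W Wi; first by rewrite /= ev_nil.
  rewrite -[(size (a :: v)).-1]/(size v) /W.
  (* A face [v] is the image of 0 1 ... under [wmap], and the homotopy is natural in the letters. *)
  transitivity (ev (average_htpy R (size v) (iota 0 (size v).+1)) (fun u =>
      word_value c (ext_tuple rho) (map (wmap (a :: v)) u) phi x s)); last first.
    rewrite -(@average_htpy_map R (size v) (wmap (a :: v)) (iota 0 (size v).+1)
      (fun u => word_value c (ext_tuple rho) u phi x s) (size_iota _ _)).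
    by congr (ev (average_htpy R (size v) _) _); exact: (wmap_iota (a :: v)).
  apply: eq_ev => u _; rewrite word_value_map; congr (word_value c _ u phi x s).
  apply/funext => j.
  have e : (inord (minn j (size v)) : 'I_(size v).+1) = minn j (size v) :> nat.
    by rewrite inordK// ltnS geq_minr.
  by rewrite -[LHS]/(ext_tuple rho (nth 0%N (a :: v) (inord (minn j (size v)) : 'I_(size v).+1))) e.
suff -> : (-1) ^+ p * extd atlas (htpy_cochain rho) phi x s =
    ev (average_htpy R p (iota 0 p.+1)) (coface W).
  by rewrite average_htpyP ?size_iota//; ring.
have [[ap dx]|nad] := pselect (atlas phi /\ dom phi x); last first.
  rewrite /extd asboolF// mulr0 /ev big1// => y _.
  rewrite (_ : coface _ _ = 0) ?mulr0// -[RHS](@asum0 R _ y.2); apply: eq_asum => a v _.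
  by apply: contrapT => /word_value_neq0[? ? _]; apply: nad.
have Uy := range_coord dx.
rewrite extdE//.
transitivity ((-1) ^+ p * ev (average_htpy R p (iota 0 p.+1)) (fun v =>
    asum (fun a u => 'D_(delta_mx 0 a) (fun y => word_value c (ext_tuple rho) v phi (param phi y) u) (coord phi x)) s)).
  congr (_ * _); rewrite ev_asum; apply: eq_asum => a u _.
  rewrite (_ : (fun y => formM (htpy_cochain rho) phi y u) = \sum_(y <- average_htpy R p (iota 0 p.+1))
    (fun z => y.1 * word_value c (ext_tuple rho) y.2 phi (param phi z) u)); last first.
    by apply/funext => z; rewrite fct_sumE.
  have dW y : derivable (fun z => word_value c (ext_tuple rho) y phi (param phi z) u) (coord phi x) (delta_mx 0 a).
    by apply: diff_derivable; apply: (word_value_smooth (ext_tuple rho) y u ap [::]).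
  elim: (average_htpy _ _ _) => [|y l IH]; first by rewrite big_nil ev_nil derive_cst.
  rewrite big_cons -cat1s ev_cat -IH deriveD; last first.
  - elim: (l) => [|y' l' IH']; first by rewrite big_nil; exact: derivable_cst.
    by rewrite big_cons; apply: derivableD => //; apply: derivableZ.
  - exact: derivableZ.
  by congr (_ + _); rewrite /ev big_seq1 deriveZ.
rewrite -evZ; apply: eq_ev => v vh.
have sv := average_htpy_size (size_iota 0 p.+1) vh.
have := congr1 (fun f : family (bott_cochain M) => word_value f (ext_tuple rho) v phi x s) dc.
rewrite /= !(word_valueE _ _ sv).
have -> (rho' : 'I_p.+2 -> diffeo M) : bott_differential c rho' phi x s =
   group_coboundary c rho' phi x s + (-1) ^+ p.+1 * extd atlas (c rho') phi x s by [].
rewrite -[group_coboundary _ _ _ _ _](f_equal (fun f : coefs R M n => f phi x s) (word_valueE (group_coboundary c) (ext_tuple rho) sv)).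
rewrite -coface_word_value -/(W _) extdE// exprS mulN1r mulNr => /eqP; rewrite subr_eq0 => /eqP ->.
by congr (_ * _); apply: eq_asum => a u _; congr ('D_ _ _ _).
Qed.

End BottCochains.

(** * The primitive of a cocycle modulo its integral *)

Section Primitives.
Variables (R : realType) (n : nat) (M : smoothManifold R n).
Local Notation atlas := (@atlas R n M).
Local Notation J phi psi f x := ('J (local_map phi psi f) (coord phi x)).
Implicit Types (phi psi : chart R M n) (x : M).

Lemma alternating_scale X (k : R) (G : seq X -> R) : alternating G -> alternating (fun s => k * G s).
Proof. by move=> aG s1 i j s2; rewrite aG mulrN. Qed.

Lemma alternating_Kop_pcont p w (eta : pform R p n) : pcont eta ->
  (forall t, alternating (eta t)) -> forall t, alternating (Kop w eta t).
Proof.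
elim: w eta => //= j w IH eta ce ae t.
by apply: (IH (hop j eta)); [exact: pcont_hop|exact: alternating_hop_pcont].
Qed.

Lemma alternating_sop p m (eta : pform R p n) : pcont eta ->
  (forall t, alternating (eta t)) -> forall t, alternating (sop m eta t).
Proof.
move=> ce ae t; apply: alternating_sum => q; apply: alternating_scale.
apply: alternating_Bop => w t'.
by apply: (@alternating_ev R _ _ (fun v => Kop v eta t')) => v; exact: alternating_Kop_pcont.
Qed.

Lemma sop_degree p m (eta : pform R p n) : (forall t s, size s != m -> eta t s = 0) ->
  forall t s, (size s).+1 != m -> sop m eta t s = 0.
Proof.
move=> eta0 t s sm; rewrite /sop big1// => q _; rewrite (_ : Bop _ _ _ _ = 0) ?mulr0//.
(* [d] is m - 1; for m = 0, where there is no such degree, any number different from [size s]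
   serves. *)
have [d [sd dm]] : exists d, size s != d /\ forall k, (k != d -> k.+1 != m)%N.
  by case: (m) sm => [|m1] sm; [exists (size s).+1; split=> //; lia|exists m1].
apply: (@Bop_degree R p n q d) => // w u sw ud; rewrite /ev big1_seq// => x /andP[_ xr].
have [sx _ _] := sorting_words (map_f snd xr).
by rewrite (Kop_deg eta0) ?mulr0// sx sw addnS dm.
Qed.

Lemma related_sop p p' m (C : 'M[R]_n) mu (D : set 'rV[R]_p) (eta : pform R p n) (eta' : pform R p' n) :
  {homo mu : i j / (i <= j)%N} -> (forall i, (i <= p -> mu i <= p')%N) ->
  (forall j, vtx R p' (mu (minn j p)) = vtx R p' (mu j)) ->
  (forall t j u, D t -> 0 <= u <= 1 -> D (seg (vtx R p j) t u)) ->
  pcont eta' -> related (affB R p p' mu) (affb R p' mu) C D eta eta' ->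
  related (affB R p p' mu) (affb R p' mu) C D (sop m eta) (sop m eta').
Proof.
move=> hmu lmu vmu sD ce ee t s Dt; rewrite /sop pull_sum; apply: eq_bigr => q _.
rewrite pullZ; congr (_ * _).
apply: (@related_Bop R p p' n n _ _ _ mu _ _ _ q _
  (fun w t s => ev (sorting R w) (fun v => Kop v eta' t s))) => //.
- by move=> t' l; exact: aff_bary.
- by move=> a l; exact: aff_dbary.
move=> w u; rewrite pull_ev sorting_map//; apply: eq_ev => v _.
by apply: (related_Kop (mu := mu) _ sD v ce ee) => // j; exact: aff_vtx.
Qed.

Lemma fsmooth_sop p m (O : set 'rV[R]_n) (F : 'rV[R]_n -> pform R p n) : open O ->
  fsmooth O F -> fsmooth O (fun y => sop m (F y)).
Proof.
move=> oO sF s; apply: psmooth_sum => // q _; apply: psmoothZ => //.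
apply: (@fsmooth_Bop _ _ _ _ _ oO q (fun w y t s => ev (sorting R w) (fun v => Kop v (F y) t s))) => w.
by apply: (@fsmooth_ev R p n O oO _ (fun v y => Kop v (F y))) => v; exact: fsmooth_Kop.
Qed.

Section Primitive.
Variables (m : nat) (z : family (simplicial_form M)).
Hypothesis zf : is_simplicial_form m z.

Definition primitive : family (simplicial_form M) :=
  simplicial_of (fun p rho phi x => sop m (zeta m z rho phi x)).

Lemma primitive_simplicial m' : m = m'.+1 -> is_simplicial_form m' primitive.
Proof.
move=> mm'; apply: is_simplicial_of.
- by move=> p rho phi x t ap dx; apply: alternating_sop; [exact: zeta_pcont|exact: zeta_alternating].
- move=> p rho phi x t s _ _ sm; apply: sop_degree; last by rewrite mm' eqSS.
  by move=> t' s'; exact: zeta_degree.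
- move=> p rho phi psi x ap aq dx dx'; rewrite -(affB_id R p) -(affb_id R p).
  apply: related_sop => //; first by move=> j; rewrite vtx_minn.
    exact: zeta_pcont.
  by rewrite affB_id affb_id; exact: zeta_charts.
- by move=> p rho phi ap; apply: fsmooth_sop; [exact: open_range|exact: zeta_smooth].
- move=> p p' mu rho phi psi x hmu ap aq dx dx'; apply: related_sop.
  + exact: ext_vertices_homo.
  + by move=> i _; exact: ext_vertices_le.
  + exact: ext_vertices_vtx.
  + by move=> t j u; exact: simplex_seg.
  + exact: zeta_pcont.
  + exact: zeta_simplicial.
- move=> p sigma rho phi psi x ap aq dx dx'; rewrite -(affB_id R p) -(affb_id R p).
  apply: related_sop => //.
  + by move=> j; rewrite vtx_minn.
  + by move=> t j u; exact: simplex_seg.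
  + exact: zeta_pcont.
  + by rewrite affB_id affb_id; exact: zeta_invariant.
- move=> p phi ap; have [k zk] := zeta_jets zf p ap; exists k => s.
  apply: jet_smooth_sum => q; apply: jet_smoothZ.
  apply: (@jet_smooth_Bop R n M p k p phi q (fun w rho x t s =>
    ev (sorting R w) (fun v => Kop v (zeta m z rho phi x) t s))) => w u.
  apply: (@jet_smooth_ev R n M p k p phi (sorting R w) (fun v rho x t => Kop v (zeta m z rho phi x) t u)) => v.
  exact: (@jet_smooth_Kop R n M p k p phi v (fun rho x => zeta m z rho phi x) zk u).
Qed.

Hypothesis dz : (fun p rho => simplex_extd (@z p rho)) = 0 :> family (simplicial_form M).

(** In [dfm_sop] the terms with the derivative of [zeta] vanish by locality, as dz = 0 is known over
    the simplex, which contains all segments used. Since [sorting] yields weakly increasing words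
    only, the remaining integrals are values of the integrated cochain by [epsw_sorted]. *)
Lemma cocycle_homotopy p (rho : 'I_p.+1 -> diffeo M) phi x t s :
  atlas phi -> dom phi x -> simplex t ->
  dfm (fun y => sop m (zeta m z rho phi (param phi y))) (coord phi x) t s =
  zeta m z rho phi x t s - Eop m
    (fun v => word_value (integration_along_fibers M z) (ext_tuple rho) v phi x) t s.
Proof.
move=> ap dx st; have oU := open_range ap; have Uy := range_coord dx.
pose F y := zeta m z rho phi (param phi y).
have Fx : F (coord phi x) = zeta m z rho phi x by rewrite /F paramK.
have dF t' s' : simplex t' -> dfm F (coord phi x) t' s' = 0.
  move=> st'; rewrite -zeta_extd//.
  by have /(congr1 (fun f : family (simplicial_form M) => f p rho (prod_chart p phi) (t', x) s')) := dz.
have sg (t' : 'rV[R]_p) j u : simplex t' -> 0 <= u <= 1 -> simplex (seg (vtx R p j) t' u).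
  exact: simplex_seg.
rewrite (dfm_sop oU (F := F))//; last first.
- by move=> t' s'; exact: zeta_degree.
- by move=> y t' _; exact: zeta_alternating.
- exact: zeta_smooth.
rewrite Fx [X in _ - _ - X](_ : _ = 0) ?subr0; last first.
  rewrite big1// => q _; rewrite (_ : Bop _ _ _ _ = 0) ?mulr0//.
  rewrite -[RHS](Bop0 (R := R) (n := n) q t s); apply: eq_Bop => w u _.
  rewrite /ev big1// => y _; rewrite (eq_Kop sg (eta' := fun _ _ => 0) _ y.2 u st) ?Kop0 ?mulr0//.
congr (_ - _); apply: eq_bigr => q _; apply: eq_Bop_letters => w u sw aw.
apply: eq_ev => v /sorting_words[sv ov vw]; apply: (epsw_sorted zf) => //.
  by rewrite -size_eq0 sv sw.
by apply/allP => i /vw; exact: (allP aw).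
Qed.

Lemma Eop_word0 p k (rho : 'I_p.+1 -> diffeo M) phi x t s :
  @Eop R n p k (fun v => word_value (0 : family (bott_cochain M)) (ext_tuple rho) v phi x) t s = 0.
Proof.
rewrite /Eop big1// => q _; rewrite -[RHS](Bop0 (R := R) (n := n) q t s).
apply: eq_Bop => w u _; rewrite /word_psi /ev big1// => -[l v] _.
rewrite (_ : liftx _ _ = 0) ?mulr0// -[RHS](@liftx0 R n p u); apply: eq_liftx => u'.
by case: v.
Qed.

(** In degree 0 there is nothing to contract: [sop] vanishes and the homotopy formula reads z = E of
    the integral of z. *)
Lemma cocycle_in_degree0 : m = 0%N -> integration_along_fibers M z = 0 -> z = 0.
Proof.
move=> m0 fz0; apply: eq_supported; first exact: supported_form zf.
  by move=> p rho Phi y s.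
move=> p rho phi x t s ap dx st; rewrite (zetaE zf)//.
have := cocycle_homotopy rho s ap dx st; rewrite fz0.
have -> : (fun y => sop m (zeta m z rho phi (param phi y))) = (fun _ _ _ => 0).
  apply/funext => y; apply/funext => t'; apply/funext => s'.
  by apply: sop_degree; [move=> t'' s''; exact: zeta_degree|rewrite m0].
have -> : dfm (fun _ : 'rV[R]_n => fun _ _ => 0) (coord phi x) t s = 0.
  by rewrite -[RHS](@asum0 R _ s); apply: eq_asum => a v _; exact: pd_cst.
rewrite Eop_word0.
by rewrite subr0 => <-.
Qed.

(** Both sides vanish off the simplex and outside the product charts, so it suffices to compare them
    where [cocycle_homotopy] applies. *)
Lemma cocycle_decomposition m' : m = m'.+1 ->
  z = ((fun p rho => simplex_extd (@primitive p rho)) : family (simplicial_form M)) +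
      word_form m (integration_along_fibers M z).
Proof.
move=> mm'; have pf := primitive_simplicial mm'.
apply: eq_supported; first exact: supported_form zf.
  move=> p rho Phi y s AB.
  have [A0|A0] := pselect (simplex_extd (primitive rho) Phi y s = 0).
    have [B0|B0] := pselect (word_form m (integration_along_fibers M z) rho Phi y s = 0).
      case: AB; rewrite -[LHS]/(simplex_extd (primitive rho) Phi y s +
        word_form m (integration_along_fibers M z) rho Phi y s).
      by rewrite A0 B0 addr0.
    exact: supported_simplicial_of B0.
  exact: (supported_extd pf A0).
move=> p rho phi x t s ap dx st.
rewrite -[RHS]/(simplex_extd (primitive rho) (prod_chart p phi) (t, x) s +
      word_form m (integration_along_fibers M z) rho (prod_chart p phi) (t, x) s).
rewrite word_formE// (zetaE zf)//; apply/eqP; rewrite -subr_eq; apply/eqP.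
rewrite -(cocycle_homotopy rho s ap dx st) (zeta_extd pf)//.
have oU := open_range ap; have Uy := range_coord dx.
(* [sop] of the chosen extension of z and the extension chosen for [primitive] agree on the simplex,
   hence so do their derivatives. *)
apply: (@eq_dfm_simplex R n p (chart_range phi)
  (fun y => sop m (zeta m z rho phi (param phi y)))
  (fun y => zeta m' primitive rho phi (param phi y)) (coord phi x) t s oU) => //.
- by apply: fsmooth_sop => //; exact: zeta_smooth.
- exact: zeta_smooth.
- move=> y t' u Oy st'; rewrite -(zetaE pf)// /primitive /simplicial_of /on_simplex/= asboolT//.
  by rewrite mkprodE//; exact: dom_param.
Qed.

End Primitive.
End Primitives.

(** * Cohomology *)

Section AbstractComplexes.
Variable R : realType.

Definition linear_complex (C : complex R) : Prop :=
  [/\ forall m, exists a, cochains (c := C) m a,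
      forall m (k : R) (z z' : ambient C), cochains m z -> cochains m z' -> cochains m (k *: z + z') &
      forall m (k : R) (z z' : ambient C), cochains m z -> cochains m z' ->
        differential (k *: z + z') = k *: differential z + differential z'].

Section Cosets.
Variable C : complex R.
Hypothesis lC : linear_complex C.
Implicit Types z b : ambient C.

Lemma cochains0 m : cochains m (0 : ambient C).
Proof.
have [/(_ m)[a ca] lc _] := lC.
by have := lc m (-1) a a ca ca; rewrite scaleN1r addNr.
Qed.

Lemma differential0 : differential (0 : ambient C) = 0.
Proof.
have [_ _ ld] := lC; have := ld 0%N (-1) 0 0 (cochains0 0) (cochains0 0).
by rewrite scaler0 addr0 scaleN1r addNr.
Qed.

Lemma coboundaries_linear m (k : R) b b' :
  coboundaries m b -> coboundaries m b' -> coboundaries m (k *: b + b').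
Proof.
have [_ lc ld] := lC; move=> [cb Eb] [cb' Eb']; split; first exact: lc.
case: m cb Eb cb' Eb' => [|m] cb Eb cb' Eb'; first by rewrite Eb Eb' scaler0 addr0.
case: Eb Eb' => a ca -> [a' ca' ->]; exists (k *: a + a'); first exact: lc.
by rewrite (ld m).
Qed.

Lemma coboundaries0 m : coboundaries m (0 : ambient C).
Proof.
split; first exact: cochains0.
case: m => // m; exists 0; first exact: cochains0.
by rewrite differential0.
Qed.

Lemma eq_class m z z' : coboundaries m (z' - z) -> cohomology_class m z = cohomology_class m z'.
Proof.
move=> b; apply/seteqP; split=> y; rewrite /cohomology_class/= => yz.
  have -> : y - z' = -1 *: (z' - z) + (y - z).
    by rewrite scaleN1r opprB [RHS]addrC addrA subrK.
  exact: coboundaries_linear.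
have -> : y - z = 1 *: (z' - z) + (y - z').
  by rewrite scale1r [RHS]addrC addrA subrK.
exact: coboundaries_linear.
Qed.

Lemma mem_class m z : cohomology_class m z z.
Proof. by rewrite /cohomology_class/= subrr; exact: coboundaries0. Qed.

Lemma cochainsB m z z' : cochains m z -> cochains m z' -> cochains m (z - z').
Proof.
have [_ lc _] := lC; move=> cz cz'.
by have := lc m (-1) z' z cz' cz; rewrite scaleN1r addrC.
Qed.

Lemma differentialB m z z' : cochains m z -> cochains m z' ->
  differential (z - z') = differential z - differential z'.
Proof.
have [_ _ ld] := lC; move=> cz cz'.
by have := ld m (-1) z' z cz' cz; rewrite !scaleN1r addrC [RHS]addrC.
Qed.

End Cosets.

Section Bijection.
Variables (C D : complex R) (f : ambient C -> ambient D).
Hypotheses (lC : linear_complex C) (lD : linear_complex D) (cf : chain_map f).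
Hypothesis f_inj : forall m z, cocycles m z -> coboundaries m (f z) -> coboundaries m z.
Hypothesis f_surj : forall m c, cocycles m c ->
  exists2 z, cocycles m z & coboundaries m (f z - c).

Let fB m z z' : cochains m z -> cochains m z' -> f (z - z') = f z - f z'.
Proof.
have [_ lf _] := cf; move=> cz cz'.
by have := lf m (-1) z' z cz' cz; rewrite !scaleN1r addrC [RHS]addrC.
Qed.

Let f0 : f 0 = 0.
Proof. by have := fB (cochains0 lC 0) (cochains0 lC 0); rewrite !subrr. Qed.

Let f_coboundaries m b : coboundaries m b -> coboundaries m (f b).
Proof.
have [fc _ fd] := cf; move=> [cb Eb]; split; first exact: fc.
case: m cb Eb => [|m] cb; first by move=> ->.
by move=> [a ca ->]; exists (f a); [exact: fc|exact: fd ca].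
Qed.

(** The images of cohomologous cocycles are cohomologous, so the union in [cohomology_map] collapses
    to a single coset. *)
Lemma cohomology_map_class m z : cocycles m z ->
  cohomology_map f m (cohomology_class m z) = cohomology_class m (f z).
Proof.
move=> [cz dz]; apply/seteqP; split=> [y [z' zz' yz']|y yz]; last first.
  by exists z => //; exact: mem_class.
have cz' : cochains m z'.
  have [_ lc _] := lC; have := lc m 1 _ _ zz'.1 cz.
  by rewrite scale1r subrK.
rewrite (@eq_class D lD m (f z) (f z'))// -(fB cz' cz).
exact: f_coboundaries.
Qed.

Lemma cohomology_bij m : set_bij (cohomology C m) (cohomology D m) (cohomology_map f m).
Proof.
have [fc _ fd] := cf; split.
- move=> _ [z zc <-]; exists (f z); last by rewrite cohomology_map_class.
  by case: zc => cz dz; split; [exact: fc|rewrite -(fd m)// dz f0].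
- move=> _ _ /set_mem[z zc <-] /set_mem[z' zc' <-].
  rewrite !cohomology_map_class// => E.
  have fzz : coboundaries m (f z' - f z).
    by have := mem_class lD m (f z'); rewrite -E.
  have [[cz dz] [cz' dz']] := (zc, zc').
  apply: (eq_class lC); apply: f_inj; last by rewrite (fB cz' cz).
  split; first exact: cochainsB.
  by rewrite (differentialB lC cz' cz) dz dz' subrr.
- move=> _ [c cc <-]; have [z zc zb] := f_surj cc.
  exists (cohomology_class m z); first by exists z.
  rewrite cohomology_map_class//; apply/esym/(eq_class lD).
  exact: zb.
Qed.

End Bijection.
End AbstractComplexes.

(** * Linearity of the two complexes and comparison of their cohomology *)

Section LinearStructure.
Variables (R : realType) (n : nat) (M : smoothManifold R n).
Local Notation atlas := (@atlas R n M).
Local Notation sfamily := (family (simplicial_form M)).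
Local Notation bfamily := (family (bott_cochain M)).
Implicit Types (phi psi : chart R M n) (x : M).

Section Simplicial.
Variables (m : nat) (k : R) (z z' : sfamily).
Hypotheses (zf : is_simplicial_form m z) (zf' : is_simplicial_form m z').

Lemma supported_linear A B : supported A -> supported B -> supported (k *: A + B : sfamily).
Proof.
move=> sA sB p rho Phi y s AB.
have [A0|A0] := pselect (A p rho Phi y s = 0); last exact: sA A0.
have [B0|B0] := pselect (B p rho Phi y s = 0); last exact: sB B0.
case: AB; rewrite -[LHS]/(k * A p rho Phi y s + B p rho Phi y s).
by rewrite A0 B0 mulr0 addr0.
Qed.

(** Brings a linear combination to the shape to which [is_simplicial_of] applies. *)
Lemma linear_simplicial_of : k *: z + z' = simplicial_of (fun p rho phi x t s =>
  k * zeta m z rho phi x t s + zeta m z' rho phi x t s).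
Proof.
apply: eq_supported.
- by apply: supported_linear; [exact: supported_form zf|exact: supported_form zf'].
- exact: supported_simplicial_of.
move=> p rho phi x t s ap dx st; rewrite /simplicial_of /on_simplex/= asboolT// mkprodE//.
by rewrite -(zetaE zf)// -(zetaE zf').
Qed.

Lemma simplicial_linear : is_simplicial_form m (k *: z + z').
Proof.
rewrite linear_simplicial_of; apply: is_simplicial_of.
- move=> p rho phi x t _ _ s1 i j s2.
  by rewrite (zeta_alternating zf) (zeta_alternating zf') mulrN opprD.
- by move=> p rho phi x t s _ _ sm; rewrite (zeta_degree zf)// (zeta_degree zf')// mulr0 addr0.
- move=> p rho phi psi x ap aq dx dx' t s _; rewrite pullD pullZ.
  by congr (_ * _ + _); [apply: (zeta_charts zf)|apply: (zeta_charts zf')].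
- move=> p rho phi ap s; have oU := open_range ap.
  by apply: psmoothD => //; [apply: psmoothZ => //; exact: (zeta_smooth zf)|exact: (zeta_smooth zf')].
- move=> p p' mu rho phi psi x hmu ap aq dx dx' t s st; rewrite pullD pullZ.
  by congr (_ * _ + _); [apply: (zeta_simplicial zf)|apply: (zeta_simplicial zf')].
- move=> p sigma rho phi psi x ap aq dx dx' t s st; rewrite pullD pullZ.
  by congr (_ * _ + _); [apply: (zeta_invariant zf)|apply: (zeta_invariant zf')].
- move=> p phi ap; have [l zl] := zeta_jets zf p ap; have [l' zl'] := zeta_jets zf' p ap.
  exists (maxn l l') => s; apply: jet_smoothD.
    apply: jet_smoothZ.
    exact: (@jet_smooth_select R n M p l (maxn l l') p p phi id _ (leq_maxl _ _) (zl s)).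
  exact: (@jet_smooth_select R n M p l' (maxn l l') p p phi id _ (leq_maxr _ _) (zl' s)).
Qed.

Lemma simplex_extd_linear :
  (fun p rho => simplex_extd ((k *: z + z') p rho)) =
  k *: ((fun p rho => simplex_extd (@z p rho)) : sfamily) + (fun p rho => simplex_extd (@z' p rho)) :> sfamily.
Proof.
have kf := simplicial_linear.
apply: eq_supported.
- exact: (supported_extd kf).
- by apply: supported_linear; [exact: supported_extd zf|exact: supported_extd zf'].
move=> p rho phi x t s ap dx st; have oU := open_range ap; have Uy := range_coord dx.
rewrite (zeta_extd kf)//.
rewrite -[RHS]/(k * simplex_extd (@z p rho) (prod_chart p phi) (t, x) s +
  simplex_extd (@z' p rho) (prod_chart p phi) (t, x) s).
rewrite (zeta_extd zf)// (zeta_extd zf')//.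
pose F y := zeta m z rho phi (param phi y); pose F' y := zeta m z' rho phi (param phi y).
have sF : fsmooth (chart_range phi) F by exact: (zeta_smooth zf).
have sF' : fsmooth (chart_range phi) F' by exact: (zeta_smooth zf').
have skF : fsmooth (chart_range phi) (fun y t s => k * F y t s) by move=> v; exact: psmoothZ.
transitivity (dfm (fun y t s => k * F y t s + F' y t s) (coord phi x) t s).
  apply: (@eq_dfm_simplex R n p (chart_range phi) (fun y => zeta m (k *: z + z') rho phi (param phi y))
    (fun y t s => k * F y t s + F' y t s) (coord phi x) t s oU) => //.
  - exact: (zeta_smooth kf).
  - by move=> v; apply: psmoothD => //; exact: psmoothZ.
  - by move=> y t' u Oy st'; rewrite -(zetaE kf)// /F /F' -(zetaE zf)// -(zetaE zf').
rewrite -/F -/F' -(dfmZ (O := chart_range phi))// /dfm -asumD; apply: eq_asum => a v _.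
by rewrite (pdD (O := chart_range phi)).
Qed.

Lemma integration_linear :
  integration_along_fibers M (k *: z + z') =
  k *: integration_along_fibers M z + integration_along_fibers M z'.
Proof.
have kf := simplicial_linear.
apply: functional_extensionality_dep => p; apply/funext => rho; apply/funext => phi.
apply/funext => x; apply/funext => s.
rewrite -[RHS]/(k * integration_along_fibers M z p rho phi x s + integration_along_fibers M z' p rho phi x s).
have [[ap dx]|nad] := pselect (atlas phi /\ dom phi x); last first.
  have f0 w : is_simplicial_form m w -> integration_along_fibers M w p rho phi x s = 0.
    by move=> wf; apply: contrapT => /(integration_neq0 wf)[? ? _]; apply: nad.
  by rewrite !f0// mulr0 addr0.
have fE w : is_simplicial_form m w -> integration_along_fibers M w p rho phi x s =
    simplex_integral 1 (fun t => zeta m w rho phi x t (map (lshift n) (enum 'I_p) ++ map (@rshift p n) s)).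
  move=> wf; apply: eq_simplex_integral => // t t0 t1; apply: (zetaE wf).
  exact/simplexP.
rewrite !fE// -simplex_integral_linear; [|exact: (zeta_pcont zf)|exact: (zeta_pcont zf')].
apply: eq_simplex_integral => // t t0 t1; have st : simplex t by exact/simplexP.
by rewrite -(zetaE kf)// -(zetaE zf)// -(zetaE zf').
Qed.

End Simplicial.

Section Bott.
Variables (m : nat) (k : R) (c c' : bfamily).
Hypotheses (cc : is_bott_cochain m c) (cc' : is_bott_cochain m c').

Let evalE p (rho : 'I_p.+1 -> diffeo M) phi x s :
  (k *: c + c') p rho phi x s = k * @c p rho phi x s + @c' p rho phi x s.
Proof. by []. Qed.

Lemma pull_linear a b (A : 'M[R]_(a, b)) w w' s :
  pull A (fun v => k * w v + w' v) s = k * pull A w s + pull A w' s.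
Proof. by rewrite pullD pullZ. Qed.

Lemma cochain_smooth c0 p (rho : 'I_p.+1 -> diffeo M) phi s : is_bott_cochain m c0 -> atlas phi ->
  smooth_on (chart_range phi) (fun y => c0 p rho phi (param phi y) s).
Proof.
move=> c0c ap; have := word_value_smooth c0c (ext_tuple rho) (iota 0 p.+1) s ap.
by rewrite word_value_iota.
Qed.

Lemma bott_linear : is_bott_cochain m (k *: c + c').
Proof.
move=> p; have [cf cs cd] := cc p; have [cf' cs' cd'] := cc' p; split.
- move=> rho; case: leqP => pm; last first.
    rewrite -[LHS]/(k *: @c p rho + @c' p rho) (c_above cc)// (c_above cc')//.
    by rewrite scaler0 addr0.
  have [w0 wa wp ws] := c_form cc rho pm; have [w0' wa' wp' ws'] := c_form cc' rho pm.
  split.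
  + move=> phi x s; rewrite evalE => kc.
    have [A0|A0] := pselect (@c p rho phi x s = 0); last exact: w0 A0.
    have [B0|B0] := pselect (@c' p rho phi x s = 0); last exact: w0' B0.
    by case: kc; rewrite A0 B0 mulr0 addr0.
  + by move=> phi x s1 i j s2; rewrite !evalE wa wa' mulrN opprD.
  + move=> phi psi x ap aq _ dx dx'; apply/funext => s; rewrite evalE pull_linear.
    by rewrite (wp phi psi x)// (wp' phi psi x).
  + move=> phi s ap; have oU := open_range ap.
    by apply: (smooth_onD oU); [apply: (smooth_onZ oU); exact: ws|exact: ws'].
- move=> sigma rho phi psi x ap aq _ dx dx'; apply/funext => s; rewrite evalE pull_linear.
  by rewrite (cs sigma rho phi psi x)// (cs' sigma rho phi psi x).
- apply/differentiable_cochainP => phi ap.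
  have [l cl] := (differentiable_cochainP (@c p)).1 cd phi ap.
  have [l' cl'] := (differentiable_cochainP (@c' p)).1 cd' phi ap.
  exists (maxn l l') => s; apply: jet_smoothD.
    apply: jet_smoothZ.
    exact: (@jet_smooth_select R n M 0 l (maxn l l') p p phi id _ (leq_maxl _ _) (cl s)).
  exact: (@jet_smooth_select R n M 0 l' (maxn l l') p p phi id _ (leq_maxr _ _) (cl' s)).
Qed.

Lemma bott_differential_linear :
  bott_differential (k *: c + c') = k *: bott_differential c + bott_differential c'.
Proof.
apply: functional_extensionality_dep => p; apply/funext => rho; apply/funext => phi.
apply/funext => x; apply/funext => s.
have E (b : bfamily) : bott_differential b rho phi x s = group_coboundary b rho phi x s +
    (-1) ^+ p * extd atlas (b p rho) phi x s by [].
rewrite -[RHS]/(k * bott_differential c rho phi x s + bott_differential c' rho phi x s) !E.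
have -> : group_coboundary (k *: c + c') rho phi x s =
    k * group_coboundary c rho phi x s + group_coboundary c' rho phi x s.
  case: p rho E => [|p] rho _; first by rewrite /= mulr0 addr0.
  rewrite /= !coefs_sumE mulr_sumr -big_split/=; apply: eq_bigr => i _.
  rewrite -[LHS]/((-1) ^+ i * (k * @c p (fun j => rho (lift i j)) phi x s + @c' p (fun j => rho (lift i j)) phi x s)).
  rewrite -[X in _ = k * X + _]/((-1) ^+ i * @c p (fun j => rho (lift i j)) phi x s).
  rewrite -[X in _ = _ + X]/((-1) ^+ i * @c' p (fun j => rho (lift i j)) phi x s).
  by rewrite mulrDr mulrCA.
have -> : extd atlas ((k *: c + c') p rho) phi x s =
    k * extd atlas (@c p rho) phi x s + extd atlas (@c' p rho) phi x s.
  have [[ap dx]|nad] := pselect (atlas phi /\ dom phi x); last first.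
    by rewrite /extd !asboolF// mulr0 addr0.
  rewrite !extdE// -asumZ -asumD; apply: eq_asum => a v _.
  have df (c0 : bfamily) : is_bott_cochain m c0 ->
      derivable (fun y => formM (c0 p rho) phi y v) (coord phi x) (delta_mx 0 a).
    move=> c0c; apply: diff_derivable.
    exact: (cochain_smooth rho v c0c ap [::] (range_coord dx)).
  rewrite (_ : (fun y => formM ((k *: c + c') p rho) phi y v) =
    (k \*: (fun y => formM (@c p rho) phi y v)) + (fun y => formM (@c' p rho) phi y v))//.
  rewrite deriveD; [|by apply: derivableZ; exact: df|exact: df].
  by rewrite deriveZ//; exact: df.
by ring.
Qed.

End Bott.

Lemma zero_cochain m : is_bott_cochain m (0 : bfamily).
Proof.
move=> p; split.
- move=> rho; case: leqP => // _; split=> //.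
  + by move=> phi x s1 i j s2; rewrite oppr0.
  + by move=> phi psi x _ _ _ _ _; apply/funext => s; rewrite pull0.
  + by move=> phi s ap; exact: smooth_on_cst.
- by move=> sigma rho phi psi x _ _ _ _ _; apply/funext => s; rewrite pull0.
- by apply/differentiable_cochainP => phi ap; exists 0%N => s; exact: jet_smooth0.
Qed.

Lemma word_form0 m : word_form m (0 : bfamily) = 0.
Proof.
apply: eq_supported; [exact: supported_simplicial_of|by move=> p rho Phi y s|].
by move=> p rho phi x t s ap dx st; rewrite word_formE// Eop_word0.
Qed.

Lemma linear_bott_complex : linear_complex (bott_complex M).
Proof.
split.
- by move=> m; exists 0; exact: zero_cochain.
- by move=> m k z z'; exact: bott_linear.
- by move=> m k z z'; exact: bott_differential_linear.
Qed.

Lemma linear_simplicial_complex : linear_complex (simplicial_deRham_complex M).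
Proof.
split.
- by move=> m; exists (word_form m 0); apply: word_form_simplicial; exact: zero_cochain.
- by move=> m k z z'; exact: simplicial_linear.
- by move=> m k z z'; exact: simplex_extd_linear.
Qed.

Lemma integration_chain_map : chain_map (integration_along_fibers M).
Proof.
split.
- by move=> m z; exact: integration_cochain.
- by move=> m k z z'; exact: integration_linear.
- by move=> m z; exact: integration_differential.
Qed.

Lemma integration_injective m (z : ambient (simplicial_deRham_complex M)) : cocycles m z ->
  @coboundaries R (bott_complex M) m (integration_along_fibers M z) -> coboundaries m z.
Proof.
move=> [zf dz] [_ fz]; split=> //; case: m zf fz => [|m] zf fz.
  exact: (cocycle_in_degree0 zf dz erefl fz).
case: fz => b bc fz.
exists ((1 : R) *: primitive m.+1 z + word_form m b).
  by apply: simplicial_linear; [exact: primitive_simplicial|exact: word_form_simplicial].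
rewrite [LHS](cocycle_decomposition zf dz erefl) fz.
rewrite -[RHS]/(fun p rho => simplex_extd ((1 *: primitive m.+1 z + word_form m b) p rho)).
rewrite (simplex_extd_linear 1 (primitive_simplicial zf erefl) (word_form_simplicial bc)) scale1r.
by congr (_ + _); rewrite (word_form_differential bc).
Qed.

Lemma integration_surjective m (c : ambient (bott_complex M)) : cocycles m c ->
  exists2 z, @cocycles R (simplicial_deRham_complex M) m z &
    @coboundaries R (bott_complex M) m (integration_along_fibers M z - c).
Proof.
move=> [cc dc]; have wf := word_form_simplicial cc.
exists (word_form m c).
  split=> //; rewrite -[LHS]/(fun p rho => simplex_extd (word_form m c rho)).
  by rewrite (word_form_differential cc) -(word_form0 m.+1); congr word_form.
have hE := htpy_cochain_differential cc dc.
split; first exact: (cochainsB linear_bott_complex (integration_cochain wf) cc).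
case: m cc wf hE => [|m] cc wf hE.
  (* A homotopy cochain of degree -1 is 0, so in degree 0 the integral of E c equals c, as the
     definition of [coboundaries] requires there. *)
  rewrite -hE; have -> : htpy_cochain c = 0.
    apply: functional_extensionality_dep => p; apply/funext => rho; apply/funext => phi.
    apply/funext => x; apply/funext => s; apply: contrapT.
    by move=> /(htpy_cochain_neq0 cc)[_ _].
  exact: (differential0 linear_bott_complex).
by exists (htpy_cochain c); [exact: (htpy_cochain_cochain cc)|rewrite -hE].
Qed.

End LinearStructure.

Theorem theorem1p1 (R : realType) (n : nat) (M : smoothManifold R n)
    (o : orientation M) :
  chain_map (integration_along_fibers M) /\
  forall m : nat,
    set_bij (cohomology (simplicial_deRham_complex M) m)
            (cohomology (bott_complex M) m)
            (cohomology_map (integration_along_fibers M) m).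
Proof.
split; first exact: integration_chain_map.
move=> m; apply: cohomology_bij.
- exact: linear_simplicial_complex.
- exact: linear_bott_complex.
- exact: integration_chain_map.
- exact: integration_injective.
- exact: integration_surjective.
Qed.
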